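(* Let $n\ge2$ and $(g,n)\ne(0,2)$. Then, in the ring $R=\mathbb{C}[[z_1,\dots,z_n]][\{(z_i-z_j)^{-1}\}_{i\ne j}]$, $$D_1\cdots D_nH_{g,n}=[\hbar^{2g-2+n}]\,U_n\cdots U_1\sum_{\gamma\in\Gamma_n}\prod_{\{v_k,v_\ell\}\in E_\gamma}w_{k,\ell},$$ where $$w_{k,\ell}=e^{\hbar^2u_ku_\ell\mathcal S(u_k\hbar Q_kD_k)\mathcal S(u_\ell\hbar Q_\ell D_\ell)\frac{z_kz_\ell}{(z_k-z_\ell)^2}}-1$$ and $U_i$ acts on functions $f$ of $u_i,z_i$ (and the other variables) by $$U_if=\sum_{j,r\ge0}D_i^j\Big(\frac{[v^j]L_r(v,y(z_i),\hbar)}{Q_i}\,[u_i^r]\frac{e^{u_i(\mathcal S(u_i\hbar Q_iD_i)-1)y(z_i)}}{u_i\hbar\,\mathcal S(u_i\hbar)}f\Big).$$ For fixed $g,n$, after taking $[\hbar^{2g-2+n}]$ all sums are finite and the right-hand side is a rational expression in $z_1,\dots,z_n$ and the derivatives of $y_i=y(z_i)$ and of $\psi(y_i)$.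
   Context: $\psi(y)=\sum_{k\ge1}c_ky^k$, $y(z)=\sum_{k\ge1}s_kz^k$ formal power series, $\hbar$ formal. $Z=\sum_\lambda\exp\big(\sum_{(i,j)\in\lambda}\psi(\hbar(j-i))\big)s_\lambda(p)s_\lambda(s/\hbar)$ (sum over partitions, $s_\lambda$ Schur functions in power sums $p_k$, $(i,j)$ cells with row $i$, column $j$, $s_\lambda(s/\hbar)$ is $s_\lambda$ at $p_k=s_k/\hbar$), $F=\log Z$, $H_n=\sum_{k_i\ge1}\frac{\partial^nF}{\partial p_{k_1}\cdots\partial p_{k_n}}|_{p=0}X_1^{k_1}\cdots X_n^{k_n}=\sum_g\hbar^{2g-2+n}H_{g,n}$. Set $X(z)=ze^{-\psi(y(z))}$, $X_i=X(z_i)$, $Q(z)=1-zy'(z)\psi'(y(z))$, $Q_i=Q(z_i)$, $D_i=X_i\partial_{X_i}=\frac1{Q_i}z_i\partial_{z_i}$ (so $Q_iD_i=z_i\partial_{z_i}$). $\mathcal S(u)=\frac{e^{u/2}-e^{-u/2}}{u}$, and $\mathcal S(a\,z\partial_z)$ denotes the corresponding power series in the operator $z\partial_z$. $L_0(v,y,\hbar)=\exp\big(v(\frac{\mathcal S(v\hbar\partial_y)}{\mathcal S(\hbar\partial_y)}-1)\psi(y)\big)$, $L_r=(\partial_y+v\psi'(y))^rL_0$. $\Gamma_n$: connected simple graphs on vertices $v_1,\dots,v_n$; $E_\gamma$: its edges. *)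

(* Defs.v *)
From HB Require Import structures.
From mathcomp Require Import all_boot all_order all_algebra.
From mathcomp Require Import finmap complex.
From mathcomp Require Import boolp classical_sets functions cardinality fsbigop.
From mathcomp Require Import reals.
From mathcomp Require Import zify ring.

Set Implicit Arguments.
Unset Strict Implicit.
Unset Printing Implicit Defensive.

Import Order.TTheory GRing.Theory Num.Theory.

Local Open Scope classical_set_scope.
Local Open Scope ring_scope.

(* Exponents of monomials: commutative monoids, written additively, in which *)
(* every element has finitely many decompositions.                           *)
HB.mixin Record hasFiniteSplits M of GRing.Nmodule M := {
  finite_splits : forall m : M, finite_set [set d : M * M | d.1 + d.2 = m]
}.

#[short(type="exponentType")]
HB.structure Definition Exponent := {M of GRing.Nmodule M & hasFiniteSplits M}.

Definition splits (M : exponentType) (m : M) : seq (M * M) :=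
  fset_set [set d : M * M | d.1 + d.2 = m].

Lemma splits_uniq (M : exponentType) (m : M) : uniq (splits m).
Proof. exact: fset_uniq. Qed.

Lemma mem_splits (M : exponentType) (m : M) d :
  (d \in splits m) = (d.1 + d.2 == m).
Proof.
rewrite /splits in_fset_set; last exact: finite_splits.
by apply/idP/eqP; rewrite inE.
Qed.

Lemma nat_finite_splits (m : nat) : finite_set [set d : nat * nat | d.1 + d.2 = m].
Proof.
apply: (@sub_finite_set _ _ (`I_m.+1 `*` `I_m.+1)).
  by move=> [a b] /= abm; split => /=; rewrite -abm -[(a + b)%R]/(a + b)%N; lia.
by apply: finite_setX; exact: finite_II.
Qed.

HB.instance Definition _ := hasFiniteSplits.Build nat nat_finite_splits.

Lemma ffun_finite_splits (I : finType) (m : {ffun I -> nat}) :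
  finite_set [set d : {ffun I -> nat} * {ffun I -> nat} | d.1 + d.2 = m].
Proof.
pose b := (\sum_i m i)%N.
pose B : set {ffun I -> nat} :=
  range (fun h : {ffun I -> 'I_b.+1} => [ffun i => nat_of_ord (h i)]).
have inB (f : {ffun I -> nat}) : (forall i, (f i <= m i)%N) -> B f.
  move=> fm; exists [ffun i => inord (f i)] => //.
  apply/ffunP => i; rewrite !ffunE inordK // ltnS (leq_trans (fm i)) //.
  by rewrite /b (bigD1 i) //= leq_addr.
apply: (@sub_finite_set _ _ (B `*` B)).
  move=> [f h] /= fhm; split; apply: inB => i; rewrite -fhm ffunE;
    rewrite -[(f i + h i)%R]/(f i + h i)%N; lia.
by apply: finite_setX; apply: finite_image; exact: finite_finset.
Qed.

HB.instance Definition _ (I : finType) :=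
  hasFiniteSplits.Build {ffun I -> nat} (@ffun_finite_splits I).

Lemma poly_finite_splits (m : {poly nat}) :
  finite_set [set d : {poly nat} * {poly nat} | d.1 + d.2 = m].
Proof.
pose b := (\sum_(i < size m) (m`_i)%R)%N.
pose B : set {poly nat} :=
  range (fun h : {ffun 'I_(size m) -> 'I_b.+1} =>
    \poly_(k < size m) (if insub k is Some i then nat_of_ord (h i) else 0%N)).
have inB (f : {poly nat}) : (forall i, leq (f`_i)%R (m`_i)%R) -> B f.
  move=> fm; exists [ffun i : 'I_(size m) => inord (f`_i)%R] => //.
  apply/polyP => k; rewrite coef_poly; case: ltnP => [km|mk].
    rewrite insubT ffunE inordK // ltnS (leq_trans (fm k)) //.
    by rewrite /b (bigD1 (Ordinal km)) //= leq_addr.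
  have := fm k; rewrite [(m`_k)%R]nth_default // leqn0 => /eqP ->.
  by [].
apply: (@sub_finite_set _ _ (B `*` B)).
  move=> [f h] /= fhm; split; apply: inB => i; rewrite -fhm coefD;
    rewrite -[(f`_i + h`_i)%R]/(addn (f`_i)%R (h`_i)%R); lia.
by apply: finite_setX; apply: finite_image; exact: finite_finset.
Qed.

HB.instance Definition _ := hasFiniteSplits.Build {poly nat} poly_finite_splits.

(* [mseries M A] is the ring of formal power series with coefficients in A   *)
(* and exponents in M: M = nat for one variable, M = {ffun I -> nat} for     *)
(* finitely many variables indexed by I, and M = {poly nat} (finitely        *)
(* supported sequences of natural numbers) for countably many variables.     *)
Record mseries (M : Type) (A : Type) := MSeries { mcoef :> M -> A }.

Section MSeriesRing.
Variables (M : exponentType) (A : comNzRingType).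
Implicit Types f g h : mseries M A.

HB.instance Definition _ := gen_eqMixin (mseries M A).
HB.instance Definition _ := gen_choiceMixin (mseries M A).

Lemma mseriesP f g : f =1 g -> f = g.
Proof. by case: f g => [f] [g] /= fg; congr MSeries; exact/funext. Qed.

Definition smono (m : M) (a : A) : mseries M A :=
  MSeries (fun k => if k == m then a else 0).

Let add f g := MSeries (fun m => f m + g m).
Let opp f := MSeries (fun m => - f m).
Let zero : mseries M A := MSeries (fun=> 0).
Let mul f g := MSeries (fun m => \sum_(d <- splits m) f d.1 * g d.2).

Let addA : associative add.
Proof. by move=> f g h; apply: mseriesP => m /=; rewrite addrA. Qed.
Let addC : commutative add.
Proof. by move=> f g; apply: mseriesP => m /=; rewrite addrC. Qed.
Let add0 : left_id zero add.
Proof. by move=> f; apply: mseriesP => m /=; rewrite add0r. Qed.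
Let addN : left_inverse zero opp add.
Proof. by move=> f; apply: mseriesP => m /=; rewrite addNr. Qed.

HB.instance Definition _ :=
  GRing.isZmodule.Build (mseries M A) addA addC add0 addN.

Let mulA : associative mul.
Proof.
move=> f g h; apply: mseriesP => m /=.
pose F (t : M * M * M) := f t.1.1 * g t.1.2 * h t.2.
transitivity (\sum_(t <- [seq (x.1, y.1, y.2) | x <- splits m,
    y <- splits x.2]) F t).
  rewrite big_allpairs_dep; apply: eq_bigr => x _; rewrite mulr_sumr.
  by apply: eq_bigr => y _; rewrite mulrA.
transitivity (\sum_(t <- [seq (y.1, y.2, x.2) | x <- splits m,
    y <- splits x.1]) F t); last first.
  by rewrite big_allpairs_dep; apply: eq_bigr => x _; rewrite mulr_suml.
apply: perm_big; apply: uniq_perm.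
- apply: allpairs_uniq_dep; [exact: splits_uniq| by move=> *; exact: splits_uniq|].
  move=> p q /allpairsPdep[[a b] [[c d] [_ /= cd ->]]].
  move=> /allpairsPdep[[a' b'] [[c' d'] [_ /= cd' ->]]].
  move: cd cd'; rewrite !mem_splits /= => /eqP <- /eqP <-.
  by move=> [-> -> ->].
- apply: allpairs_uniq_dep; [exact: splits_uniq| by move=> *; exact: splits_uniq|].
  move=> p q /allpairsPdep[[a b] [[c d] [_ /= cd ->]]].
  move=> /allpairsPdep[[a' b'] [[c' d'] [_ /= cd' ->]]].
  move: cd cd'; rewrite !mem_splits /= => /eqP <- /eqP <-.
  by move=> [-> -> ->].
- move=> [[a b] c]; apply/allpairsPdep/allpairsPdep.
    move=> [x [z []]]; rewrite !mem_splits => /eqP e1 /eqP e2 [-> -> ->].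
    exists (x.1 + z.1, z.2), (x.1, z.1).
    by rewrite !mem_splits /= -addrA e2 e1 !eqxx.
  move=> [x [z []]]; rewrite !mem_splits => /eqP e1 /eqP e2 [-> -> ->].
  exists (z.1, z.2 + x.2), (z.2, x.2).
  by rewrite !mem_splits /= addrA e2 e1 !eqxx.
Qed.

Let mulC : commutative mul.
Proof.
move=> f g; apply: mseriesP => m /=.
pose sw (d : M * M) := (d.2, d.1).
transitivity (\sum_(d <- map sw (splits m)) g d.1 * f d.2).
  by rewrite big_map; apply: eq_bigr => d _; rewrite mulrC.
apply: perm_big; apply: uniq_perm; last first.
- move=> [a b]; apply/mapP/idP => [[[c d]]|].
    by rewrite !mem_splits /= => /eqP cd [-> ->]; rewrite addrC cd.
  by rewrite mem_splits => ab; exists (b, a); rewrite ?mem_splits //= addrC.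
- exact: splits_uniq.
- by rewrite map_inj_uniq ?splits_uniq // => -[a b] [c d] [-> ->].
Qed.

Let mul1 : left_id (smono 0 1) mul.
Proof.
move=> f; apply: mseriesP => m /=.
rewrite (bigD1_seq (0, m)) ?splits_uniq ?mem_splits ?add0r ?eqxx //= mul1r.
rewrite big_seq_cond big1 ?addr0 // => -[a b] /andP[].
rewrite mem_splits /= => /eqP abm; case: (eqVneq a 0) => [a0|_ _]; last first.
  by rewrite mul0r.
by move: abm; rewrite a0 add0r => ->; rewrite eqxx.
Qed.

Let mulDl : left_distributive mul add.
Proof.
move=> f g h; apply: mseriesP => m /=; rewrite -big_split /=.
by apply: eq_bigr => d _; rewrite mulrDl.
Qed.

Let oner_neq0 : smono 0 1 != 0.
Proof.
apply/eqP => /(congr1 (fun f : mseries M A => f 0)) /=.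
by rewrite eqxx => /eqP; rewrite oner_eq0.
Qed.

HB.instance Definition _ :=
  GRing.Zmodule_isComNzRing.Build (mseries M A) mulA mulC mul1 mulDl oner_neq0.

Lemma mcoefM f g m : (f * g) m = \sum_(d <- splits m) f d.1 * g d.2.
Proof. by []. Qed.

End MSeriesRing.

Section ClassicalInverse.
Variable A : comNzRingType.

Definition cunit : {pred A} := [pred x | `[< exists y, y * x = 1 >]].
Definition cinv (x : A) : A := xget x [set y | y * x = 1].

Lemma cmulVx : {in cunit, left_inverse 1 cinv *%R}.
Proof. by move=> x /asboolP[y]; exact: (@xgetI _ x [set y | y * x = 1]). Qed.

Lemma cunitPl (x y : A) : y * x = 1 -> cunit x.
Proof. by move=> yx; apply/asboolP; exists y. Qed.

Lemma cinv_out : {in [predC cunit], cinv =1 id}.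
Proof.
move=> x; rewrite inE => /asboolPn nx.
by rewrite /cinv; case: xgetP => // y _ yx; case: nx; exists y.
Qed.

End ClassicalInverse.

HB.instance Definition _ (M : exponentType) (A : comNzRingType) :=
  GRing.ComNzRing_hasMulInverse.Build (mseries M A)
    (@cmulVx (mseries M A)) (@cunitPl (mseries M A)) (@cinv_out (mseries M A)).

Section MSeriesDomain.
Variables (n : nat) (A : idomainType).
Implicit Types (a b c d : {ffun 'I_n -> nat}).

Let lexle (k : nat) a b := (forall i : 'I_n, (i < k)%N -> a i = b i) \/
  exists i : 'I_n, [/\ (i < k)%N, (a i < b i)%N &
    forall j : 'I_n, (j < i)%N -> a j = b j].

Let lex_min (S : set {ffun 'I_n -> nat}) : S !=set0 -> forall k, (k <= n)%N ->
  exists2 a, S a & forall b, S b -> lexle k a b.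
Proof.
move=> [a0 Sa0]; elim=> [_|k IH kn].
  by exists a0 => // b _; left.
have [a Sa amin] := IH (ltnW kn); pose ik := Ordinal kn.
pose P t := `[< exists b, [/\ S b, forall i : 'I_n, (i < k)%N -> a i = b i & b ik = t] >].
have exP : exists t, P t by exists (a ik); apply/asboolP; exists a.
case: (ex_minnP exP) => t /asboolP[b [Sb ab bt]] tmin.
exists b => // c Sc; case: (amin c Sc) => [ac|[i [ik' aci eqac]]]; last first.
  right; exists i; split; [exact: leq_trans ik' _ | by rewrite -ab |].
  by move=> j ji; rewrite -ab ?eqac // (ltn_trans ji).
have tc : (t <= c ik)%N by apply: tmin; apply/asboolP; exists c.
have bck (i : 'I_n) : (i < k)%N -> b i = c i by move=> ik'; rewrite -ab // ac.
move: tc; rewrite -bt leq_eqVlt => /orP[/eqP bc|bc].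
  left=> i; rewrite ltnS leq_eqVlt => /orP[/eqP ik'|]; last exact: bck.
  by have -> : i = ik by exact: val_inj.
by right; exists ik; split=> // j jk; exact: bck.
Qed.

Let lex_add a b c d : lexle n a c -> lexle n b d -> a + b = c + d ->
  (c, d) = (a, b).
Proof.
move=> ac bd e; have {}e i : (a i + b i = c i + d i)%N.
  by have := congr1 (fun f : {ffun _} => f i) e; rewrite !ffunE.
case: ac => [ac|[i [_ aci ac]]].
  have {}ac : a = c by apply/ffunP => i; exact: ac.
  rewrite -ac in e *; congr pair; apply/ffunP => i; apply/esym/(@addnI (a i)); exact: e.
case: bd => [bd|[j [_ bdj bd]]]; first by have := e i; have := bd i (ltn_ord i); lia.
case: (ltngtP i j) => ij.
- by have := e i; have := bd i ij; lia.
- by have := e j; have := ac j ij; lia.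
- by have ij' : i = j by [exact: val_inj]; subst j; have := e i; lia.
Qed.

Lemma mseries_integral : GRing.integral_domain_axiom (mseries {ffun 'I_n -> nat} A).
Proof.
move=> f g fg0; apply: contrapT => /negP; rewrite negb_or => /andP[f0 g0].
have supp (h : mseries {ffun 'I_n -> nat} A) : h != 0 -> [set a | h a != 0] !=set0.
  move=> /eqP h0; apply: contrapT => /set0P/negP; rewrite negbK => /eqP hS.
  apply: h0; apply: mseriesP => a /=; apply/eqP; apply: contrapT => /negP ha.
  by have : [set a | h a != 0] a by []; rewrite hS.
have [a fa amin] := lex_min (supp f f0) (leqnn n).
have [b gb bmin] := lex_min (supp g g0) (leqnn n).
have := congr1 (fun h : mseries {ffun 'I_n -> nat} A => h (a + b)) fg0.
rewrite mcoefM (bigD1_seq (a, b)) ?splits_uniq ?mem_splits ?eqxx //=.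
rewrite big_seq_cond big1 => [|[c d] /andP[]].
  by rewrite addr0 => /eqP; rewrite mulf_eq0 (negbTE fa) (negbTE gb).
rewrite mem_splits /= => /eqP cd; have [->|fc] := eqVneq (f c) 0.
  by rewrite mul0r.
have [->|gd] := eqVneq (g d) 0; first by rewrite mulr0.
by rewrite (lex_add (amin c fc) (bmin d gd)) ?eqxx.
Qed.

HB.instance Definition _ :=
  GRing.ComUnitRing_isIntegral.Build (mseries {ffun 'I_n -> nat} A)
    mseries_integral.

End MSeriesDomain.

(* Formal Laurent series in one variable. *)
Record laurent (A : nmodType) := Laurent {
  lcoef :> int -> A;
  laurent_lb : exists N : int, forall k : int, k < N -> lcoef k = 0
}.

Section LaurentRing.
Variable A : comNzRingType.
Implicit Types f g h : laurent A.

HB.instance Definition _ := gen_eqMixin (laurent A).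
HB.instance Definition _ := gen_choiceMixin (laurent A).

Lemma laurentP f g : f =1 g -> f = g.
Proof.
case: f g => [f pf] [g pg] /= fg.
have e : f = g by exact/funext.
by subst g; congr Laurent; exact: Prop_irrelevance.
Qed.

Let add_lb f g : exists N : int, forall k : int, k < N -> f k + g k = 0.
Proof.
have [N Nf] := laurent_lb f; have [P Pg] := laurent_lb g.
exists (Num.min N P) => k; rewrite lt_min => /andP[kN kP].
by rewrite Nf // Pg // addr0.
Qed.
Let opp_lb f : exists N : int, forall k : int, k < N -> - f k = 0.
Proof. by have [N Nf] := laurent_lb f; exists N => k /Nf ->; rewrite oppr0. Qed.
Let zero_lb : exists N : int, forall k : int, k < N -> 0 = 0 :> A.
Proof. by exists 0. Qed.
Let mono_lb (m : int) (a : A) :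
  exists N : int, forall k : int, k < N -> (if k == m then a else 0) = 0.
Proof. by exists m => k; case: eqP => // ->; rewrite ltxx. Qed.

Definition lmono (m : int) (a : A) : laurent A := Laurent (mono_lb m a).

Let add f g := Laurent (add_lb f g).
Let opp f := Laurent (opp_lb f).
Let zero := Laurent zero_lb.

Let addA : associative add.
Proof. by move=> f g h; apply: laurentP => m /=; rewrite addrA. Qed.
Let addC : commutative add.
Proof. by move=> f g; apply: laurentP => m /=; rewrite addrC. Qed.
Let add0 : left_id zero add.
Proof. by move=> f; apply: laurentP => m /=; rewrite add0r. Qed.
Let addN : left_inverse zero opp add.
Proof. by move=> f; apply: laurentP => m /=; rewrite addNr. Qed.

HB.instance Definition _ :=
  GRing.isZmodule.Build (laurent A) addA addC add0 addN.

Let lb f (N : int) := forall k : int, k < N -> f k = 0.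
Let shift f (N : int) : mseries nat A := MSeries (fun t => f (N + t%:Z)).
Let conv f g (k : int) := \sum_(i \in [set: int]) f i * g (k - i).

Let conv_lb f g N P k : lb f N -> lb g P -> k < N + P -> conv f g k = 0.
Proof.
move=> fN gP kNP; rewrite /conv fsbig1 // => i _.
have [iN|Ni] := ltP i N; first by rewrite fN ?mul0r.
by rewrite gP ?mulr0 //; lia.
Qed.

Let convE f g N P (t : nat) : lb f N -> lb g P ->
  conv f g (N + P + t%:Z) = (shift f N * shift g P) t.
Proof.
move=> fN gP; rewrite mcoefM /conv /=.
pose r := [seq N + d.1%:Z | d <- splits t].
have r_uniq : uniq r.
  rewrite map_inj_in_uniq ?splits_uniq // => -[a b] [c d] /=.
  rewrite !mem_splits /= -[(a + b)%R]/(a + b)%N -[(c + d)%R]/(c + d)%N.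
  by move=> /eqP ab /eqP cd e; congr pair; lia.
rewrite (fsbigE r) //.
  rewrite big_mkcond big_map big_seq [RHS]big_seq; apply: eq_bigr => -[a b].
  rewrite mem_splits /= -[(a + b)%R]/(a + b)%N in_setT => /eqP abt.
  by congr (_ * g _); lia.
move=> i _ ir; have [iN|Ni] := ltP i N; first by rewrite fN ?mul0r.
rewrite gP ?mulr0 //; rewrite ltNge; apply/negP => le; move/negP: ir; apply.
apply/mapP; exists (absz (i - N)%R, absz (N + t%:Z - i)%R); last by rewrite /=; lia.
by rewrite mem_splits /= -[(_ + _)%R]/(_ + _)%N; lia.
Qed.

Let mul_lb f g : exists N : int, forall k : int, k < N -> conv f g k = 0.
Proof.
have [N Nf] := laurent_lb f; have [P Pg] := laurent_lb g.
by exists (N + P) => k; exact: conv_lb.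
Qed.

Let mul f g := Laurent (mul_lb f g).

Let mul_lbD f g N P : lb f N -> lb g P -> lb (mul f g) (N + P).
Proof. by move=> fN gP k; exact: conv_lb. Qed.

Let shiftM f g N P : lb f N -> lb g P ->
  shift (mul f g) (N + P) = shift f N * shift g P.
Proof. by move=> fN gP; apply: mseriesP => t; rewrite -convE. Qed.

Let shift_inj f g N : lb f N -> lb g N -> shift f N = shift g N -> f = g.
Proof.
move=> fN gN e; apply: laurentP => k; have [kN|Nk] := ltP k N.
  by rewrite fN ?gN.
have -> : k = N + (absz (k - N)%R)%:Z by lia.
by have := congr1 (fun s : mseries nat A => s (absz (k - N)%R)) e.
Qed.

Let mulA : associative mul.
Proof.
move=> f g h; have [N fN] := laurent_lb f.
have [P gP] := laurent_lb g; have [S hS] := laurent_lb h.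
apply: (@shift_inj _ _ (N + P + S)); first by rewrite -addrA; do 2?apply: mul_lbD.
  by do 2?apply: mul_lbD.
rewrite -{1}addrA !shiftM ?mulrA //; exact: mul_lbD.
Qed.

Let mulC : commutative mul.
Proof.
move=> f g; have [N fN] := laurent_lb f; have [P gP] := laurent_lb g.
apply: (@shift_inj _ _ (N + P)); [exact: mul_lbD|by rewrite addrC; apply: mul_lbD|].
by rewrite {2}addrC !shiftM // mulrC.
Qed.

Let mul1 : left_id (lmono 0 1) mul.
Proof.
move=> f; have [N fN] := laurent_lb f.
have l1 : lb (lmono 0 1) 0 by move=> k /=; case: eqP => // ->; rewrite ltxx.
apply: (@shift_inj _ _ N) => //; first by rewrite -[N]add0r; exact: mul_lbD.
by rewrite -{1}[N]add0r shiftM // -[RHS]mul1r; congr (_ * _).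
Qed.

Let mulDl : left_distributive mul add.
Proof.
move=> f g h; have [N fN] := laurent_lb f.
have [P gP] := laurent_lb g; have [S hS] := laurent_lb h.
pose B := Num.min N P.
have fB : lb f B by move=> k; rewrite lt_min => /andP[/fN].
have gB : lb g B by move=> k; rewrite lt_min => /andP[_ /gP].
have fgB : lb (add f g) B by move=> k kB /=; rewrite fB // gB // addr0.
have sD f1 f2 T : shift (add f1 f2) T = shift f1 T + shift f2 T by exact: mseriesP.
have lD : lb (add (mul f h) (mul g h)) (B + S).
  by move=> k kB; rewrite /= (conv_lb fB hS kB) (conv_lb gB hS kB) addr0.
apply: (@shift_inj _ _ (B + S)) => //; first exact: mul_lbD.
by rewrite sD !shiftM // sD mulrDl.
Qed.

Let oner_neq0 : lmono 0 1 != 0.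
Proof.
apply/eqP => /(congr1 (fun f : laurent A => f 0)) /= /eqP.
by rewrite oner_eq0.
Qed.

HB.instance Definition _ :=
  GRing.Zmodule_isComNzRing.Build (laurent A) mulA mulC mul1 mulDl oner_neq0.

Lemma lcoefM f g k : (f * g) k = \sum_(i \in [set: int]) f i * g (k - i).
Proof. by []. Qed.

End LaurentRing.

HB.instance Definition _ (A : comNzRingType) :=
  GRing.ComNzRing_hasMulInverse.Build (laurent A)
    (@cmulVx (laurent A)) (@cunitPl (laurent A)) (@cinv_out (laurent A)).

Section FormalSums.
Variable A : comUnitRingType.

(* Coefficientwise sum of a family of series.  As [\sum_(i \in _) _] is 0    *)
(* when infinitely many terms are nonzero, it is meaningful for families     *)
(* with finitely many nonzero terms at each coefficient.                     *)
Definition csum (M : exponentType) (I : choiceType) (F : I -> mseries M A) :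
    mseries M A :=
  MSeries (fun m => \sum_(i \in [set: I]) F i m).

Definition sconst (M : exponentType) (a : A) : mseries M A := smono 0 a.

(* For f with zero constant term. *)
Definition expS (M : exponentType) (f : mseries M A) : mseries M A :=
  csum (fun k : nat => sconst M (k`!%:R)^-1 * f ^+ k).

(* For f with constant term 1. *)
Definition logS (M : exponentType) (f : mseries M A) : mseries M A :=
  csum (fun k : nat => sconst M ((-1) ^+ k / k.+1%:R) * (f - 1) ^+ k.+1).

(* Composition f(x), for x with zero constant term. *)
Definition scomp (M : exponentType) (f : mseries nat A) (x : mseries M A) :
    mseries M A :=
  csum (fun k : nat => sconst M (f k) * x ^+ k).

Definition sderiv (f : mseries nat A) : mseries nat A :=
  MSeries (fun k => f k.+1 *+ k.+1).

End FormalSums.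

Definition smap (M A B : Type) (phi : A -> B) (f : mseries M A) : mseries M B :=
  MSeries (fun m => phi (f m)).

Section LaurentSums.
Variable A : comNzRingType.

Definition laurent_of (f : int -> A) : laurent A :=
  if pselect (exists N : int, forall k : int, k < N -> f k = 0) is left pf
  then Laurent pf else 0.

Definition lser (f : mseries nat A) : laurent A :=
  laurent_of (fun k => if k is Posz m then f m else 0).

Definition lsum (I : choiceType) (F : I -> laurent A) : laurent A :=
  laurent_of (fun k => \sum_(i \in [set: I]) F i k).

Definition summable (I : choiceType) (F : I -> laurent A) : Prop :=
  (forall k, finite_set [set i | F i k != 0]) /\
  (exists N : int, forall i (k : int), k < N -> F i k = 0).

End LaurentSums.

(* For phi with phi 0 = 0. *)
Definition lmap (A B : comNzRingType) (phi : A -> B) (f : laurent A) : laurent B :=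
  laurent_of (fun k => phi (f k)).

Definition partitions : set (seq nat) :=
  [set lam | sorted geq lam /\ 0%N \notin lam].

Section Schur.
Variables (A : comUnitRingType) (p : nat -> A).

(* \sum_k h_k t^k = exp (\sum_(k >= 1) p_k t^k / k). *)
Definition hsym (k : nat) : A :=
  expS (MSeries (fun j => if j is 0 then 0 else p j / j%:R)) k.

(* Jacobi-Trudi, with h_k = 0 for k < 0. *)
Definition schur (lam : seq nat) : A :=
  \det (\matrix_(i < size lam, j < size lam)
    if (i <= nth 0 lam i + j)%N then hsym (nth 0 lam i + j - i)%N else 0).

End Schur.

(* S(u) = (e^(u/2) - e^(-u/2)) / u. *)
Definition Sser (K : fieldType) : mseries nat K :=
  MSeries (fun a => (2^-1 ^+ a.+1 - (- 2^-1) ^+ a.+1) / (a.+1)`!%:R).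

Notation zser K n := (mseries {ffun 'I_n -> nat} K).
Notation zfrac K n := {fraction (zser K n)}.
Notation tofr := (@FracField.tofrac _).
Notation useries K n := (mseries {ffun 'I_n -> nat} (laurent (zfrac K n))).

Local Open Scope quotient_scope.

Lemma frac_repr (A : idomainType) (x : {fraction A}) :
  x = tofr \n_(repr x) / tofr \d_(repr x).
Proof.
rewrite -{1}[x]reprK; set r := repr x.
have d0 : \d_r != 0 by exact: denom_ratioP.
rewrite -[X in _ = X]/(FracField.mul (tofr \n_r) (FracField.inv (tofr \d_r))).
rewrite !piE; apply/eqmodP.
rewrite /= FracField.equivfE /FracField.mulf /FracField.invf.
by rewrite !numden_Ratio ?mulf_neq0 ?mul1r ?mulr1 ?oner_neq0 // mulrC.
Qed.

Local Close Scope quotient_scope.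

Section Correlators.
Variables (K : fieldType) (psi y : mseries nat K).

(* \sum_((i, j) \in lam) psi (hbar (j - i)), as a series in hbar. *)
Definition content_sum (lam : seq nat) : mseries nat K :=
  \sum_(i < size lam) \sum_(j < nth 0 lam i)
    MSeries (fun k => psi k * (j%:Z - i%:Z)%:~R ^+ k).

(* The power of hbar defining H_{g,n}; nonnegative for n >= 2. *)
Definition hpow (g n : nat) : int := (g.*2 + n)%:Z - 2.

(* The coefficients are Laurent series in hbar; the variable p_k is the      *)
(* monomial of exponent 'X^k, so the exponent m : {poly nat} stands for      *)
(* \prod_k p_k ^+ m`_k.                                                      *)
Definition pvar (k : nat) : mseries {poly nat} (laurent K) := smono 'X^k 1.

Definition Zfun : mseries {poly nat} (laurent K) :=
  MSeries (fun m => \sum_(lam \in partitions)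
    lser (expS (content_sum lam)) *
    schur (fun k => lmono (-1) (y k)) lam *
    schur pvar lam m).

Definition Ffun : mseries {poly nat} (laurent K) := logS Zfun.

Definition pderiv (k : nat) (f : mseries {poly nat} (laurent K)) :
    mseries {poly nat} (laurent K) :=
  MSeries (fun m : {poly nat} => f (m + 'X^k) *+ (m`_k)%R.+1).

Definition Hgn (g n : nat) : mseries {ffun 'I_n -> nat} K :=
  MSeries (fun k : {ffun 'I_n -> nat} =>
    if [forall i, (0 < k i)%N] then
      foldr pderiv Ffun [seq k i | i <- enum 'I_n] 0 (hpow g n)
    else 0).

Definition Xser : mseries nat K := smono 1%N 1 * expS (- scomp psi y).

Definition Qser : mseries nat K :=
  1 - smono 1%N 1 * sderiv y * scomp (sderiv psi) y.

(* L_r as a series in v over series in hbar over series in the variable of   *)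
(* psi.                                                                      *)
Local Notation hy_series := (mseries nat (mseries nat K)).
Local Notation vhy_series := (mseries nat hy_series).

Definition vvar : vhy_series := smono 1%N 1.
Definition vhy_cst (f : mseries nat K) : vhy_series := sconst _ (sconst _ f).

(* S(hbar d/dy)^-1 f *)
Definition Sinv_hdy (f : mseries nat K) : hy_series :=
  MSeries (fun b => sconst _ ((Sser K)^-1 b) * iter b (@sderiv K) f).

(* S(v hbar d/dy) f *)
Definition S_vhdy (f : hy_series) : vhy_series :=
  MSeries (fun a => smono a (sconst _ (Sser K a)) * smap (iter a (@sderiv K)) f).

Definition L0 : vhy_series :=
  expS (vvar * (S_vhdy (Sinv_hdy psi) - vhy_cst psi)).

Definition Lfun (r : nat) : vhy_series :=
  iter r (fun f => smap (smap (@sderiv K)) f + vvar * vhy_cst (sderiv psi) * f) L0.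

Variable n : nat.
Local Notation expn_n := {ffun 'I_n -> nat}.
Local Notation zser := (zser K n).
Local Notation zfrac := (zfrac K n).
Local Notation useries := (useries K n).

Definition dexp (i : 'I_n) : expn_n := [ffun k => nat_of_bool (k == i)].

Definition zvar (i : 'I_n) : zser := smono (dexp i) 1.

(* The ring K[[z_1,...,z_n]][(z_i - z_j)^-1], inside the field of fractions  *)
(* of K[[z_1,...,z_n]].                                                      *)
Definition Rloc : set zfrac :=
  [set x | exists (f : zser) (k : nat),
    x = tofr f / (\prod_(e : 'I_n * 'I_n | (e.1 < e.2)%N)
                     tofr (zvar e.1 - zvar e.2)) ^+ k].

(* z_i d/dz_i on power series and, by the quotient rule, on fractions. *)
Definition theta (i : 'I_n) (f : zser) : zser :=
  MSeries (fun m => f m *+ m i).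

Definition thetaF (i : 'I_n) (x : zfrac) : zfrac :=
  tofr (theta i \n_(repr x) * \d_(repr x) - \n_(repr x) * theta i \d_(repr x))
    / tofr (\d_(repr x) ^+ 2).

Lemma thetaM i (f h : zser) : theta i (f * h) = theta i f * h + f * theta i h.
Proof.
apply: mseriesP => m.
rewrite -[LHS]/((f * h) m *+ m i) -[RHS]/((theta i f * h) m + (f * theta i h) m).
rewrite !mcoefM -sumrMnl -big_split /= big_seq [RHS]big_seq.
apply: eq_bigr => d; rewrite mem_splits => /eqP <-.
by rewrite ffunE mulrnDr mulrnAl mulrnAr.
Qed.

(* The quotient rule does not depend on the choice of the representative. *)
Lemma thetaF_frac i (f h : zser) : h != 0 ->
  thetaF i (tofr f / tofr h) =
  tofr (theta i f * h - f * theta i h) / tofr (h ^+ 2).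
Proof.
move=> h0; set x : zfrac := tofr f / tofr h; rewrite /thetaF.
have := denom_ratioP (repr x); set a := \n_(repr x); set b := \d_(repr x) => b0.
have e : a * h = f * b.
  apply/eqP; rewrite -tofrac_eq !tofracM -eqr_div ?tofrac_eq0 //.
  by rewrite -frac_repr.
have := congr1 (theta i) e; rewrite !thetaM => te.
apply/eqP; rewrite eqr_div ?tofrac_eq0 ?expf_neq0 // -!tofracM tofrac_eq.
rewrite -subr_eq0; apply/eqP.
transitivity (b * h * (theta i a * h + a * theta i h
    - (theta i f * b + f * theta i b))
    - (b * theta i h + h * theta i b) * (a * h - f * b)); first by ring.
by rewrite te e !subrr !mulr0 subrr.
Qed.

Definition at_z (i : 'I_n) (f : mseries nat K) : zser :=
  scomp f (zvar i).

Definition Qz (i : 'I_n) : zfrac := tofr (at_z i Qser).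

Definition Dz (i : 'I_n) (x : zfrac) : zfrac := (Qz i)^-1 * thetaF i x.

(* H_{g,n}(X(z_1),...,X(z_n)) *)
Definition Hgn_z (g : nat) : zser :=
  csum (fun k : expn_n =>
    sconst _ (Hgn g n k) * \prod_(i < n) at_z i Xser ^+ k i).

Definition DHgn (g : nat) : zfrac := foldr Dz (tofr (Hgn_z g)) (enum 'I_n).

Definition zcst (x : zfrac) : useries := sconst _ (lmono 0 x).

Definition Sz (a : nat) : zfrac := tofr (sconst _ (Sser K a)).

Definition Du (i : 'I_n) (f : useries) : useries := smap (lmap (Dz i)) f.

Definition QDu (i : 'I_n) (f : useries) : useries := zcst (Qz i) * Du i f.

(* u_i^a hbar^a *)
Definition uh (i : 'I_n) (a : nat) : useries := smono (dexp i *+ a) (lmono a%:Z 1).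

(* S(u_i hbar Q_i D_i) f *)
Definition S_uhQD (i : 'I_n) (f : useries) : useries :=
  csum (fun a : nat => zcst (Sz a) * uh i a * iter a (QDu i) f).

(* S(u_i hbar) *)
Definition S_uh (i : 'I_n) : useries :=
  csum (fun a : nat => zcst (Sz a) * uh i a).

Definition w (k l : 'I_n) : useries :=
  let zk := tofr (zvar k) in let zl := tofr (zvar l) in
  expS (uh k 1 * uh l 1 *
        S_uhQD k (S_uhQD l (zcst (zk * zl / (zk - zl) ^+ 2)))) - 1.

(* A simple graph is given by its edges, the unordered pair {k, l} being     *)
(* represented by (k, l) with k < l.                                         *)
Definition simple_graph (E : {set 'I_n * 'I_n}) : bool :=
  [forall e in E, (e.1 < e.2)%N].

Definition connected_graph (E : {set 'I_n * 'I_n}) : bool :=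
  [forall a, forall b,
    connect (fun k l => ((k, l) \in E) || ((l, k) \in E)) a b].

Definition graph_sum : useries :=
  \sum_(E : {set 'I_n * 'I_n} | simple_graph E && connected_graph E)
    \prod_(e in E) w e.1 e.2.

(* [u_i^r] f, for r >= 0 *)
Definition ucoef (i : 'I_n) (r : nat) (f : useries) : useries :=
  MSeries (fun m : expn_n => if m i == 0%N then f (m + dexp i *+ r) else 0).

(* [v^j] L_r(v, y(z_i), hbar) *)
Definition Lz (i : 'I_n) (j r : nat) : laurent zfrac :=
  lser (smap (fun f => tofr (scomp f (at_z i y))) (Lfun r j)).

Definition kernel (i : 'I_n) : useries :=
  let yi := zcst (tofr (at_z i y)) in
  expS (smono (dexp i) 1 * (S_uhQD i yi - yi)) * (S_uh i)^-1.

(* The (j, r) term of U_i f.  The factor 1 / (u_i hbar) is accounted for by  *)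
(* [u_i^r] (h / (u_i hbar)) = hbar^-1 [u_i^(r+1)] h.                         *)
Definition Uterm (i : 'I_n) (jr : nat * nat) (f : useries) : useries :=
  iter jr.1 (Du i)
    (sconst _ (Lz i jr.1 jr.2) * zcst (Qz i)^-1 *
     (sconst _ (lmono (-1) 1) * ucoef i jr.2.+1 (kernel i * f))).

Definition Uop (i : 'I_n) (f : useries) : useries :=
  MSeries (fun m => lsum (fun jr : nat * nat => Uterm i jr f m)).

Definition Uiter (s : seq 'I_n) : useries :=
  foldl (fun f i => Uop i f) graph_sum s.

(* [hbar^N] U_n ... U_1 (graph_sum); no u_i is left, so this is the          *)
(* coefficient at u = 0.                                                     *)
Definition rhs (N : int) : zfrac := Uiter (enum 'I_n) 0 N.

(* The double sums defining the successive U_i f are finite at each power of *)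
(* hbar, and so is, at hbar^N, the multiple sum obtained by expanding        *)
(* U_n ... U_1.                                                              *)
Definition finite_sums (N : int) : Prop :=
  (forall (i : 'I_n) (m : expn_n),
    summable (fun jr => Uterm i jr (Uiter (take i (enum 'I_n))) m)) /\
  finite_set [set jr : {ffun 'I_n -> nat * nat} |
    foldl (fun f i => Uterm i (jr i) f) graph_sum (enum 'I_n) 0 N != 0].

End Correlators.

(* Rational expressions in z_i and in the derivatives of y at z_i and of psi *)
(* at y(z_i); [RDy i k] and [RDpsi i k] stand for derivatives of order k+1.  *)
Inductive ratexpr (K : Type) (n : nat) :=
  | RConst of K
  | RZ of 'I_n
  | RDy of 'I_n & nat
  | RDpsi of 'I_n & nat
  | RAdd of ratexpr K n & ratexpr K n
  | RMul of ratexpr K n & ratexpr K n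
  | RInv of ratexpr K n.

Section RatExpr.
Variables (K : fieldType) (n : nat) (psi y : mseries nat K).

Fixpoint reval (e : ratexpr K n) : zfrac K n :=
  match e with
  | RConst c => tofr (sconst _ c)
  | RZ i => tofr (zvar K i)
  | RDy i k => tofr (at_z i (iter k.+1 (@sderiv K) y))
  | RDpsi i k => tofr (scomp (iter k.+1 (@sderiv K) psi) (at_z i y))
  | RAdd e1 e2 => reval e1 + reval e2
  | RMul e1 e2 => reval e1 * reval e2
  | RInv e1 => (reval e1)^-1
  end.

(* No division by zero. *)
Fixpoint rdefined (e : ratexpr K n) : bool :=
  match e with
  | RAdd e1 e2 | RMul e1 e2 => rdefined e1 && rdefined e2
  | RInv e1 => rdefined e1 && (reval e1 != 0)
  | _ => true
  end.

End RatExpr.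

(* Main.v *)
(** Both sides are expanded in the region |z_1| > ... > |z_n|, where the ring R embeds into Laurent series.
    The residues of a series against the powers of X(z_i) determine it; on them D_i acts as multiplication by an
    integer a_i, so the sums over (j, r) in U_i become a Taylor expansion at y = 0, and the residue of the right-hand
    side is a sum over connected multigraphs.  The same sum computes connected vacuum expectations of vertex operators
    E_(a_i) in the bosonic Fock space: their commutation relations come from the symmetric function identity behind
    the pair interaction z_k z_l / (z_k - z_l)^2.  If all a_i are positive, a computation with Schur determinants recovers
    the expansion of Z, and the connected expectation is a_1 ... a_n times the derivative of F = log Z.
    If some a_i is nonpositive, commuting E_(a_i) to the vacuum shows that the connected expectation vanishes, except
    for a contribution at (g, n) = (0, 2). *)
Require Import Defs.
From HB Require Import structures.
From mathcomp Require Import all_boot all_order all_algebra.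
From mathcomp Require Import fingroup perm finmap complex.
From mathcomp Require Import boolp classical_sets functions cardinality fsbigop.
From mathcomp Require Import reals.
From mathcomp Require Import zify ring.

Set Implicit Arguments.
Unset Strict Implicit.
Unset Printing Implicit Defensive.

Import Order.TTheory GRing.Theory Num.Theory.

Local Open Scope classical_set_scope.
Local Open Scope ring_scope.

Arguments GRing.mul : simpl never.
Arguments GRing.exp : simpl never.


(** As functions of the formal variables u_i, vertex operators do not commute up to scalars: the
    commutator of two of them is again a vertex operator, with a prefactor whose denominator is
    e^((u_x+u_z)/2) - e^(-(u_x+u_z)/2). Scalars appear only under the functional that turns powers
    of u_i into derivatives in y. It sends (e^(u_i/2) - e^(-u_i/2)) e^(c u_i) to [Phi psi a_i c],
    which for a positive integer a_i is the product of e^(psi(hbar z)) over a_i consecutive contents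
    z centred at c. Such products obey a cocycle rule in a_i, so the two terms of the prefactor have
    equal images and cancel; what is left when a_x + a_z = 0 becomes the scalar a_z. The obstacle is
    the division: the quotient by the denominator has to remain a combination of exponentials in u_x
    + u_z on which the functional can be evaluated, and this is why polynomial functions carry a
    predicate on their coefficients. For positive a_i the same functional turns the mean content in
    the exponent of each vertex operator into the content product that occurs in Z. *)

(** * Coefficients of formal series, and degrees of exponents *)

Section SeriesBasics.
Variables (M : exponentType) (A : comNzRingType).
Implicit Types (f g : mseries M A) (m : M).

Lemma mcoef0 m : (0 : mseries M A) m = 0. Proof. by []. Qed.
Lemma mcoefD f g m : (f + g) m = f m + g m. Proof. by []. Qed.
Lemma mcoefN f m : (- f) m = - f m. Proof. by []. Qed.
Lemma mcoefB f g m : (f - g) m = f m - g m. Proof. by []. Qed.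

Lemma mcoef1 m : (1 : mseries M A) m = (m == 0)%:R.
Proof. by rewrite -[LHS]/(if m == 0 then 1 else 0); case: eqP. Qed.

Lemma mcoef_sum I (r : seq I) (P : pred I) (F : I -> mseries M A) m :
  (\sum_(i <- r | P i) F i) m = \sum_(i <- r | P i) F i m.
Proof. by apply: (big_morph (fun f : mseries M A => f m)). Qed.

Lemma mcoefMn f k m : (f *+ k) m = f m *+ k.
Proof. by elim: k => [|k IH]; rewrite ?mulr0n // !mulrS mcoefD IH. Qed.

Lemma smonoE (a : M) (x : A) m : smono a x m = if m == a then x else 0.
Proof. by []. Qed.

Lemma mcoefCM (x : A) f m : (smono 0 x * f) m = x * f m.
Proof.
rewrite mcoefM (bigD1_seq (0, m)) ?splits_uniq ?mem_splits ?add0r ?eqxx //= eqxx.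
rewrite big_seq_cond big1 ?addr0 // => -[a b] /andP[].
rewrite mem_splits /= => /eqP abm; case: (eqVneq a 0) => [a0|_ _]; last first.
  by rewrite mul0r.
by move: abm; rewrite a0 add0r => ->; rewrite eqxx.
Qed.

Lemma smonoM (a b : M) (x y : A) : smono a x * smono b y = smono (a + b) (x * y).
Proof.
apply: mseriesP => m; rewrite mcoefM smonoE; case: eqP => [->|ne].
  rewrite (bigD1_seq (a, b)) ?splits_uniq ?mem_splits ?eqxx //= !eqxx.
  rewrite big1 ?addr0 // => -[c d] /= ne.
  case: eqP => [ca|]; last by rewrite mul0r.
  case: eqP => [db|]; last by rewrite mulr0.
  by move: ne; rewrite ca db eqxx.
rewrite big_seq big1 // => -[c d]; rewrite mem_splits /= => /eqP e.
case: eqP => [ca|]; last by rewrite mul0r.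
case: eqP => [db|]; last by rewrite mulr0.
by case: ne; rewrite -e ca db.
Qed.

Lemma smono_is_zmod_morphism (a : M) : zmod_morphism (@smono M A a).
Proof.
by move=> x y; apply: mseriesP => m; rewrite mcoefB !smonoE; case: eqP; rewrite ?subr0.
Qed.
HB.instance Definition _ (a : M) := GRing.isZmodMorphism.Build A (mseries M A)
  (@smono M A a) (smono_is_zmod_morphism a).

Lemma smonoMn (a : M) (x : A) k : smono a x *+ k = smono a (x *+ k).
Proof. by rewrite raddfMn. Qed.

Lemma smono0_is_monoid_morphism : monoid_morphism (@smono M A 0).
Proof. by split => [//|x y]; rewrite smonoM add0r. Qed.
HB.instance Definition _ := GRing.isMonoidMorphism.Build A (mseries M A)
  (@smono M A 0) smono0_is_monoid_morphism.

End SeriesBasics.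

(* A grading of the exponents by which powers of series without constant term tend to zero. *)
Record degree (M : exponentType) := Degree {
  deg :> M -> nat;
  degD : forall a b, deg (a + b) = (deg a + deg b)%N;
  deg_eq0 : forall a, deg a = 0%N -> a = 0 }.

Section Degree.
Variables (M : exponentType) (dg : degree M).

Lemma deg0 : dg 0 = 0%N.
Proof. by have := degD dg 0 0; rewrite addr0; lia. Qed.

Lemma mcoef_pow_deg (A : comNzRingType) (f : mseries M A) k m :
  f 0 = 0 -> (dg m < k)%N -> (f ^+ k) m = 0.
Proof.
move=> f0; elim: k m => // k IH m mk.
rewrite exprS mcoefM big_seq big1 // => -[a b]; rewrite mem_splits /= => /eqP e.
have [a0|a0] := eqVneq (dg a) 0%N; first by rewrite (deg_eq0 a0) f0 mul0r.
by rewrite [X in _ * X]IH ?mulr0 //; move: mk a0; rewrite -e degD; lia.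
Qed.

Lemma eq_mcoefMr (A : comNzRingType) (f g h : mseries M A) m :
  (forall a, (dg a <= dg m)%N -> g a = h a) -> (f * g) m = (f * h) m.
Proof.
move=> gh; rewrite !mcoefM big_seq [RHS]big_seq; apply: eq_bigr => -[a b].
by rewrite mem_splits /= => /eqP e; rewrite gh // -e degD leq_addl.
Qed.

Lemma eq_mcoefM (A : comNzRingType) (f f' g g' : mseries M A) m :
  (forall a, (dg a <= dg m)%N -> f a = f' a) ->
  (forall a, (dg a <= dg m)%N -> g a = g' a) -> (f * g) m = (f' * g') m.
Proof.
by move=> ff gg; rewrite (eq_mcoefMr _ gg) mulrC (eq_mcoefMr _ ff) mulrC.
Qed.

End Degree.

Lemma nat_deg_eq0 (a : nat) : a = 0%N -> a = 0. Proof. by []. Qed.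
Definition degN : degree nat := @Degree nat id (fun _ _ => erefl) nat_deg_eq0.

Section DegF.
Variable I : finType.
Lemma ffun_degD (a b : {ffun I -> nat}) :
  (\sum_i (a + b)%R i = \sum_i a i + \sum_i b i)%N.
Proof. by rewrite -big_split; apply: eq_bigr => i _; rewrite ffunE. Qed.
Lemma ffun_deg_eq0 (a : {ffun I -> nat}) : (\sum_i a i)%N = 0%N -> a = 0.
Proof.
move=> /eqP; rewrite sum_nat_eq0 => /forallP a0; apply/ffunP => i; rewrite ffunE.
exact/eqP/(implyP (a0 i)).
Qed.
Definition degF : degree {ffun I -> nat} := Degree ffun_degD ffun_deg_eq0.
End DegF.

Section DegP.
Definition poly_deg (p : {poly nat}) : nat := (\sum_(i < size p) (p`_i)%R)%N.
Lemma poly_degE (p : {poly nat}) N : (size p <= N)%N ->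
  poly_deg p = (\sum_(i < N) (p`_i)%R)%N.
Proof.
move=> pN; rewrite /poly_deg (big_ord_widen_cond N xpredT (fun i => p`_i)) //=.
rewrite big_mkcond; apply: eq_bigr => i _; case: ltnP => // h.
by rewrite nth_default.
Qed.
Lemma poly_degD (a b : {poly nat}) : poly_deg (a + b) = (poly_deg a + poly_deg b)%N.
Proof.
pose N := maxn (size a) (size b).
rewrite !(@poly_degE _ N) ?leq_max ?leqnn ?orbT //; last first.
  by rewrite -leq_max; exact: leq_trans (size_polyD a b) _.
by rewrite -big_split; apply: eq_bigr => i _; rewrite coefD.
Qed.
Lemma poly_deg_eq0 (a : {poly nat}) : poly_deg a = 0%N -> a = 0.
Proof.
move=> /eqP; rewrite sum_nat_eq0 => /forallP a0; apply/polyP => i; rewrite coef0.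
case: (ltnP i (size a)) => ia; last by rewrite nth_default.
exact/eqP/(implyP (a0 (Ordinal ia))).
Qed.
Definition degP : degree {poly nat} := Degree poly_degD poly_deg_eq0.
End DegP.

(** Characteristic zero in a form inherited along ring morphisms, hence valid in all the series,
    Laurent and polynomial rings over the base field. *)
Definition qalg (A : comUnitRingType) := forall k, (k.+1%:R : A) \is a GRing.unit.

Lemma qalg_rmorph (A B : comUnitRingType) (h : {rmorphism A -> B}) : qalg A -> qalg B.
Proof. by move=> qA k; rewrite -(rmorph_nat h) rmorph_unit. Qed.

Lemma qalg_num (K : numFieldType) : qalg K.
Proof. by move=> k; rewrite unitfE pnatr_eq0. Qed.

Lemma qalg_mseries (M : exponentType) (A : comUnitRingType) : qalg A -> qalg (mseries M A).
Proof. exact: (qalg_rmorph (@smono M A 0)). Qed.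

Lemma qalg_fact (A : comUnitRingType) (qA : qalg A) k : (k`!%:R : A) \is a GRing.unit.
Proof.
elim: k => [|k IH]; first by rewrite fact0 unitr1.
by rewrite factS natrM unitrM qA IH.
Qed.

Section FiniteCsum.
Variables (M : exponentType) (A : comUnitRingType).

Lemma csum_seq (I : choiceType) (F : I -> mseries M A) m (r : seq I) :
  uniq r -> (forall i, i \notin r -> F i m = 0) -> csum F m = \sum_(i <- r) F i m.
Proof.
move=> ur rF; rewrite /= (fsbigE r) //=; last by move=> i _; exact: rF.
by apply: eq_bigl => i; rewrite in_setT.
Qed.

Lemma csum_nat (F : nat -> mseries M A) m N :
  (forall k, (N <= k)%N -> F k m = 0) -> csum F m = \sum_(k < N) F k m.
Proof.
move=> FN; rewrite (csum_seq (iota_uniq 0 N)).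
  by rewrite -[N in iota _ N]subn0 -/(index_iota 0 N) big_mkord.
by move=> i; rewrite mem_iota add0n /= -leqNgt; exact: FN.
Qed.

Lemma csum1 (F : nat -> mseries M A) m k0 :
  (forall k, k != k0 -> F k m = 0) -> csum F m = F k0 m.
Proof.
move=> F0; rewrite (@csum_seq _ F m [:: k0]) ?big_seq1 // => i.
by rewrite inE; exact: F0.
Qed.

End FiniteCsum.

Lemma triangular_sum (V : zmodType) (G : nat -> nat -> V) N :
  \sum_(k < N) \sum_(i < k.+1) G i (k - i)%N = \sum_(i < N) \sum_(j < N - i) G i j.
Proof.
elim: N => [|N IH]; first by rewrite !big_ord0.
rewrite big_ord_recr IH /= [RHS](eq_bigr (fun i : 'I_N.+1 =>
  \sum_(j < N - i) G i j + G i (N - i)%N)); last first.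
  by move=> i _; rewrite subSn ?big_ord_recr //= -ltnS.
by rewrite big_split /=; congr (_ + _); rewrite big_ord_recr /= subnn big_ord0 addr0.
Qed.

(** * Exponential and logarithm of series without, respectively with, constant term *)

Section ExpLog.
Variables (M : exponentType) (dg : degree M) (A : comUnitRingType).
Hypothesis qA : qalg A.
Implicit Types f g : mseries M A.

Definition expN N f : mseries M A := \sum_(k < N) smono 0 (k`!%:R)^-1 * f ^+ k.

Lemma expSE f m N : f 0 = 0 -> (dg m < N)%N -> expS f m = expN N f m.
Proof.
move=> f0 mN; rewrite /expN mcoef_sum; apply: csum_nat => k Nk.
by rewrite mcoefCM (mcoef_pow_deg (dg := dg)) ?mulr0 // (leq_trans mN).
Qed.

Lemma expS_sum f m N : f 0 = 0 -> (dg m < N)%N ->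
  expS f m = \sum_(k < N) (k`!%:R)^-1 * (f ^+ k) m.
Proof.
move=> f0 mN; rewrite (expSE f0 mN) mcoef_sum; apply: eq_bigr => k _.
by rewrite mcoefCM.
Qed.

Lemma expS0c f : f 0 = 0 -> expS f 0 = 1.
Proof.
move=> f0; rewrite (@expS_sum _ _ 1) ?deg0 // big_ord1 expr0 fact0 mcoef1 eqxx.
by rewrite mulr1 invr1.
Qed.

Lemma expS_0 : expS (0 : mseries M A) = 1.
Proof.
apply: mseriesP => m; rewrite (@expS_sum _ _ (dg m).+1) // big_ord_recl expr0 fact0.
by rewrite invr1 mul1r big1 ?addr0 // => k _; rewrite lift0 expr0n mcoef0 mulr0.
Qed.

Lemma expSD f g : f 0 = 0 -> g 0 = 0 -> expS (f + g) = expS f * expS g.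
Proof.
move=> f0 g0; apply: mseriesP => m; pose N := (dg m).+1.
have fg0 : (f + g) 0 = 0 by rewrite mcoefD f0 g0 addr0.
rewrite (@expSE _ _ N) //.
rewrite (@eq_mcoefM _ dg _ _ (expN N f) _ (expN N g)); first last.
- by move=> a am; apply: expSE.
- by move=> a am; apply: expSE.
rewrite /expN big_distrl /= !mcoef_sum.
under [RHS]eq_bigr => i _ do rewrite big_distrr mcoef_sum /=.
pose G (i j : nat) := (smono 0 (i`!%:R)^-1 * f ^+ i * (smono 0 (j`!%:R)^-1 * g ^+ j)) m.
have GE i j : G i j = (i`!%:R)^-1 * (j`!%:R)^-1 * (f ^+ i * g ^+ j) m.
  by rewrite /G mulrACA -rmorphM mcoefCM.
transitivity (\sum_(k < N) \sum_(i < k.+1) G i (k - i)%N).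
  apply: eq_bigr => k _; rewrite mcoefCM addrC exprDn mcoef_sum mulr_sumr.
  apply: eq_bigr => i _; have ik : (i <= k)%N by rewrite -ltnS.
  have uk : forall j, (j`!%:R : A) \is a GRing.unit by exact: qalg_fact.
  rewrite mcoefMn GE mulrC mulrnAl -mulrnAr [g ^+ _ * _]mulrC mulrC; congr (_ * _).
  apply: (mulrI (uk k)); rewrite mulrnAr divrr // -(bin_fact ik) !natrM.
  by rewrite -mulrA [X in _ * X]mulrACA !divrr // !mulr1.
rewrite triangular_sum; apply: eq_bigr => i _.
rewrite (big_ord_widen N (fun j => G i j)) ?leq_subr //.
rewrite [RHS](bigID (fun j : 'I_N => (j < N - i)%N)) /=.
(* For i + j >= N the product f^i g^j has no coefficient in the degree of [m], so the triangle of
   indices may be completed to a square. *)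
rewrite [X in _ + X]big1 ?addr0 // => j; rewrite -leqNgt leq_subLR => ijN.
rewrite -[LHS]/(G i j) GE mcoefM big_seq big1 ?mulr0 // => -[a b]; rewrite mem_splits /= => /eqP e.
have [ai|ia] := ltnP (dg a) i; first by rewrite (mcoef_pow_deg (dg := dg)) ?mul0r.
rewrite [X in _ * X](mcoef_pow_deg (dg := dg)) ?mulr0 //.
by have := congr1 dg e; rewrite degD => de; clear -ijN de ia; subst N; lia.
Qed.

(** Covers both z d/dz (no shift, weight the exponent) and d/dp_k (shift by the monomial p_k), so
    that exp and log are differentiated only once. *)
Definition cder (s : M -> M) (c : M -> nat) f : mseries M A :=
  MSeries (fun m => f (s m) *+ c m).

Lemma cder_is_zmod_morphism s c : zmod_morphism (cder s c).
Proof. by move=> f g; apply: mseriesP => m /=; rewrite mulrnBl. Qed.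
HB.instance Definition _ s c := GRing.isZmodMorphism.Build
  (mseries M A) (mseries M A) (cder s c) (cder_is_zmod_morphism s c).

Definition leibniz (D : mseries M A -> mseries M A) :=
  forall f g, D (f * g) = D f * g + f * D g.

Section Der.
Variables (s : M -> M) (c : M -> nat).
Hypothesis lD : leibniz (cder s c).
Let D := cder s c.

Lemma cderB f g : D (f - g) = D f - D g. Proof. exact: (raddfB (cder s c)). Qed.
Lemma cderD f g : D (f + g) = D f + D g. Proof. exact: (raddfD (cder s c)). Qed.
Lemma cder_sum I (r : seq I) (P : pred I) F :
  D (\sum_(i <- r | P i) F i) = \sum_(i <- r | P i) D (F i).
Proof. exact: (raddf_sum (cder s c)). Qed.

Lemma leibniz1 : D 1 = 0.
Proof.
by have := lD 1 1; rewrite !mulr1 mul1r => /esym/(canRL (addrK _)); rewrite subrr.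
Qed.

Lemma leibnizC x f : D (smono 0 x * f) = smono 0 x * D f.
Proof. by apply: mseriesP => m; rewrite mcoefCM -[LHS]/((smono 0 x * f) (s m) *+ c m) mcoefCM mulrnAr. Qed.

Lemma leibnizX f k : D (f ^+ k) = f ^+ k.-1 * D f *+ k.
Proof.
elim: k => [|k IH]; first by rewrite leibniz1.
rewrite exprS /D lD -/D IH /=; case: k IH => [|k] IH; first by rewrite mulr0n mulr0 addr0 expr0 mulrC.
by rewrite -mulrnAr mulrA -exprS [RHS]mulrS [D f * _]mulrC mulrnAr.
Qed.

Lemma cder_expS f : f 0 = 0 -> D (expS f) = D f * expS f.
Proof.
move=> f0; apply: mseriesP => m; pose N := (maxn (dg m) (dg (s m))).+1.
have -> : D (expS f) m = D (expN N.+1 f) m.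
  by rewrite -[LHS]/(expS f (s m) *+ c m) (@expSE _ _ N.+1) // /N; lia.
rewrite (@eq_mcoefMr _ dg _ _ _ (expN N f)); last first.
  by move=> a am; apply: expSE => //; rewrite /N; lia.
have -> : expN N.+1 f = 1 + \sum_(k < N) smono 0 (k.+1`!%:R)^-1 * f ^+ k.+1.
  by rewrite /expN big_ord_recl fact0 invr1 expr0 mulr1 rmorph1.
rewrite cderD leibniz1 add0r cder_sum mulr_sumr.
congr (mcoef _ m); apply: eq_bigr => k _.
rewrite -[LHS]/(D _) leibnizC leibnizX /= mulrC -mulrnAl -mulrA mulrnAl -mulrnAr mulrC mulrA.
rewrite -mulrnAr smonoMn; congr (_ * smono 0 _ * _).
by rewrite factS natrM invrM ?qA ?qalg_fact // -mulrnAr -[_^-1 *+ _]mulr_natr mulVr ?mulr1 ?qA.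
Qed.

Lemma cder_logS f : f 0 = 1 -> D f = f * D (logS f).
Proof.
move=> f1; apply: mseriesP => m; pose N := (maxn (dg m) (dg (s m))).+1; pose g := f - 1.
have g0 : g 0 = 0 by rewrite mcoefB f1 mcoef1 eqxx subrr.
pose lg := \sum_(k < N) smono 0 ((-1) ^+ k / k.+1%:R) * g ^+ k.+1.
have lgE a : (dg a < N)%N -> logS f a = lg a.
  move=> aN; rewrite /lg mcoef_sum; apply: csum_nat => k Nk.
  by rewrite mcoefCM (mcoef_pow_deg (dg := dg)) ?mulr0 // ltnS (leq_trans (ltnW aN)).
(* The shift [s] may raise degrees, so the truncated logarithm has to be exact at every [s d.2] met
   in the product, not only up to the degree of [m]. *)
pose N' := (maxn (\max_(d <- splits m) dg (s d.2)) N).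
pose lg' := \sum_(k < N') smono 0 ((-1) ^+ k / k.+1%:R) * g ^+ k.+1.
have lgE' a : (dg a <= N')%N -> logS f a = lg' a.
  move=> aN; rewrite /lg' mcoef_sum; apply: csum_nat => k Nk.
  by rewrite mcoefCM (mcoef_pow_deg (dg := dg)) ?mulr0 // ltnS (leq_trans aN).
have -> : (f * D (logS f)) m = (f * D lg') m.
  rewrite !mcoefM big_seq [RHS]big_seq; apply: eq_bigr => d dm.
  congr (_ * _); rewrite -[LHS]/(logS f (s d.2) *+ c d.2) lgE' // leq_max; apply/orP; left.
  exact: (@leq_bigmax_seq _ (splits m) xpredT (fun d : M * M => dg (s d.2)) d dm).
have Df : D f = D g by rewrite /g cderB leibniz1 subr0.
have -> : D lg' = \sum_(k < N') (- g) ^+ k * D g.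
  rewrite /lg' cder_sum; apply: eq_bigr => k _.
  rewrite leibnizC leibnizX -[k.+1.-1]/(k : nat) mulrnAr -mulrnAl smonoMn mulrA.
  by rewrite -mulrnAr -[_^-1 *+ _]mulr_natr mulVr ?qA // mulr1 rmorphXn rmorphN1 -exprNn.
rewrite -mulr_suml mulrA.
(* Geometric sum for f = 1 - (-g); the remainder (-g)^N' is invisible in the degree of [m]. *)
have -> : f * (\sum_(k < N') (- g) ^+ k) = 1 - (- g) ^+ N'.
  have -> : f = 1 - (- g) by rewrite opprK /g addrC subrK.
  by rewrite -[1 - - g]opprB mulNr -subrX1 opprB.
rewrite mulrBl mul1r mcoefB Df mulrC.
suff -> : (D g * (- g) ^+ N') m = 0 by rewrite subr0.
rewrite mcoefM big_seq big1 // => -[a b]; rewrite mem_splits => /eqP /= e.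
rewrite [X in _ * X](mcoef_pow_deg (dg := dg)) ?mulr0 ?mcoefN ?g0 ?oppr0 //.
rewrite /N' /N -e degD; lia.
Qed.

End Der.
End ExpLog.

(** * Convolution in one variable and complete homogeneous functions of power sums *)

Lemma perm_nat_splits (k : nat) :
  perm_eq (splits k : seq (nat * nat)) [seq (i, (k - i)%N) | i <- iota 0 k.+1].
Proof.
have msk (x : nat * nat) : (x \in (splits k : seq (nat * nat))) = (x.1 + x.2 == k)%N.
  exact: mem_splits.
apply: uniq_perm; first exact: splits_uniq.
  by rewrite map_inj_in_uniq ?iota_uniq // => a b _ _ [].
move=> [a b]; rewrite msk; apply/idP/idP => [/eqP <- | h].
  by apply/mapP; exists a; rewrite ?mem_iota ?addKn //=; lia.
by case/(@mapP nat _ (fun i => (i, (k - i)%N))): h => i; rewrite mem_iota => ik [-> ->] /=; lia.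
Qed.

Lemma mcoefM_nat (A : comNzRingType) (f g : mseries nat A) (k : nat) :
  (f * g) k = \sum_(i < k.+1) f i * g (k - i)%N.
Proof.
rewrite mcoefM (perm_big _ (perm_nat_splits k)) big_map.
by rewrite -[iota 0 k.+1]/(index_iota 0 k.+1) big_mkord.
Qed.

Lemma mulrSn_inj (A : comUnitRingType) (qA : qalg A) k (x y : A) :
  x *+ k.+1 = y *+ k.+1 -> x = y.
Proof. by rewrite -[x *+ _]mulr_natr -[y *+ _]mulr_natr => /(mulIr (qA k)). Qed.

(* A locked copy: comparing two unfolded instances of [hsym] is intractable. *)
HB.lock Definition hs (A : comUnitRingType) (p : nat -> A) (k : nat) : A := hsym p k.

Lemma hsym_hs (A : comUnitRingType) (p : nat -> A) k : hsym p k = hs p k.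
Proof. by rewrite unlock. Qed.

Section Hsym.
Variables (A : comUnitRingType) (qA : qalg A).
Implicit Types p : nat -> A.

Definition pser p : mseries nat A :=
  MSeries (fun j => if j is 0 then 0 else p j / j%:R).

Lemma hsymE p k : hs p k = expS (pser p) k. Proof. by rewrite unlock. Qed.

Lemma eq_hsym p p' k : (forall j, (0 < j)%N -> p j = p' j) -> hs p k = hs p' k.
Proof.
move=> e; rewrite !hsymE; congr (mcoef (expS _) k).
by apply: mseriesP => -[|j] //=; rewrite e.
Qed.

Lemma euler_leibniz : leibniz (@cder nat A id id).
Proof.
move=> f g; apply: mseriesP => m.
rewrite mcoefD -[LHS]/((f * g) m *+ m) !mcoefM_nat -sumrMnl -big_split /=.
apply: eq_bigr => i _; rewrite mulrnAl mulrnAr -mulrnDr; congr (_ *+ _).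
by have := ltn_ord i; lia.
Qed.

Lemma hsym0 p : hs p 0 = 1.
Proof. by rewrite hsymE; exact: (expS0c degN). Qed.

Lemma hsym_rec p k :
  hs p k.+1 *+ k.+1 = \sum_(i < k.+1) p i.+1 * hs p (k - i)%N.
Proof.
have := congr1 (fun f => mcoef f k.+1) (cder_expS degN qA euler_leibniz (f := pser p) erefl).
rewrite -[LHS]/(expS (pser p) k.+1 *+ k.+1) -hsymE => ->; rewrite mcoefM_nat big_ord_recl.
rewrite -[cder _ _ _ _]/(0 *+ 0) mul0r add0r; apply: eq_bigr => i _.
rewrite lift0 subSS hsymE; congr (_ * _).
by rewrite -[LHS]/(p i.+1 / i.+1%:R *+ i.+1) -mulr_natr divrK ?qA.
Qed.

(** Newton's recursion determines the h_k one after the other; evaluations such as [hsymZ],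
    [hsym_geom] and [hs_map] then only have to check it. *)
Lemma hsym_uniq p (h : nat -> A) : h 0%N = 1 ->
  (forall k, h k.+1 *+ k.+1 = \sum_(i < k.+1) p i.+1 * h (k - i)%N) ->
  forall k, h k = hs p k.
Proof.
move=> h0 hr k; have [n] := ubnP k; elim: n k => // n IH [|k] kn.
  by rewrite h0 hsym0.
apply: (mulrSn_inj qA (k := k)); rewrite hr hsym_rec; apply: eq_bigr => i _.
by rewrite IH //; lia.
Qed.

Lemma hsymD p p' k : hs (fun j => p j + p' j) k =
  \sum_(i < k.+1) hs p i * hs p' (k - i)%N.
Proof.
rewrite hsymE; transitivity ((expS (pser p) * expS (pser p')) k); last first.
  by rewrite mcoefM_nat; apply: eq_bigr => i _; rewrite !hsymE.
rewrite -(expSD degN qA (f := pser p) (g := pser p') erefl erefl); congr (mcoef (expS _) k).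
by apply: mseriesP => -[|j]; rewrite mcoefD /= ?addr0 // mulrDl.
Qed.

Lemma hsymZ c p k : hs (fun j => c ^+ j * p j) k = c ^+ k * hs p k.
Proof.
apply/esym; move: k.
apply: (hsym_uniq (h := fun k => c ^+ k * hs p k)) => [|k]; first by rewrite hsym0 mulr1.
rewrite -mulrnAr hsym_rec mulr_sumr; apply: eq_bigr => i _.
rewrite mulrACA -exprD; congr (_ ^+ _ * _); have := ltn_ord i; lia.
Qed.

Lemma hsym_const0 k : hs (fun=> 0 : A) k = (k == 0)%:R.
Proof.
rewrite hsymE -[pser _]/(pser (fun=> 0)); have -> : pser (fun=> 0) = 0.
  by apply: mseriesP => -[|j] //=; rewrite mul0r.
by rewrite (expS_0 degN) mcoef1.
Qed.

Lemma hsymK p k : \sum_(i < k.+1) hs (fun j => - p j) i * hs p (k - i)%N = (k == 0)%:R.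
Proof.
rewrite -hsymD -hsym_const0; apply: eq_hsym => j _; exact: addNr.
Qed.

Lemma hsym_geom (c : A) k : hs (fun j => c ^+ j) k = c ^+ k.
Proof.
apply/esym; move: k; apply: (hsym_uniq (h := fun k => c ^+ k)) => // k.
under eq_bigr => i _ do rewrite -exprD.
rewrite (eq_bigr (fun=> c ^+ k.+1)) ?sumr_const ?card_ord // => i _.
by congr (_ ^+ _); have := ltn_ord i; lia.
Qed.

(** The generating series exp(- sum_j c^j x^j / j) is 1 - c x. *)
Lemma hsym_Ngeom (c : A) k : hs (fun j => - c ^+ j) k =
  if k is 0 then 1 else if k is 1 then - c else 0.
Proof.
apply/esym; move: k.
apply: (hsym_uniq (h := fun k => if k is 0 then 1 else if k is 1 then - c else 0)) => // -[|k].
  by rewrite big_ord1 expr1 mulr1.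
rewrite mul0rn big_ord_recr big_ord_recr /= subnn subSnn mulr1 big1 => [|i _].
  by rewrite add0r mulrN mulNr opprK -exprSr subrr.
by case: i => i /= ik; case e : (k.+1 - i)%N => [|[|j]]; rewrite ?mulr0 //; lia.
Qed.

Lemma hsym_Ngeom2 (a b : A) k : hs (fun j => - a ^+ j - b ^+ j) k =
  if k is 0 then 1 else if k is 1 then - (a + b) else if k is 2 then a * b else 0.
Proof.
rewrite (hsymD (fun j => - a ^+ j) (fun j => - b ^+ j)).
under eq_bigr => i _ do rewrite !hsym_Ngeom.
case: k => [|[|[|k]]].
- by rewrite big_ord1 mulr1.
- by rewrite 2!big_ord_recr big_ord0 /= add0r mul1r mulr1 opprD addrC.
- by rewrite 3!big_ord_recr big_ord0 /= add0r mul0r mulr0 addr0 add0r mulrNN.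
rewrite big1 // => -[[|[|i]] ik] _ /=; by rewrite ?mul0r ?mulr0.
Qed.

(** Partial fractions of 1 / ((1 - a x)(1 - b x)), with a - b cleared because it need not be
    invertible. *)
Lemma hsym_geom2 (a b : A) k : (a - b) * hs (fun j => a ^+ j + b ^+ j) k = a ^+ k.+1 - b ^+ k.+1.
Proof.
rewrite (hsymD (fun j => a ^+ j) (fun j => b ^+ j)).
under eq_bigr => i _ do rewrite !hsym_geom.
rewrite subrXX; congr (_ * _); rewrite (reindex_inj rev_ord_inj) /=.
apply: eq_bigr => i _; rewrite subSS; congr (_ ^+ _ * _ ^+ _).
by have := ltn_ord i; lia.
Qed.

(* The coefficients of the pair interaction of two vertex operators. *)
Lemma hsym_pair (a b c d : A) k : a * b = 1 -> c * d = 1 -> (0 < k)%N ->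
  (a - b) * hs (fun j => a ^+ j + b ^+ j + (- c ^+ j - d ^+ j)) k =
  (a + b - (c + d)) * (a ^+ k - b ^+ k).
Proof.
move=> ab cd; case: k => // k _; rewrite (hsymD (fun j => a ^+ j + b ^+ j)).
rewrite mulr_sumr; under eq_bigr => i _ do rewrite mulrA hsym_geom2 hsym_Ngeom2.
case: k => [|k].
  rewrite 2!big_ord_recr big_ord0 /= add0r !expr1 mulr1 mulrC.
  by ring.
rewrite 3!big_ord_recr /= big1 => [|i _]; last first.
  case: i => i /= ik; case e : (k.+2 - i)%N => [|[|[|j]]]; rewrite ?mulr0 //; lia.
have -> : (k.+2 - k)%N = 2%N by lia.
have -> : (k.+2 - k.+1)%N = 1%N by lia.
rewrite subnn add0r mulr1 cd mulr1.
have ea : a ^+ k.+1 = a * b * a ^+ k.+1 by rewrite ab mul1r.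
have eb : b ^+ k.+1 = a * b * b ^+ k.+1 by rewrite ab mul1r.
by rewrite {1}ea {1}eb !exprS; ring.
Qed.

End Hsym.

Lemma sum_unit (V : nmodType) (F : unit -> V) : \sum_i F i = F tt.
Proof. by rewrite (big_pred1 tt) // => -[]. Qed.

(** * Vertex operators on polynomial functions and their commutator *)

Section Fock.
Variables (L : idomainType) (qL : qalg L).
Local Notation vec := ((nat -> L) -> L).

Lemma natrL_eq0 k : (k%:R == 0 :> L) = (k == 0)%N.
Proof.
case: k => [|k]; first by rewrite !eqxx.
by apply/negbTE/eqP => e; have := qL k; rewrite e unitr0.
Qed.

Lemma natrL_inj : injective (fun k : nat => k%:R : L).
Proof.
have h (a b : nat) : (a <= b)%N -> (a%:R : L) = b%:R -> a = b.
  move=> ab /eqP; rewrite eq_sym -subr_eq0 -natrB // natrL_eq0; lia.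
by move=> a b e; case: (leqP a b) => [/h|/ltnW /h] ->.
Qed.

Lemma poly_nat_roots (q : {poly L}) B :
  (forall k, (B <= k)%N -> q.[k%:R] = 0) -> q = 0.
Proof.
move=> q0; apply/eqP; apply: contraT => nq.
have := max_poly_roots (p := q) (rs := [seq k%:R | k <- iota B (size q)]) nq.
rewrite size_map size_iota ltnn; apply.
  by apply/allP => x /mapP[k]; rewrite mem_iota => /andP[Bk _] ->; rewrite /root q0.
by rewrite map_inj_uniq ?iota_uniq //; exact: natrL_inj.
Qed.

Definition csub (P : L -> Prop) : Prop :=
  [/\ P 1, forall x y, P x -> P y -> P (x - y), forall x y, P x -> P y -> P (x * y) &
      forall k, P (k.+1%:R)^-1].

(** The Fock space, as polynomial functions of the times t_k. The predicate on coefficients later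
    records which variables u_i they involve ([depP]), or that they are exponential sums in u_x +
    u_z ([Pc]). *)
Inductive pf (P : L -> Prop) : vec -> Prop :=
  | pfC a : P a -> pf P (fun=> a)
  | pfV k : pf P (fun t => t k)
  | pfD v w : pf P v -> pf P w -> pf P (fun t => v t + w t)
  | pfM v w : pf P v -> pf P w -> pf P (fun t => v t * w t).

Section PolynomialFunctions.
Variables (P : L -> Prop) (cP : csub P).

Lemma csub1 : P 1. Proof. by case: cP. Qed.
Lemma csubB x y : P x -> P y -> P (x - y). Proof. by case: cP => _ h _ _; exact: h. Qed.
Lemma csubM x y : P x -> P y -> P (x * y). Proof. by case: cP => _ _ h _; exact: h. Qed.
Lemma csubV k : P (k.+1%:R)^-1. Proof. by case: cP. Qed.
Lemma csub0 : P 0. Proof. by rewrite -(subrr 1); apply: csubB; exact: csub1. Qed.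
Lemma csubN x : P x -> P (- x).
Proof. by move=> Px; rewrite -sub0r; apply: csubB => //; exact: csub0. Qed.
Lemma csubD x y : P x -> P y -> P (x + y).
Proof. by move=> Px Py; rewrite -[y]opprK; apply: csubB => //; exact: csubN. Qed.
Lemma csub_sum I (r : seq I) (Q : pred I) F :
  (forall i, Q i -> P (F i)) -> P (\sum_(i <- r | Q i) F i).
Proof. by move=> h; apply: big_ind => //; [exact: csub0|exact: csubD]. Qed.

Lemma pf_sum I (r : seq I) (Q : pred I) (F : I -> vec) :
  (forall i, Q i -> pf P (F i)) -> pf P (fun t => \sum_(i <- r | Q i) F i t).
Proof.
move=> h; elim: r => [|i r IH].
  rewrite (_ : (fun _ => _) = fun=> 0); first exact/pfC/csub0.
  by apply/funext => t; rewrite big_nil.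
have [Qi|nQ] := boolP (Q i).
  rewrite (_ : (fun _ => _) = fun t => F i t + \sum_(i <- r | Q i) F i t).
    exact: pfD (h _ Qi) IH.
  by apply/funext => t; rewrite big_cons Qi.
rewrite (_ : (fun _ => _) = fun t => \sum_(i <- r | Q i) F i t) //.
by apply/funext => t; rewrite big_cons (negbTE nQ).
Qed.

Lemma pf_prod I (r : seq I) (F : I -> vec) :
  (forall i, pf P (F i)) -> pf P (fun t => \prod_(i <- r) F i t).
Proof.
move=> h; elim: r => [|i r IH].
  rewrite (_ : (fun _ => _) = fun=> 1); first exact/pfC/csub1.
  by apply/funext => t; rewrite big_nil.
rewrite (_ : (fun _ => _) = fun t => F i t * \prod_(i <- r) F i t).
  exact: pfM (h _) IH.
by apply/funext => t; rewrite big_cons.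
Qed.

Definition sh (kap t : nat -> L) (s : L) : nat -> L := fun k => t k + kap k * s ^+ k.

(** The expansion in s is kept as a finite sum of monomials whose exponents may repeat, so that sums
    and products need no normal form. *)
Lemma pf_shift kap v : (forall k, P (kap k)) -> pf P v ->
  exists (I : finType) (w : I -> vec) (e : I -> nat), (forall i, pf P (w i)) /\
    forall t s, v (sh kap t s) = \sum_i w i t * s ^+ e i.
Proof.
move=> Pk; elim=> [a Pa|k|{}v v' _ [I [w [e [pw vE]]]] _ [I' [w' [e' [pw' vE']]]]
                  |{}v v' _ [I [w [e [pw vE]]]] _ [I' [w' [e' [pw' vE']]]]].
- exists unit, (fun _ _ => a), (fun=> 0%N); split => [_|t s]; first exact: pfC.
  by rewrite (big_pred1 tt) ?mulr1 // => -[].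
- exists bool, (fun b t => if b then t k else kap k), (fun b => if b then 0%N else k).
  split => [[]|t s]; [exact: pfV|exact/pfC/Pk|].
  by rewrite big_bool /= expr0 mulr1.
- exists (I + I')%type, (fun i t => match i with inl i => w i t | inr i => w' i t end),
    (fun i => match i with inl i => e i | inr i => e' i end).
  by split => [[i|i]|t s]; rewrite ?vE ?vE' ?big_sumType.
exists (I * I')%type, (fun i t => w i.1 t * w' i.2 t), (fun i => e i.1 + e' i.2)%N.
split => [i|t s]; first exact: pfM.
rewrite vE vE' big_distrl /= [RHS](eq_bigr
  (fun i => w i.1 t * s ^+ e i.1 * (w' i.2 t * s ^+ e' i.2))); last first.
  by move=> i _; rewrite exprD mulrACA.
rewrite -(pair_bigA _ (fun i j => w i t * s ^+ e i * (w' j t * s ^+ e' j))) /=.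
by apply: eq_bigr => i _; rewrite big_distrr.
Qed.

Lemma pf_hsym kap M : (forall k, P (kap k)) ->
  pf P (fun t => hs (fun k => kap k * t k) M).
Proof.
move=> Pk; have [n] := ubnP M; elim: n M => // n IH [|M] Mn.
  rewrite (_ : (fun _ => _) = fun=> 1); first exact/pfC/csub1.
  by apply/funext => t; rewrite hsym0.
rewrite (_ : (fun _ => _) = fun t => (M.+1%:R)^-1 *
    \sum_(i < M.+1) (kap i.+1 * t i.+1) * hs (fun k => kap k * t k) (M - i)); last first.
  apply/funext => t; apply: (mulrI (qL M)); rewrite mulrA divrr ?qL // mul1r.
  by rewrite -hsym_rec // mulr_natl.
apply: (pfM (v := fun=> _)); first exact/pfC/csubV.
apply: pf_sum => i _; apply: (pfM (v := fun t => kap i.+1 * t i.+1)); last by apply: IH; lia.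
exact: (pfM (v := fun=> _) (pfC (Pk _)) (pfV _ _)).
Qed.

End PolynomialFunctions.

Definition he (kap t : nat -> L) (M : int) : L :=
  if M is Posz m then hs (fun k => kap k * t k) m else 0.

Definition shpoly kap (v : vec) t : {poly L} :=
  xget 0 [set q : {poly L} | forall s, v (sh kap t s) = q.[s]].

(** The coefficient of x^m in exp(sum_k kap_k t_k x^k / k) exp(sum_k kap_k x^(-k) d/dt_k): the shift
    yields q_k x^(-k), which must meet h_(m+k). *)
Definition Eop (m : int) kap (v : vec) : vec := fun t =>
  let q := shpoly kap v t in \sum_(k < size q) q`_k * he kap t (m + k%:Z).

Lemma shpolyE kap v t (q : {poly L}) :
  (forall s, v (sh kap t s) = q.[s]) -> shpoly kap v t = q.
Proof.
move=> vq; rewrite /shpoly; case: xgetP => [q' _ /= vq'|/(_ q)]; last by case.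
apply/eqP; rewrite -subr_eq0; apply/eqP/(@poly_nat_roots _ 0) => k _.
by rewrite hornerD hornerN -vq -vq' subrr.
Qed.

Lemma Eop_eval m kap v t (I : finType) (a : I -> L) (e : I -> nat) :
  (forall s, v (sh kap t s) = \sum_i a i * s ^+ e i) ->
  Eop m kap v t = \sum_i a i * he kap t (m + (e i)%:Z).
Proof.
move=> vE; pose q : {poly L} := \sum_i (a i)%:P * 'X^(e i).
have qE k : q`_k = \sum_i a i * (k == e i)%:R.
  by rewrite coef_sum; apply: eq_bigr => i _; rewrite coefCM coefXn.
rewrite /Eop (@shpolyE _ _ _ q); last first.
  move=> s; rewrite vE /q horner_sum; apply: eq_bigr => i _.
  by rewrite hornerCM hornerXn.
have qN : (size q <= (\max_i e i).+1)%N.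
  apply/leq_sizeP => j ej; rewrite qE big1 // => i _.
  by have := leq_bigmax (F := e) i; case: eqP => [|_ _]; rewrite ?mulr0 //; lia.
transitivity (\sum_(k < (\max_i e i).+1) q`_k * he kap t (m + k%:Z)).
  rewrite (big_ord_widen _ (fun k => q`_k * he kap t (m + k%:Z)) qN) big_mkcond.
  by apply: eq_bigr => k _; case: ltnP => // h; rewrite nth_default ?mul0r.
rewrite (eq_bigr (fun k : 'I_(\max_i e i).+1 =>
  \sum_i a i * ((k : nat) == e i)%:R * he kap t (m + k%:Z))); last first.
  by move=> k _; rewrite -mulr_suml; congr (_ * _); exact: qE.
rewrite exchange_big; apply: eq_bigr => i _ /=.
have ei : (e i < (\max_i e i).+1)%N by rewrite ltnS (leq_bigmax (F := e)).
rewrite (bigD1 (Ordinal ei)) //= eqxx mulr1 big1 ?addr0 // => k ki.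
have /negbTE -> : (k : nat) != e i by [].
by rewrite mulr0 mul0r.
Qed.

Lemma pf_he P kap M : csub P -> (forall k, P (kap k)) -> pf P (fun t => he kap t M).
Proof.
move=> cP Pk; case: M => M; first exact: (pf_hsym cP).
exact/pfC/(csub0 cP).
Qed.

Lemma pf_Eop P m kap v : csub P -> (forall k, P (kap k)) -> pf P v -> pf P (Eop m kap v).
Proof.
move=> cP Pk pv; have [I [w [e [pw vE]]]] := pf_shift Pk pv.
rewrite (_ : Eop m kap v = fun t => \sum_i w i t * he kap t (m + (e i)%:Z)).
  by apply: pf_sum => // i _; apply: (pfM (v := w i)) => //; exact: pf_he.
by apply/funext => t; apply: Eop_eval => s; exact: vE.
Qed.

Definition pfT := pf (fun=> True).
Lemma csubT : csub (fun=> True). Proof. by split. Qed.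

Lemma pf_sub P Q v : (forall x, P x -> Q x) -> pf P v -> pf Q v.
Proof.
by move=> PQ; elim=> [a /PQ|k|? ? _ ? _|? ? _ ? _]; [exact: pfC|exact: pfV|exact: pfD|exact: pfM].
Qed.

Lemma EopD m kap v w t : pfT v -> pfT w ->
  Eop m kap (fun t => v t + w t) t = Eop m kap v t + Eop m kap w t.
Proof.
move=> pv pw; have [I [a [e [_ vE]]]] := pf_shift (P := fun=> True) (kap := kap) (fun=> Logic.I) pv.
have [J [b [f [_ wE]]]] := pf_shift (P := fun=> True) (kap := kap) (fun=> Logic.I) pw.
rewrite (Eop_eval _ (vE t)) (Eop_eval _ (wE t)).
rewrite (@Eop_eval m kap _ t (I + J)%type (fun i => match i with inl i => a i t | inr i => b i t end)
  (fun i => match i with inl i => e i | inr i => f i end)); first by rewrite big_sumType.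
by move=> s; rewrite vE wE big_sumType.
Qed.

Lemma EopZ m kap c v t : pfT v ->
  Eop m kap (fun t => c * v t) t = c * Eop m kap v t.
Proof.
move=> pv; have [I [a [e [_ vE]]]] := pf_shift (P := fun=> True) (kap := kap) (fun=> Logic.I) pv.
rewrite (Eop_eval _ (vE t)) mulr_sumr.
rewrite (@Eop_eval m kap _ t I (fun i => c * a i t) e).
  by apply: eq_bigr => i _; rewrite mulrA.
by move=> s; rewrite vE mulr_sumr; apply: eq_bigr => i _; rewrite mulrA.
Qed.

Lemma sum_support (G : int -> L) (r1 r2 : seq int) : uniq r1 -> uniq r2 ->
  (forall x, G x != 0 -> (x \in r1) && (x \in r2)) ->
  \sum_(x <- r1) G x = \sum_(x <- r2) G x.
Proof.
move=> u1 u2 h; have red r : \sum_(x <- r) G x = \sum_(x <- [seq x <- r | G x != 0]) G x.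
  rewrite big_filter [LHS](bigID (fun x => G x != 0)) /= [X in _ + X]big1 ?addr0 //.
  by move=> x; rewrite negbK => /eqP.
rewrite red [RHS]red; apply: perm_big; apply: uniq_perm; rewrite ?filter_uniq // => x.
by rewrite !mem_filter; case: (boolP (G x != 0)) => // /h /andP[-> ->].
Qed.

(** For g = e^(u/2) this is 2 sinh(k u / 2). *)
Definition kap (g : L) (k : nat) : L := g ^+ k - g^-1 ^+ k.

(** Fusion of two shifts: the two arguments have ratio g1 g2, which is a pole of the pair
    interaction. [he_merge] is the same fusion for the multiplication part; the variants with
    inverses belong to the other pole. *)
Lemma kap_merge (g1 g2 : L) k s : g1 \is a GRing.unit -> g2 \is a GRing.unit ->
  kap (g1 * g2) k * s ^+ k = kap g1 k * (g2^-1 * s) ^+ k + kap g2 k * (g1 * s) ^+ k.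
Proof.
by move=> u1 u2; rewrite /kap invrM // !exprMn; ring.
Qed.

Lemma he_neg k1 t (M : int) : M < 0 -> he k1 t M = 0.
Proof. by case: M. Qed.

(* The coefficient of [s^d] in the change of [he kap2 t M] under [t -> sh kap1 t s]. *)
Lemma he_sh k1 k2 t s M D : (M < D%:Z) ->
  he k2 (sh k1 t s) M =
  \sum_(d < D) hs (fun k => k1 k * k2 k) d * s ^+ d * he k2 t (M - d%:Z).
Proof.
move=> MD; case: M MD => M MD; last first.
  by rewrite /= big1 // => d _; rewrite [X in he _ _ X](_ : _ = Negz (M + d)) ?mulr0 //; lia.
have MD' : (M.+1 <= D)%N by lia.
rewrite [LHS](_ : _ = \sum_(d < M.+1) hs (fun k => k1 k * k2 k) d * s ^+ d *
    he k2 t (M%:Z - d%:Z)); last first.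
  rewrite /he /= (@eq_hsym _ _ (fun k => s ^+ k * (k1 k * k2 k) + k2 k * t k)); last first.
    by move=> j _; rewrite /sh; ring.
  rewrite (hsymD qL (fun k => s ^+ k * (k1 k * k2 k))); apply: eq_bigr => d _.
  rewrite (hsymZ qL) [s ^+ d * _]mulrC; congr (_ * _).
  by rewrite (_ : M%:Z - d%:Z = (M - d)%N%:Z) //; have := ltn_ord d; lia.
rewrite (big_ord_widen D (fun d => hs (fun k => k1 k * k2 k) d * s ^+ d *
    he k2 t (M%:Z - d%:Z)) MD') big_mkcond; apply: eq_bigr => d _.
case: ltnP => // h.
by rewrite [X in he _ _ X](_ : _ = Negz (d - M).-1) ?mulr0 //; lia.
Qed.

Lemma he_merge (g1 g2 : L) t n : g1 \is a GRing.unit -> g2 \is a GRing.unit ->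
  he (kap (g1 * g2)) t n%:Z = \sum_(a < n.+1)
    g1 ^ (a%:Z - n%:Z) * g2 ^ a%:Z * (he (kap g1) t a%:Z * he (kap g2) t (n%:Z - a%:Z)).
Proof.
move=> u1 u2; rewrite /he (@eq_hsym _ _ (fun k => g2 ^+ k * (kap g1 k * t k) +
   g1^-1 ^+ k * (kap g2 k * t k))); last first.
  move=> j _; rewrite /kap invrM // !exprMn; ring.
rewrite (hsymD qL (fun k => g2 ^+ k * (kap g1 k * t k))); apply: eq_bigr => a _.
rewrite !hsymZ //; have an : (a <= n)%N by rewrite -ltnS.
have -> : n%:Z - a%:Z = (n - a)%N%:Z by lia.
have -> : a%:Z - n%:Z = - (n - a)%N%:Z by lia.
have -> : g1 ^ (- (n - a)%N%:Z) = g1^-1 ^+ (n - a) by rewrite exprVn -exprnN.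
by rewrite -[g2 ^ a%:Z]/(g2 ^+ a) mulrACA [g2 ^+ a * _]mulrC.
Qed.

Lemma he_mergeV (g1 g2 : L) t n : g1 \is a GRing.unit -> g2 \is a GRing.unit ->
  he (kap (g1 * g2)) t n%:Z = \sum_(a < n.+1)
    g1 ^ (n%:Z - a%:Z) * g2 ^ (- a%:Z) * (he (kap g1) t a%:Z * he (kap g2) t (n%:Z - a%:Z)).
Proof.
move=> u1 u2; rewrite /he (@eq_hsym _ _ (fun k => g2^-1 ^+ k * (kap g1 k * t k) +
   g1 ^+ k * (kap g2 k * t k))); last first.
  by move=> j _; rewrite /kap invrM // !exprMn; ring.
rewrite (hsymD qL (fun k => g2^-1 ^+ k * (kap g1 k * t k))); apply: eq_bigr => a _.
rewrite !hsymZ //; have an : (a <= n)%N by rewrite -ltnS.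
have -> : n%:Z - a%:Z = (n - a)%N%:Z by lia.
have -> : g2 ^ (- a%:Z) = g2^-1 ^+ a by rewrite exprVn -exprnN.
by rewrite -[g1 ^ (n - a)%N%:Z]/(g1 ^+ (n - a)) mulrACA [g2^-1 ^+ a * _]mulrC.
Qed.

(* Both orders of two vertex operators expand over the same coefficients, on either side of the
   pole; their difference is a sum over all integers. *)
Lemma pair_commutator (g1 g2 : L) t (M1 M2 : int) D :
  g1 \is a GRing.unit -> g2 \is a GRing.unit ->
  (`|M1| + `|M2| < D%:Z) ->
  let c := g1 * g2 in
  let h d := hs (fun k => kap g1 k * kap g2 k) d in
  kap c 1 * (\sum_(d < D) h d * (he (kap g1) t (M1 + d%:Z) * he (kap g2) t (M2 - d%:Z)) -
             \sum_(d < D) h d * (he (kap g1) t (M1 - d%:Z) * he (kap g2) t (M2 + d%:Z))) =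
  kap g1 1 * kap g2 1 * ((g2 ^ (- M1) * g1 ^ M2 - g2 ^ M1 * g1 ^ (- M2)) *
     he (kap c) t (M1 + M2)).
Proof.
move=> u1 u2 MD c h; have uc : c \is a GRing.unit by rewrite unitrM u1.
pose F (a : int) := he (kap g1) t a * he (kap g2) t (M1 + M2 - a).
have F0 (a : int) : (a < 0) || (M1 + M2 < a) -> F a = 0.
  rewrite /F; case: a => a; last by rewrite mul0r.
  by move=> h0; rewrite [X in _ * X]he_neg ?mulr0 //; lia.
pose kz (a : int) : L := c ^ a - c ^ (- a).
pose G (a : int) := kz (a - M1) * F a.
have hE d : (0 < d)%N -> kap c 1 * h d = kap g1 1 * kap g2 1 * kap c d.
  move=> d0; rewrite /h /kap !expr1.
  rewrite (@eq_hsym _ _ (fun j => c ^+ j + c^-1 ^+ j +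
     (- (g1 * g2^-1) ^+ j - (g1^-1 * g2) ^+ j))); last first.
    by move=> j _; rewrite /c invrM // !exprMn; ring.
  rewrite (hsym_pair qL) //; last 2 first.
  - by rewrite divrr.
  - by rewrite mulrACA divrr // mulVr // mulr1.
  by congr (_ * _); rewrite /c invrM //; ring.
transitivity (kap g1 1 * kap g2 1 *
   \sum_(d < D) (G (M1 + d%:Z) + G (M1 - d%:Z))).
  rewrite -sumrB !mulr_sumr; apply: eq_bigr => d _.
  have -> : he (kap g1) t (M1 + d%:Z) * he (kap g2) t (M2 - d%:Z) = F (M1 + d%:Z).
    by congr (_ * he _ _ _); lia.
  have -> : he (kap g1) t (M1 - d%:Z) * he (kap g2) t (M2 + d%:Z) = F (M1 - d%:Z).
    by congr (_ * he _ _ _); lia.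
  rewrite -mulrBr mulrA /G.
  have -> : M1 + d%:Z - M1 = d%:Z by lia.
  have -> : M1 - d%:Z - M1 = - d%:Z by lia.
  have -> : kz (- d%:Z) = - kz d%:Z by rewrite /kz opprK opprB.
  rewrite mulNr -mulrBr; case: (posnP d) => [->|d0].
    by rewrite oppr0 addr0 subrr !mulr0.
  by rewrite hE // [RHS]mulrA; congr (_ * _ * _); rewrite /kz /kap exprVn exprnN.
congr (_ * _).
have kz0 : kz 0 = 0 by rewrite /kz oppr0 subrr.
have D0 : (0 < D)%N by lia.
(* The two one-sided sums are glued at M1 into one window. Their common term d = 0 carries the
   factor [kz 0], which is 0, so it may be listed once. *)
pose r1 := [seq M1 + k%:Z | k <- iota 0 D] ++ [seq M1 - k%:Z | k <- iota 1 D.-1].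
have -> : \sum_(d < D) (G (M1 + d%:Z) + G (M1 - d%:Z)) = \sum_(x <- r1) G x.
  rewrite big_split /r1 big_cat !big_map /=; congr (_ + _).
    by rewrite -(big_mkord xpredT (fun d => G (M1 + d%:Z))) /index_iota subn0.
  rewrite -(big_mkord xpredT (fun d => G (M1 - d%:Z))) big_ltn // oppr0 addr0.
  by rewrite {1}/G subrr kz0 mul0r add0r /index_iota subn1.
have ur1 : uniq r1.
  rewrite cat_uniq; apply/and3P; split.
  - by rewrite map_inj_uniq ?iota_uniq // => a b /addrI [].
  - apply/hasPn => x /mapP[k]; rewrite mem_iota => k0 ->.
    by apply/negP => /mapP[j _]; move: k0; lia.
  - by rewrite map_inj_uniq ?iota_uniq // => a b; lia.
have mr1 (x : int) : `|x - M1| < D%:Z -> x \in r1.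
  move=> xD; rewrite mem_cat; apply/orP; case: (lerP M1 x) => Mx; [left|right].
    by apply/mapP; exists `|x - M1|%N; rewrite ?mem_iota; lia.
  by apply/mapP; exists `|x - M1|%N; rewrite ?mem_iota; lia.
have [S0|S0] := ltrP (M1 + M2) 0.
  rewrite he_neg // mulr0 big1 // => x _.
  by rewrite /G F0 ?mulr0 //; lia.
case e : (M1 + M2) S0 => [n|] // _.
(* The summand is supported on 0, ..., M1 + M2, which lies in the window because D exceeds the sum
   of the absolute values. *)
rewrite (@sum_support G r1 [seq k%:Z | k <- iota 0 n.+1]) //; first last.
- move=> x; apply: contraNT => h0; rewrite /G F0 ?mulr0 //.
  move: h0; rewrite negb_and; case: (boolP (x \in r1)) => [_|/negP nx]; last first.
    by move=> _; apply: contraT => h0; case: nx; apply: mr1; lia.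
  by rewrite orFb; apply: contraR => h0; apply/mapP; exists `|x|%N; rewrite ?mem_iota; lia.
- by rewrite map_inj_uniq ?iota_uniq // => a b [].
rewrite big_map -[iota 0 n.+1]/(index_iota 0 n.+1) big_mkord.
rewrite mulrBl {1}he_merge // he_mergeV // !mulr_sumr -sumrB; apply: eq_bigr => a _.
rewrite /G /F e mulrBl !mulrA; congr (_ * _ * _ - _ * _ * _).
  rewrite [g2 ^ _ * _]mulrC -mulrA mulrACA -!exprzDr // mulrC /c exprzMl //.
  by rewrite [LHS]mulrC; congr (_ ^ _ * _ ^ _); lia.
rewrite [g2 ^ _ * _]mulrC -mulrA mulrACA -!exprzDr // mulrC /c exprzMl //.
by rewrite [LHS]mulrC; congr (_ ^ _ * _ ^ _); lia.
Qed.

Lemma pf_shift2 P k1 k2 v : (forall k, P (k1 k)) -> (forall k, P (k2 k)) -> pf P v ->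
  exists (I : finType) (w : I -> vec) (e f : I -> nat), (forall i, pf P (w i)) /\
    forall t s1 s2, v (sh k2 (sh k1 t s1) s2) = \sum_i w i t * (s1 ^+ e i * s2 ^+ f i).
Proof.
move=> P1 P2; elim=> [a Pa|k|{}v v' _ [I [w [e [f [pw vE]]]]] _ [I' [w' [e' [f' [pw' vE']]]]]
                  |{}v v' _ [I [w [e [f [pw vE]]]]] _ [I' [w' [e' [f' [pw' vE']]]]]].
- exists unit, (fun _ _ => a), (fun=> 0%N), (fun=> 0%N); split => [_|t s1 s2]; first exact: pfC.
  by rewrite (big_pred1 tt) ?mulr1 // => -[].
- exists (unit + bool)%type,
   (fun b t => match b with inl _ => t k | inr true => k1 k | _ => k2 k end),
   (fun b => if b is inr true then k else 0%N), (fun b => if b is inr false then k else 0%N).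
  split => [[_|[]]|t s1 s2]; [exact: pfV|exact/pfC/P1|exact/pfC/P2|].
  by rewrite big_sumType sum_unit big_bool /= !mulr1 mul1r addrA.
- exists (I + I')%type, (fun i t => match i with inl i => w i t | inr i => w' i t end),
    (fun i => match i with inl i => e i | inr i => e' i end),
    (fun i => match i with inl i => f i | inr i => f' i end).
  by split => [[i|i]|t s1 s2]; rewrite ?vE ?vE' ?big_sumType.
exists (I * I')%type, (fun i t => w i.1 t * w' i.2 t), (fun i => e i.1 + e' i.2)%N,
  (fun i => f i.1 + f' i.2)%N.
split => [i|t s1 s2]; first exact: pfM.
rewrite vE vE' big_distrl /= [RHS](eq_bigr
  (fun i => w i.1 t * (s1 ^+ e i.1 * s2 ^+ f i.1) *
    (w' i.2 t * (s1 ^+ e' i.2 * s2 ^+ f' i.2)))); last first.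
  by move=> i _; rewrite !exprD [RHS]mulrACA; congr (_ * _); exact: mulrACA.
rewrite -(pair_bigA _ (fun i j => w i t * (s1 ^+ e i * s2 ^+ f i) *
   (w' j t * (s1 ^+ e' j * s2 ^+ f' j)))) /=.
by apply: eq_bigr => i _; rewrite big_distrr.
Qed.

(** The outer shift acts on the inner h; D only has to exceed the index of that h, since h vanishes
    at negative indices. *)
Lemma Eop_comp m1 m2 k1 k2 v t (I : finType) (w : I -> L) (e f : I -> nat) D :
  (forall s1 s2, v (sh k2 (sh k1 t s1) s2) = \sum_i w i * (s1 ^+ e i * s2 ^+ f i)) ->
  (forall i, m2 + (f i)%:Z < D%:Z) ->
  Eop m1 k1 (Eop m2 k2 v) t = \sum_i w i * \sum_(d < D) hs (fun k => k1 k * k2 k) d *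
    (he k1 t (m1 + (e i)%:Z + d%:Z) * he k2 t (m2 + (f i)%:Z - d%:Z)).
Proof.
move=> vE mD.
rewrite (@Eop_eval _ _ _ _ (I * 'I_D)%type (fun i => w i.1 * (hs (fun k => k1 k * k2 k) i.2 *
  he k2 t (m2 + (f i.1)%:Z - i.2%:Z))) (fun i => e i.1 + i.2)%N); last first.
  move=> s; rewrite (@Eop_eval _ _ _ _ _ (fun i => w i * s ^+ e i) f); last first.
    by move=> s2; rewrite vE; apply: eq_bigr => i _; rewrite mulrA.
  rewrite -(pair_bigA _ (fun i (d : 'I_D) => w i * (hs (fun k => k1 k * k2 k) d *
    he k2 t (m2 + (f i)%:Z - d%:Z)) * s ^+ (e i + d))) /=.
  apply: eq_bigr => i _; rewrite (he_sh _ _ _ _ (mD i)) mulr_sumr; apply: eq_bigr => d _.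
  by rewrite exprD; ring.
rewrite -(pair_bigA _ (fun i (d : 'I_D) => w i * (hs (fun k => k1 k * k2 k) d *
    he k2 t (m2 + (f i)%:Z - d%:Z)) * he k1 t (m1 + (e i + d)%N%:Z))) /=.
apply: eq_bigr => i _; rewrite mulr_sumr; apply: eq_bigr => d _.
by rewrite PoszD [m1 + (_ + _)]addrA -!mulrA; congr (_ * (_ * _)); rewrite mulrC.
Qed.

(** The factor [kap (g1 * g2) 1] clears the denominator of the pair interaction. What remains of the
    commutator comes from its two poles, where the two operators fuse into one with parameter g1
    g2. *)
Lemma Eop_comm (g1 g2 : L) m1 m2 v t : g1 \is a GRing.unit -> g2 \is a GRing.unit ->
  pfT v ->
  kap (g1 * g2) 1 * (Eop m1 (kap g1) (Eop m2 (kap g2) v) t -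
                     Eop m2 (kap g2) (Eop m1 (kap g1) v) t) =
  kap g1 1 * kap g2 1 * ((g2 ^ (- m1) * g1 ^ m2 - g2 ^ m1 * g1 ^ (- m2)) *
     Eop (m1 + m2) (kap (g1 * g2)) v t).
Proof.
move=> u1 u2 pv.
have [I [w [e [f [_ vE]]]]] := pf_shift2 (P := fun=> True) (k1 := kap g1) (k2 := kap g2)
  (fun=> Logic.I) (fun=> Logic.I) pv.
pose D := (\max_i (`|(m1 + (e i)%:Z)%R| + `|(m2 + (f i)%:Z)%R|)%N).+1.
have DE i : `|m1 + (e i)%:Z| + `|m2 + (f i)%:Z| < D%:Z.
  have := leq_bigmax (F := fun i => (`|(m1 + (e i)%:Z)%R| + `|(m2 + (f i)%:Z)%R|)%N) i.
  by rewrite /D; lia.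
rewrite (@Eop_comp _ _ _ _ _ _ _ (fun i => w i t) e f D) //; last first.
  by move=> i; have := DE i; lia.
rewrite (@Eop_comp _ _ (kap g2) (kap g1) _ _ _ (fun i => w i t) f e D); first last.
- by move=> i; have := DE i; lia.
- move=> s1 s2; rewrite (_ : sh _ _ _ = sh (kap g2) (sh (kap g1) t s2) s1) ?vE.
    by apply: eq_bigr => i _; congr (_ * _); rewrite mulrC.
  by apply/funext => k; rewrite /sh addrAC.
(* Two expansions of the fused operator, one for each pole. *)
have cE : Eop (m1 + m2) (kap (g1 * g2)) v t = \sum_i w i t * (g2^-1 ^+ e i * g1 ^+ f i) *
    he (kap (g1 * g2)) t (m1 + m2 + (e i + f i)%N%:Z).
  apply: Eop_eval => s; rewrite (_ : sh _ _ _ = sh (kap g2) (sh (kap g1) t (g2^-1 * s)) (g1 * s)).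
    by rewrite vE; apply: eq_bigr => i _; rewrite !exprMn exprD; ring.
  by apply/funext => k; rewrite /sh kap_merge // addrA.
have cE' : Eop (m1 + m2) (kap (g1 * g2)) v t = \sum_i w i t * (g2 ^+ e i * g1^-1 ^+ f i) *
    he (kap (g1 * g2)) t (m1 + m2 + (e i + f i)%N%:Z).
  apply: Eop_eval => s; rewrite (_ : sh _ _ _ = sh (kap g2) (sh (kap g1) t (g2 * s)) (g1^-1 * s)).
    by rewrite vE; apply: eq_bigr => i _; rewrite !exprMn exprD; ring.
  by apply/funext => k; rewrite /sh [g1 * g2]mulrC kap_merge // addrA addrAC.
rewrite [(_ - _) * Eop _ _ _ _]mulrBl {1}cE cE' !mulr_sumr -!sumrB !mulr_sumr; apply: eq_bigr => i _.
have hC : (fun k => kap g2 k * kap g1 k) = (fun k => kap g1 k * kap g2 k).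
  by apply/funext => k; rewrite mulrC.
have := pair_commutator t u1 u2 (DE i) => /=.
set S1 := \sum_(d < D) _; set S2 := \sum_(d < D) _ => E.
have -> : \sum_(d < D) hs (fun k => kap g2 k * kap g1 k) d *
  (he (kap g2) t (m2 + (f i)%:Z + d%:Z) * he (kap g1) t (m1 + (e i)%:Z - d%:Z)) = S2.
  by apply: eq_bigr => d _; rewrite hC [he (kap g2) _ _ * _]mulrC.
rewrite -mulrBr mulrCA E.
have -> : m1 + m2 + (e i + f i)%N%:Z = m1 + (e i)%:Z + (m2 + (f i)%:Z) by lia.
rewrite opprD !exprzDr // !opprD !exprzDr //.
have -> : g2 ^ (- (e i)%:Z) = g2^-1 ^+ e i by rewrite exprVn -exprnN.
have -> : g1 ^ (- (f i)%:Z) = g1^-1 ^+ f i by rewrite exprVn -exprnN.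
rewrite -[g1 ^ (f i)%:Z]/(g1 ^+ f i) -[g2 ^ (e i)%:Z]/(g2 ^+ e i).
set x := he _ _ _; by ring.
Qed.

Section Division.
Variables (P : L -> Prop) (cP : csub P) (k0 : L) (k' : nat -> L).
Hypotheses (Pk0 : P k0) (Pk' : forall k, P (k' k)).
Let k1 k := k0 * k' k.

Lemma pf_shift_div v : pf P v ->
  exists (I : finType) (w : I -> vec) (e : I -> nat), (forall i, pf P (w i)) /\
    forall t s, v (sh k1 t s) = v t + k0 * \sum_i w i t * s ^+ e i.
Proof.
have PkC : pf P (fun=> k0) by exact: pfC.
elim=> [a Pa|k|{}v v' pv [I [w [e [pw vE]]]] pv' [I' [w' [e' [pw' vE']]]]
                  |{}v v' pv [I [w [e [pw vE]]]] pv' [I' [w' [e' [pw' vE']]]]].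
- exists unit, (fun _ _ => 0), (fun=> 0%N); split => [_|t s]; first exact/pfC/(csub0 cP).
  by rewrite big1 ?mulr0 ?addr0 // => i _; rewrite mul0r.
- exists unit, (fun _ _ => k' k), (fun=> k); split => [_|t s]; first exact: pfC.
  by rewrite (big_pred1 tt) /sh /k1 ?mulrA // => -[].
- exists (I + I')%type, (fun i t => match i with inl i => w i t | inr i => w' i t end),
    (fun i => match i with inl i => e i | inr i => e' i end).
  split => [[i|i]|t s] //; rewrite vE vE' big_sumType /=; set A := \sum_i _; set B := \sum_i _.
  by ring.
exists (I + I' + I * I')%type, (fun i t => match i with
    | inl (inl i) => v' t * w i t | inl (inr i) => v t * w' i t
    | inr i => k0 * (w i.1 t * w' i.2 t) end),
  (fun i => match i with inl (inl i) => e i | inl (inr i) => e' i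
    | inr i => (e i.1 + e' i.2)%N end).
split => [[[i|i]|i]|t s]; first exact: pfM.
- exact: pfM.
- by apply: (pfM (v := fun=> k0)) => //; exact: pfM.
rewrite vE vE' big_sumType big_sumType /=.
have -> : \sum_i v' t * w i t * s ^+ e i = v' t * \sum_i w i t * s ^+ e i.
  by rewrite mulr_sumr; apply: eq_bigr => i _; rewrite mulrA.
have -> : \sum_i v t * w' i t * s ^+ e' i = v t * \sum_i w' i t * s ^+ e' i.
  by rewrite mulr_sumr; apply: eq_bigr => i _; rewrite mulrA.
have -> : \sum_i k0 * (w i.1 t * w' i.2 t) * s ^+ (e i.1 + e' i.2) =
    k0 * ((\sum_i w i t * s ^+ e i) * (\sum_i w' i t * s ^+ e' i)).
  rewrite big_distrl /= mulr_sumr -(pair_bigA _ (fun i j =>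
    k0 * (w i t * w' j t) * s ^+ (e i + e' j))) /=; apply: eq_bigr => i _.
  by rewrite big_distrr /= mulr_sumr; apply: eq_bigr => j _; rewrite exprD; ring.
set A := \sum_i _; set B := \sum_i _; by ring.
Qed.

Lemma pf_he_div (M : int) : exists w, pf P w /\
  forall t, he k1 t M = k0 * w t + (M == 0)%:R.
Proof.
case: M => [[|M]|M].
- exists (fun=> 0); split => [|t]; first exact/pfC/(csub0 cP).
  by rewrite /= hsym0 mulr0 add0r.
- exists (fun t => (M.+1%:R)^-1 * \sum_(i < M.+1) (k' i.+1 * t i.+1) * he k1 t (M - i)%N).
  split => [|t].
    apply: (pfM (v := fun=> _)); first exact/pfC/(csubV cP).
    apply: pf_sum => // i _; apply: (pfM (v := fun t => k' i.+1 * t i.+1)).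
      exact: (pfM (v := fun=> _) (pfC (Pk' _)) (pfV _ _)).
    by apply: pf_he => // k; apply: csubM.
  rewrite /= addr0; apply: (mulrI (qL M)).
  rewrite [RHS]mulrCA [M.+1%:R * (_ * _)]mulrA divrr ?qL // mul1r mulr_natl hsym_rec // mulr_sumr.
  by apply: eq_bigr => i _; rewrite /k1 !mulrA.
exists (fun=> 0); split => [|t]; first exact/pfC/(csub0 cP).
by rewrite /= mulr0 add0r.
Qed.

(** When every kap_k is a multiple of k0, the shift and the h_m with m > 0 are trivial modulo k0, so
    the mode m is delta_(m,0) modulo k0. The quotient keeps its coefficients in P; this allows k0 to
    be cancelled from [Eop_comm]. *)
Lemma Eop_div m v : pf P v -> exists w, pf P w /\
  forall t, Eop m k1 v t = k0 * w t + (m == 0)%:R * v t.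
Proof.
move=> pv; have [I [w [e [pw vE]]]] := pf_shift_div pv.
have [w0 [pw0 hE]] := pf_he_div m.
exists (fun t => v t * w0 t + \sum_i w i t * he k1 t (m + (e i)%:Z)); split.
  apply: (pfD (v := fun t => v t * w0 t)); first exact: pfM.
  apply: pf_sum => // i _; apply: pfM => //; apply: pf_he => // k; exact: csubM.
move=> t; rewrite (@Eop_eval _ _ _ _ (unit + I)%type (fun i => if i is inr i then k0 * w i t else v t)
  (fun i => if i is inr i then e i else 0%N)); last first.
  move=> s; rewrite vE big_sumType sum_unit mulr1 mulr_sumr; congr (_ + _).
  by apply: eq_bigr => i _; rewrite mulrA.
rewrite big_sumType sum_unit /= addr0 hE.
have -> : \sum_i k0 * w i t * he k1 t (m + (e i)%:Z) =
    k0 * \sum_i w i t * he k1 t (m + (e i)%:Z).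
  by rewrite mulr_sumr; apply: eq_bigr => i _; rewrite mulrA.
by set S := \sum_i _; ring.
Qed.

End Division.

Definition word (s : seq (int * (nat -> L))) (v : vec) : vec :=
  foldr (fun l v => Eop l.1 l.2 v) v s.

Lemma word_cat s s' v : word (s ++ s') v = word s (word s' v).
Proof. exact: foldr_cat. Qed.

Lemma pf_word P s v : csub P -> (forall l, List.In l s -> forall k, P (l.2 k)) ->
  pf P v -> pf P (word s v).
Proof.
move=> cP; elim: s => //= l s IH Ps pv; apply: pf_Eop => //.
  by move=> k; apply: Ps; left.
by apply: IH => // l' sl'; apply: Ps; right.
Qed.

Lemma pfT_word s v : pfT v -> pfT (word s v).
Proof. by move=> pv; apply: pf_word. Qed.

Lemma wordD s a b v w : pfT v -> pfT w ->
  word s (fun t => a * v t + b * w t) = fun t => a * word s v t + b * word s w t.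
Proof.
move=> pv pw; elim: s => //= l s ->; apply/funext => t.
rewrite (@EopD _ _ (fun t => a * word s v t) (fun t => b * word s w t)).
- by rewrite !EopZ //; exact: pfT_word.
- by apply: (pfM (v := fun=> a)); [exact: pfC|exact: pfT_word].
- by apply: (pfM (v := fun=> b)); [exact: pfC|exact: pfT_word].
Qed.

End Fock.

(** * Determinants with one row or column replaced *)

Section Determinants.
Variables (R : comNzRingType) (N : nat).
Implicit Types A B : 'M[R]_N.

(** Both sides are the derivative of det(A + e B) at e = 0. *)
Lemma det_rowcol A B :
  \sum_j \det (\matrix_(i, k) if k == j then B i k else A i k) =
  \sum_j \det (\matrix_(i, k) if i == j then B i k else A i k).
Proof.
rewrite /determinant exchange_big [RHS]exchange_big; apply: eq_bigr => s _ /=.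
rewrite -!mulr_sumr; congr (_ * _); rewrite (reindex_inj (@perm_inj _ s)).
apply: eq_bigr => j _; apply: eq_bigr => i _.
by rewrite !mxE (inj_eq perm_inj).
Qed.

Lemma det_colZ A j c :
  \det (\matrix_(i, k) if k == j then c * A i k else A i k) = c * \det A.
Proof.
rewrite /determinant mulr_sumr; apply: eq_bigr => s _; rewrite mulrCA; congr (_ * _).
rewrite (bigD1 ((s^-1)%g j)) //= !mxE permKV eqxx [in RHS](bigD1 ((s^-1)%g j)) //= permKV mulrA.
congr (_ * _); apply: eq_bigr => i ij; rewrite !mxE.
by case: eqP => // e; move: ij; rewrite -e permK eqxx.
Qed.

Lemma det_rowZ A j c :
  \det (\matrix_(i, k) if i == j then c * A i k else A i k) = c * \det A.
Proof.
rewrite -[\det A]det_tr -(det_colZ _ j) -[RHS]det_tr; congr (\det _).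
by apply/matrixP => i k; rewrite !mxE.
Qed.

Lemma det_id_col (y : 'I_N -> R) j :
  \det (\matrix_(i, k) if k == j then y i else (i == k)%:R) = y j.
Proof.
rewrite /determinant (bigD1 1%g) //= odd_perm1 expr0 mul1r.
rewrite (bigD1 j) //= !mxE perm1 eqxx [X in _ * X]big1 ?mulr1 => [|i ij]; last first.
  by rewrite mxE perm1 (negbTE ij) eqxx.
rewrite big1 ?addr0 // => s s1.
have [i si] : exists i, (s i != j) && (s i != i).
  apply/existsP; apply: contraT; rewrite negb_exists => /forallP h.
  have {}h i : s i = j \/ s i = i.
    by have := h i; rewrite negb_and !negbK => /orP[/eqP|/eqP]; [left|right].
  have sj : s j = j by case: (h j).
  case/negP: s1; apply/eqP/permP => i; rewrite perm1.
  by case: (h i) => // sij; move: (sij); rewrite -{1}sj => /perm_inj ij; rewrite sij ij.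
rewrite (bigD1 i) //= mxE; case/andP: si => /negbTE -> /negbTE.
by rewrite eq_sym => ->; rewrite mul0r mulr0.
Qed.

(** Cramer's rule: the new matrix is A times an identity matrix with column j replaced by y. *)
Lemma det_replace A j (y : 'I_N -> R) :
  \det (\matrix_(i, k) if k == j then \sum_l A i l * y l else A i k) = y j * \det A.
Proof.
rewrite mulrC -(det_id_col y j) -det_mulmx; congr (\det _).
apply/matrixP => i k; rewrite !mxE; case: (eqVneq k j) => [kj|kj].
  by apply: eq_bigr => l _; rewrite mxE kj eqxx.
rewrite (bigD1 k) //= mxE (negbTE kj) eqxx mulr1 big1 ?addr0 // => l lk.
by rewrite mxE (negbTE kj) (negbTE lk) mulr0.
Qed.

End Determinants.

(** * Alternants, Schur determinants and words of vertex operators *)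

Lemma prodr_exp_sum (R : comNzRingType) (I : finType) (c : R) (e : I -> nat) :
  \prod_i c ^+ e i = c ^+ (\sum_i e i).
Proof. by rewrite (big_morph _ (exprD c) (expr0 c)). Qed.

Definition hz (A : comUnitRingType) (t : nat -> A) (a r : nat) : A :=
  if (r <= a)%N then hs t (a - r) else 0.
(** The Schur function with beta-numbers b_j, antisymmetric in b; [rho] gives the empty
    partition. *)
Definition Sdet (A : comUnitRingType) (N : nat) (b : 'I_N -> nat) (t : nat -> A) : A :=
  \det (\matrix_(r < N, j < N) hz t (b j) r).
Definition addb (N : nat) (b : 'I_N -> nat) j m : 'I_N -> nat := fun k => (b k + (k == j) * m)%N.
Definition rho (N : nat) : 'I_N -> nat := fun j => j.
Arguments rho {N}.

Section Alternants.
Variables (L : idomainType) (qL : qalg L) (N : nat).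
Implicit Types (x : 'I_N -> L) (b : 'I_N -> nat) (t : nat -> L).

Definition psum x (k : nat) : L := \sum_i x i ^+ k.
Definition Alt b x : L := \det (\matrix_(i, j) x i ^+ b j).
Definition upd x i y : 'I_N -> L := fun k => if k == i then y else x k.
(** Replacing columns raises one beta-number, replacing rows dilates one variable by g^2;
    [det_rowcol] exchanges the two. *)
Lemma Alt_shift (g : L) m b x :
  \sum_j (g ^+ 2) ^+ b j * Alt (addb b j m) x =
  \sum_i x i ^+ m * Alt b (upd x i (g ^+ 2 * x i)).
Proof.
pose A : 'M[L]_N := \matrix_(i, k) x i ^+ b k.
pose B : 'M[L]_N := \matrix_(i, k) (x i ^+ m * (g ^+ 2 * x i) ^+ b k).
transitivity (\sum_j \det (\matrix_(i, k) if k == j then B i k else A i k)).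
  apply: eq_bigr => j _; rewrite /Alt -(det_colZ _ j); congr (\det _).
  apply/matrixP => i k; rewrite !mxE /addb; case: eqP => [->|_].
    by rewrite mul1n [(g ^+ 2 * _) ^+ _]exprMn [x i ^+ (_ + _)]exprD mulrA [RHS]mulrC.
  by rewrite mul0n addn0.
rewrite det_rowcol; apply: eq_bigr => i _; rewrite /Alt -(det_rowZ _ i); congr (\det _).
by apply/matrixP => i' k; rewrite !mxE /upd; case: eqP => [->|].
Qed.

(** Up to sign these are elementary symmetric functions, zero beyond the number of variables. *)
Lemma hsym_Nsum (s : seq L) r : (size s < r)%N ->
  hs (fun k => - \sum_(x <- s) x ^+ k) r = 0.
Proof.
elim: s r => [|x s IH] r /= sr.
  rewrite (@eq_hsym _ _ (fun=> 0)) => [|j _]; last by rewrite big_nil oppr0.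
  by rewrite hsym_const0; case: r sr.
rewrite (@eq_hsym _ _ (fun k => - x ^+ k + - \sum_(x <- s) x ^+ k)) => [|j _]; last first.
  by rewrite big_cons opprD.
rewrite (hsymD qL (fun k => - x ^+ k)) big1 // => -[i ir] _ /=.
rewrite (hsym_Ngeom qL); case: i ir => [|[|i]] ir; rewrite ?mul0r // IH ?mulr0 //; lia.
Qed.

Definition pother x i (k : nat) : L := \sum_(j | j != i) x j ^+ k.

Lemma hsym_pother x i r : (N <= r)%N -> hs (fun k => - pother x i k) r = 0.
Proof.
move=> Nr; have N0 : (0 < N)%N by case: (N) i => // -[].
rewrite (@eq_hsym _ _ (fun k => - \sum_(y <- [seq x j | j <- enum (predC1 i)]) y ^+ k)).
  by apply: hsym_Nsum; rewrite size_map -cardE cardC1 card_ord; lia.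
by move=> k _; rewrite big_map big_enum.
Qed.

Lemma psum_pother x i k : psum x k = x i ^+ k + pother x i k.
Proof. by rewrite /psum (bigD1 i). Qed.

(** The power sums of x_i alone are those of all variables minus those of the others. Since h_r of
    minus the others vanishes for r >= N, this factors the N by N matrix of powers. *)
Lemma power_expand x i a :
  x i ^+ a = \sum_(r < N) hs (fun k => - pother x i k) r * hz (psum x) a r.
Proof.
rewrite -(hsym_geom qL) (@eq_hsym _ _ (fun k => - pother x i k + psum x k)); last first.
  by move=> j _; rewrite (psum_pother x i) addrC addrK.
rewrite (hsymD qL (fun k => - pother x i k)).
pose F r := hs (fun k => - pother x i k) r * hz (psum x) a r.
transitivity (\sum_(r < N + a.+1) F r).
  rewrite (big_ord_widen (N + a.+1) (fun r => hs (fun k => - pother x i k) r *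
     hs (psum x) (a - r))) ?leq_addl // big_mkcond; apply: eq_bigr => r _.
  by rewrite /F /hz ltnS; case: leqP => //; rewrite mulr0.
rewrite -[RHS]/(\sum_(r < N) F r) [RHS](big_ord_widen (N + a.+1) F) ?leq_addr //.
rewrite [RHS]big_mkcond; apply: eq_bigr => r _.
by case: ltnP => // Nr; rewrite /F hsym_pother ?mul0r.
Qed.

Lemma Sdet_rho t : Sdet (@rho N) t = 1.
Proof.
rewrite /Sdet -det_tr det_trig; last first.
  apply/is_trig_mxP => i j ij; rewrite !mxE /hz /rho; case: leqP => //; lia.
by rewrite big1 // => i _; rewrite !mxE /hz /rho leqnn subnn hsym0.
Qed.

Lemma bialternant b x : Alt b x = Alt rho x * Sdet b (psum x).
Proof.
pose C : 'M[L]_N := \matrix_(i, r) hs (fun k => - pother x i k) r.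
have AE a : Alt a x = \det C * Sdet a (psum x).
  rewrite /Alt /Sdet -det_mulmx; congr (\det _); apply/matrixP => i j.
  by rewrite !mxE power_expand; apply: eq_bigr => r _; rewrite !mxE.
by rewrite AE [Alt rho x]AE Sdet_rho mulr1.
Qed.

(* The hook expansion: only hooks occur when a single power sum acts on the vacuum. *)
Lemma Alt_hook j M x : Alt (addb rho j M) x =
  (\sum_(a < N - j) hs (fun k => - psum x k) a * hz (psum x) M a) * Alt rho x.
Proof.
pose y (k : 'I_N) := \sum_(a < N - k) hs (fun k => - psum x k) a * hz (psum x) (j + M) (k + a).
have yE i : x i ^+ (j + M) = \sum_(k < N) x i ^+ k * y k.
  rewrite power_expand.
  have oE r : hs (fun k => - pother x i k) r =
      \sum_(a < r.+1) x i ^+ a * hs (fun k => - psum x k) (r - a).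
    rewrite (@eq_hsym _ _ (fun k => x i ^+ k + - psum x k)); last first.
      by move=> k _; rewrite (psum_pother x i) opprD addNKr.
    rewrite (hsymD qL (fun k => x i ^+ k)); apply: eq_bigr => a _.
    by rewrite hsym_geom.
  under eq_bigr => r _ do rewrite oE mulr_suml.
  pose G a c := x i ^+ a * hs (fun k => - psum x k) c * hz (psum x) (j + M) (a + c).
  rewrite (eq_bigr (fun r : 'I_N => \sum_(a < r.+1) G a (r - a)%N)); last first.
    by move=> r _; apply: eq_bigr => a _; rewrite /G subnKC // -ltnS.
  rewrite triangular_sum; apply: eq_bigr => k _; rewrite mulr_sumr.
  by apply: eq_bigr => a _; rewrite /G mulrA.
transitivity (y j * Alt rho x).
  rewrite /Alt -det_replace; congr (\det _); apply/matrixP => i k; rewrite !mxE /addb.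
  case: eqP => [->|_]; last by rewrite mul0n addn0.
  by rewrite mul1n yE; apply: eq_bigr => l _; rewrite !mxE.
congr (_ * _); apply: eq_bigr => a _; congr (_ * _).
by rewrite /hz leq_add2l subnDl.
Qed.

(** After the hook expansion the sum over beta-numbers is a geometric sum in g^2, which [kap g 1]
    telescopes. *)
Lemma vertex_vacuum (g : L) M x : g \is a GRing.unit -> (0 < M)%N ->
  kap g 1 * \sum_i (g * x i) ^+ M * Alt rho (upd x i (g ^+ 2 * x i)) =
  g ^ (N.*2%:Z - 1) * (Alt rho x * he (kap g) (psum x) M%:Z).
Proof.
move=> ug M0; have gV : g * g^-1 = 1 by rewrite divrr.
pose ht a := hs (fun k => - psum x k) a; pose h a := hz (psum x) M a.
have ht0 a : (N < a)%N -> ht a = 0.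
  move=> Na; rewrite /ht (@eq_hsym _ _ (fun k => - \sum_(y <- [seq x j | j <- enum 'I_N]) y ^+ k)).
    by rewrite hsym_Nsum // size_map size_enum_ord.
  by move=> k _; rewrite big_map big_enum.
have -> : \sum_i (g * x i) ^+ M * Alt rho (upd x i (g ^+ 2 * x i)) =
    g ^+ M * (\sum_(j < N) (g ^+ 2) ^+ j * \sum_(a < N - j) ht a * h a) * Alt rho x.
  rewrite -mulrA mulr_suml; under eq_bigr => i _ do rewrite exprMn -mulrA.
  rewrite -mulr_sumr -Alt_shift; congr (_ * _); apply: eq_bigr => j _.
  by rewrite Alt_hook mulrA.
have -> : \sum_(j < N) (g ^+ 2) ^+ j * (\sum_(a < N - j) ht a * h a) =
    \sum_(a < N) (ht a * h a) * \sum_(j < N - a) (g ^+ 2) ^+ j.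
  under eq_bigr => j _ do rewrite mulr_sumr.
  rewrite -(triangular_sum (fun j a => (g ^+ 2) ^+ j * (ht a * h a))).
  under [RHS]eq_bigr => a _ do rewrite mulr_sumr.
  rewrite -(triangular_sum (fun a j => (ht a * h a) * (g ^+ 2) ^+ j)).
  apply: eq_bigr => k _; rewrite (reindex_inj rev_ord_inj); apply: eq_bigr => i _ /=.
  by rewrite subSS subKn 1?mulrC // -ltnS.
have kapS n : kap g 1 * \sum_(j < n) (g ^+ 2) ^+ j = g^-1 * (g ^+ n.*2 - 1).
  have -> : kap g 1 = g^-1 * (g ^+ 2 - 1).
    by rewrite /kap !expr1 mulrBr mulr1 expr2 mulrA mulVr // mul1r.
  by rewrite -mulrA -subrX1 -exprM mul2n.
pose B := (N + M.+1)%N; pose X a := ht a * h a.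
have -> : kap g 1 * (g ^+ M * (\sum_(a < N) X a * \sum_(j < N - a) (g ^+ 2) ^+ j) * Alt rho x) =
   g^-1 * g ^+ M * (\sum_(a < B) X a * (g ^ (N.*2%:Z - a.*2%:Z) - 1)) * Alt rho x.
  rewrite mulrA; congr (_ * _); rewrite mulrCA mulr_sumr -mulrA mulrCA; congr (_ * _).
  rewrite (big_ord_widen B (fun a => kap g 1 * (X a * \sum_(j < N - a) (g ^+ 2) ^+ j))) ?leq_addr //.
  rewrite mulr_sumr big_mkcond; apply: eq_bigr => a _.
  case: ltnP => [aN|Na]; last first.
    case: (eqVneq N (a : nat)) => [->|nNa]; first by rewrite subrr subrr mulr0 mulr0.
    by rewrite /X ht0 ?mul0r ?mulr0 //; move: nNa Na; rewrite leq_eqVlt => /negbTE ->.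
  rewrite mulrCA kapS mulrCA; congr (_ * (_ * (_ - _))).
  by rewrite (_ : N.*2%:Z - a.*2%:Z = (N - a).*2%:Z) //; lia.
(* The lower ends of the telescoped sums add up to sum_a h_a(-p) h_(M-a)(p), which is 0 as M > 0. *)
have hK : \sum_(a < B) X a = 0.
  transitivity (\sum_(a < M.+1) ht a * hs (psum x) (M - a)); last first.
    by rewrite hsymK //; case: (M) M0.
  rewrite (big_ord_widen B (fun a => ht a * hs (psum x) (M - a))) ?leq_addl //.
  rewrite [RHS]big_mkcond; apply: eq_bigr => a _.
  by rewrite /X /h /hz ltnS; case: leqP => //; rewrite mulr0.
have -> : \sum_(a < B) X a * (g ^ (N.*2%:Z - a.*2%:Z) - 1) =
    \sum_(a < B) X a * g ^ (N.*2%:Z - a.*2%:Z).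
  under eq_bigr => a _ do rewrite mulrBr mulr1.
  by rewrite sumrB hK subr0.
rewrite [Alt _ _ * _]mulrC mulrA; congr (_ * _).
rewrite /he (@eq_hsym _ _ (fun k => g^-1 ^+ k * (- psum x k) + g ^+ k * psum x k)); last first.
  by move=> k _; rewrite /kap; ring.
rewrite (hsymD qL (fun k => g^-1 ^+ k * (- psum x k))) !mulr_sumr.
rewrite (big_ord_widen B (fun a => g ^ (N.*2%:Z - 1) * (hs (fun k => g^-1 ^+ k * (- psum x k)) a *
   hs (fun j => g ^+ j * psum x j) (M - a)))) ?leq_addl // [RHS]big_mkcond.
apply: eq_bigr => a _; rewrite /X /h /hz ltnS; case: leqP => aM; last by rewrite mulr0 mul0r mulr0.
rewrite !hsymZ // -/(ht a).
have -> : g^-1 ^+ a = g ^ (- a%:Z) by rewrite exprVn -exprnN.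
have -> : g^-1 * g ^+ M * (ht a * hs (psum x) (M - a) * g ^ (N.*2%:Z - a.*2%:Z)) =
  (g^-1 * (g ^+ M * g ^ (N.*2%:Z - a.*2%:Z))) * (ht a * hs (psum x) (M - a)).
  by set u := g ^ _; set v := hs _ _; ring.
have -> : g ^ (N.*2%:Z - 1) * (g ^ (- a%:Z) * ht a * (g ^+ (M - a) * hs (psum x) (M - a))) =
  (g ^ (N.*2%:Z - 1) * (g ^ (- a%:Z) * g ^+ (M - a))) * (ht a * hs (psum x) (M - a)).
  by set u := g ^ _; set u' := g ^ _; set v := hs _ _; ring.
congr (_ * _); rewrite -[g ^+ M]/(g ^ M%:Z) -[g ^+ (M - a)]/(g ^ (M - a)%N%:Z).
rewrite -[g^-1]/(g ^ (-1)) -!exprzDr //; congr (_ ^ _); lia.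
Qed.

(** Successive moves of beta-numbers from [rho], the last letter of the list moving first. For g =
    e^(u/2) the weight of a move is e^(u c), where c is the mean of the contents b_j + 1 - N, ...,
    b_j + m - N that it passes. *)
Fixpoint Wsum (s : seq (nat * L)) (F : ('I_N -> nat) -> L) : L :=
  if s is (m, g) :: s' then
    Wsum s' (fun b => \sum_j g ^ ((b j).*2%:Z + m%:Z + 1 - N.*2%:Z) * F (addb b j m))
  else F rho.

Lemma Wsum_lin (I : finType) s (a : I -> L) (F : I -> ('I_N -> nat) -> L) :
  Wsum s (fun b => \sum_i a i * F i b) = \sum_i a i * Wsum s (F i).
Proof.
elim: s F => //= -[m g] s IH F; rewrite -IH; congr (Wsum _ _); apply/funext => b.
under eq_bigr => j _ do rewrite mulr_sumr.
rewrite exchange_big; apply: eq_bigr => i _; rewrite mulr_sumr.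
by apply: eq_bigr => j _; rewrite mulrCA.
Qed.

Lemma WsumZ s a F : Wsum s (fun b => a * F b) = a * Wsum s F.
Proof.
have := Wsum_lin s (fun _ : unit => a) (fun=> F); rewrite sum_unit => <-.
by congr (Wsum _ _); apply/funext => b; rewrite sum_unit.
Qed.

Definition letters (s : seq (nat * L)) : seq (int * (nat -> L)) :=
  [seq (Posz l.1, kap l.2) | l <- s].

Lemma psum_upd x i (g : L) k : g \is a GRing.unit ->
  psum (upd x i (g ^+ 2 * x i)) k = psum x k + kap g k * (g * x i) ^+ k.
Proof.
move=> ug; rewrite /psum (bigD1 i) //= [in RHS](bigD1 i) //= /upd eqxx.
rewrite (eq_bigr (fun j => x j ^+ k)) => [|j /negbTE -> //].
rewrite -addrAC; congr (_ + _); rewrite /kap mulrBl exprMn -exprM mul2n -addnn exprD.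
have -> : g^-1 ^+ k * (g * x i) ^+ k = x i ^+ k by rewrite -exprMn mulKr.
by rewrite exprMn; ring.
Qed.

(** Dilating x_i by g^2 shifts the power sums exactly as the vertex operator with s = g x_i does
    ([psum_upd]), so the first letter is peeled off by [Alt_shift] and evaluated by
    [vertex_vacuum]. *)
Lemma star_alternant (s : seq (nat * L)) x :
  all (fun l => (0 < l.1)%N && (l.2 \is a GRing.unit)) s ->
  (\prod_(l <- s) kap l.2 1) * Wsum s (fun b => Alt b x) =
  Alt rho x * word (letters s) (fun=> 1) (psum x).
Proof.
elim: s x => [|[m g] s IH] x /=; first by rewrite big_nil mul1r mulr1.
move=> /andP[/andP[m0 ug] sall]; rewrite big_cons /=.
have -> : (fun b => \sum_j g ^ ((b j).*2%:Z + m%:Z + 1 - N.*2%:Z) * Alt (addb b j m) x) =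
    fun b => \sum_i (g ^ (m%:Z + 1 - N.*2%:Z) * x i ^+ m) * Alt b (upd x i (g ^+ 2 * x i)).
  apply/funext => b; under [RHS]eq_bigr => i _ do rewrite -mulrA.
  rewrite -mulr_sumr -Alt_shift mulr_sumr; apply: eq_bigr => j _.
  rewrite mulrA; congr (_ * _); rewrite -exprM mul2n -[g ^+ _]/(g ^ (b j).*2%:Z) -exprzDr //.
  by congr (_ ^ _); lia.
rewrite Wsum_lin -mulrA mulr_sumr.
rewrite (eq_bigr (fun i => g ^ (m%:Z + 1 - N.*2%:Z) * x i ^+ m *
  (Alt rho (upd x i (g ^+ 2 * x i)) *
   word (letters s) (fun=> 1) (psum (upd x i (g ^+ 2 * x i)))))); last first.
  by move=> i _; rewrite -(IH _ sall) mulrCA.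
set v := word (letters s) (fun=> 1).
have pv : pfT v by apply: pfT_word => //; exact: pfC.
have [I [w [e [_ vE]]]] := pf_shift (P := fun=> True) (kap := kap g) (fun=> Logic.I) pv.
rewrite (Eop_eval qL _ (vE (psum x))) !mulr_sumr.
transitivity (\sum_i \sum_k g ^ (1 - N.*2%:Z) * w k (psum x) *
    (kap g 1 * ((g * x i) ^+ (m + e k) * Alt rho (upd x i (g ^+ 2 * x i))))).
  apply: eq_bigr => i _; have -> : psum (upd x i (g ^+ 2 * x i)) = sh (kap g) (psum x) (g * x i).
    by apply/funext => k; rewrite psum_upd.
  rewrite vE !mulr_sumr; apply: eq_bigr => k _.
  have -> : g ^ (m%:Z + 1 - N.*2%:Z) = g ^ (1 - N.*2%:Z) * g ^+ m.
    by rewrite -[g ^+ m]/(g ^ m%:Z) -exprzDr //; congr (_ ^ _); lia.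
  rewrite [(g * x i) ^+ (m + _)]exprD [(g * x i) ^+ m]exprMn.
  by set u := g ^ _; set p := Alt _ _; set q := w k _; set r := (g * _) ^+ _; ring.
rewrite exchange_big; apply: eq_bigr => k _ /=; rewrite -!mulr_sumr vertex_vacuum //; last by lia.
have ggi : g ^ (1 - N.*2%:Z) * g ^ (N.*2%:Z - 1) = 1.
  by rewrite -exprzDr // (_ : _ + _ = 0) ?expr0z //; lia.
by rewrite mulrACA ggi mul1r mulrCA.
Qed.

(** Distinct integers make the Vandermonde factor nonzero, so it can be cancelled. *)
Lemma star_nat (s : seq (nat * L)) (n : 'I_N -> nat) : injective n ->
  all (fun l => (0 < l.1)%N && (l.2 \is a GRing.unit)) s ->
  let x i := (n i)%:R in
  (\prod_(l <- s) kap l.2 1) * Wsum s (fun b => Sdet b (psum x)) =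
  word (letters s) (fun=> 1) (psum x).
Proof.
move=> n_inj sall x; apply: (@mulfI _ (Alt rho x)).
  rewrite /Alt -det_tr (_ : _^T = Vandermonde N (\row_i x i)); last first.
    by apply/matrixP => i j; rewrite !mxE.
  rewrite det_Vandermonde; apply/prodf_neq0 => i _; apply/prodf_neq0 => j ij.
  rewrite !mxE subr_eq0; apply/negP => /eqP /(natrL_inj qL) /n_inj e.
  by rewrite e ltnn in ij.
rewrite -star_alternant // mulrCA; congr (_ * _); rewrite -WsumZ; congr (Wsum _ _).
by apply/funext => b; rewrite -bialternant.
Qed.

Lemma Wsum_scale s c F : Wsum s (fun b => c ^+ (\sum_j b j) * F b) =
  c ^+ (\sum_(j < N) j + \sum_(l <- s) l.1) * Wsum s F.
Proof.
elim: s F => [|[m g] s IH] F /=; first by rewrite big_nil addn0.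
rewrite big_cons /= addnCA exprD -mulrA -IH -WsumZ; congr (Wsum _ _); apply/funext => b.
rewrite !mulr_sumr; apply: eq_bigr => j _.
have -> : (\sum_k addb b j m k = \sum_k b k + m)%N.
  rewrite big_split /=; congr (_ + _)%N.
  rewrite (bigD1 j) //= eqxx mul1n big1 ?addn0 // => k /negbTE ->; exact: mul0n.
by rewrite exprD mulrA mulrCA [c ^+ m * _]mulrC !mulrA.
Qed.

Lemma Sdet_scale c b t :
  c ^+ (\sum_(j < N) j) * Sdet b (fun k => c ^+ k * t k) = c ^+ (\sum_j b j) * Sdet b t.
Proof.
rewrite /Sdet /determinant !mulr_sumr; apply: eq_bigr => s _.
rewrite (mulrCA (c ^+ (\sum_(j < N) j)) ((-1) ^+ s)) (mulrCA (c ^+ (\sum_j b j)) ((-1) ^+ s)).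
apply: (congr1 (fun z => (-1) ^+ s * z)).
have -> : (\sum_j b j = \sum_j b (s j))%N by rewrite (reindex_inj (@perm_inj _ s)).
rewrite -(prodr_exp_sum c (fun j : 'I_N => j : nat)) -(prodr_exp_sum c (fun j => b (s j))).
rewrite -[LHS]big_split -[RHS]big_split; apply: eq_bigr => i _ /=; rewrite mxE [in RHS]mxE /hz.
case: leqP => ib; last by rewrite !mulr0.
by rewrite hsymZ // mulrA -exprD subnKC.
Qed.

End Alternants.

(** * Extension of polynomial identities from integer points *)

Section Density.
Variables (L : idomainType) (qL : qalg L).

Lemma pf_line (v : (nat -> L) -> L) (e0 : nat -> nat) : pfT v ->
  exists (I : finType) (w : I -> (nat -> L) -> L) (e : I -> nat),
    forall t c, v (fun k => c ^+ e0 k * t k) = \sum_i w i t * c ^+ e i.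
Proof.
elim=> [a _|k|{}v v' _ [I [w [e vE]]] _ [I' [w' [e' vE']]]
             |{}v v' _ [I [w [e vE]]] _ [I' [w' [e' vE']]]].
- exists unit, (fun _ _ => a), (fun=> 0%N) => t s.
  by rewrite sum_unit mulr1.
- by exists unit, (fun _ t => t k), (fun=> e0 k) => t c; rewrite sum_unit mulrC.
- exists (I + I')%type, (fun i t => match i with inl i => w i t | inr i => w' i t end),
    (fun i => match i with inl i => e i | inr i => e' i end).
  by move=> t s; rewrite ?vE ?vE' ?big_sumType.
exists (I * I')%type, (fun i t => w i.1 t * w' i.2 t), (fun i => e i.1 + e' i.2)%N => t s.
rewrite vE vE' big_distrl /= [RHS](eq_bigr
  (fun i => w i.1 t * s ^+ e i.1 * (w' i.2 t * s ^+ e' i.2))); last first.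
  by move=> i _; rewrite exprD mulrACA.
rewrite -(pair_bigA _ (fun i j => w i t * s ^+ e i * (w' j t * s ^+ e' j))) /=.
by apply: eq_bigr => i _; rewrite big_distrr.
Qed.

Lemma sum_monomials_poly (I : finType) (a : I -> L) (e : I -> nat) :
  exists q : {poly L}, forall c, \sum_i a i * c ^+ e i = q.[c].
Proof.
exists (\sum_i (a i)%:P * 'X^(e i)) => c; rewrite horner_sum; apply: eq_bigr => i _.
by rewrite hornerCM hornerXn.
Qed.

(* A weighted homogeneous polynomial function of degree [d] only depends on the variables of weight at most [d]. *)
Lemma pf_homogeneous_trunc (v : (nat -> L) -> L) d : pfT v ->
  (forall c t, v (fun k => c ^+ k * t k) = c ^+ d * v t) ->
  forall t, v t = v (fun k => if (k <= d)%N then t k else 0).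
Proof.
move=> pv vd t; pose t' k := if (k <= d)%N then t k else 0.
have [q [q' [qE q'E qq']]] : exists q q' : {poly L},
    [/\ forall c, v (fun k => c ^+ k * t k) = q.[c],
        forall c, v (fun k => c ^+ k * t' k) = q'.[c] &
        forall j, (j <= d)%N -> q`_j = q'`_j].
  elim: pv {vd} => [a _|k|{}v w _ [p [p' [pE p'E pp']]] _ [q [q' [qE q'E qq']]]
             |{}v w _ [p [p' [pE p'E pp']]] _ [q [q' [qE q'E qq']]]].
  - by exists a%:P, a%:P; split => // c; rewrite hornerC.
  - exists ((t k)%:P * 'X^k), ((t' k)%:P * 'X^k); split => [c|c|j jd].
    + by rewrite hornerCM hornerXn mulrC.
    + by rewrite hornerCM hornerXn mulrC.
    + rewrite !coefCM !coefXn /t'; case: eqP => [jk|]; last by rewrite !mulr0.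
      by rewrite -jk jd.
  - exists (p + q), (p' + q'); split => [c|c|j jd].
    + by rewrite pE qE hornerD.
    + by rewrite p'E q'E hornerD.
    + by rewrite !coefD pp' ?qq'.
  exists (p * q), (p' * q'); split => [c|c|j jd].
  + by rewrite pE qE hornerM.
  + by rewrite p'E q'E hornerM.
  rewrite !coefM; apply: eq_bigr => i _; have := ltn_ord i => ij.
  by rewrite pp' ?qq' //; lia.
have qX (t0 : nat -> L) (p : {poly L}) : (forall c, v (fun k => c ^+ k * t0 k) = p.[c]) ->
    v t0 = p`_d.
  move=> pE; have -> : p = (v t0)%:P * 'X^d.
    apply/eqP; rewrite -subr_eq0; apply/eqP/(@poly_nat_roots _ qL _ 0) => k _.
    by rewrite hornerD hornerN -pE hornerCM hornerXn vd mulrC subrr.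
  by rewrite coefCM coefXn eqxx mulr1.
by rewrite (qX _ _ qE) (qX _ _ q'E) qq'.
Qed.

Lemma vanish_injective_nat N (f : ('I_N -> L) -> L) :
  (forall x i, exists q : {poly L}, forall y, f (upd x i y) = q.[y]) ->
  (forall n : 'I_N -> nat, injective n -> f (fun i => (n i)%:R) = 0) ->
  forall x, f x = 0.
Proof.
move=> fq f0.
(* The first k coordinates are free, the others distinct integers. Freeing one more uses a
   polynomial that vanishes at every integer beyond all entries of n. *)
have H k : (k <= N)%N -> forall (x : 'I_N -> L) (n : 'I_N -> nat),
    (forall i : 'I_N, (k <= i)%N -> x i = (n i)%:R) ->
    (forall i j : 'I_N, (k <= i)%N -> (k <= j)%N -> n i = n j -> i = j) -> f x = 0.
  elim: k => [_|k IH kN] x n xn ninj.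
    by rewrite (_ : x = fun i => (n i)%:R); [apply: f0 => i j; exact: ninj|apply/funext => i; exact: xn].
  pose i := Ordinal kN; have [q qE] := fq x i; have -> : x = upd x i (x i).
    by apply/funext => j; rewrite /upd; case: eqP => [->|].
  rewrite qE; suff -> : q = 0 by rewrite horner0.
  apply: (@poly_nat_roots _ qL _ (\max_j n j).+1) => m mB.
  rewrite -qE; apply: (IH (ltnW kN) _ (fun j => if j == i then m else n j)) => [j kj|j l kj kl].
    rewrite /upd; case: (eqVneq j i) => // ji; apply: xn.
    by rewrite ltn_neqAle kj andbT; apply: contra ji => /eqP e; apply/eqP/val_inj.
  have lt j0 : (n j0 < m)%N by apply: leq_ltn_trans mB; exact: (leq_bigmax (F := n)).
  have kl0 (j0 : 'I_N) : (k <= j0)%N -> j0 != i -> (k.+1 <= j0)%N.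
    move=> kj0 ji; rewrite ltn_neqAle kj0 andbT; apply: contra ji => /eqP e.
    exact/eqP/val_inj.
  case: (eqVneq j i) => [->|ji]; case: (eqVneq l i) => [->|li] //.
  - by move=> e; have := lt l; rewrite e ltnn.
  - by move=> e; have := lt j; rewrite e ltnn.
  - by apply: ninj; apply: kl0.
by move=> x; apply: (H N _ x (fun=> 0%N)) => // i; have := ltn_ord i; lia.
Qed.

End Density.

Section Newton.
Variable K : closedFieldType.
Hypothesis qK : qalg K.

Lemma coef_prod_roots (r : seq K) k : (k <= size r)%N ->
  (\prod_(z <- r) ('X - z%:P))`_(size r - k) = hs (fun j => - \sum_(z <- r) z ^+ j) k.
Proof.
elim: r k => [|z r IH] k /= kr.
  move: kr; rewrite leqn0 => /eqP ->; by rewrite big_nil hsym0 coef1.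
rewrite big_cons mulrBl coefB coefXM coefCM.
rewrite (@eq_hsym _ _ (fun k => - z ^+ k + - \sum_(x <- r) x ^+ k)) => [|j _]; last first.
  by rewrite big_cons opprD.
rewrite (hsymD qK (fun k => - z ^+ k)).
have szr : (\prod_(z <- r) ('X - z%:P))`_(size r).+1 = 0.
  by rewrite nth_default // size_prod_XsubC.
case: k kr => [|k] kr.
  rewrite subn0 /= szr mulr0 subr0 big_ord1 /= (hsym_Ngeom qK) mul1r.
  by have := IH 0%N isT; rewrite subn0.
rewrite big_ord_recl big_ord_recl [X in _ + (_ + X)]big1 => [|i _]; last first.
  by rewrite (hsym_Ngeom qK) /= mul0r.
rewrite !(hsym_Ngeom qK) /= mul1r addr0 mulNr subSS !subn0; congr (_ - _ * _); last first.
  by rewrite subn1 IH // ltnW.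
case: (ltnP k (size r)) => kr'.
  by rewrite -IH // subn_eq0 leqNgt kr' /=; congr (_`__); lia.
have -> : k = size r by lia.
rewrite subnn eqxx; apply/esym.
rewrite (@eq_hsym _ _ (fun k => - \sum_(x <- r) x ^+ k)) //; exact: hsym_Nsum.
Qed.

(** The points are the roots of the monic polynomial with coefficients h_k(-tau), hence the
    algebraically closed field; Newton's recursion then recovers the power sums. *)
Lemma newton_points (tau : nat -> K) N : exists x : 'I_N -> K,
  forall k, (0 < k <= N)%N -> psum x k = tau k.
Proof.
pose F : {poly K} := \poly_(i < N.+1) hs (fun j => - tau j) (N - i).
have FN : F`_N = 1 by rewrite coef_poly ltnSn subnn hsym0.
have sF : size F = N.+1.
  by apply/eqP; rewrite size_poly_eq // subnn hsym0 oner_neq0.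
have [r rE] := closed_field_poly_normal F.
have lF : lead_coef F = 1 by rewrite /lead_coef sF.
rewrite lF scale1r in rE.
have sr : size r = N by have := congr1 (fun p : {poly K} => size p) rE; rewrite sF size_prod_XsubC => -[].
pose x (i : 'I_N) := nth 0 r i; exists x.
have xr k : psum x k = \sum_(z <- r) z ^+ k.
  by rewrite (big_nth 0) big_mkord sr.
have hE k : (k <= N)%N -> hs (fun j => - psum x j) k = hs (fun j => - tau j) k.
  move=> kN; transitivity (hs (fun j => - \sum_(z <- r) z ^+ j) k).
    by apply: eq_hsym => j _; congr (- _); exact: xr.
  rewrite -coef_prod_roots ?sr // -rE coef_poly subKn //.
  by rewrite ltnS leq_subr.
move=> k; have [n] := ubnP k; elim: n k => // n IH [|k] // kn /andP[_ kN].
have := hsym_rec qK (fun j => - psum x j) k; rewrite hE // (hsym_rec qK).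
rewrite big_ord_recr [X in _ = X]big_ord_recr /= subnn.
rewrite (hsym0 (fun j => - tau j)) (hsym0 (fun j => - psum x j)) (mulr1 (- tau _)) (mulr1 (- psum x _)).
move=> e; apply: oppr_inj; move: e.
rewrite (eq_bigr (fun i : 'I_k => - psum x i.+1 * hs (fun j => - psum x j) (k - i))).
  by move/addrI.
move=> i _; rewrite hE; last by lia.
by rewrite IH // ?(ltn_ord i) //; have := ltn_ord i; lia.
Qed.

End Newton.

Section StarLine.
Variables (L : idomainType) (qL : qalg L).
Implicit Types (v : (nat -> L) -> L) (t : nat -> L).

(** The coordinate t_0 is present in the functions but has no meaning as a time. *)
Definition ext0 v := forall t t', (forall k, (0 < k)%N -> t k = t' k) -> v t = v t'.

Lemma he_ext0 kap t t' M : (forall k, (0 < k)%N -> t k = t' k) -> he kap t M = he kap t' M.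
Proof. by move=> tt'; case: M => // M /=; apply: eq_hsym => j j0; rewrite tt'. Qed.

Lemma Eop_ext0 m kap v : pfT v -> ext0 v -> ext0 (Eop m kap v).
Proof.
move=> pv ve t t' tt'.
have [I [w [e [_ vE]]]] := pf_shift (P := fun=> True) (kap := kap) (fun=> Logic.I) pv.
rewrite (Eop_eval qL _ (vE t)) (@Eop_eval _ qL _ _ _ t' I (fun i => w i t) e).
  by apply: eq_bigr => i _; rewrite (he_ext0 _ _ tt').
by move=> s; rewrite -vE; apply: ve => k k0; rewrite /sh tt'.
Qed.

Lemma word_ext0 s : ext0 (word s (fun=> 1)).
Proof. by elim: s => //= l s IH; apply: Eop_ext0 => //; apply: pfT_word => //; exact: pfC. Qed.

(** Expansions that agree as functions of s have the same coefficients, so every linear functional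
    of the monomials agrees on them. *)
Lemma monomial_functional (I J : finType) (a : I -> L) (e : I -> nat) (b : J -> L)
    (f : J -> nat) (X : nat -> L) :
  (forall s, \sum_i a i * s ^+ e i = \sum_j b j * s ^+ f j) ->
  \sum_i a i * X (e i) = \sum_j b j * X (f j).
Proof.
move=> h; pose B := (\max_i e i + \max_j f j).+1.
have red (H : finType) (c : H -> L) (g : H -> nat) : (forall i, (g i < B)%N) ->
    \sum_i c i * X (g i) = \sum_(k < B) (\sum_i (c i)%:P * 'X^(g i))`_k * X k.
  move=> gB; under [RHS]eq_bigr => k _ do rewrite coef_sum mulr_suml.
  rewrite exchange_big; apply: eq_bigr => i _ /=.
  rewrite (bigD1 (Ordinal (gB i))) //= coefCM coefXn eqxx mulr1 big1 ?addr0 // => k ki.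
  rewrite coefCM coefXn; have /negbTE -> : (k : nat) != g i by [].
  by rewrite mulr0 mul0r.
have ev (H : finType) (c : H -> L) (g : H -> nat) s :
    (\sum_i (c i)%:P * 'X^(g i)).[s] = \sum_i c i * s ^+ g i.
  by rewrite horner_sum; apply: eq_bigr => i _; rewrite hornerCM hornerXn.
rewrite red => [|i]; last by have := leq_bigmax (F := e) i; rewrite /B; lia.
rewrite [RHS]red => [|j]; last by have := leq_bigmax (F := f) j; rewrite /B; lia.
suff -> : \sum_i (a i)%:P * 'X^(e i) = \sum_j (b j)%:P * 'X^(f j) by [].
apply/eqP; rewrite -subr_eq0; apply/eqP/(@poly_nat_roots _ qL _ 0) => k _.
by rewrite hornerD hornerN !ev h subrr.
Qed.

Lemma Eop_scale (m : nat) kap v D : pfT v ->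
  (forall c t, v (fun k => c ^+ k * t k) = c ^+ D * v t) ->
  forall c t, Eop m%:Z kap v (fun k => c ^+ k * t k) = c ^+ (m + D) * Eop m%:Z kap v t.
Proof.
move=> pv vD c t; pose ct k := c ^+ k * t k.
have [I [w [e [_ vE]]]] := pf_shift (P := fun=> True) (kap := kap) (fun=> Logic.I) pv.
rewrite (Eop_eval qL _ (vE t)) (Eop_eval qL _ (vE ct)) mulr_sumr.
have heE M : he kap ct M%:Z = c ^+ M * he kap t M%:Z.
  rewrite /he -(hsymZ qL); apply: eq_hsym => j _; rewrite /ct; ring.
pose X k := c ^+ m * he kap t (m + k)%N%:Z.
transitivity (\sum_i (w i ct * c ^+ e i) * X (e i)).
  by apply: eq_bigr => i _; rewrite /X -PoszD heE exprD; ring.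
rewrite (@monomial_functional I I _ e (fun i => c ^+ D * w i t) e X).
  by apply: eq_bigr => i _; rewrite /X exprD -PoszD; ring.
move=> s; transitivity (v (sh kap ct (c * s))).
  by rewrite vE; apply: eq_bigr => i _; rewrite exprMn mulrA.
have -> : sh kap ct (c * s) = fun k => c ^+ k * sh kap t s k.
  by apply/funext => k; rewrite /sh /ct exprMn; ring.
by rewrite vD vE mulr_sumr; apply: eq_bigr => i _; rewrite mulrA.
Qed.

Lemma word_scale (s : seq (nat * L)) c t :
  word (letters s) (fun=> 1) (fun k => c ^+ k * t k) =
  c ^+ (\sum_(l <- s) l.1) * word (letters s) (fun=> 1) t.
Proof.
elim: s c t => [|l s IH] c t /=; first by rewrite big_nil mulr1.
rewrite big_cons; apply: (@Eop_scale l.1 _ _ (\sum_(l <- s) l.1)) => //.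
by apply: pfT_word => //; exact: pfC.
Qed.

Lemma pf_Sdet N (b : 'I_N -> nat) : pfT (Sdet b : _ -> L).
Proof.
rewrite /Sdet (_ : (fun _ => _) = fun t => \sum_(s : 'S_N)
    (-1) ^+ s * \prod_i hz t (b (s i)) i); last first.
  apply/funext => t; apply: eq_bigr => s _; congr (_ * _).
  by apply: eq_bigr => i _; rewrite mxE.
apply: (@pf_sum L _ (csubT L)) => s _; apply: (pfM (v := fun=> _)); first exact: pfC.
apply: (@pf_prod L _ (csubT L)) => i; rewrite /hz; case: leqP => _; last exact: pfC.
have := @pf_hsym L qL (fun=> True) (csubT L) (fun=> 1) (b (s i) - i) (fun=> Logic.I).
congr (pf _ _); apply/funext => t; apply: eq_hsym => j _; exact: mul1r.
Qed.

Lemma Sdet_ext0 N (b : 'I_N -> nat) : ext0 (Sdet b : _ -> L).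
Proof.
move=> t t' tt'; rewrite /Sdet; congr (\det _); apply/matrixP => i j; rewrite !mxE /hz.
by case: leqP => // _; apply: eq_hsym.
Qed.

Lemma pf_Wsum N s (F : ('I_N -> nat) -> (nat -> L) -> L) :
  (forall b, pfT (F b)) -> pfT (fun t => Wsum s (fun b => F b t)).
Proof.
elim: s F => //= -[m g] s IH F pF; apply: (IH (fun b t =>
  \sum_j g ^ ((b j).*2%:Z + m%:Z + 1 - N.*2%:Z) * F (addb b j m) t)) => b.
by apply: (@pf_sum L _ (csubT L)) => j _; apply: (pfM (v := fun=> _)); [exact: pfC|exact: pF].
Qed.

(* Weighted homogeneity and the surjectivity of the power sums over an algebraically closed field
   extend the identity from power sums of distinct integers to all arguments. *)
Lemma star_line (K : closedFieldType) (io : {rmorphism K -> L}) N (s : seq (nat * L))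
    (tau : nat -> K) (c : L) : qalg K ->
  all (fun l => (0 < l.1)%N && (l.2 \is a GRing.unit)) s -> (\sum_(l <- s) l.1 <= N)%N ->
  let t k := c * io (tau k) in
  (\prod_(l <- s) kap l.2 1) * Wsum s (fun b : 'I_N -> nat => Sdet b t) =
  word (letters s) (fun=> 1) t.
Proof.
move=> qK sall dN t; pose d := (\sum_(l <- s) l.1)%N.
pose P t := \prod_(l <- s) kap l.2 1 * Wsum s (fun b : 'I_N -> nat => Sdet b t) -
   word (letters s) (fun=> 1) t.
have pP : pfT P.
  rewrite /P (_ : (fun _ => _) = fun t => (\prod_(l <- s) kap l.2 1) *
      Wsum s (fun b : 'I_N -> nat => Sdet b t) + (-1) * word (letters s) (fun=> 1) t); last first.
    by apply/funext => t'; rewrite mulN1r.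
  apply: (pfD (v := fun t => _ * _)).
    by apply: (pfM (v := fun=> _)); [exact: pfC|apply: pf_Wsum => b; exact: pf_Sdet].
  by apply: (pfM (v := fun=> _)); [exact: pfC|apply: pfT_word => //; exact: pfC].
have P0 : ext0 P.
  move=> t1 t2 tt; rewrite /P (word_ext0 _ tt); congr (_ * Wsum _ _ - _).
  by apply/funext => b; exact: Sdet_ext0.
have Ppsum (x : 'I_N -> L) : P (psum x) = 0.
  move: x; apply: (@vanish_injective_nat L qL N (fun x => P (psum x))) => [x i|n ninj].
    have [I [w [e [_ vE]]]] := pf_shift (P := fun=> True) (kap := fun=> 1) (fun=> Logic.I) pP.
    have [q qE] := sum_monomials_poly (fun j => w j (pother x i)) e.
    exists q => y; rewrite -qE -vE; congr P; apply/funext => k.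
    rewrite (psum_pother _ i) /upd eqxx /sh mul1r addrC; congr (_ + _).
    by apply: eq_bigr => j /negbTE ->.
  by rewrite /P (star_nat qL ninj sall) subrr.
(* A power of a must be cancelled here; polynomiality in a then covers a = 0, as
   [pf_homogeneous_trunc] asks for. *)
have Pscale0 a t0 : a != 0 -> P (fun k => a ^+ k * t0 k) = a ^+ d * P t0.
  move=> a0; rewrite /P word_scale mulrBr; congr (_ - _); rewrite mulrCA; congr (_ * _).
  apply: (@mulfI _ (a ^+ (\sum_(j < N) j))); first exact: expf_neq0.
  rewrite mulrA -exprD -Wsum_scale -WsumZ; congr (Wsum _ _); apply/funext => b.
  exact: Sdet_scale.
have Pscale a t0 : P (fun k => a ^+ k * t0 k) = a ^+ d * P t0.
  have [I [w [e vE]]] := pf_line id pP.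
  have [q qE] := sum_monomials_poly (fun j => w j t0) e.
  have -> : P (fun k => a ^+ k * t0 k) = q.[a] by rewrite -qE -vE.
  suff -> : q = (P t0)%:P * 'X^d by rewrite hornerCM hornerXn mulrC.
  apply/eqP; rewrite -subr_eq0; apply/eqP/(@poly_nat_roots _ qL _ 1) => k k1.
  rewrite hornerD hornerN -qE -vE Pscale0; last by rewrite natrL_eq0 // -lt0n.
  by rewrite hornerCM hornerXn mulrC subrr.
have Ptau (tau' : nat -> K) : P (fun k => io (tau' k)) = 0.
  have [x xE] := newton_points qK tau' N.
  rewrite (pf_homogeneous_trunc qL pP Pscale) -(Ppsum (fun i => io (x i))).
  rewrite [RHS](pf_homogeneous_trunc qL pP Pscale); apply: P0 => k k0.
  case: leqP => // kd; rewrite -xE ?k0 ?(leq_trans kd) // /psum rmorph_sum.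
  by apply: eq_bigr => i _; rewrite rmorphXn.
(* The scalar c lies outside the base field. Along the line through tau, P is a polynomial in c that
   vanishes at the integers, by [Ptau] for the multiples of tau. *)
have [I [w [e vE]]] := pf_line (fun=> 1%N) pP.
have [q qE] := sum_monomials_poly (fun j => w j (fun k => io (tau k))) e.
have q0 : q = 0.
  apply: (@poly_nat_roots _ qL _ 0) => k _; rewrite -qE -vE -(Ptau (fun j => k%:R * tau j)).
  by congr P; apply/funext => j; rewrite expr1 rmorphM rmorph_nat.
apply/eqP; rewrite -subr_eq0 -/(P t); apply/eqP.
have := vE (fun k => io (tau k)) c; rewrite qE q0 horner0 => <-.
by congr P; apply/funext => k; rewrite expr1.
Qed.

End StarLine.

(** * Laurent series, constant terms and derivations *)

Section LaurentToolkit.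
Variable A : comNzRingType.
Implicit Types f g : laurent A.
Lemma lcoefB f g k : (f - g) k = f k - g k. Proof. by []. Qed.
Lemma lmonoE (m : int) (a : A) k : lmono m a k = if k == m then a else 0. Proof. by []. Qed.
Lemma lcoef1 k : (1 : laurent A) k = (k == 0)%:R.
Proof. by rewrite -[LHS]/(if k == 0 then 1 else 0); case: eqP. Qed.

Definition lbnd f (N : int) := forall k, k < N -> f k = 0.

Lemma lcoefM_seq f g k (r : seq int) : uniq r ->
  (forall i, i \notin r -> f i * g (k - i) = 0) ->
  (f * g) k = \sum_(i <- r) f i * g (k - i).
Proof.
move=> ur h; rewrite lcoefM (fsbigE r) //=; last by move=> i _; exact: h.
by apply: eq_bigl => i; rewrite in_setT.
Qed.

Lemma lcoefM_nat f g N P (t : nat) : lbnd f N -> lbnd g P ->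
  (f * g) (N + P + t%:Z) = \sum_(i < t.+1) f (N + i%:Z) * g (P + (t - i)%N%:Z).
Proof.
move=> fN gP; rewrite (@lcoefM_seq _ _ _ [seq N + i%:Z | i <- iota 0 t.+1]).
- rewrite big_map -[iota 0 t.+1]/(index_iota 0 t.+1) big_mkord; apply: eq_bigr => i _.
  by congr (_ * g _); have := ltn_ord i; lia.
- by rewrite map_inj_uniq ?iota_uniq // => a b /addrI [].
move=> i; have [iN|Ni] := ltP i N; first by rewrite fN ?mul0r.
have [iP|Pi] := ltP (N + P + t%:Z - i) P; first by rewrite gP ?mulr0.
by case/mapP; exists `|i - N|%N; rewrite ?mem_iota; lia.
Qed.

Lemma lbndM f g N P : lbnd f N -> lbnd g P -> lbnd (f * g) (N + P).
Proof.
move=> fN gP k kNP; rewrite (@lcoefM_seq _ _ _ [::]) ?big_nil // => i _.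
have [iN|Ni] := ltP i N; first by rewrite fN ?mul0r.
by rewrite gP ?mulr0 //; lia.
Qed.

Lemma lcoef_monoM (m : int) a f k : (lmono m a * f) k = a * f (k - m).
Proof.
rewrite (@lcoefM_seq _ _ _ [:: m]) // ?big_seq1 ?lmonoE ?eqxx // => i.
by rewrite inE => /negbTE im; rewrite lmonoE im mul0r.
Qed.

Lemma lmonoM (m p : int) (a b : A) : lmono m a * lmono p b = lmono (m + p) (a * b).
Proof.
apply: laurentP => k; rewrite lcoef_monoM !lmonoE.
have -> : (k - m == p) = (k == m + p) by rewrite subr_eq addrC.
by case: eqP; rewrite ?mulr0.
Qed.

Lemma lmono_is_zmod_morphism (m : int) : zmod_morphism (@lmono A m).
Proof. by move=> x y; apply: laurentP => k; rewrite lcoefB !lmonoE; case: eqP; rewrite ?subr0. Qed.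
HB.instance Definition _ (m : int) := GRing.isZmodMorphism.Build A (laurent A)
  (@lmono A m) (lmono_is_zmod_morphism m).
Lemma lmono0_is_monoid_morphism : monoid_morphism (@lmono A 0).
Proof. by split => [//|x y]; rewrite lmonoM addr0. Qed.
HB.instance Definition _ := GRing.isMonoidMorphism.Build A (laurent A)
  (@lmono A 0) lmono0_is_monoid_morphism.

Lemma laurent_ofE (f : int -> A) N : (forall k, k < N -> f k = 0) ->
  forall k, laurent_of f k = f k.
Proof. by move=> fN k; rewrite /laurent_of; case: pselect => // -[]; exists N. Qed.

Lemma lserE (f : mseries nat A) k : lser f k = if k is Posz m then f m else 0.
Proof. by rewrite /lser (@laurent_ofE _ 0) //; case. Qed.

Lemma lbnd_lser (f : mseries nat A) : lbnd (lser f) 0.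
Proof. by move=> k; rewrite lserE; case: k. Qed.

Lemma lser_is_zmod_morphism : zmod_morphism (@lser A).
Proof. by move=> f g; apply: laurentP => -[k|k]; rewrite lcoefB !lserE ?subr0. Qed.
HB.instance Definition _ := GRing.isZmodMorphism.Build (mseries nat A) (laurent A)
  (@lser A) lser_is_zmod_morphism.
Lemma lser_is_monoid_morphism : monoid_morphism (@lser A).
Proof.
split => [|f g]; apply: laurentP => -[k|k].
- by rewrite lserE mcoef1 lcoef1.
- by rewrite lserE lcoef1.
- rewrite lserE (_ : Posz k = 0 + 0 + k%:Z); last by rewrite !add0r.
  rewrite lcoefM_nat ?mcoefM_nat; [|exact: lbnd_lser..].
  by apply: eq_bigr => i _; rewrite !add0r !lserE.
- by rewrite lserE (lbndM (@lbnd_lser f) (@lbnd_lser g)).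
Qed.
HB.instance Definition _ := GRing.isMonoidMorphism.Build (mseries nat A) (laurent A)
  (@lser A) lser_is_monoid_morphism.

End LaurentToolkit.

Lemma qalg_laurent (A : comUnitRingType) : qalg A -> qalg (laurent A).
Proof. exact: (qalg_rmorph (@lmono A 0)). Qed.

Lemma hs_map (A B : comUnitRingType) (h : {rmorphism A -> B}) (p : nat -> A) k :
  qalg A -> qalg B -> h (hs p k) = hs (fun j => h (p j)) k.
Proof.
move=> qA qB; move: k; apply: (hsym_uniq qB (h := fun k => h (hs p k))) => [|k].
  by rewrite hsym0 rmorph1.
rewrite -rmorphMn hsym_rec // rmorph_sum; apply: eq_bigr => i _.
by rewrite rmorphM.
Qed.

Section ConstantTerm.
Variables (M : exponentType) (dg : degree M) (A : comNzRingType).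

Definition mconst of degree M := fun f : mseries M A => f 0.

Lemma mconst_is_zmod_morphism : zmod_morphism (mconst dg).
Proof. by []. Qed.
HB.instance Definition _ := GRing.isZmodMorphism.Build (mseries M A) A
  (mconst dg) mconst_is_zmod_morphism.

Lemma mconst_is_monoid_morphism : monoid_morphism (mconst dg).
Proof.
split => [|f g]; rewrite /mconst; first by rewrite mcoef1 eqxx.
rewrite mcoefM (bigD1_seq (0, 0)) ?splits_uniq ?mem_splits ?addr0 ?eqxx //=.
rewrite big_seq_cond big1 ?addr0 // => -[a b] /andP[]; rewrite mem_splits /= => /eqP ab.
have := congr1 dg ab; rewrite degD deg0 => ab0.
have a0 : a = 0 by apply: (@deg_eq0 _ dg); lia.
have b0 : b = 0 by apply: (@deg_eq0 _ dg); lia.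
by rewrite a0 b0 eqxx.
Qed.
HB.instance Definition _ := GRing.isMonoidMorphism.Build (mseries M A) A
  (mconst dg) mconst_is_monoid_morphism.

End ConstantTerm.

Section Derivations.
Variables (A : comNzRingType) (D : A -> A).
Hypotheses (DD : forall x y, D (x + y) = D x + D y)
  (DM : forall x y, D (x * y) = D x * y + x * D y).

Lemma der0 : D 0 = 0.
Proof. by have := DD 0 0; rewrite addr0 => /esym/(canRL (addrK _)); rewrite subrr. Qed.

Lemma der1 : D 1 = 0.
Proof. by have := DM 1 1; rewrite !mulr1 mul1r => /esym/(canRL (addrK _)); rewrite subrr. Qed.

Lemma derN x : D (- x) = - D x.
Proof. by apply/eqP; rewrite -addr_eq0 -DD addNr der0. Qed.

Lemma der_sum I (r : seq I) (P : pred I) F :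
  D (\sum_(i <- r | P i) F i) = \sum_(i <- r | P i) D (F i).
Proof. exact: (big_morph D DD der0). Qed.

Lemma der_prod (I : finType) (F : I -> A) :
  D (\prod_i F i) = \sum_j \prod_i (if i == j then D (F i) else F i).
Proof.
have gen (r : seq I) : uniq r -> D (\prod_(i <- r) F i) =
    \sum_(j <- r) \prod_(i <- r) (if i == j then D (F i) else F i).
  elim: r => [|a r IH] /=; first by rewrite !big_nil der1.
  move=> /andP[ar ur]; rewrite !big_cons DM IH // eqxx; congr (_ * _ + _).
    rewrite big_seq [RHS]big_seq; apply: eq_bigr => i ir.
    by case: eqP => // ia; rewrite ia (negbTE ar) in ir.
  rewrite mulr_sumr big_seq [RHS]big_seq; apply: eq_bigr => j jr; rewrite big_cons.
  by case: eqP => // aj; rewrite aj jr in ar.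
by rewrite gen ?index_enum_uniq.
Qed.

Lemma der_det N (B : 'M[A]_N) :
  D (\det B) = \sum_j \det (\matrix_(i, k) if k == j then D (B i k) else B i k).
Proof.
rewrite /determinant exchange_big der_sum; apply: eq_bigr => s _ /=.
rewrite -mulr_sumr DM.
have -> : D ((-1) ^+ s) = 0.
  by case: (odd_perm s); rewrite ?expr0 ?der1 // expr1 derN der1 oppr0.
rewrite mul0r add0r; congr (_ * _); rewrite der_prod (reindex_inj (@perm_inj _ (s^-1)%g)).
apply: eq_bigr => j _; apply: eq_bigr => i _; rewrite !mxE.
by rewrite -{1}(permK s i) (inj_eq perm_inj).
Qed.

End Derivations.

(** * Paths of beta-numbers *)

Section PathSums.
Variables (A : comNzRingType) (N : nat).
Implicit Types (b o : 'I_N -> nat) (F : ('I_N -> nat) -> A).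

Fixpoint Psum b (ks : seq nat) F : A :=
  if ks is k :: ks' then Psum b ks' (fun o => \sum_j F (addb o j k)) else F b.

Lemma Psum_lin (I : finType) b ks (a : I -> A) (F : I -> ('I_N -> nat) -> A) :
  Psum b ks (fun b => \sum_i a i * F i b) = \sum_i a i * Psum b ks (F i).
Proof.
elim: ks F => //= k ks IH F; rewrite -IH; congr (Psum _ _ _); apply/funext => o.
by rewrite exchange_big; apply: eq_bigr => i _; rewrite mulr_sumr.
Qed.

Lemma sum_addb b j k : (\sum_i addb b j k i = \sum_i b i + k)%N.
Proof.
rewrite big_split /=; congr (_ + _)%N.
rewrite (bigD1 j) //= eqxx mul1n big1 ?addn0 // => i /negbTE ->; exact: mul0n.
Qed.

Lemma eq_Psum b ks F G :
  (forall o, (\sum_i o i = \sum_i b i + sumn ks)%N -> F o = G o) ->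
  Psum b ks F = Psum b ks G.
Proof.
elim: ks F G => [|k ks IH] F G FG /=; first by apply: FG; rewrite addn0.
apply: IH => o oE; apply: eq_bigr => j _; apply: FG.
by rewrite sum_addb oE /=; lia.
Qed.

Lemma Psum_perm (s : 'S_N) b ks F :
  Psum b ks (fun o => F (fun j => o (s j))) = Psum (fun j => b (s j)) ks F.
Proof.
elim: ks F => //= k ks IH F; rewrite -IH; congr (Psum _ _ _); apply/funext => o.
rewrite (reindex_inj (@perm_inj _ s)); apply: eq_bigr => j _; congr F.
by apply/funext => i; rewrite /addb (inj_eq perm_inj).
Qed.

Lemma Psum_shift b c ks F :
  Psum b ks (fun o => F (fun j => c j + o j)%N) = Psum (fun j => c j + b j)%N ks F.
Proof.
elim: ks F => //= k ks IH F; rewrite -IH; congr (Psum _ _ _); apply/funext => o.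
by apply: eq_bigr => j _; congr F; apply/funext => i; rewrite /addb addnA.
Qed.

(** The value at p = 0 of the Schur determinant after derivatives have lowered column j by o_j:
    there h_m becomes delta_(m,0). *)
Definition detd (b o : 'I_N -> nat) : A :=
  \det (\matrix_(r < N, j < N) ((b j == r + o j)%N)%:R).

Lemma detdE b o : detd b o =
  \sum_(s : 'S_N) (-1) ^+ s * [forall r, b (s r) == (r + o (s r))%N]%:R.
Proof.
apply: eq_bigr => s _; congr (_ * _); under eq_bigr => i _ do rewrite mxE.
case: forallP => [h|nh]; first by rewrite big1 // => i _; rewrite h.
have [i hi] : exists i, b (s i) != (i + o (s i))%N.
  by apply: contrapT => h; apply: nh => i; apply/negPn/negP => hi; apply: h; exists i.
by rewrite (bigD1 i) //= (negbTE hi) mul0r.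
Qed.

Lemma detd0 b o : (\sum_j b j != \sum_(j < N) j + \sum_j o j)%N -> detd b o = 0.
Proof.
move=> h; rewrite detdE big1 // => s _; case: forallP => [e|]; last by rewrite mulr0.
case/negP: h; rewrite (reindex_inj (@perm_inj _ s)) [X in (_ + X)%N](reindex_inj (@perm_inj _ s)).
by rewrite -big_split; apply/eqP/eq_bigr => j _; exact/eqP/e.
Qed.

Variable B : nat.
Definition inc (be : {ffun 'I_N -> 'I_B}) : bool :=
  [forall i : 'I_N, forall j : 'I_N, (i < j)%N ==> (be i < be j)%N].
Definition bval (be : {ffun 'I_N -> 'I_B}) : 'I_N -> nat := fun j => be j.

Lemma incP (be : {ffun 'I_N -> 'I_B}) : reflect (forall i j : 'I_N, (i < j)%N -> (be i < be j)%N) (inc be).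
Proof.
apply: (iffP forallP) => [h i j ij|h i].
  by have /forallP/(_ j)/implyP := h i; exact.
by apply/forallP => j; apply/implyP; exact: h.
Qed.

Lemma inc_inj be : inc be -> injective be.
Proof.
move=> /incP h i j e; apply: val_inj; case: (ltngtP i j) => // ij.
- by have := h _ _ ij; rewrite e ltnn.
- by have := h _ _ ij; rewrite e ltnn.
Qed.

Lemma inc_uniq be be' (s s' : 'S_N) : inc be -> inc be' ->
  (forall i, be (s i) = be' (s' i) :> nat) -> be = be' /\ s = s'.
Proof.
move=> hb hb' e.
have srt (c : {ffun 'I_N -> 'I_B}) : inc c -> sorted ltn [seq val (c i) | i <- enum 'I_N].
  move=> /incP h; apply/(sortedP 0%N) => k; rewrite size_map size_enum_ord => kN.
  have kN' := ltnW kN; pose i0 := Ordinal kN.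
  have nE l (lN : (l < N)%N) : nth 0%N [seq val (c i) | i <- enum 'I_N] l = c (Ordinal lN).
    rewrite (nth_map i0) ?size_enum_ord //; congr (val (c _)); apply: val_inj.
    by rewrite /= nth_enum_ord.
  by rewrite (nE _ kN) (nE _ kN'); apply: h.
have bb : be = be'.
  have : [seq val (be i) | i <- enum 'I_N] = [seq val (be' i) | i <- enum 'I_N].
    apply: (irr_sorted_eq ltn_trans ltnn) => [||x]; try exact: srt.
    apply/mapP/mapP => -[i _ ->].
      exists (s' ((s^-1)%g i)); first exact: mem_enum.
      by rewrite /= -e permKV.
    exists (s ((s'^-1)%g i)); first exact: mem_enum.
    by rewrite /= e permKV.
  move=> /eq_in_map h; apply/ffunP => i; apply: val_inj; apply: h; exact: mem_enum.
split=> //; apply/permP => i; apply: (inc_inj hb'); by apply: val_inj; rewrite /= -e bb.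
Qed.

Lemma inc_exists (b : 'I_N -> nat) : injective b -> (forall i, (b i < B)%N) ->
  exists (be : {ffun 'I_N -> 'I_B}) (s : 'S_N), inc be /\ forall i, be (s i) = b i :> nat.
Proof.
move=> binj bB; pose rk i := #|[pred j | (b j < b i)%N]|.
have rkN i : (rk i < N)%N.
  rewrite -[X in (_ < X)%N]card_ord; apply: proper_card; apply/properP; split.
    exact/fintype.subsetP.
  by exists i => //; rewrite inE ltnn.
have rklt i j : (b i < b j)%N -> (rk i < rk j)%N.
  move=> bij; apply: proper_card; apply/properP; split.
    by apply/fintype.subsetP => k; rewrite !inE => /ltn_trans; exact.
  by exists i; rewrite !inE ?ltnn.
have rkinj : injective (fun i => Ordinal (rkN i)).
  move=> i j [e]; case: (ltngtP (b i) (b j)) => [/rklt|/rklt|/binj //]; rewrite e ltnn //.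
pose s : 'S_N := perm rkinj.
exists [ffun k => Ordinal (bB ((s^-1)%g k))], s; split => [|i]; last by rewrite ffunE /= permK.
apply/incP => k l kl; rewrite !ffunE /=; set i := (s^-1)%g k; set j := (s^-1)%g l.
rewrite ltnNge leq_eqVlt; apply/negP => /orP[/eqP/binj e|/rklt h].
  by move: kl; rewrite -[k](permKV s) -[l](permKV s) -/i -/j e ltnn.
by move: kl; rewrite -[k](permKV s) -[l](permKV s) -/i -/j !permE /= ltnNge (ltnW h).
Qed.

(** Once the determinants are expanded, an increasing b together with a permutation is the same as
    an injective end point of a path, and antisymmetry absorbs the sign. B has to contain every end
    point. *)
Lemma Psum_antisym (f : ('I_N -> nat) -> A) ks :
  (forall b (s : 'S_N), f (fun i => b (s i)) = (-1) ^+ s * f b) ->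
  (N + sumn ks <= B)%N ->
  \sum_(be | inc be) f (bval be) * Psum (fun=> 0%N) ks (detd (bval be)) =
  Psum (@rho N) ks (fun b => if injectiveb [ffun i => b i] then f b else 0).
Proof.
move=> fs NB; pose fa be := if inc be then f (bval be) else 0.
pose Y be (s : 'S_N) (o : 'I_N -> nat) : A := [forall r, bval be (s r) == (r + o r)%N]%:R.
transitivity (\sum_be \sum_(s : 'S_N) fa be * (-1) ^+ s * Psum (fun=> 0%N) ks (Y be s)).
  rewrite big_mkcond; apply: eq_bigr => be _; rewrite /fa; case: ifP => _; last first.
    by rewrite big1 // => s _; rewrite !mul0r.
  rewrite (_ : detd _ = fun o => \sum_(s : 'S_N) (-1) ^+ s * Y be s (fun j => o (s j))); last first.
    by apply/funext => o; exact: detdE.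
  rewrite Psum_lin mulr_sumr; apply: eq_bigr => s _; rewrite mulrA; congr (_ * _).
  exact: Psum_perm.
rewrite pair_bigA -(Psum_lin _ _ (fun p : {ffun 'I_N -> 'I_B} * 'S_N => fa p.1 * (-1) ^+ p.2)
   (fun p => Y p.1 p.2)).
have -> : @rho N = (fun j => rho j + 0)%N by apply/funext => j; rewrite addn0.
rewrite -[RHS]Psum_shift; apply: eq_Psum => o.
have z0 : (\sum_(i < N) 0 = 0)%N by rewrite big1.
rewrite z0 add0n => oE; pose b j := (rho j + o j)%N.
have bB i : (b i < B)%N.
  have : (o i <= \sum_i o i)%N by rewrite (bigD1 i) //= leq_addr.
  by rewrite oE /b /rho; have := ltn_ord i; lia.
have YE be s : Y be s o = [forall r, bval be (s r) == b r]%:R by [].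
case: injectiveP => [binj|nbinj]; last first.
  rewrite big1 // => -[be s] _ /=; rewrite /fa; case: ifP => [ib|]; last by rewrite !mul0r.
  rewrite YE; case: forallP => [h|]; last by rewrite mulr0.
  case: nbinj => i j; rewrite !ffunE -/(b i) -/(b j) -(eqP (h i)) -(eqP (h j)) => /val_inj.
  by move=> /(inc_inj ib) /perm_inj.
have {}binj : injective b by move=> i j e; apply: binj; rewrite !ffunE.
have [be [s [ib bE]]] := inc_exists binj bB.
rewrite (bigD1 (be, s)) //= big1 ?addr0 => [|[be' s'] /= ne].
  rewrite YE /fa ib (_ : [forall r, _]); last by apply/forallP => r; rewrite /bval bE.
  by rewrite mulr1 mulrC -fs; congr f; apply/funext => i; rewrite /bval bE.
rewrite YE /fa; case: ifP => [ib'|]; last by rewrite !mul0r.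
case: forallP => [h|]; last by rewrite mulr0.
have [e1 e2] : be = be' /\ s = s'.
  by apply: inc_uniq => // i; rewrite bE -(eqP (h i)).
by rewrite e1 e2 eqxx in ne.
Qed.

End PathSums.

(** * Jacobi-Trudi determinants and derivatives in the power sums *)

Section JacobiTrudiRows.
Variables (A : comUnitRingType) (p : nat -> A).

Definition JTm N (lam : seq nat) : A := \det (\matrix_(i < N, j < N)
  if (i <= nth 0%N lam i + j)%N then hs p (nth 0%N lam i + j - i) else 0).

Lemma schur_JTm lam : schur p lam = JTm (size lam) lam.
Proof.
by rewrite /schur /JTm; congr (\det _); apply/matrixP => i j; rewrite !mxE hsym_hs.
Qed.

(** A zero part adds a last row (0, ..., 0, 1). *)
Lemma JTm_pad N lam : (size lam <= N)%N -> JTm N.+1 lam = JTm N lam.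
Proof.
move=> sN; rewrite /JTm (expand_det_row _ ord_max) (bigD1 ord_max) //= big1 ?addr0 => [|j jN].
  rewrite !mxE nth_default //= leqnn add0n subnn hsym0 mul1r /cofactor.
  rewrite -signr_odd addnn odd_double expr0 mul1r; congr (\det _).
  by apply/matrixP => i j; rewrite !mxE !lift_max.
rewrite !mxE nth_default //= add0n leqNgt (_ : (j < N)%N) ?mul0r //.
by have := ltn_ord j; move: jN; rewrite -(inj_eq val_inj) /=; lia.
Qed.

Lemma JTm_size N lam : (size lam <= N)%N -> schur p lam = JTm N lam.
Proof.
move=> /subnK <-; elim: (N - size lam)%N => [|k IH]; first by rewrite schur_JTm.
by rewrite addSn JTm_pad // leq_addl.
Qed.

(** Transpose and reverse the order of rows and of columns; the two signs of the reversal cancel. *)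
Lemma schur_Sdet N lam : (size lam <= N)%N ->
  schur p lam = Sdet (fun j : 'I_N => nth 0%N lam (rev_ord j) + j)%N p.
Proof.
move=> sN; rewrite (JTm_size sN) /Sdet -[RHS]det_tr /JTm; pose rv : 'S_N := perm (@rev_ord_inj N).
set M := (X in \det X = _).
transitivity (\det (row_perm rv (col_perm rv M))).
  rewrite row_permE col_permE !det_mulmx !det_perm odd_permV mulrCA -signr_addb addbb.
  by rewrite expr0 mulr1.
congr (\det _); apply/matrixP => i j; rewrite !mxE !permE /= /hz.
have ii := ltn_ord i; have jj := ltn_ord j.
set a := nth _ _ _; have -> : (N - i.+1 <= a + (N - j.+1))%N = (j <= a + i)%N by lia.
by case: leqP => // h; congr (hs p _); lia.
Qed.

End JacobiTrudiRows.

Section PowerSumDerivative.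
Variable A : comUnitRingType.
Hypothesis qA : qalg A.
Local Notation A' := (mseries {poly nat} A).

Definition pder (k : nat) : A' -> A' :=
  cder (fun m : {poly nat} => m + 'X^k) (fun m => (m`_k)%R.+1).
Definition pvr (k : nat) : A' := smono 'X^k 1.

Lemma poly_nat_sub (p : {poly nat}) k : (0 < (p`_k)%R)%N -> exists p' : {poly nat}, p = p' + 'X^k.
Proof.
move=> pk; exists (\poly_(i < size p) (if i == k then (p`_i)%R.-1 else (p`_i)%R)).
apply/polyP => i; rewrite coefD coef_poly coefXn.
case: ltnP => ip; last first.
  rewrite nth_default //; case: eqP => [ik|]; last by rewrite addr0.
  by move: pk; rewrite -ik nth_default.
case: (eqVneq i k) => [->|_]; last by rewrite addr0.
by rewrite -[(_ + _)%R]/(_ + 1)%N addn1 prednK.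
Qed.

Lemma poly_nat_addI (k : nat) : injective (fun p : {poly nat} => p + 'X^k).
Proof.
move=> p q /polyP e; apply/polyP => i; have := e i; rewrite !coefD.
exact: (@addIn ('X^k)`_i).
Qed.

Lemma pder_leibniz k : leibniz (pder k).
Proof.
(* Weighted by the exponent of p_k in the first part, only decompositions where p_k divides that
   part count, and these come from decompositions of [m]. *)
have key (F G : {poly nat} -> A) (m : {poly nat}) :
    \sum_(d <- splits (m + 'X^k)) F d.1 * G d.2 *+ (d.1`_k)%R =
    \sum_(d <- splits m) F (d.1 + 'X^k) * G d.2 *+ (d.1`_k)%R.+1.
  pose sm (d : {poly nat} * {poly nat}) := (d.1 + 'X^k, d.2).
  transitivity (\sum_(d <- map sm (splits m)) F d.1 * G d.2 *+ (d.1`_k)%R); last first.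
    rewrite big_map; apply: eq_bigr => d _ /=; rewrite coefD coefXn eqxx.
    by rewrite -[(d.1`_k + _)%R]/((d.1`_k)%R + 1)%N addn1.
  rewrite (bigID (fun d : {poly nat} * {poly nat} => (0 < (d.1`_k)%R)%N)) /= [X in _ + X]big1 ?addr0.
    rewrite -big_filter; apply: perm_big; apply: uniq_perm.
    - by rewrite filter_uniq ?splits_uniq.
    - by rewrite map_inj_uniq ?splits_uniq // => -[a b] [c d] [/poly_nat_addI -> ->].
    move=> [a b]; rewrite mem_filter mem_splits /=; apply/andP/mapP.
      move=> [/poly_nat_sub [a' ->] /eqP e]; exists (a', b) => //; rewrite mem_splits /=.
      by apply/eqP/(@poly_nat_addI k); rewrite -e addrAC.
    move=> [[a' b']]; rewrite mem_splits /= => /eqP e [-> ->]; split.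
      by rewrite coefD coefXn eqxx -[(_ + _)%R]/(_ + 1)%N addn1.
    by rewrite addrAC e.
  by move=> d; rewrite -eqn0Ngt => /eqP ->; rewrite mulr0n.
move=> f g; apply: mseriesP => m.
rewrite -[LHS]/((f * g) (m + 'X^k) *+ (m`_k)%R.+1) mcoefD !mcoefM.
rewrite -sumrMnl.
transitivity (\sum_(d <- splits (m + 'X^k)) (f d.1 * g d.2 *+ (d.1`_k)%R + f d.1 * g d.2 *+ (d.2`_k)%R)).
  rewrite big_seq [RHS]big_seq; apply: eq_bigr => d; rewrite mem_splits => /eqP e.
  rewrite -mulrnDr; congr (_ *+ _); have := congr1 (fun q : {poly nat} => (q`_k)%R) e.
  by rewrite !coefD coefXn eqxx -![(_ + _)%R]/(_ + _)%N addn1 => ->.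
rewrite big_split key; congr (_ + _).
  by apply: eq_bigr => d _; rewrite -[pder k f d.1]/(f (d.1 + 'X^k) *+ (d.1`_k)%R.+1) mulrnAl.
pose sw (d : {poly nat} * {poly nat}) := (d.2, d.1).
have swp (q : {poly nat}) : perm_eq (map sw (splits q)) (splits q).
  apply: uniq_perm; rewrite ?splits_uniq //.
    by rewrite map_inj_uniq ?splits_uniq // => -[a b] [c d] [-> ->].
  move=> [a b]; rewrite mem_splits; apply/mapP/idP.
    by move=> [[c d]]; rewrite mem_splits /= => /eqP e [-> ->]; rewrite addrC e.
  by move=> e; exists (b, a) => //; rewrite mem_splits /= addrC.
transitivity (\sum_(d <- splits (m + 'X^k)) g d.1 * f d.2 *+ (d.1`_k)%R).
  rewrite -(perm_big _ (swp _)) big_map; apply: eq_bigr => d _ /=; rewrite mulrC //.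
rewrite key -(perm_big _ (swp m)) big_map; apply: eq_bigr => d _ /=.
by rewrite -mulrnAl mulrC.
Qed.

(** The operator k d/dp_k, normalised so as to lower h_a to h_(a-k). *)
Definition Dk (k : nat) (f : A') : A' := pder k f *+ k.

Lemma DkD k f g : Dk k (f + g) = Dk k f + Dk k g.
Proof. by rewrite /Dk /pder raddfD mulrnDl. Qed.

Lemma DkM k f g : Dk k (f * g) = Dk k f * g + f * Dk k g.
Proof. by rewrite /Dk pder_leibniz mulrnDl mulrnAl mulrnAr. Qed.

Lemma Dk_pvr k i : Dk k (pvr i) = if i == k then k%:R else 0.
Proof.
rewrite /Dk; have -> : pder k (pvr i) = (i == k)%:R.
  apply: mseriesP => m; rewrite -[LHS]/((if m + 'X^k == 'X^i then 1 else 0) *+ (m`_k)%R.+1).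
  have [e|ne] := eqVneq (m + 'X^k) ('X^i).
    have dX j : poly_deg 'X^j = 1%N.
      rewrite (@poly_degE _ j.+1) ?size_polyXn // big_ord_recr /= coefXn eqxx.
      by rewrite big1 // => l _; rewrite coefXn; have := ltn_ord l; case: eqP => //; lia.
    have m0 : m = 0.
      by apply: poly_deg_eq0; have := congr1 poly_deg e; rewrite poly_degD !dX; lia.
    have ik : i = k.
      move: e; rewrite m0 add0r => /polyP/(_ i); rewrite !coefXn eqxx.
      by case: eqP.
    by rewrite m0 ik eqxx mcoef1 eqxx coef0.
  rewrite mul0rn; case: (eqVneq i k) => [ik|]; last by rewrite mcoef0.
  rewrite mcoef1; case: (eqVneq m 0) => // m0.
  by rewrite m0 ik add0r eqxx in ne.
by case: eqP => // _; rewrite mul0rn.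
Qed.

Lemma Dk_hs k a : (0 < k)%N -> Dk k (hs pvr a) = hz pvr a k.
Proof.
move=> k0; have qA' : qalg A' := qalg_mseries _ qA.
have [n] := ubnP a; elim: n a => // n IH [|a] an.
  rewrite hsym0 /hz leqNgt k0 /=; exact: (der1 (DkM k)).
apply: (mulrSn_inj qA' (k := a)).
have -> : Dk k (hs pvr a.+1) *+ a.+1 = Dk k (hs pvr a.+1 *+ a.+1).
  by rewrite /Dk /pder raddfMn -!mulrnA mulnC.
rewrite hsym_rec // (der_sum (DkD k) ).
under eq_bigr => i _ do rewrite DkM Dk_pvr.
rewrite big_split /=.
have -> : \sum_(i < a.+1) pvr i.+1 * Dk k (hs pvr (a - i)) =
    \sum_(i < a.+1) pvr i.+1 * hz pvr (a - i) k.
  by apply: eq_bigr => i _; rewrite IH //; lia.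
rewrite /hz; case: leqP => [ka|ak]; last first.
  rewrite mul0rn big1 => [|i _]; last by case: eqP => [e|]; rewrite ?mul0r //; have := ltn_ord i; lia.
  by rewrite big1 ?addr0 // => i _; case: leqP => h; rewrite ?mulr0 //; lia.
have kp : (k.-1 < a.+1)%N by lia.
rewrite (bigD1 (Ordinal kp)) //= prednK // eqxx [X in _ + X + _]big1 ?addr0 => [|i ik]; last first.
  case: eqP => [e|]; rewrite ?mul0r //; case/negP: ik; apply/eqP/val_inj => /=; lia.
have -> : (a - k.-1 = a.+1 - k)%N by lia.
rewrite mulr_natl; set c := (a.+1 - k)%N.
have -> : \sum_(i < a.+1) pvr i.+1 * (if (k <= a - i)%N then hs pvr (a - i - k) else 0) = hs pvr c *+ c.
  case ec : c => [|c'].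
    by rewrite mulr0n big1 // => i _; case: leqP => h; rewrite ?mulr0 //; lia.
  rewrite hsym_rec // (big_ord_widen a.+1 (fun i => pvr i.+1 * hs pvr (c' - i))); last by lia.
  rewrite [RHS]big_mkcond; apply: eq_bigr => i _; have := ltn_ord i => ia.
  have -> : (k <= a - i)%N = (i < c'.+1)%N by lia.
  by case: ltnP => h; rewrite ?mulr0 //; congr (_ * hs _ _); lia.
by rewrite -mulrnDr; congr (_ *+ _); lia.
Qed.

Lemma Dk_hz k a r : (0 < k)%N -> Dk k (hz pvr a r) = hz pvr a (r + k)%N.
Proof.
move=> k0; rewrite /hz; case: (leqP r a) => ra; last first.
  by rewrite (der0 (DkD k)); case: leqP => //; lia.
rewrite Dk_hs // /hz; have -> : (k <= a - r)%N = (r + k <= a)%N by lia.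
by case: leqP => // _; congr (hs _ _); lia.
Qed.

Definition Sdo N (b o : 'I_N -> nat) : A' := \det (\matrix_(r, j) hz pvr (b j) (r + o j)).

Lemma Dk_Sdo N k (b o : 'I_N -> nat) : (0 < k)%N ->
  Dk k (Sdo b o) = \sum_j Sdo b (addb o j k).
Proof.
move=> k0; rewrite (der_det (DkD k) (DkM k)); apply: eq_bigr => j _; congr (\det _).
apply/matrixP => r l; rewrite !mxE /addb; case: eqP => [->|_].
  by rewrite Dk_hz // mul1n addnA.
by rewrite mul0n addn0.
Qed.

Lemma fold_Dk_Sdo N ks (b o : 'I_N -> nat) : all (ltn 0) ks ->
  foldr Dk (Sdo b o) ks = Psum o ks (Sdo b).
Proof.
elim: ks => //= k ks IH /andP[k0 kall]; rewrite IH //.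
have dP c F : Dk k (Psum c ks F) = Psum c ks (fun o => Dk k (F o)).
  elim: (ks) F => //= k' ks' IH' F; rewrite IH'; congr (Psum _ _ _); apply/funext => o'.
  exact: (der_sum (DkD k)).
by rewrite dP; congr (Psum _ _ _); apply/funext => o'; exact: Dk_Sdo.
Qed.

Lemma Psum_const N ks (c : 'I_N -> nat) (F : ('I_N -> nat) -> A') m :
  Psum c ks F m = Psum c ks (fun o => F o m).
Proof.
elim: ks F => //= k ks IH F; rewrite IH; congr (Psum _ _ _); apply/funext => o.
by rewrite mcoef_sum.
Qed.

Lemma Sdo0 N (b o : 'I_N -> nat) : Sdo b o 0 = detd A b o.
Proof.
have qA' : qalg A' := qalg_mseries _ qA.
rewrite -[LHS]/(mconst degP (Sdo b o)) /Sdo -det_map_mx /detd; congr (\det _).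
apply/matrixP => r j; rewrite !mxE /hz; case: leqP => h; last first.
  by rewrite rmorph0; case: eqP => //; lia.
rewrite (hs_map (mconst degP)) // (@eq_hsym _ _ (fun=> 0)) => [|i i0].
  by rewrite hsym_const0; congr (_%:R); lia.
rewrite -[LHS]/((if 0 == 'X^i :> {poly nat} then 1 else 0) : A); case: eqP => // /polyP/(_ i); rewrite coef0 coefXn eqxx //.
Qed.

Lemma fold_Dk_Sdet N ks (b : 'I_N -> nat) : all (ltn 0) ks ->
  foldr Dk (Sdet b pvr) ks 0 = Psum (fun=> 0%N) ks (detd A b).
Proof.
move=> kall; have -> : Sdet b pvr = Sdo b (fun=> 0%N).
  by congr (\det _); apply/matrixP => r j; rewrite !mxE addn0.
rewrite fold_Dk_Sdo // Psum_const; congr (Psum _ _ _); apply/funext => o; exact: Sdo0.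
Qed.

(** Iterated derivatives at p = 0 read off one coefficient with a positive multiplicity. This is how
    the infinite sum over partitions in Z can be differentiated term by term. *)
Lemma fold_Dk_coef ks : all (ltn 0) ks ->
  exists m c, forall f : A', foldr Dk f ks 0 = f m *+ c.+1.
Proof.
move=> kall; suff h m0 : exists m c, forall f : A', foldr Dk f ks m0 = f m *+ c.+1 by exact: h.
elim: ks m0 kall => [|k ks IH] m0 /=; first by exists m0, 0%N.
case/andP => k0 /(IH (m0 + 'X^k)) [m [c fE]].
exists m, (c.+1 * (m0`_k)%R.+1 * k).-1 => f.
rewrite prednK ?muln_gt0 ?k0 // -[Dk k _ m0]/((pder k (foldr Dk f ks) *+ k) m0) mcoefMn.
by rewrite -[pder k _ m0]/(foldr Dk f ks (m0 + 'X^k) *+ (m0`_k)%R.+1) fE -!mulrnA mulnA.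
Qed.

Lemma fold_Dk_pder ks (f : A') : foldr Dk f ks = foldr pder f ks *+ (\prod_(k <- ks) k)%N.
Proof.
elim: ks => [|k ks IH] /=; first by rewrite big_nil.
by rewrite big_cons IH /Dk /pder raddfMn -mulrnA mulnC.
Qed.

End PowerSumDerivative.

Section PositivePart.

Lemma nth_pos_part (s : seq nat) i : sorted geq s ->
  nth 0%N [seq x <- s | 0 < x]%N i = nth 0%N s i.
Proof.
elim: s i => [|x s IH] i //= px; have ps := path_sorted px.
case: (posnP x) => [x0|xp]; last by case: i => //= i; exact: IH.
have s0 : all (fun y => y == 0)%N s.
  have tr : transitive geq by move=> a b c; rewrite /geq /= => h1 h2; lia.
  by apply: sub_all (order_path_min tr px) => y; rewrite /geq x0 /= => h; rewrite -leqn0.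
have -> : [seq y <- s | 0 < y]%N = [::].
  apply/eqP; rewrite -[_ == _]negbK -has_filter; apply/hasPn => y ys.
  by rewrite -eqn0Ngt; exact: (allP s0).
rewrite nth_nil; case: i => //= i; case: (ltnP i (size s)) => h; last by rewrite nth_default.
by apply/esym/eqP; exact: (allP s0 _ (mem_nth _ h)).
Qed.

End PositivePart.

(** * Partitions as increasing sequences of beta-numbers *)

Section PartitionsAsBeta.
Variables (N B : nat).
Implicit Types be : {ffun 'I_N -> 'I_B}.

Definition lam_of be : seq nat :=
  [seq x <- [seq be (rev_ord i) - rev_ord i | i <- enum 'I_N] | 0 < x]%N.
Definition betaf (lam : seq nat) : 'I_N -> nat := fun j => (nth 0 lam (rev_ord j) + j)%N.

Lemma inc_ge be (j : 'I_N) : inc be -> (j <= be j)%N.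
Proof.
move=> /incP h; case: j => j jN; elim: j jN => // j IH jN.
by have := h (Ordinal (ltnW jN)) (Ordinal jN) (ltnSn j); have := IH (ltnW jN); rewrite /=; lia.
Qed.

Let nth_enum (T : Type) (x0 : T) (f : 'I_N -> T) (i : 'I_N) : nth x0 [seq f i | i <- enum 'I_N] i = f i.
Proof.
rewrite (nth_map i) ?size_enum_ord //; congr f; apply: val_inj.
by rewrite /= nth_enum_ord.
Qed.

Lemma lam_of_pre_sorted be : inc be ->
  sorted geq [seq (be (rev_ord i) - rev_ord i)%N | i <- enum 'I_N].
Proof.
move=> ib; apply/(sortedP 0%N) => k; rewrite size_map size_enum_ord => kN.
rewrite -[k]/(val (Ordinal (ltnW kN))) -[k.+1]/(val (Ordinal kN)) !nth_enum /geq /=.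
have := inc_ge (rev_ord (Ordinal (ltnW kN))) ib; have := inc_ge (rev_ord (Ordinal kN)) ib.
have /incP h := ib; have := h (rev_ord (Ordinal kN)) (rev_ord (Ordinal (ltnW kN))).
by move=> /=; lia.
Qed.

Lemma lam_of_nth be (i : 'I_N) : inc be ->
  nth 0%N (lam_of be) i = (be (rev_ord i) - rev_ord i)%N.
Proof. by move=> ib; rewrite nth_pos_part ?nth_enum // lam_of_pre_sorted. Qed.

Lemma lam_of_size be : (size (lam_of be) <= N)%N.
Proof.
by rewrite size_filter (leq_trans (count_size _ _)) // size_map size_enum_ord.
Qed.

Lemma betaf_lam_of be : inc be -> betaf (lam_of be) = bval be.
Proof.
move=> ib; apply/funext => j; rewrite /betaf lam_of_nth // rev_ordK subnK //.
exact: inc_ge.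
Qed.

Lemma lam_of_partition be : inc be -> partitions (lam_of be).
Proof.
move=> ib; split; last by rewrite mem_filter.
apply: sorted_filter (lam_of_pre_sorted ib).
by move=> a b c; rewrite /geq /= => h1 h2; lia.
Qed.

Lemma betaf_inj be be' : inc be -> inc be' -> lam_of be = lam_of be' -> be = be'.
Proof.
move=> ib ib' e; apply/ffunP => i; apply: val_inj.
by rewrite -[LHS]/(bval be i) -[RHS]/(bval be' i) -!betaf_lam_of // e.
Qed.

Lemma partition_lam_of lam : partitions lam -> (size lam <= N)%N ->
  (forall i, N + nth 0 lam i <= B)%N -> exists2 be, inc be & lam_of be = lam.
Proof.
move=> [slam lam0] sN lB.
have bB j : (betaf lam j < B)%N.
  by rewrite /betaf; have := lB (rev_ord j); have := ltn_ord j; lia.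
have dec i j : (i <= j)%N -> (nth 0%N lam j <= nth 0%N lam i)%N.
  move=> ij; case: (ltnP j (size lam)) => js; last by rewrite nth_default.
  have tr : transitive geq by move=> a b c; rewrite /geq /= => h1 h2; lia.
  have rf : reflexive geq by move=> a; rewrite /geq /=.
  by apply: (sorted_leq_nth tr rf 0%N slam) => //; rewrite inE; lia.
pose be : {ffun 'I_N -> 'I_B} := [ffun j => Ordinal (bB j)].
exists be.
  apply/incP => i j ij; rewrite !ffunE /= /betaf.
  have := @dec (rev_ord j) (rev_ord i); rewrite /=; have := ltn_ord j; lia.
have -> : lam_of be = [seq x <- lam ++ nseq (N - size lam) 0 | 0 < x]%N.
  congr filter; apply: (@eq_from_nth _ 0%N).
    by rewrite size_map size_enum_ord size_cat size_nseq subnKC.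
  move=> k; rewrite size_map size_enum_ord => iN.
  rewrite -[k]/(val (Ordinal iN)) nth_enum ffunE /= /betaf -[(N - k.+1)%N]/(val (rev_ord (Ordinal iN))).
  rewrite rev_ordK /= addnK nth_cat; case: ltnP => // h.
  by rewrite nth_default // nth_nseq if_same.
rewrite filter_cat [X in _ ++ X](_ : _ = [::]).
  rewrite cats0; apply/all_filterP/allP => x xl; rewrite lt0n; apply: contra lam0.
  by move=> /eqP <-.
by elim: (N - size lam)%N.
Qed.

End PartitionsAsBeta.

Lemma Sdet_perm (A : comUnitRingType) N (b : 'I_N -> nat) (t : nat -> A) (s : 'S_N) :
  Sdet (fun i => b (s i)) t = (-1) ^+ s * Sdet b t.
Proof.
rewrite /Sdet; set M := (X in _ = _ * \det X).
have -> : \matrix_(r, j) hz t (b (s j)) r = col_perm s M by apply/matrixP => i j; rewrite !mxE.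
by rewrite col_permE det_mulmx det_perm odd_permV mulrC.
Qed.

Lemma Sdet_noninj (A : comUnitRingType) N (b : 'I_N -> nat) (t : nat -> A) :
  ~~ injectiveb [ffun i => b i] -> Sdet b t = 0.
Proof.
move=> /injectivePn [i [j ij e]]; rewrite !ffunE in e.
rewrite /Sdet -det_tr; apply: (determinant_alternate ij) => r; by rewrite !mxE e.
Qed.

(** * Content weights and the derivatives of Z as weighted path sums *)

Section WeightedPaths.
Variables (A : comNzRingType) (N : nat) (phi : nat -> nat -> A).
Implicit Types F : ('I_N -> nat) -> A.

Fixpoint Wgen (ks : seq nat) F : A :=
  if ks is k :: ks' then Wgen ks' (fun b => \sum_j phi k (b j) * F (addb b j k)) else F rho.

Lemma Psum_Wgen (E : ('I_N -> nat) -> A) ks F : E rho = 1 ->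
  (forall b j k, E (addb b j k) = E b * phi k (b j)) ->
  Psum (@rho N) ks (fun b => E b * F b) = Wgen ks F.
Proof.
move=> E1 EA; elim: ks F => [|k ks IH] F /=; first by rewrite E1 mul1r.
rewrite -IH; congr (Psum _ _ _); apply/funext => b; rewrite mulr_sumr.
by apply: eq_bigr => j _; rewrite EA mulrA.
Qed.

End WeightedPaths.

Section PartitionFunction.
Variables (K : fieldType) (qK : qalg K) (psi y : mseries nat K).
Hypothesis psi0 : psi 0%N = 0.
Local Notation t := (fun k => lmono (-1) (y k) : laurent K).

Definition cgi (z : int) : mseries nat K := MSeries (fun k => psi k * z%:~R ^+ k).
Definition cgN (N r : nat) : mseries nat K := cgi (r%:Z + 1 - N%:Z).
(** The content sum read from beta-numbers: the cells of the row with beta-number b_j occupy the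
    positions j, ..., b_j - 1, the cell at r having content r + 1 - N. *)
Definition ecs N (b : 'I_N -> nat) : mseries nat K :=
  \sum_j (\sum_(r < b j) cgN N r - \sum_(r < j) cgN N r).
Definition cwt N (k b : nat) : laurent K :=
  lser (expS (\sum_(r < k) cgN N (b + r))).

Lemma cgi0 z : cgi z 0%N = 0.
Proof. by rewrite -[LHS]/(psi 0%N * _) psi0 mul0r. Qed.

Lemma ecs0 N (b : 'I_N -> nat) : ecs b 0%N = 0.
Proof.
rewrite /ecs mcoef_sum big1 // => j _; rewrite -[LHS]/((\sum_(r < b j) cgN N r) 0%N - (\sum_(r < j) cgN N r) 0%N).
by rewrite !mcoef_sum !big1 ?subrr // => i _; exact: cgi0.
Qed.

Lemma ecs_rho N : ecs (@rho N) = 0.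
Proof. by rewrite /ecs big1 // => j _; rewrite subrr. Qed.

Lemma ecs_perm N (b : 'I_N -> nat) (s : 'S_N) : ecs (fun i => b (s i)) = ecs b.
Proof.
rewrite /ecs !big_split /=; congr (_ + _).
by rewrite [RHS](reindex_inj (@perm_inj _ s)).
Qed.

Lemma ecs_addb N (b : 'I_N -> nat) j k :
  ecs (addb b j k) = ecs b + \sum_(r < k) cgN N (b j + r).
Proof.
rewrite /ecs (bigD1 j) //= [in RHS](bigD1 j) //=.
rewrite (_ : \sum_(i < N | i != j) (\sum_(r < addb b j k i) cgN N r - \sum_(r < i) cgN N r) =
  \sum_(i < N | i != j) (\sum_(r < b i) cgN N r - \sum_(r < i) cgN N r)); last first.
  by apply: eq_bigr => i /negbTE ij; rewrite /addb ij mul0n addn0.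
rewrite /addb eqxx mul1n.
have -> : \sum_(r < b j + k) cgN N r = \sum_(r < b j) cgN N r + \sum_(r < k) cgN N (b j + r).
  by rewrite big_split_ord.
by rewrite -[RHS]addrAC; congr (_ + _); rewrite addrAC.
Qed.

Lemma content_ecs N lam : (size lam <= N)%N -> content_sum psi lam = ecs (@betaf N lam).
Proof.
move=> sN; rewrite /content_sum (big_ord_widen N (fun i => \sum_(j < nth 0 lam i)
   MSeries (fun k : nat => psi k * (j%:Z - i%:Z)%:~R ^+ k))) //.
rewrite big_mkcond /ecs (reindex_inj (@rev_ord_inj N)) /=; apply: eq_bigr => j _.
rewrite /betaf /=; set a := nth _ _ _.
have -> : \sum_(r < a + j) cgN N r = \sum_(r < j) cgN N r + \sum_(r < a) cgN N (j + r).
  by rewrite addnC big_split_ord.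
rewrite addrAC subrr add0r; case: ltnP => h.
  apply: eq_bigr => i _; rewrite /cgN /cgi; congr MSeries; apply/funext => k.
  congr (_ * _%:~R ^+ _); have := ltn_ord j; lia.
by rewrite /a nth_default // big_ord0.
Qed.

Lemma lser_expSD (f g : mseries nat K) : f 0%N = 0 -> g 0%N = 0 ->
  lser (expS (f + g)) = lser (expS f) * lser (expS g).
Proof. by move=> f0 g0; rewrite (expSD degN qK) // rmorphM. Qed.

(** Both the Schur determinant and the derivatives of the other Schur factor are antisymmetric in
    the beta-numbers, which turns the sum over partitions into a sum over paths from [rho]; the
    content weight then splits along the path. *)
Theorem fold_Zfun N ks : all (ltn 0) ks -> (sumn ks <= N)%N ->
  foldr (@Dk (laurent K)) (Zfun psi y) ks 0 = Wgen (cwt N) ks (fun b : 'I_N -> nat => Sdet b t).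
Proof.
move=> kall dN; have qA : qalg (laurent K) by exact: qalg_laurent.
have [m [c mc]] := @fold_Dk_coef (laurent K) _ kall.
pose E N' (b : 'I_N' -> nat) : laurent K := lser (expS (ecs b)).
pose B := (N + sumn ks)%N.
pose wt lam := lser (expS (content_sum psi lam)) * schur t lam.
pose r := [seq lam_of be | be : {ffun 'I_N -> 'I_B} <- enum (@inc N B)].
have term lam : wt lam * schur (@pvar K) lam m *+ c.+1 =
    wt lam * foldr (@Dk (laurent K)) (schur (@pvar K) lam) ks 0.
  by rewrite mc mulrnAr.
have ur : uniq r.
  rewrite map_inj_in_uniq ?enum_uniq // => be be'; rewrite !mem_enum => ib ib'.
  exact: betaf_inj.
have inpart lam : lam \in r -> partitions lam.
  by move=> /mapP[be]; rewrite mem_enum => ib ->; exact: lam_of_partition.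
(* By degree, a nonzero derivative forces the size of lam to be the sum of ks; such a partition has
   at most N parts and fits into the box. *)
have out lam : partitions lam -> lam \notin r -> wt lam * schur (@pvar K) lam m = 0.
  move=> plam; apply: contraNeq => nz.
  have : foldr (@Dk (laurent K)) (schur (@pvar K) lam) ks 0 != 0.
    apply: contra nz => /eqP e; apply/eqP; apply: (mulrSn_inj qA (k := c)).
    by rewrite term e mulr0 mul0rn.
  rewrite (@schur_Sdet _ _ (size lam)) // fold_Dk_Sdet // => nz'.
  have dE : sumn lam = sumn ks.
    apply/eqP; apply: contraNT nz' => ne; rewrite (@eq_Psum _ _ _ _ _ (fun=> 0)) => [|o oE].
      apply/eqP; elim: (ks) => //= k ks' IH; rewrite -[RHS]IH; congr (Psum _ _ _).
      by apply/funext => o; rewrite big1.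
    have z0 : (\sum_(i < size lam) 0 = 0)%N by rewrite big1.
    rewrite z0 add0n in oE; apply: detd0; rewrite oE big_split /= addnC eqn_add2l.
    suff -> : (\sum_(i < size lam) nth 0 lam (size lam - i.+1) = sumn lam)%N by [].
    rewrite sumnE (big_nth 0%N) big_mkord [RHS](reindex_inj (@rev_ord_inj (size lam))).
    by apply: eq_bigr => i _.
  have [be ib <-] : exists2 be : {ffun 'I_N -> 'I_B}, inc be & lam_of be = lam.
    have le i : (nth 0 lam i <= sumn lam)%N.
      case: (ltnP i (size lam)) => h; last by rewrite nth_default.
      by rewrite sumnE (big_nth 0%N) (bigD1_seq i) ?mem_index_iota ?iota_uniq //= leq_addr.
    apply: partition_lam_of => // [|i]; last by rewrite leq_add2l -dE.
    rewrite (leq_trans _ dN) // -dE; case: plam => _.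
    elim: (lam) => //= x l IH; rewrite inE negb_or => /andP[x0 /IH]; lia.
  by apply/mapP; exists be => //; rewrite mem_enum.
rewrite mc -[Zfun psi y m]/(\sum_(lam \in partitions) wt lam * schur (@pvar K) lam m).
rewrite (fsbigE r) //.
have -> : \sum_(lam <- r | lam \in partitions) wt lam * schur (@pvar K) lam m =
    \sum_(lam <- r) wt lam * schur (@pvar K) lam m.
  rewrite big_seq_cond [RHS]big_seq; apply: eq_bigl => lam; case lr: (lam \in r) => //=.
  by rewrite mem_set //; exact: inpart.
rewrite -sumrMnl; under eq_bigr => lam _ do rewrite term.
rewrite big_map big_enum /=.
pose f (b : 'I_N -> nat) := E N b * Sdet b t.
transitivity (\sum_(be : {ffun 'I_N -> 'I_B} | inc be) f (bval be) * Psum (fun=> 0%N) ks (detd (laurent K) (bval be))).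
  apply: eq_bigr => be ib; rewrite /wt !(schur_Sdet _ (lam_of_size be)) -/(betaf (lam_of be)).
  by rewrite (content_ecs (lam_of_size be)) betaf_lam_of // fold_Dk_Sdet.
rewrite Psum_antisym ?leqnn //; last first.
  by move=> b s; rewrite /f /E ecs_perm Sdet_perm mulrCA.
rewrite -(@Psum_Wgen _ _ _ (E N)); last 2 first.
- by rewrite /E ecs_rho (expS_0 degN); exact: (rmorph1 (@lser K)).
- move=> b j k; rewrite /E ecs_addb lser_expSD ?ecs0 //.
  by rewrite mcoef_sum big1 // => i _; exact: cgi0.
congr (Psum _ _ _); apply/funext => b; case: ifP => // /negbT ni.
by rewrite Sdet_noninj ?mulr0.
Qed.

End PartitionFunction.

(** * Moments and cumulants indexed by sets *)

Section CumulantRelation.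
Variables (A : comNzRingType) (n : nat).
Implicit Types (M kp : {set 'I_n} -> A) (S T : {set 'I_n}).

(** The moment-cumulant formula over set partitions, in the recursive form that singles out the
    block of a. *)
Definition cumulant_rel M kp := forall S a, a \in S ->
  M S = \sum_(T : {set 'I_n} | (T \subset S) && (a \in T)) kp T * M (S :\: T).

Lemma cumulant_uniq M kp kp' : M finset.set0 = 1 ->
  cumulant_rel M kp -> cumulant_rel M kp' ->
  forall S, S != finset.set0 -> kp S = kp' S.
Proof.
move=> M1 h h' S; have [c] := ubnP #|S|; elim: c S => // c IH S Sc S0.
have /set0Pn [a aS] := S0.
have := h S a aS; rewrite (h' S a aS) (bigD1 S) ?subxx //= [X in _ = X](bigD1 S) ?subxx //=.
rewrite finset.setDv M1 !mulr1 => /esym.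
rewrite [X in _ + X = _](_ : _ = \sum_(T : {set 'I_n} | (T \subset S) && (a \in T) && (T != S))
  kp' T * M (S :\: T)); first exact: addIr.
apply: eq_bigr => T /andP[/andP[TS aT] TnS]; congr (_ * _).
apply: IH; last by apply/set0Pn; exists a.
have : T \proper S by rewrite finset.properEneq TnS.
by move=> /proper_card; lia.
Qed.

(** A Wick contraction of one pair in all moments is seen only by the cumulant of that pair. *)
Lemma cumulant_swap M kp M' (C : A) x y : cumulant_rel M kp -> x != y ->
  (forall S, M' S = M S - (if (x \in S) && (y \in S) then C * M (S :\: [set x; y]%SET) else 0)) ->
  cumulant_rel M' (fun T => kp T - (if T == [set x; y]%SET then C else 0)).
Proof.
move=> h xy M'E S a aS.
pose XY := [set x; y]%SET; have xXY : x \in XY by rewrite !inE eqxx.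
have yXY : y \in XY by rewrite !inE eqxx orbT.
have XYS (U : {set 'I_n}) : (XY \subset U) = (x \in U) && (y \in U).
  by rewrite finset.subUset !finset.sub1set.
pose X2 T := if (x \in S :\: T) && (y \in S :\: T) then kp T * (C * M (S :\: T :\: XY)) else 0.
pose X3 T := if T == XY then C * M (S :\: T) else 0.
have e T : (kp T - (if T == XY then C else 0)) * M' (S :\: T) = kp T * M (S :\: T) - X2 T - X3 T.
  rewrite M'E /X2 /X3; case: (eqVneq T XY) => [->|_].
    by rewrite finset.in_setD xXY /= !subr0 mulrBl.
  by rewrite !subr0; case: ifP => _; [rewrite mulrBr|rewrite !subr0].
under eq_bigr => T _ do rewrite e.
rewrite !sumrB -h // M'E -/XY -addrA -opprD; congr (_ - _).
have [xyS|nxyS] := boolP ((x \in S) && (y \in S)); last first.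
  rewrite !big1 ?addr0 // => T /andP[TS aT]; rewrite /X2 /X3.
    by case: eqP => // TE; move: TS; rewrite TE XYS (negbTE nxyS).
  case: ifP => // /andP[]; rewrite !finset.in_setD => /andP[_ xS] /andP[_ yS].
  by rewrite xS yS in nxyS.
(* If a lies in the pair, only [X3] survives, at T = {x, y}. Otherwise only [X2] does, and the
   relation for S without the pair sums it. *)
have [aXY|naXY] := boolP (a \in XY).
  rewrite big1 ?add0r => [|T /andP[TS aT]].
    rewrite (bigD1 XY) ?aXY ?XYS ?xyS //= /X3 eqxx big1 ?addr0 // => T /andP[_ /negbTE ->] //.
  rewrite /X2; case: ifP => //; rewrite !finset.in_setD => /andP[/andP[xT _] /andP[yT _]].
  by move: aXY; rewrite !inE => /orP[]/eqP aE; rewrite -aE aT in xT yT.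
rewrite [X in _ = _ + X]big1 ?addr0 => [|T /andP[TS aT]]; last first.
  by rewrite /X3; case: eqP => // TE; rewrite -TE aT in naXY.
rewrite (h (S :\: XY) a) ?finset.in_setD ?naXY // mulr_sumr /X2 -big_mkcondr.
apply: eq_big => [T|T _]; last by rewrite mulrCA !finset.setDDl finset.setUC.
have dT : [disjoint T & XY]%B = (x \in S :\: T) && (y \in S :\: T).
  rewrite !finset.in_setD; case/andP: xyS => -> ->; rewrite !andbT.
  rewrite disjoint_sym disjoint_subset; apply/fintype.subsetP/andP => [hh|[xT yT] z].
    by split; [apply: (hh x)|apply: (hh y)].
  by rewrite !inE => /orP[]/eqP ->.
rewrite finset.subsetD -dT; case: (T \subset S); case: (a \in T); rewrite ?andbT ?andbF //.
Qed.

End CumulantRelation.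

Section SetDerivatives.
Variables (A : comUnitRingType) (qA : qalg A) (n : nat) (k : 'I_n -> nat).
Local Notation A' := (mseries {poly nat} A).
Implicit Types (f g : A') (S T : {set 'I_n}).

Lemma Dk_comm i j f : Dk i (Dk j f) = Dk j (Dk i f).
Proof.
have pc : pder i (pder j f) = pder j (pder i f).
  have pE a b m : pder a (pder b f) m = f (m + 'X^a + 'X^b) *+ ((m + 'X^a)`_b)%R.+1 *+ (m`_a)%R.+1 by [].
  apply: mseriesP => m; rewrite !pE -!mulrnA addrAC; congr (_ *+ _).
  rewrite !coefD !coefXn eq_sym; case: eqP => [->|_]; rewrite ?addr0 //.
  by rewrite mulnC.
by rewrite /Dk /pder !raddfMn /= -/(pder i _) -/(pder j _) pc -!mulrnA mulnC.
Qed.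

Lemma foldr_Dk_rem i ks f : i \in ks -> foldr (@Dk A) f ks = Dk i (foldr (@Dk A) f (rem i ks)).
Proof.
elim: ks => //= j ks IH; rewrite inE eq_sym; case: eqP => [-> //|_] /= iks.
by rewrite IH // Dk_comm.
Qed.

Lemma foldr_Dk_perm ks ls f : perm_eq ks ls -> foldr (@Dk A) f ks = foldr (@Dk A) f ls.
Proof.
elim: ks ls => [|i ks IH] ls; first by move=> /perm_nilP/(_)-> || by rewrite perm_sym => /perm_nilP ->.
move=> pe; have il : i \in ls by rewrite -(perm_mem pe) mem_head.
rewrite (foldr_Dk_rem _ il) /=; congr (Dk i _); apply: IH.
by rewrite -(perm_cons i) (perm_trans pe) // perm_to_rem.
Qed.

Lemma foldr_Dk_in i ks f : foldr (@Dk A) (Dk i f) ks = Dk i (foldr (@Dk A) f ks).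
Proof. by elim: ks => //= j ks ->; rewrite Dk_comm. Qed.

Definition DS S f := foldr (@Dk A) f [seq k i | i <- enum S].

Lemma DS0 f : DS finset.set0 f = f.
Proof. by rewrite /DS enum_set0. Qed.

Lemma DSU1 a S f : a \notin S -> DS (a |: S)%SET f = Dk (k a) (DS S f).
Proof.
move=> aS; rewrite /DS -[RHS]/(foldr (@Dk A) f (map k (a :: enum S))).
apply: foldr_Dk_perm; apply: perm_map; apply: uniq_perm; rewrite /= ?mem_enum ?aS ?enum_uniq //.
by move=> i; rewrite inE !mem_enum !inE.
Qed.

Lemma DSD1 a S f : a \in S -> DS S f = Dk (k a) (DS (S :\ a)%SET f).
Proof. by move=> aS; rewrite -DSU1 ?finset.setD1K // !inE eqxx. Qed.

Lemma sum_subsets_with (G : {set 'I_n} -> A') a S : a \in S ->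
  \sum_(T : {set 'I_n} | (T \subset S) && (a \in T)) G T =
  \sum_(T : {set 'I_n} | T \subset (S :\ a)%SET) G (a |: T)%SET.
Proof.
move=> aS; rewrite (reindex_onto (fun T => a |: T)%SET (fun T => T :\ a)%SET); last first.
  by move=> T /andP[_ aT]; rewrite finset.setD1K.
apply: eq_bigl => T; rewrite finset.subsetU1 || idtac.
rewrite finset.subUset finset.sub1set aS /= finset.subsetD1 !inE eqxx /=.
case: (boolP (a \in T)) => aT; last by rewrite finset.setU1K // eqxx !andbT.
rewrite !andbT !andbF; apply/negP => /andP[_ /eqP e].
by move: aT; rewrite -e !inE eqxx.
Qed.

Lemma DSM S f g : DS S (f * g) = \sum_(T : {set 'I_n} | T \subset S) DS T f * DS (S :\: T) g.
Proof.
have [c] := ubnP #|S|; elim: c S => // c IH S Sc.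
have [->|/set0Pn [a aS]] := eqVneq S finset.set0.
  rewrite (big_pred1 finset.set0) => [|T]; last by rewrite finset.subset0.
  by rewrite finset.setD0 !DS0.
rewrite (DSD1 _ aS) IH; last by move: Sc; rewrite (cardsD1 a) aS; lia.
rewrite (der_sum (@DkD _ _)) [RHS](bigID (fun T : {set 'I_n} => a \in T)) /=.
rewrite sum_subsets_with //.
under eq_bigr => T _ do rewrite DkM.
rewrite big_split /=; congr (_ + _).
  apply: eq_bigr => T; rewrite finset.subsetD1 => /andP[_ aT].
  rewrite DSU1 //; congr (_ * DS _ _); by rewrite finset.setDDl.
apply: eq_big => [T|T]; first by rewrite finset.subsetD1.
rewrite finset.subsetD1 => /andP[_ aT]; congr (_ * _).
rewrite (@DSD1 a (S :\: T)) ?finset.in_setD ?aT ?aS //; congr (Dk _ (DS _ _)).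
by rewrite !finset.setDDl finset.setUC.
Qed.

(** The Leibniz rule over subsets, applied to D Z = D(log Z) Z with D the derivative belonging to
    a. *)
Lemma cumulant_logS (Z : A') : Z 0 = 1 ->
  cumulant_rel (fun S => DS S Z 0) (fun S => DS S (logS Z) 0).
Proof.
move=> Z1 S a aS /=.
have DZ : Dk (k a) Z = Dk (k a) (logS Z) * Z.
  rewrite /Dk mulrnAl; congr (_ *+ _); rewrite mulrC.
  apply: (cder_logS degP qA) => //; exact: pder_leibniz.
transitivity ((\sum_(T : {set 'I_n} | (T \subset S) && (a \in T)) DS T (logS Z) * DS (S :\: T) Z) 0).
  congr (mcoef _ 0); rewrite sum_subsets_with // (DSD1 _ aS) -foldr_Dk_in DZ -/(DS _ _) DSM.
  apply: eq_bigr => T; rewrite finset.subsetD1 => /andP[_ aT].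
  by rewrite DSU1 // /DS foldr_Dk_in finset.setDDl.
rewrite mcoef_sum; apply: eq_bigr => T _.
by rewrite -[LHS]/(mconst degP (DS T (logS Z) * DS (S :\: T) Z)) rmorphM.
Qed.

End SetDerivatives.

(** * Units and substitution *)

Section SeriesUnits.
Variables (M : exponentType) (dg : degree M) (A : comUnitRingType).
Implicit Types f g : mseries M A.

(** The inverse is the geometric series in 1 - f, truncated at an order that depends on the
    coefficient read. *)
Lemma mseries_unit1 f : f 0 = 1 -> f \is a GRing.unit.
Proof.
move=> f1; pose g := 1 - f; have g0 : g 0 = 0 by rewrite mcoefB f1 mcoef1 eqxx subrr.
pose h : mseries M A := MSeries (fun m => (\sum_(k < (dg m).+1) g ^+ k) m).
apply/unitrPr; exists h; apply: mseriesP => m.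
rewrite (@eq_mcoefMr _ dg _ _ _ (\sum_(k < (dg m).+1) g ^+ k)) => [|a am].
  have -> : f = - (g - 1) by rewrite /g opprB opprB addrC subrK.
  rewrite mulNr -subrX1 opprB mcoefB (mcoef_pow_deg (dg := dg)) ?subr0 //.
rewrite -[LHS]/((\sum_(k < (dg a).+1) g ^+ k) a) !mcoef_sum.
rewrite (big_ord_widen (dg m).+1 (fun k => (g ^+ k) a)) // big_mkcond.
by apply: eq_bigr => k _; case: ltnP => // ak; rewrite (mcoef_pow_deg (dg := dg)).
Qed.

Lemma mcoefV0 f : f \is a GRing.unit -> (f^-1) 0 = (f 0)^-1.
Proof. by move=> u; rewrite -[LHS]/(mconst dg f^-1) rmorphV. Qed.

Lemma mcoef_mulX_deg (f x : mseries M A) k m : x 0 = 0 -> (dg m < k)%N -> (f * x ^+ k) m = 0.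
Proof.
move=> x0 mk; rewrite (@eq_mcoefMr _ dg _ _ _ 0) ?mulr0 // => a am.
by rewrite (mcoef_pow_deg (dg := dg)) //; lia.
Qed.

End SeriesUnits.

Section Substitution.
Variables (M : exponentType) (dg : degree M) (A B : comUnitRingType).
Variables (h : {rmorphism A -> mseries M B}) (x : mseries M B).
Hypothesis x0 : x 0 = 0.

(* The substitution of [x] for the variable, the coefficients being mapped by [h]. *)
Definition hcomp of x 0 = 0 := fun f : mseries nat A =>
  MSeries (fun m => (\sum_(k < (dg m).+1) h (f k) * x ^+ k) m).
Local Notation hc := (hcomp x0).

Lemma hcompE f m N : (dg m < N)%N -> hc f m = (\sum_(k < N) h (f k) * x ^+ k) m.
Proof.
move=> mN; rewrite -[LHS]/((\sum_(k < (dg m).+1) h (f k) * x ^+ k) m) !mcoef_sum.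
rewrite (big_ord_widen N (fun k => (h (f k) * x ^+ k) m)) // big_mkcond.
by apply: eq_bigr => k _; case: ltnP => // ak; rewrite (mcoef_mulX_deg (dg := dg)).
Qed.

Lemma hcomp_is_zmod_morphism : zmod_morphism hc.
Proof.
move=> f g; apply: mseriesP => m; rewrite mcoefB !(@hcompE _ _ (dg m).+1) // -mcoefB.
by congr (mcoef _ m); rewrite -sumrB; apply: eq_bigr => k _; rewrite mcoefB rmorphB mulrBl.
Qed.
HB.instance Definition _ := GRing.isZmodMorphism.Build (mseries nat A) (mseries M B)
  hc hcomp_is_zmod_morphism.

Lemma hcomp_smono k a : hc (smono k a) = h a * x ^+ k.
Proof.
apply: mseriesP => m; rewrite (@hcompE _ _ ((dg m).+1 + k.+1)%N) ?leq_addr //.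
have kN : (k < (dg m).+1 + k.+1)%N by lia.
congr (mcoef _ m); rewrite (bigD1 (Ordinal kN)) //= eqxx big1 ?addr0 // => i ik.
by case: eqP => [e|_]; [rewrite -val_eqE /= e eqxx in ik|rewrite rmorph0 mul0r].
Qed.

Lemma hcomp_is_monoid_morphism : monoid_morphism hc.
Proof.
split=> [|f g]; first by rewrite -[1]/(smono 0%N 1) hcomp_smono rmorph1 mul1r expr0.
apply: mseriesP => m; pose N := (dg m).+1.
rewrite (@hcompE _ _ N) //.
rewrite (@eq_mcoefM _ dg _ _ (\sum_(k < N) h (f k) * x ^+ k) _ (\sum_(k < N) h (g k) * x ^+ k)).
- transitivity ((\sum_(k < N) \sum_(i < k.+1) (h (f i) * h (g (k - i)%N)) * x ^+ (i + (k - i))) m).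
    congr (mcoef _ m); apply: eq_bigr => k _; rewrite mcoefM_nat rmorph_sum mulr_suml.
    by apply: eq_bigr => i _; rewrite rmorphM subnKC // -ltnS.
  rewrite (triangular_sum (fun i j => (h (f i) * h (g j)) * x ^+ (i + j))) big_distrlr.
  rewrite !mcoef_sum; apply: eq_bigr => i _; rewrite !mcoef_sum.
  rewrite (big_ord_widen N (fun j => (h (f i) * h (g j) * x ^+ (i + j)) m)) ?leq_subr //.
  rewrite big_mkcond; apply: eq_bigr => j _; have := ltn_ord i => iN.
  case: ltnP => ij; first by rewrite -[X in _ = mcoef X m]/((h (f i) * x ^+ i) * (h (g j) * x ^+ j)) exprD mulrACA.
  by rewrite -[X in _ = mcoef X m]/((h (f i) * x ^+ i) * (h (g j) * x ^+ j)) mulrACA -exprD (mcoef_mulX_deg (dg := dg)) // -leq_subLR.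
- by move=> a am; apply: hcompE.
- by move=> a am; apply: hcompE.
Qed.
HB.instance Definition _ := GRing.isMonoidMorphism.Build (mseries nat A) (mseries M B)
  hc hcomp_is_monoid_morphism.

Lemma hcomp0 f : hc f 0 = h (f 0%N) 0.
Proof. by rewrite (@hcompE _ _ 1) ?deg0 // big_ord1 expr0 mulr1. Qed.

Lemma hcomp_expS (f : mseries nat A) : qalg A -> f 0%N = 0 -> hc (expS f) = expS (hc f).
Proof.
move=> qA f0; have qB' := qalg_rmorph h qA; apply: mseriesP => m; pose N := (dg m).+1.
have qB : qalg B := qalg_rmorph (mconst dg) qB'.
have hf0 : hc f 0 = 0 by rewrite hcomp0 f0 rmorph0.
rewrite (@hcompE _ _ N) // (expS_sum (dg := dg) (N := N)) //.
have -> : \sum_(k < N) h (expS f k) * x ^+ k =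
    \sum_(j < N) smono 0 (j`!%:R)^-1 * \sum_(k < N) h ((f ^+ j) k) * x ^+ k.
  under [RHS]eq_bigr => j _ do rewrite mulr_sumr.
  rewrite exchange_big; apply: eq_bigr => k _.
  rewrite (expS_sum (dg := degN) (N := N)) //; last exact: ltn_ord.
  rewrite rmorph_sum mulr_suml; apply: eq_bigr => j _; rewrite rmorphM mulrA; congr (_ * _ * _).
  by rewrite rmorphV ?qalg_fact // rmorph_nat rmorphV ?qalg_fact // rmorph_nat.
rewrite mcoef_sum; apply: eq_bigr => j _; rewrite mcoefCM; congr (_ * _).
by rewrite -rmorphXn (@hcompE _ _ N).
Qed.

End Substitution.

Lemma scomp_hcomp (M : exponentType) (dg : degree M) (A : comUnitRingType) (x : mseries M A)
  (x0 : x 0 = 0) f : scomp f x = hcomp dg (@smono M A 0) x0 f.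
Proof.
apply: mseriesP => m; rewrite (@hcompE _ _ _ _ _ _ _ _ _ (dg m).+1) // mcoef_sum.
by apply: csum_nat => k mk; rewrite (mcoef_mulX_deg (dg := dg)).
Qed.

(** * Strings of contents, their products, and the series L_0 *)

Section ExponentialSeries.
Variables (K : fieldType) (qK : qalg K).

Definition Eser (c : K) : mseries nat K := MSeries (fun k => c ^+ k / k`!%:R).
Definition Xs : mseries nat K := smono 1%N 1.

Lemma qfact k : (k`!%:R : K) != 0.
Proof. by rewrite -unitfE; exact: qalg_fact. Qed.

Lemma qnat_neq0 k : (k.+1%:R : K) != 0.
Proof. by rewrite -unitfE; exact: qK. Qed.

Lemma EserD c d : Eser (c + d) = Eser c * Eser d.
Proof.
apply: mseriesP => k; rewrite mcoefM_nat -[LHS]/((c + d) ^+ k / k`!%:R).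
rewrite addrC exprDn mulr_suml; apply: eq_bigr => i _.
rewrite -[Eser c i]/(c ^+ i / i`!%:R) -[Eser d _]/(d ^+ (k - i) / (k - i)`!%:R).
have ik : (i <= k)%N by rewrite -ltnS.
rewrite -mulr_natr -(bin_fact ik) !natrM.
have f1 := qfact i; have f2 := qfact (k - i).
have f3 : ('C(k, i)%:R : K) != 0.
  by have := qfact k; rewrite -(bin_fact ik) natrM mulf_eq0 negb_or => /andP[].
by field; rewrite f1 f2 f3.
Qed.

Lemma Eser0 : Eser 0 = 1.
Proof.
apply: mseriesP => -[|k]; rewrite -[LHS]/(0 ^+ _ / _) mcoef1 ?expr0 ?fact0 ?divr1 //.
by rewrite expr0n mul0r.
Qed.

Lemma mcoefXs f k : (Xs * f) k = if k is k'.+1 then f k' else 0.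
Proof.
rewrite mcoefM_nat; case: k => [|k].
  by rewrite big_ord1 smonoE mul0r.
rewrite big_ord_recl big_ord_recl big1 => [|i _]; last by rewrite -[Xs _]/(0 : K) mul0r.
rewrite -[Xs ord0]/(0 : K) -[Xs (lift _ _)]/(1 : K) mul0r mul1r add0r addr0.
by rewrite -[(k.+1 - _)%N]/(k.+1 - 1)%N subSS subn0.
Qed.

Lemma Xs_inj f g : Xs * f = Xs * g -> f = g.
Proof. by move=> e; apply: mseriesP => k; have := congr1 (fun h : mseries nat K => h k.+1) e; rewrite !mcoefXs. Qed.

(* The series of [(e^((c + a/2) x) - e^((c - a/2) x)) / x]. *)
Definition Tser (a c : K) : mseries nat K :=
  MSeries (fun k => ((c + a / 2) ^+ k.+1 - (c - a / 2) ^+ k.+1) / k.+1`!%:R).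

Lemma Tser_Eser a c : Xs * Tser a c = Eser (c + a / 2) - Eser (c - a / 2).
Proof.
apply: mseriesP => k; rewrite mcoefXs mcoefB; case: k => [|k].
  by rewrite -[Eser (c + _) _]/(_ / _) -[Eser (c - _) _]/(_ / _) !expr0 subrr.
by rewrite -[LHS]/((_ - _) / _) mulrBl.
Qed.

Lemma TserE a c : Tser a c = Eser c * Tser a 0.
Proof.
apply: Xs_inj; rewrite mulrCA !Tser_Eser mulrBr -!EserD; congr (Eser _ - Eser _); ring.
Qed.

Lemma Tser_S a k : Tser a 0 k = a ^+ k.+1 * Sser K k.
Proof.
rewrite -[LHS]/((_ - _) / _) -[Sser K k]/((_ - _) / _) mulrA mulrBr -!exprMn.
by congr ((_ ^+ _ - _ ^+ _) / _); ring.
Qed.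

Lemma two_neq0 : (2 : K) != 0. Proof. exact: (qnat_neq0 1). Qed.

Lemma Sser0 : Sser K 0%N = 1.
Proof. by rewrite -[LHS]/((_ - _) / _) !expr1 -[1`!%N]/1%N divr1; have := two_neq0; move=> h; field. Qed.

Lemma Sser_unit : Sser K \is a GRing.unit.
Proof. by apply: (mseries_unit1 degN); exact: Sser0. Qed.

(** This is e^(c x) sinh(a x / 2) / sinh(x / 2); for a natural number a it is the sum of e^(z x)
    over a unit-spaced points z centred at c. *)
Definition Pgf (a c : K) : mseries nat K := (Sser K)^-1 * Tser a c.

Lemma Pgf1 c : Pgf 1 c = Eser c.
Proof.
rewrite /Pgf TserE mulrCA; have -> : Tser 1 0 = Sser K.
  by apply: mseriesP => k; rewrite Tser_S expr1n mul1r.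
by rewrite mulVr ?mulr1 // Sser_unit.
Qed.

Lemma Pgf0 c : Pgf 0 c = 0.
Proof.
rewrite /Pgf (_ : Tser 0 c = 0) ?mulr0 //; apply: mseriesP => k.
by rewrite -[LHS]/((_ - _) / _) mul0r addr0 subr0 subrr mul0r.
Qed.

(** Two adjacent strings, of lengths a and b, glue to one of length a + b. *)
Lemma Pgf_cocycle a b c : Pgf a (c + b / 2) + Pgf b (c - a / 2) = Pgf (a + b) c.
Proof.
rewrite /Pgf -mulrDr; congr (_ * _); apply: mseriesP => k.
rewrite mcoefD -![Tser _ _ k]/((_ - _) / _) -mulrDl; congr (_ / _).
have -> : c - a / 2 + b / 2 = c + b / 2 - a / 2 by ring.
rewrite addrA subrK; congr (_ ^+ _ - _ ^+ _); ring.
Qed.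

Variable psi : mseries nat K.
Hypothesis psi0 : psi 0%N = 0.

(** The sum of psi(hbar z) over the string centred at c, continued from natural numbers to every
    length a. *)
Definition pexp (a c : K) : mseries nat K := MSeries (fun k => psi k * (k`!%:R * Pgf a c k)).
Definition Phi (a c : K) : mseries nat K := expS (pexp a c).

Lemma pexp0 a c : pexp a c 0%N = 0.
Proof. by rewrite -[LHS]/(_ * _) psi0 mul0r. Qed.

Lemma Phi0 c : Phi 0 c = 1.
Proof.
rewrite /Phi (_ : pexp 0 c = 0) ?(expS_0 degN) //; apply: mseriesP => k.
by rewrite -[LHS]/(_ * _) Pgf0 mcoef0 !mulr0.
Qed.

Lemma Phi_cocycle a b c : Phi a (c + b / 2) * Phi b (c - a / 2) = Phi (a + b) c.
Proof.
rewrite /Phi -(expSD degN qK (pexp0 _ _) (pexp0 _ _)); congr expS; apply: mseriesP => k.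
by rewrite mcoefD -![pexp _ _ k]/(_ * _) -!mulrDr -mcoefD Pgf_cocycle.
Qed.

(** The string cut in the other order; the equality of the two cuts is what cancels commutators. *)
Lemma Phi_cocycleV a b c : Phi a (c - b / 2) * Phi b (c + a / 2) = Phi (a + b) c.
Proof. by rewrite mulrC Phi_cocycle addrC. Qed.

Lemma cwt_Phi N m b :
  cwt psi N m b = lser (Phi m%:R (b%:R - N%:R + (m%:R + 1) / 2)).
Proof.
rewrite /cwt; congr (lser (expS _)).
elim: m b => [|m IH] b.
  by rewrite big_ord0; apply: mseriesP => k; rewrite -[RHS]/(_ * _) Pgf0 mcoef0 !mulr0.
(* The string loses its lowest content b + 1 - N, and the centre of the rest moves up by one
   half. *)
rewrite big_ord_recl (eq_bigr (fun i : 'I_m => cgN psi N (b.+1 + i))); last first.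
  by move=> i _; rewrite lift0 addnS addSn.
rewrite IH; apply: mseriesP => k; rewrite mcoefD -[cgN psi N _ k]/(_ * _).
rewrite -![pexp _ _ k]/(_ * _) -mulrDr; congr (_ * _); rewrite -[m.+1%:R]natr1.
rewrite -Pgf_cocycle mcoefD mulrDr addrC; have t0 := two_neq0; congr (_ * _ + _).
  by congr (Pgf _ _ _); rewrite -natr1; field.
rewrite Pgf1 -[Eser _ k]/(_ / _) mulrC mulfVK ?qfact //; congr (_ ^+ _).
by rewrite addn0 !rmorphB !rmorphD /= -!pmulrn; field.
Qed.

End ExponentialSeries.

Section Specialization.
Variables (K : fieldType) (qK : qalg K) (a : K).
Local Notation hy := (mseries nat (mseries nat K)).
Local Notation vhy := (mseries nat hy).
Implicit Types f g : vhy.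

(* The value at [v = a]; each coefficient of hbar is to be a polynomial in [v]. *)
Definition spec f : hy :=
  csum (fun j : nat => MSeries (fun l => smono 0%N (a ^+ j) * f j l)).

(** Under this bound evaluation at v = a is a finite sum at each power of hbar, and it is compatible
    with products and exponentials. *)
Definition vbnd (c : nat) f := forall j l, (2 * l + c < j)%N -> f j l = 0.

Lemma specE f l N : (forall j, (N <= j)%N -> f j l = 0) ->
  spec f l = \sum_(j < N) smono 0%N (a ^+ j) * f j l.
Proof. move=> fN; apply: csum_nat => j /fN e.
by rewrite -[LHS]/(smono 0%N (a ^+ j) * f j l) e mulr0. Qed.

Lemma spec_bnd c f l N : vbnd c f -> (2 * l + c < N)%N ->
  spec f l = \sum_(j < N) smono 0%N (a ^+ j) * f j l.
Proof. by move=> fc lN; apply: specE => j jN; apply: fc; lia. Qed.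

Lemma vhy_coefM f g j l :
  (f * g) j l = \sum_(i < j.+1) \sum_(p < l.+1) f i p * g (j - i)%N (l - p)%N.
Proof. by rewrite mcoefM_nat mcoef_sum; apply: eq_bigr => i _; rewrite mcoefM_nat. Qed.

Lemma vbndM c d f g : vbnd c f -> vbnd d g -> vbnd (c + d) (f * g).
Proof.
move=> fc gd j l lj; rewrite vhy_coefM big1 // => i _; rewrite big1 // => p _.
have pl : (p <= l)%N by rewrite -ltnS.
have [ip|ip] := ltnP (2 * p + c) i; first by rewrite fc ?mul0r.
by rewrite [X in _ * X]gd ?mulr0 //; lia.
Qed.

Lemma spec_mul c d f g : vbnd c f -> vbnd d g -> spec (f * g) = spec f * spec g.
Proof.
move=> fc gd; apply: mseriesP => l; pose N := (2 * l + c + d).+1.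
rewrite mcoefM_nat (spec_bnd (N := N) (vbndM fc gd)); last by rewrite /N; lia.
pose G i j := \sum_(p < l.+1) (smono 0%N (a ^+ i) * f i p) * (smono 0%N (a ^+ j) * g j (l - p)%N).
transitivity (\sum_(k < N) \sum_(i < k.+1) G i (k - i)%N).
  apply: eq_bigr => j _; rewrite vhy_coefM mulr_sumr; apply: eq_bigr => i _.
  rewrite mulr_sumr; apply: eq_bigr => p _; have ij : (i <= j)%N by rewrite -ltnS.
  by rewrite -{1}(subnKC ij) exprD rmorphM mulrACA.
rewrite triangular_sum (eq_bigr (fun i : 'I_N => \sum_(j < N) G i j)) => [|i _]; last first.
  rewrite (big_ord_widen N (G i)) ?leq_subr // big_mkcond; apply: eq_bigr => j _.
  have iN := ltn_ord i; case: ltnP => // ij; rewrite /G big1 // => p _.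
  have pl : (p <= l)%N by rewrite -ltnS.
  have [ip|ip] := ltnP (2 * p + c) i; first by rewrite fc ?mulr0 ?mul0r.
  by rewrite [g _ _]gd ?mulr0 //; move: ij; rewrite leq_subLR /N; move: (nat_of_ord i) (nat_of_ord j) ip => i' j'; lia.
rewrite /G; under eq_bigr => i _ do rewrite exchange_big.
rewrite exchange_big; apply: eq_bigr => p _; have pl : (p <= l)%N by rewrite -ltnS.
rewrite (spec_bnd (N := N) fc) ?(spec_bnd (N := N) gd) ?big_distrlr //; rewrite /N; lia.
Qed.

Lemma vbnd1 : vbnd 0 1.
Proof. by move=> [|j] l // lj; rewrite mcoef1. Qed.

Lemma spec1 : spec 1 = 1.
Proof.
apply: mseriesP => l; rewrite (@specE _ _ 1) => [|[|j]] //.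
by rewrite big_ord1 expr0 rmorph1 mul1r.
Qed.

Lemma vbndX f k : vbnd 0 f -> vbnd 0 (f ^+ k).
Proof.
move=> f0; elim: k => [|k IH]; first exact: vbnd1.
by rewrite exprS; exact: (vbndM f0 IH).
Qed.

Lemma spec_exp f k : vbnd 0 f -> spec (f ^+ k) = spec f ^+ k.
Proof.
move=> f0; elim: k => [|k IH]; first exact: spec1.
by rewrite !exprS (spec_mul f0 (vbndX k f0)) IH.
Qed.

Lemma fact_const_V (M : exponentType) (A : comUnitRingType) k : qalg A ->
  ((k`!%:R)^-1 : mseries M A) = smono 0 (k`!%:R)^-1.
Proof. by move=> qA; rewrite rmorphV ?qalg_fact // rmorph_nat. Qed.

Lemma expS_coef2 f j l N : f 0%N = 0 -> (j < N)%N ->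
  expS f j l = \sum_(k < N) (k`!%:R)^-1 * (f ^+ k) j l.
Proof.
move=> f0 jN; have q1 : qalg (mseries nat K) by exact: qalg_mseries.
rewrite (expS_sum (dg := degN) (N := N)) // mcoef_sum; apply: eq_bigr => k _.
by rewrite fact_const_V // mcoefCM.
Qed.

Lemma vbnd_expS f : f 0%N = 0 -> vbnd 0 f -> vbnd 0 (expS f).
Proof.
move=> f0 fb j l lj; rewrite (@expS_coef2 f j l j.+1) // big1 // => k _.
by rewrite (vbndX k fb) ?mulr0.
Qed.

Lemma spec_expS f : f 0%N = 0 -> vbnd 0 f -> spec f 0%N = 0 -> spec (expS f) = expS (spec f).
Proof.
move=> f0 fb sf0; apply: mseriesP => l; pose N := (2 * l).+1.
rewrite (spec_bnd (N := N) (vbnd_expS f0 fb)); last by rewrite /N; lia.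
have lN : (degN l < N)%N by rewrite -[degN l]/l /N; lia.
rewrite (expS_sum sf0 lN).
under eq_bigr => j _ do rewrite (expS_coef2 _ f0 (ltn_ord j)) mulr_sumr.
rewrite exchange_big; apply: eq_bigr => k _; rewrite -spec_exp //.
rewrite (spec_bnd (N := N) (vbndX k fb)); last by rewrite /N; lia.
by rewrite mulr_sumr; apply: eq_bigr => j _; rewrite mulrCA.
Qed.

End Specialization.

Lemma iter_sderiv (K : fieldType) (qK : qalg K) (f : mseries nat K) k r :
  iter k (@sderiv K) f r = f (r + k)%N * ((r + k)`!%:R / r`!%:R).
Proof.
elim: k r => [|k IH] r; first by rewrite addn0 divff ?qfact ?mulr1.
rewrite iterS -[LHS]/(iter k (@sderiv K) f r.+1 *+ r.+1) IH addSnnS -[LHS]mulr_natr -mulrA.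
congr (_ * _); rewrite factS natrM.
have := qfact qK r; have := qnat_neq0 qK r.
by move: (r.+1%:R : K) (r`!%:R : K) => u v h1 h2; field; rewrite h1 h2.
Qed.

Lemma Sinv0 (K : fieldType) (qK : qalg K) : (Sser K)^-1 0%N = 1.
Proof.
rewrite -[LHS]/((Sser K)^-1 0) (mcoefV0 degN) ?Sser_unit //.
by rewrite -[Sser K 0]/(Sser K 0%N) Sser0 // invr1.
Qed.

Section PhiExpansion.
Variables (K : fieldType) (qK : qalg K) (psi : mseries nat K) (a c : K).
Hypothesis psi0 : psi 0%N = 0.
Local Notation hy := (mseries nat (mseries nat K)).

Definition Lexp : mseries nat hy :=
  vvar K * (S_vhdy (Sinv_hdy psi) - vhy_cst psi).

(** The coefficient of hbar^l carries the l-th derivative of psi; the one with l = 0 cancels against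
    psi, whence j <= l + 1 <= 2 l. *)
Lemma Lexp_coef j l : Lexp j l = if j is al.+1 then
  if (al <= l)%N && (0 < l)%N then
    smono 0%N (Sser K al * (Sser K)^-1 (l - al)%N) * iter l (@sderiv K) psi
  else 0 else 0.
Proof.
rewrite /Lexp -[vvar K]/(smono 1%N 1) mcoefM_nat; case: j => [|al].
  by rewrite big_ord1 smonoE mul0r.
rewrite big_ord_recl big_ord_recl big1 => [|i _]; last by rewrite smonoE mul0r.
rewrite smonoE mul0r add0r addr0 smonoE mul1r.
rewrite -[(al.+1 - _)%N]/(al.+1 - 1)%N subSS subn0 mcoefB.
rewrite -[S_vhdy _ al]/(smono al (sconst _ (Sser K al)) * smap (iter al (@sderiv K)) (Sinv_hdy psi)).
rewrite [X in X - _](_ : _ = if (al <= l)%N then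
    smono 0%N (Sser K al * (Sser K)^-1 (l - al)%N) * iter l (@sderiv K) psi else 0); last first.
  rewrite mcoefM_nat; case: leqP => h; last first.
    by rewrite big1 // => i _; rewrite smonoE; case: eqP => [e|]; rewrite ?mul0r //; have := ltn_ord i; lia.
  have al' : (al < l.+1)%N by [].
  rewrite (bigD1 (Ordinal al')) // big1 => [|i ne]; last first.
    by rewrite smonoE; case: eqP => [e|]; rewrite ?mul0r //; case/negP: ne; apply/eqP/val_inj.
  rewrite smonoE eqxx [LHS]addr0.
  rewrite -[smap _ _ _]/(iter al (@sderiv K) (smono 0%N ((Sser K)^-1 (l - al)%N) * iter (l - al) (@sderiv K) psi)).
  rewrite rmorphM -mulrA; congr (_ * _); apply: mseriesP => r.
  rewrite mcoefCM !iter_sderiv // mcoefCM !iter_sderiv //.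
  rewrite -!mulrA; congr (_ * _); rewrite -addnA [(al + _)%N]addnC subnK //; congr (_ * _).
  have := qfact qK (r + al); have := qfact qK r => h1 h2; field; rewrite h1 h2 //.
rewrite (_ : vhy_cst psi al l = if (al == 0)%N && (l == 0)%N then psi else 0); last by case: al; case: l.
case: (posnP l) => [->|l0]; last by rewrite andbT andbF subr0.
rewrite andbF leqn0 andbT; case: (eqVneq al 0%N) => [->|_]; last by rewrite subr0.
by rewrite subnn Sser0 // mul1r Sinv0 // rmorph1 mul1r subrr.
Qed.

Lemma Lexp_vbnd : vbnd 0 Lexp.
Proof.
move=> [|j] l lj; rewrite Lexp_coef //; case: ifP => // /andP[h1 h2]; lia.
Qed.

Lemma Lexp0 : Lexp 0%N = 0.
Proof. by apply: mseriesP => l; rewrite Lexp_coef. Qed.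

Lemma spec_Lexp l : spec a Lexp l = if (0 < l)%N then
  smono 0%N (((Sser K)^-1 * Tser a 0) l) * iter l (@sderiv K) psi else 0.
Proof.
rewrite (_ : spec a Lexp l = \sum_(j < l.+2) smono 0%N (a ^+ j) * Lexp j l); last first.
  by apply: specE => -[|j] jl; rewrite Lexp_coef //; case: ifP => // /andP[h1 h2]; lia.
rewrite big_ord_recl Lexp_coef mulr0 add0r.
case: (posnP l) => [l0|l0].
  rewrite big1 // => i _; rewrite Lexp_coef; case: (nat_of_ord _) => [|al]; rewrite ?mulr0 //.
  by rewrite l0 andbF mulr0.
rewrite mulrC [X in smono 0%N X](_ : _ = \sum_(i < l.+1) a ^+ i.+1 * (Sser K i * (Sser K)^-1 (l - i)%N)).
  rewrite rmorph_sum mulr_sumr; apply: eq_bigr => i _; rewrite lift0 Lexp_coef.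
  have -> : (i <= l)%N && (0 < l)%N by rewrite l0 andbT -ltnS.
  by rewrite [RHS]mulrC mulrA; congr (_ * _); rewrite -rmorphM.
by rewrite mulrC mcoefM_nat; apply: eq_bigr => i _; rewrite Tser_S mulrA.
Qed.

(** The series e^(a psi(y)) L_0(a, y, hbar): the exponential factor turns d/dy + a psi' into
    d/dy. *)
Definition phia : hy := smono 0%N (expS (smono 0%N a * psi)) * spec a (L0 psi).

Let hX : mseries nat K := smono 1%N 1.
Let hX0 : hX 0%N = 0. Proof. by []. Qed.
Let cX : mseries nat K := smono 1%N c.
Let cX0 : cX 0%N = 0. Proof. by []. Qed.

Lemma smono1X (M : exponentType) (A : comNzRingType) (m : M) (b : A) k : smono m b ^+ k = smono (m *+ k) (b ^+ k).
Proof.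
elim: k => [|k IH]; first by rewrite !expr0 mulr0n.
by rewrite !exprS IH smonoM mulrS.
Qed.

Lemma natmuln1 k : (1%N : nat) *+ k = k.
Proof. by elim: k => // k IH; rewrite mulrS IH. Qed.

Definition resc := hcomp degN (@smono nat K 0%N) cX0.
HB.instance Definition _ := GRing.RMorphism.on resc.
Lemma resc_coef f N : resc f N = f N * c ^+ N.
Proof.
have tm k : (smono 0%N (f k) * cX ^+ k) N = if N == k then f k * c ^+ k else 0.
  by rewrite mcoefCM smono1X natmuln1 smonoE; case: eqP; rewrite ?mulr0.
rewrite /resc (@hcompE _ _ _ _ _ _ _ _ _ N.+1) // mcoef_sum.
rewrite (eq_bigr (fun k : 'I_N.+1 => if N == k then f k * c ^+ k else 0)) => [|k _]; last exact: tm.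
rewrite (bigD1 ord_max) //= eqxx big1 ?addr0 // => k kN; case: eqP => // e.
by case/negP: kN; apply/eqP/val_inj.
Qed.

(** The substitution y = c hbar. *)
Definition sig := hcomp degN resc hX0.
HB.instance Definition _ := GRing.RMorphism.on sig.

Lemma sig_coef (f : hy) N : sig f N = \sum_(k < N.+1) f k (N - k)%N * c ^+ (N - k).
Proof.
rewrite /sig (@hcompE _ _ _ _ _ _ _ _ _ N.+1) // mcoef_sum; apply: eq_bigr => k _.
rewrite mulrC smono1X natmuln1 expr1n mcoefM_nat.
rewrite (bigD1 k) // big1 => [|i ik]; first by rewrite smonoE eqxx mul1r [LHS]addr0 resc_coef.
by rewrite smonoE; case: eqP => [e|]; rewrite ?mul0r //; case/negP: ik; apply/eqP/val_inj.
Qed.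

Lemma resc_expS (f : mseries nat K) : f 0%N = 0 -> resc (expS f) = expS (resc f).
Proof. by move=> f0; exact: (hcomp_expS degN _ cX0 qK f0). Qed.

Lemma sig_expS (f : hy) : f 0%N = 0 -> sig (expS f) = expS (sig f).
Proof. by move=> f0; apply: (hcomp_expS degN _ hX0 _ f0); exact: qalg_mseries. Qed.

Lemma sig_const z : sig (smono 0%N z) = resc z.
Proof. by rewrite /sig hcomp_smono expr0 mulr1. Qed.

(** On the Taylor coefficients of psi at y = c hbar, the quotient S(a hbar d/dy) / S(hbar d/dy) acts
    as in [Pgf a c]. Thus L_0 encodes the content products of Z. *)
Lemma Phi_phia : sig phia = Phi psi a c.
Proof.
have ap0 : (smono 0%N a * psi) 0%N = 0 by rewrite mcoefCM psi0 mulr0.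
have qh : qalg (mseries nat K) by exact: qalg_mseries.
have sL0 : spec a Lexp 0%N = 0 by rewrite spec_Lexp.
rewrite /phia rmorphM /= -[L0 psi]/(expS Lexp) (spec_expS _ Lexp0 Lexp_vbnd sL0) //.
have e1 : resc (smono 0%N a * psi) 0%N = 0 by rewrite resc_coef mcoefCM psi0 mulr0 mul0r.
have e2 : sig (spec a Lexp) 0%N = 0 by rewrite sig_coef big_ord1 sL0 mul0r.
rewrite sig_const (resc_expS ap0) (sig_expS sL0) -(expSD degN qK e1 e2).
rewrite /Phi; congr expS; apply: mseriesP => N.
set G := (Sser K)^-1 * Tser a 0.
have PE : Pgf a c = G * Eser c by rewrite /Pgf TserE // mulrCA mulrC.
rewrite mcoefD resc_coef sig_coef mcoefCM -[RHS]/(psi N * (N`!%:R * Pgf a c N)) PE mcoefM_nat.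
have g0 : G 0%N = a.
  by rewrite /G mcoefM_nat big_ord1 subnn Tser_S // Sser0 // Sinv0 // mul1r mulr1 expr1.
rewrite big_ord_recl -[spec a Lexp (nat_of_ord ord0)]/(spec a Lexp 0%N) sL0 mcoef0 mul0r add0r big_ord_recl.
rewrite -[G (nat_of_ord ord0)]/(G 0%N) -[nat_of_ord ord0]/0%N subn0 g0 !mulrDr.
congr (_ + _).
  rewrite -[Eser c N]/(c ^+ N / N`!%:R); have := qfact qK N.
  by move: (N`!%:R : K) (c ^+ N) => u v h; field.
rewrite !mulr_sumr; apply: eq_bigr => k _; rewrite lift0 spec_Lexp -[(0 < k.+1)%N]/true mcoefCM iter_sderiv //.
have kN : (k.+1 <= N)%N by exact: ltn_ord.
rewrite subnK // -[Eser c _]/(c ^+ (N - k.+1) / (N - k.+1)`!%:R) -/G.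
have := qfact qK (N - k.+1); move: ((N - k.+1)`!%:R : K) (N`!%:R : K) (c ^+ (N - k.+1)) => u v z h.
by field.
Qed.

End PhiExpansion.

Lemma sum_supp (V : zmodType) (I : eqType) (G : I -> V) (r1 r2 : seq I) : uniq r1 -> uniq r2 ->
  (forall x, G x != 0 -> (x \in r1) && (x \in r2)) ->
  \sum_(x <- r1) G x = \sum_(x <- r2) G x.
Proof.
move=> u1 u2 h; have red r : \sum_(x <- r) G x = \sum_(x <- [seq x <- r | G x != 0]) G x.
  rewrite big_filter [RHS]big_mkcond; apply: eq_bigr => x _.
  by case: eqP => // ->.
rewrite red [RHS]red; apply: perm_big; apply: uniq_perm; rewrite ?filter_uniq //.
move=> x; rewrite !mem_filter; case: eqP => //= /eqP/h/andP[-> ->] //.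
Qed.

(** * A functional on series in the u_i, multiplicative over variables *)

Section Functional.
Variables (K : fieldType) (qK : qalg K) (n : nat) (wt : 'I_n -> nat -> mseries nat K).
Hypothesis wt_bnd : forall i r N, (N.+1 < r)%N -> wt i r N = 0.
Local Notation ex := {ffun 'I_n -> nat}.
Local Notation zs := (zser K n).
Implicit Types (S : {set 'I_n}) (f g : zs) (r d : ex).

Definition boxl (B : nat) : seq ex :=
  [seq [ffun i => nat_of_ord (h i)] | h : {ffun 'I_n -> 'I_B} <- enum {ffun 'I_n -> 'I_B}].

Lemma boxl_uniq B : uniq (boxl B).
Proof.
rewrite map_inj_uniq ?enum_uniq // => h h' /ffunP e; apply/ffunP => i; apply: val_inj.
by have := e i; rewrite !ffunE.
Qed.

Lemma mem_boxl B r : (forall i, r i < B)%N -> r \in boxl B.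
Proof.
move=> rB; apply/mapP; exists [ffun i => Ordinal (rB i)]; first by rewrite mem_enum.
by apply/ffunP => i; rewrite !ffunE.
Qed.

(** Variables outside S are set to 0. *)
Definition wprod S r : mseries nat K :=
  \prod_i (if i \in S then wt i (r i) else (r i == 0%N)%:R).

Lemma wprod_bnd S r N : wprod S r N != 0 -> forall i, (r i <= N.+1)%N.
Proof.
move=> nz i; rewrite leqNgt; apply: contra nz => h; apply/eqP.
have -> : wprod S r = (if i \in S then wt i (r i) else (r i == 0%N)%:R) *
    \prod_(j | j != i) (if j \in S then wt j (r j) else (r j == 0%N)%:R) by rewrite /wprod (bigD1 i).
rewrite mcoefM_nat big1 // => k _.
have kN : (k <= N)%N by rewrite -ltnS.
suff -> : (if i \in S then wt i (r i) else (r i == 0%N)%:R) k = 0 by rewrite mul0r.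
case: ifP => _; first by apply: wt_bnd; lia.
by rewrite (_ : (r i == 0)%N = false) ?mcoef0 //; apply/negbTE; rewrite -lt0n; lia.
Qed.

(** Linear, with value [wprod S r] on the monomial of exponent r; [wt_bnd] leaves finitely many
    exponents at each power of hbar. *)
Definition T0 S f : mseries nat K := csum (fun r => smono 0%N (f r) * wprod S r).

Lemma T0E S f N B : (N.+1 < B)%N -> T0 S f N = \sum_(r <- boxl B) f r * wprod S r N.
Proof.
move=> NB; rewrite (csum_seq (boxl_uniq B)) => [|r rB].
  by apply: eq_bigr => r _; rewrite mcoefCM.
rewrite mcoefCM; have [->|nz] := eqVneq (wprod S r N) 0; first by rewrite mulr0.
case/negP: rB; apply: mem_boxl => i; have := wprod_bnd nz i; lia.
Qed.

Lemma T0B S : zmod_morphism (T0 S).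
Proof.
move=> f g; apply: mseriesP => N; rewrite mcoefB !(@T0E _ _ _ N.+2) // -sumrB.
by apply: eq_bigr => r _; rewrite mcoefB mulrBl.
Qed.
HB.instance Definition _ S := GRing.isZmodMorphism.Build zs (mseries nat K) (T0 S) (T0B S).

Definition dep S f := forall r i, i \notin S -> r i != 0%N -> f r = 0.

Lemma wprodM S S' r r' : [disjoint S & S']%B -> (forall i, i \notin S -> r i = 0%N) ->
  (forall i, i \notin S' -> r' i = 0%N) ->
  wprod S r * wprod S' r' = wprod (S :|: S') (r + r').
Proof.
move=> dS r0 r0'; rewrite /wprod -big_split; apply: eq_bigr => i _ /=.
rewrite finset.in_setU ffunE -[(r i + r' i)%R]/(r i + r' i)%N.
have [iS|iS] := boolP (i \in S) => /=.
  have iS' : i \notin S' by rewrite (disjointFr dS).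
  by rewrite (negbTE iS') r0' // eqxx mulr1 addn0.
by rewrite r0 // eqxx mul1r add0n.
Qed.

Lemma T0M S S' f g : [disjoint S & S']%B -> dep S f -> dep S' g ->
  T0 (S :|: S') (f * g) = T0 S f * T0 S' g.
Proof.
move=> dS df dg; apply: mseriesP => N; pose L := boxl N.+2.
pose F (d : ex * ex) := f d.1 * g d.2 * wprod (S :|: S') (d.1 + d.2) N.
transitivity (\sum_(d <- [seq e | r <- L, e <- splits r]) F d).
  rewrite (@T0E _ _ _ N.+2) // big_allpairs_dep; apply: eq_bigr => r _.
  rewrite mcoefM mulr_suml big_seq [RHS]big_seq; apply: eq_bigr => d.
  by rewrite mem_splits /F => /eqP ->.
have uP1 : uniq [seq e | r <- L, e <- splits r].
  apply: allpairs_uniq_dep; [exact: boxl_uniq|by move=> *; exact: splits_uniq|].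
  move=> p q /allpairsPdep[r1 [d1 [_ s1 ->]]] /allpairsPdep[r2 [d2 [_ s2 ->]]] /= e.
  by move: s1 s2; rewrite -e !mem_splits => /eqP <- /eqP <-.
have uP2 : uniq [seq (r, r') | r <- L, r' <- L].
  by apply: allpairs_uniq; rewrite ?boxl_uniq // => -[? ?] [? ?].
rewrite (@sum_supp _ _ F _ _ uP1 uP2) => [|[d1 d2]]; last first.
  rewrite /F /= => nz; have {}nz : wprod (S :|: S') (d1 + d2) N != 0.
    by apply: contra nz => /eqP ->; rewrite mulr0.
  have b := wprod_bnd nz; apply/andP; split.
    apply/allpairsPdep; exists (d1 + d2), (d1, d2); rewrite mem_splits eqxx; split=> //.
    by apply: mem_boxl => i; rewrite ltnS.
  have b' i : (d1 i + d2 i <= N.+1)%N by have := b i; rewrite ffunE.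
  apply/allpairsPdep; exists d1, d2; split=> //; apply: mem_boxl => i;
    by rewrite ltnS (leq_trans _ (b' i)) ?leq_addr ?leq_addl.
rewrite big_allpairs_dep mcoefM_nat.
transitivity (\sum_(k < N.+1) \sum_(r <- L) \sum_(r' <- L)
    (f r * wprod S r k) * (g r' * wprod S' r' (N - k)%N)).
  rewrite [RHS]exchange_big; apply: eq_bigr => r _; rewrite [RHS]exchange_big; apply: eq_bigr => r' _.
  rewrite /F /=; have [->|fr] := eqVneq (f r) 0.
    by rewrite !mul0r big1 // => k _; rewrite !mul0r.
  have [->|gr] := eqVneq (g r') 0.
    by rewrite mulr0 mul0r big1 // => k _; rewrite mul0r mulr0.
  rewrite -wprodM //; last 2 first.
  - by move=> i iS; apply/eqP; apply: contraNT fr => ri; apply/eqP; exact: (df r i).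
  - by move=> i iS; apply/eqP; apply: contraNT gr => ri; apply/eqP; exact: (dg r' i).
  by rewrite mcoefM_nat mulr_sumr; apply: eq_bigr => k _; rewrite mulrACA.
apply: eq_bigr => k _; have kN : (k <= N)%N by rewrite -ltnS.
by rewrite !(@T0E _ _ _ N.+2) ?big_distrlr //; lia.
Qed.

Lemma T0_set0 a : T0 finset.set0 (smono 0 a) = smono 0%N a.
Proof.
apply: mseriesP => N; rewrite (@T0E _ _ _ N.+2) // (bigD1_seq 0) ?boxl_uniq //=; last first.
  by apply: mem_boxl => i; rewrite ffunE.
rewrite eqxx big1 ?addr0 => [|r r0]; last by rewrite (negbTE r0) mul0r.
rewrite /wprod big1 => [|i _]; last by rewrite finset.in_set0 ffunE eqxx.
by rewrite mcoef1; case: (N == 0)%N; rewrite ?mulr1 ?mulr0.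
Qed.

(* Extraction of q^p as multiplication by hbar^-p. *)
Definition TL S (f : {poly zs}) : laurent K :=
  \sum_(p < size f) lmono (- p%:Z) 1 * lser (T0 S f`_p).

Lemma TLE S (f : {poly zs}) N : (size f <= N)%N -> TL S f = \sum_(p < N) lmono (- p%:Z) 1 * lser (T0 S f`_p).
Proof.
move=> fN; rewrite /TL (big_ord_widen N (fun p => lmono (- p%:Z) 1 * lser (T0 S f`_p))) //.
rewrite big_mkcond; apply: eq_bigr => p _; case: ltnP => // h.
by rewrite nth_default // !raddf0 mulr0.
Qed.

Lemma TLB S : zmod_morphism (TL S).
Proof.
move=> f g; pose N := maxn (size f) (size g).
rewrite !(@TLE _ _ N) ?leq_maxl ?leq_maxr //; last first.
  by rewrite (leq_trans (size_polyD _ _)) // size_polyN.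
by rewrite -sumrB; apply: eq_bigr => p _; rewrite coefB !raddfB mulrBr.
Qed.
HB.instance Definition _ S := GRing.isZmodMorphism.Build {poly zs} (laurent K) (TL S) (TLB S).

Lemma TL_sum S I (r : seq I) (P : pred I) (F : I -> {poly zs}) :
  TL S (\sum_(i <- r | P i) F i) = \sum_(i <- r | P i) TL S (F i).
Proof. exact: raddf_sum. Qed.

Lemma TL_mono S c k : TL S (c *: 'X^k) = lmono (- k%:Z) 1 * lser (T0 S c).
Proof.
rewrite (@TLE _ _ k.+1); last by rewrite (leq_trans (size_scale_leq _ _)) // size_polyXn.
rewrite big_ord_recr /= big1 => [|p _]; first by rewrite add0r coefZ coefXn eqxx mulr1.
rewrite coefZ coefXn; case: eqP => [e|_]; first by have := ltn_ord p; rewrite e ltnn.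
by rewrite mulr0 !raddf0 mulr0.
Qed.

Lemma TLC S c : TL S c%:P = lser (T0 S c).
Proof. by have := TL_mono S c 0; rewrite expr0 alg_polyC oppr0 mul1r. Qed.

Definition depP S (f : {poly zs}) := forall p, dep S f`_p.

Lemma TLM S S' (f g : {poly zs}) : [disjoint S & S']%B -> depP S f -> depP S' g ->
  TL (S :|: S') (f * g) = TL S f * TL S' g.
Proof.
move=> dS df dg.
rewrite -{1}[f]coefK -{1}[g]coefK !poly_def big_distrlr /= raddf_sum /TL big_distrlr.
apply: eq_bigr => i _; rewrite raddf_sum; apply: eq_bigr => j _ /=.
rewrite -scalerAl -scalerAr -exprD scalerA TL_mono T0M //.
by rewrite (rmorphM (@lser K)) [RHS]mulrACA lmonoM mulr1 -opprD -PoszD.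
Qed.

Lemma dep0 S : dep S 0. Proof. by move=> r i _ _. Qed.
Lemma depB S f g : dep S f -> dep S g -> dep S (f - g).
Proof. by move=> hf hg r i iS ri; rewrite mcoefB (hf r i) // (hg r i) // subrr. Qed.
Lemma depM S f g : dep S f -> dep S g -> dep S (f * g).
Proof.
move=> hf hg r i iS ri; rewrite mcoefM big_seq big1 // => -[a b]; rewrite mem_splits /= => /eqP e.
have [a0|a0] := eqVneq (a i) 0%N; last by rewrite (hf a i) // mul0r.
rewrite [g b](hg b i) ?mulr0 //; apply: contra ri => /eqP b0.
by rewrite -e ffunE a0 b0.
Qed.
Lemma depW S S' f : S \subset S' -> dep S f -> dep S' f.
Proof.
move=> sS hf r i iS ri; apply: (hf r i) => //; apply: contra iS => iS.
exact: (fintype.subsetP sS).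
Qed.
Lemma depC S a : dep S (smono 0 a).
Proof. by move=> r i _ ri; rewrite smonoE; case: eqP => // e; rewrite e ffunE in ri. Qed.

Lemma dep1 S : dep S 1.
Proof. by rewrite -(rmorph1 (@smono ex K 0)); exact: depC. Qed.
Lemma depD S f g : dep S f -> dep S g -> dep S (f + g).
Proof. by move=> hf hg r i iS ri; rewrite mcoefD (hf r i) // (hg r i) // addr0. Qed.

Lemma natV_poly k : (k.+1%:R : {poly zs})^-1 = (smono 0 (k.+1%:R)^-1)%:P.
Proof.
have e : k.+1%:R * (smono 0 (k.+1%:R)^-1)%:P = 1 :> {poly zs}.
  rewrite -[k.+1%:R](rmorph_nat (@polyC zs)) -rmorphM -[k.+1%:R](rmorph_nat (@smono ex K 0)).
  by rewrite -rmorphM divff ?qnat_neq0 // !rmorph1.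
have u : (k.+1%:R : {poly zs}) \is a GRing.unit by apply/unitrPr; exists (smono 0 (k.+1%:R)^-1)%:P.
by apply: (mulrI u); rewrite divrr.
Qed.

Lemma depPC S c : dep S c -> depP S c%:P.
Proof. by move=> hc p; rewrite coefC; case: (p == 0)%N => //; exact: dep0. Qed.

Lemma depP_sub S : csub (depP S).
Proof.
split.
- by apply: depPC; exact: dep1.
- by move=> x y hx hy p; rewrite coefB; exact: depB.
- move=> x y hx hy p; rewrite coefM; elim/big_ind : _; [exact: dep0|exact: depD|].
  by move=> i _; exact: depM.
- by move=> k; rewrite natV_poly; apply: depPC; exact: depC.
Qed.

Lemma depPX S : depP S 'X.
Proof. by move=> p; rewrite coefX; case: (p == 1)%N; [exact: dep1|exact: dep0]. Qed.

Lemma depPW S S' (f : {poly zs}) : S \subset S' -> depP S f -> depP S' f.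
Proof. by move=> sS hf p; exact: depW (hf p). Qed.

End Functional.

Section Variables_z.
Variables (K : fieldType) (n : nat).
Local Notation ex := {ffun 'I_n -> nat}.
Implicit Type i : 'I_n.

Lemma dexpE i k (a : nat) : (dexp i *+ a) k = if k == i then a else 0%N.
Proof. by rewrite ffunMnE ffunE; case: eqP => _; [exact: natmuln1|rewrite mul0rn]. Qed.

Lemma dexp1E i k : dexp i k = if k == i then 1%N else 0%N.
Proof. by rewrite ffunE; case: eqP. Qed.

Lemma zvar0 i : zvar K i 0 = 0.
Proof.
rewrite smonoE; case: eqP => // /ffunP/(_ i); rewrite dexp1E eqxx ffunE //.
Qed.

Lemma at_zE i f : at_z i f = hcomp (degF 'I_n) (@smono ex K 0) (zvar0 i) f.
Proof. exact: scomp_hcomp. Qed.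

Lemma at_z_zmod i : zmod_morphism (@at_z K n i).
Proof. by move=> f g; rewrite !at_zE rmorphB. Qed.
HB.instance Definition _ i := GRing.isZmodMorphism.Build (mseries nat K) (zser K n)
  (@at_z K n i) (at_z_zmod i).
Lemma at_z_monoid i : monoid_morphism (@at_z K n i).
Proof. by split=> [|f g]; rewrite !at_zE ?rmorph1 ?rmorphM. Qed.
HB.instance Definition _ i := GRing.isMonoidMorphism.Build (mseries nat K) (zser K n)
  (@at_z K n i) (at_z_monoid i).

Lemma at_z_coef i (f : mseries nat K) (r : ex) : at_z i f r = if r == dexp i *+ r i then f (r i) else 0.
Proof.
have tm k : (sconst ex (f k) * zvar K i ^+ k) r = if r == dexp i *+ k then f k else 0.
  by rewrite /zvar smono1X expr1n /sconst smonoM add0r mulr1 smonoE.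
rewrite /at_z /scomp (@csum1 _ _ _ _ (r i)) ?tm // => k kr; rewrite tm.
case: eqP => // e; case/negP: kr; rewrite e dexpE eqxx //.
Qed.

Lemma at_z_coefX i (f : mseries nat K) k : at_z i f (dexp i *+ k) = f k.
Proof. by rewrite at_z_coef dexpE !eqxx. Qed.

Lemma dep_at_z i (f : mseries nat K) : dep [set i]%SET (at_z i f).
Proof.
move=> r j; rewrite finset.in_set1 => ji rj; rewrite at_z_coef; case: eqP => // e.
by move: rj; rewrite e dexpE (negbTE ji).
Qed.

Variable wt : 'I_n -> nat -> mseries nat K.
Hypothesis wt_bnd : forall i r N, (N.+1 < r)%N -> wt i r N = 0.

Lemma T0_at_z i f N : T0 wt [set i]%SET (at_z i f) N = \sum_(k < N.+2) f k * wt i k N.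
Proof.
have wE k : wprod wt [set i]%SET (dexp i *+ k) = wt i k.
  rewrite /wprod (bigD1 i) //= finset.in_set1 eqxx dexpE eqxx big1 ?mulr1 // => j ji.
  by rewrite finset.in_set1 (negbTE ji) dexpE (negbTE ji) eqxx.
rewrite /T0 (@csum_seq _ _ _ _ _ [seq dexp i *+ k | k <- iota 0 N.+2]) => [||r rn].
- rewrite big_map -[iota 0 N.+2]/(index_iota 0 N.+2) big_mkord; apply: eq_bigr => k _.
  by rewrite mcoefCM at_z_coefX wE.
- rewrite map_inj_uniq ?iota_uniq // => a b /ffunP/(_ i).
  by rewrite !dexpE eqxx.
rewrite mcoefCM at_z_coef; case: eqP => [e|]; last by rewrite mul0r.
rewrite e wE wt_bnd ?mulr0 // ltnNge; apply: contra rn => h; rewrite e; apply/mapP.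
by exists (r i) => //; rewrite mem_iota add0n ltnS.
Qed.

End Variables_z.

(** The exponential e^(c u_i): in this part the variables of [zser] play the role of the u_i, and
    the polynomial variable is q. *)
HB.lock Definition ez (K : fieldType) (n : nat) (i : 'I_n) (c : K) : {poly (zser K n)} :=
  (at_z i (Eser c))%:P.

(** * Heisenberg relations under the functional *)

Section FockFunctional.
Variables (K : closedFieldType) (qK : qalg K) (n : nat) (psi y : mseries nat K) (a : 'I_n -> int).
Hypotheses (psi0 : psi 0%N = 0).
Local Notation ex := {ffun 'I_n -> nat}.
Local Notation L := {poly (zser K n)}.
Implicit Types (i x z : 'I_n) (S : {set 'I_n}) (c d : K).
Local Notation ai i := ((a i)%:~R : K).

Lemma qalgL : qalg L.
Proof.
have q1 : qalg (zser K n) by exact: qalg_mseries.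
move=> k; rewrite -(rmorph_nat (@polyC (zser K n))); apply: rmorph_unit; exact: q1.
Qed.

(* The functional sends u^r / r! to the r-th derivative of phia at y = 0, after division by u S(u). *)
Definition wtT (i : 'I_n) (r : nat) : mseries nat K :=
  MSeries (fun N => \sum_(r0 < N.+1) (r0`!%:R * phia psi (ai i) (N - r0)%N r0) *
    (if (r <= r0.+1)%N then (Sser K)^-1 (r0.+1 - r)%N else 0)).

Lemma wtT_bnd i r N : (N.+1 < r)%N -> wtT i r N = 0.
Proof.
move=> Nr; rewrite -[LHS]/(\sum_(r0 < N.+1) _) big1 // => r0 _.
by rewrite leqNgt (leq_trans _ Nr) ?mulr0 // ltnS; exact: ltn_ord.
Qed.

Local Notation TL := (TL wtT).
Local Notation TLM := (@TLM K n wtT wtT_bnd).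

Definition gz i : L := ez i 2^-1.

Lemma ezD i c d : ez i (c + d) = ez i c * ez i d.
Proof. by rewrite ez.unlock EserD // !rmorphM. Qed.
Lemma ez0 i : ez i (0 : K) = 1. Proof. by rewrite ez.unlock Eser0 !rmorph1. Qed.
Lemma ezNK i c : ez i c * ez i (- c) = 1. Proof. by rewrite -ezD subrr ez0. Qed.
Lemma ez_unit i c : ez i c \is a GRing.unit.
Proof. by apply/unitrPr; exists (ez i (- c)); exact: ezNK. Qed.
Lemma ezV i c : (ez i c)^-1 = ez i (- c).
Proof. by apply: (mulrI (ez_unit i c)); rewrite divrr ?ez_unit // ezNK. Qed.
Lemma ezX i c k : ez i c ^+ k = ez i (c * k%:R).
Proof.
elim: k => [|k IH]; first by rewrite mulr0 ez0.
by rewrite exprS IH -ezD -natr1 mulrDr mulr1 addrC.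
Qed.
Lemma ezZ i c (e : int) : ez i c ^ e = ez i (c * e%:~R).
Proof.
case: e => k; first by rewrite -exprnP ezX.
by rewrite NegzE -exprnN ezX ezV rmorphN /= mulrN.
Qed.
Lemma dep_ez i c : depP [set i]%SET (ez i c).
Proof. by rewrite ez.unlock; apply: depPC; exact: dep_at_z. Qed.

Lemma kap_gz i k : kap (gz i) k = ez i (k%:R / 2) - ez i (- (k%:R / 2)).
Proof. by rewrite /kap ezV !ezX mulrC [- 2^-1 * _]mulrC mulrN. Qed.

Lemma kap_gzE i c : kap (gz i) 1 * ez i c = (at_z i (Xs K * (Sser K * Eser c)))%:P.
Proof.
have e : Xs K * Sser K = Eser (1 / 2) - Eser (- (1 / 2)).
  have -> : Sser K = Tser 1 0 by apply: mseriesP => k; rewrite Tser_S expr1n mul1r.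
  by rewrite Tser_Eser !add0r.
by rewrite kap_gz ez.unlock mulrA e rmorphM rmorphM rmorphB rmorphB.
Qed.

Lemma dep_kap i k : depP [set i]%SET (kap (gz i) k).
Proof. by rewrite kap_gz; apply: (csubB (depP_sub qK _)); exact: dep_ez. Qed.

Lemma dep_kapW i S k : i \in S -> depP S (kap (gz i) k).
Proof.
move=> iS p r j jS rj; have h : depP [set i]%SET (kap (gz i) k) by exact: dep_kap.
apply: (h p r j) => //.
by rewrite finset.in_set1; apply: contra jS => /eqP ->.
Qed.

(** The factor [kap (gz i) 1] is u S(u) and undoes the division in the functional; what remains is
    the Taylor series of [phia] at 0, summed at y = c hbar. *)
Lemma TL_kap i c : TL [set i]%SET (kap (gz i) 1 * ez i c) = lser (Phi psi (ai i) c).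
Proof.
rewrite kap_gzE (TLC wtT_bnd); apply: (congr1 (@lser K)); apply: mseriesP => N; rewrite (T0_at_z wtT_bnd) -Phi_phia // sig_coef.
pose h := Xs K * (Sser K * Eser c).
have hS : h * (Sser K)^-1 = Xs K * Eser c.
  by rewrite /h -mulrA mulrAC divrr ?mul1r // Sser_unit.
transitivity (\sum_(r0 < N.+1) (r0`!%:R * phia psi (ai i) (N - r0)%N r0) * (h * (Sser K)^-1) r0.+1).
  rewrite -/h; under eq_bigr => k _ do rewrite mulr_sumr.
  rewrite exchange_big; apply: eq_bigr => r0 _; rewrite mcoefM_nat mulr_sumr.
  have r0N : (r0.+2 <= N.+2)%N by rewrite !ltnS; exact: (ltn_ord r0).
  rewrite (big_ord_widen N.+2 (fun k => r0`!%:R * phia psi (ai i) (N - r0)%N r0 * (h k * (Sser K)^-1 (r0.+1 - k)%N))) //.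
  rewrite [RHS]big_mkcond; apply: eq_bigr => k _; rewrite ltnS; case: leqP => _; rewrite ?mulr0 //.
  by rewrite mulrCA.
rewrite (reindex_inj rev_ord_inj); apply: eq_bigr => k _; rewrite hS mcoefXs.
rewrite -[nat_of_ord (rev_ord k)]/(N.+1 - k.+1)%N subSS; have kN : (k <= N)%N by rewrite -ltnS.
rewrite subKn // -[Eser c _]/(c ^+ (N - k) / (N - k)`!%:R).
have := qfact qK (N - k); move: ((N - k)`!%:R : K) (phia psi _ _ _) (c ^+ _) => u v w h0; field.
exact: h0.
Qed.

Lemma TL_step i S c X : i \notin S -> depP S X ->
  TL (i |: S)%SET (kap (gz i) 1 * ez i c * X) = lser (Phi psi (ai i) c) * TL S X.
Proof.
move=> iS dX; rewrite TLM ?TL_kap //; last first.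
  by apply: (csubM (depP_sub qK _)); [exact: dep_kap|exact: dep_ez].
by rewrite disjoints1.
Qed.

Lemma TL_step2 x z S c d X : x != z -> x \notin S -> z \notin S -> depP S X ->
  TL (x |: (z |: S))%SET (kap (gz x) 1 * kap (gz z) 1 * (ez x c * ez z d) * X) =
  lser (Phi psi (ai x) c * Phi psi (ai z) d) * TL S X.
Proof.
move=> xz xS zS dX; have -> : kap (gz x) 1 * kap (gz z) 1 * (ez x c * ez z d) * X =
    kap (gz x) 1 * ez x c * (kap (gz z) 1 * ez z d * X).
  by move: (kap (gz x) 1) (kap (gz z) 1) (ez x c) (ez z d) => u v u' v'; ring.
rewrite TL_step.
- by rewrite TL_step // rmorphM mulrA.
- by rewrite !inE negb_or xz.
have cS := depP_sub qK (z |: S)%SET; apply: (csubM cS); last first.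
  by apply: depPW dX; exact: finset.subsetUr.
by apply: (csubM cS); apply: depPW (finset.subsetUl _ _) _; [exact: dep_kap|exact: dep_ez].
Qed.

(** The times t_k = s_k / hbar of the second Schur function in Z, with q for 1 / hbar. *)
Definition tt (k : nat) : L := 'X * (smono 0 (y k))%:P.

Lemma dep_tt S k : depP S (tt k).
Proof.
by apply: (csubM (depP_sub qK _)); [exact: depPX|apply: depPC; exact: depC].
Qed.

Lemma pf_eval (P : L -> Prop) v t : csub P -> pf P v -> (forall k, P (t k)) -> P (v t).
Proof.
move=> cP pv Pt; elim: pv => [b //|//|v1 v2 _ h1 _ h2|v1 v2 _ h1 _ h2].
- exact: (csubD cP).
- exact: (csubM cP).
Qed.

Definition lett i : int * (nat -> L) := (a i, kap (gz i)).
Definition wordS (s : seq 'I_n) S := word [seq lett i | i <- s & i \in S] (fun=> 1).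
(** The moments: letters outside S are deleted and the order of s is kept. *)
Definition MM s S : laurent K := TL S (wordS s S tt).

Lemma pf_wordS s S : pf (depP S) (wordS s S).
Proof.
apply: (pf_word qalgL (depP_sub qK _)); last by apply: pfC; exact: (csub1 (depP_sub qK _)).
move=> l; elim: s => //= i s IH; case: ifP => //= iS [<-|//] k /=.
exact: dep_kapW.
Qed.

Lemma dep_wordS s S : depP S (wordS s S tt).
Proof. by apply: (pf_eval (depP_sub qK _) (pf_wordS s S)) => k; exact: dep_tt. Qed.

Lemma MM0 s : MM s finset.set0 = 1.
Proof.
rewrite /MM /wordS (_ : [seq i <- s | i \in finset.set0] = [::]); last first.
  by elim: s => //= i s ->; rewrite finset.in_set0.
rewrite -[word _ _ _]/(1 : L) (_ : (1 : L) = (smono 0 1)%:P); last by rewrite !rmorph1.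
rewrite (TLC wtT_bnd) (T0_set0 wtT_bnd).
by rewrite -[smono 0%N 1]/(1 : mseries nat K) rmorph1.
Qed.

Section Pair.
Variables (x z : 'I_n) (S' : {set 'I_n}).
Hypotheses (xz : x != z) (xS : x \notin S') (zS : z \notin S').

Definition cz (c : K) : L := ez x c * ez z c.
Lemma czD c d : cz (c + d) = cz c * cz d.
Proof. by rewrite /cz !ezD; move: (ez x c) (ez z c) (ez x d) (ez z d) => u v u' v'; ring. Qed.
Lemma cz0 : cz 0 = 1. Proof. by rewrite /cz !ez0 mulr1. Qed.

(** Coefficients that arise when the letters x and z fuse: they contain u_x and u_z only through
    exponentials of u_x + u_z, where the cocycle rule applies. *)
Definition Pc (X : L) := exists2 l : seq (L * K),
  (forall p, p \in l -> depP S' p.1) & X = \sum_(p <- l) p.1 * cz p.2.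

Lemma Pc_dep X : depP S' X -> Pc X.
Proof.
move=> dX; exists [:: (X, 0)]; first by move=> p; rewrite inE => /eqP ->.
by rewrite big_seq1 cz0 mulr1.
Qed.

Lemma Pc_cz c : Pc (cz c).
Proof.
exists [:: (1, c)]; last by rewrite big_seq1 mul1r.
by move=> p; rewrite inE => /eqP ->; exact: (csub1 (depP_sub qK _)).
Qed.

Lemma Pc_sub : csub Pc.
Proof.
split.
- by apply: Pc_dep; exact: (csub1 (depP_sub qK _)).
- move=> X Y [l hl ->] [l' hl' ->]; exists (l ++ [seq (- p.1, p.2) | p <- l']).
    move=> p; rewrite mem_cat => /orP[/hl //|/mapP[q ql ->]] /=.
    exact/(csubN (depP_sub qK _))/hl'.
  by rewrite big_cat big_map -sumrN /=; congr (_ + _); apply: eq_bigr => p _; rewrite mulNr.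
- move=> X Y [l hl ->] [l' hl' ->]; exists [seq (p.1 * q.1, p.2 + q.2) | p <- l, q <- l'].
    move=> p /allpairsP[[u v] [/= ul vl ->]] /=.
    by apply: (csubM (depP_sub qK _)); [exact: hl|exact: hl'].
  rewrite big_allpairs_dep mulr_suml; apply: eq_bigr => p _; rewrite mulr_sumr.
  by apply: eq_bigr => q _; rewrite czD mulrACA.
- by move=> k; apply: Pc_dep; exact: (csubV (depP_sub qK _)).
Qed.

Definition k0 : L := cz 2^-1 - cz (- 2^-1).
(** The quotient of [kap (gz x * gz z) k] by [k0], written as k exponentials; [kdz] continues it to
    an odd function on the integers. *)
Definition kd (k : nat) : L := \sum_(j < k) cz (k%:R / 2 - j%:R - 2^-1).
Definition kdz (m : int) : L := if m is Posz k then kd k else if m is Negz k then - kd k.+1 else 0.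

Lemma k0_kd k : k0 * kd k = cz (k%:R / 2) - cz (- (k%:R / 2)).
Proof.
rewrite /kd mulr_sumr.
have t2 := two_neq0 qK.
transitivity (\sum_(0 <= j < k) (- cz (k%:R / 2 - j.+1%:R) - - cz (k%:R / 2 - j%:R))).
  rewrite big_mkord; apply: eq_bigr => j _; rewrite /k0 mulrBl -!czD opprK addrC.
  by congr (- cz _ + cz _); rewrite -?natr1; field.
rewrite telescope_sumr // subr0 opprK addrC; congr (_ - _).
by congr cz; field.
Qed.

Lemma k0_kdz m : k0 * kdz m = cz (m%:~R / 2) - cz (- (m%:~R / 2)).
Proof.
case: m => k; first exact: k0_kd.
by rewrite /kdz mulrN k0_kd opprB NegzE rmorphN /= mulNr opprK.
Qed.

Lemma kap_cz k : kap (gz x * gz z) k = k0 * kd k.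
Proof.
rewrite k0_kd /kap; have -> : gz x * gz z = cz 2^-1 by [].
have -> : (cz 2^-1)^-1 = cz (- 2^-1).
  have u : cz 2^-1 \is a GRing.unit by rewrite /cz unitrM !ez_unit.
  by apply: (mulrI u); rewrite divrr // -czD subrr cz0.
have czX c : cz c ^+ k = cz (c * k%:R) by rewrite /cz exprMn !ezX.
by rewrite !czX mulNr mulrC.
Qed.

(** Otherwise e^(u_x) would equal e^(-u_z), and the coefficient of u_x separates them. *)
Lemma k0_neq0 : k0 != 0.
Proof.
apply/eqP => e; have e1 : cz 1 = 1.
  have := congr1 (fun X => X * cz 2^-1) e; rewrite /k0 mulrBl -!czD addNr cz0 mul0r.
  have -> : 2^-1 + 2^-1 = 1 :> K by have := two_neq0 qK => h; field.
  by move/eqP; rewrite subr_eq0 => /eqP.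
have e2 : ez x (1 : K) = ez z (- 1).
  have h : cz 1 * ez z (- 1) = ez z (- 1) by rewrite e1 mul1r.
  by move: h; rewrite /cz -mulrA ezNK mulr1.
have e3 : at_z x (Eser (1 : K)) = at_z z (Eser (- 1)) :> zser K n.
  by apply: polyC_inj; move: e2; rewrite ez.unlock.
have h0 : at_z z (Eser (-1 : K)) (dexp x *+ 1) = 0.
  have h : dep [set z]%SET (at_z z (Eser (-1 : K))) by exact: dep_at_z.
  have m1 : x \notin [set z]%SET by rewrite finset.in_set1.
  have m2 : (dexp x *+ 1 : ex) x != 0%N by rewrite dexpE eqxx.
  exact: (h _ x m1 m2).
have h1 : Eser (1 : K) 1%N = 0.
  exact: etrans (esym (at_z_coefX x (Eser 1) 1)) (etrans (congr1 (fun f : zser K n => f (dexp x *+ 1)) e3) h0).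
by move: h1; rewrite -[Eser 1 _]/(1 ^+ 1 / 1%:R) expr1 divr1 => /eqP; rewrite oner_eq0.
Qed.

Definition Dz2 : L := gz z ^ (- a x) * gz x ^ (a z) - gz z ^ (a x) * gz x ^ (- a z).

(** The two exponentials in [Dz2] go to the two ways of cutting one string of length a_x + a_z. *)
Lemma TL_Dz2 X : Pc X ->
  TL (x |: (z |: S'))%SET (kap (gz x) 1 * kap (gz z) 1 * Dz2 * X) = 0.
Proof.
move=> [l hl ->]; rewrite mulr_sumr (TL_sum wtT_bnd) big_seq big1 // => -[Y c] /hl /= dY.
have t2 := two_neq0 qK.
have -> : kap (gz x) 1 * kap (gz z) 1 * Dz2 * (Y * cz c) =
  kap (gz x) 1 * kap (gz z) 1 * (ez x (c + ai z / 2) * ez z (c - ai x / 2)) * Y -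
  kap (gz x) 1 * kap (gz z) 1 * (ez x (c - ai z / 2) * ez z (c + ai x / 2)) * Y.
  rewrite /Dz2 !ezZ /cz !ezD !rmorphN /= !mulrN -!mulNr ![2^-1 * _]mulrC ![- 2^-1 * _]mulrC !mulrN -!mulNr.
  move: (kap (gz x) 1) (kap (gz z) 1) => k1 k2.
  move: (ez z (- ai x / 2)) (ez x (ai z / 2)) (ez z (ai x / 2)) (ez x (- ai z / 2)) (ez x c) (ez z c) => *.
  ring.
rewrite (TLB wtT_bnd) (TL_step2 _ _ xz xS zS dY) (TL_step2 _ _ xz xS zS dY).
apply/eqP; rewrite subr_eq0; apply/eqP; apply: (congr1 (fun q => lser q * TL S' Y)).
by apply: etrans (Phi_cocycle qK psi0 _ _ _) (esym (Phi_cocycleV qK psi0 _ _ _)).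
Qed.

(** For opposite lengths every exponential is sent to [Phi] at length 0, which is 1, so the
    functional counts the terms of [kdz m] with sign. *)
Lemma TL_kdz m X : a x + a z = 0 -> depP S' X ->
  TL (x |: (z |: S'))%SET (kap (gz x) 1 * kap (gz z) 1 * kdz m * X) = lmono 0 m%:~R * TL S' X.
Proof.
move=> axz dX; have t1 c : TL (x |: (z |: S'))%SET (kap (gz x) 1 * kap (gz z) 1 * cz c * X) = TL S' X.
  rewrite TL_step2 //; have -> : ai x = - ai z by apply/eqP; rewrite -addr_eq0 -rmorphD axz.
  have := Phi_cocycle qK psi0 (- ai z) (ai z) (c - ai z / 2).
  by rewrite subrK mulNr opprK subrK addNr Phi0 // => ->; rewrite rmorph1 mul1r.
have tk k : TL (x |: (z |: S'))%SET (kap (gz x) 1 * kap (gz z) 1 * kd k * X) = lmono 0 k%:R * TL S' X.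
  rewrite /kd mulr_sumr mulr_suml (TL_sum wtT_bnd) (eq_bigr (fun=> TL S' X)) => [|j _]; last exact: t1.
  by rewrite sumr_const card_ord (rmorph_nat (@lmono K 0)) mulr_natl.
case: m => k; first exact: tk.
rewrite /kdz mulrN mulNr -[- (_ * X)]sub0r (TLB wtT_bnd) tk.
have -> : TL (x |: (z |: S'))%SET 0 = 0 by have := TLB wtT_bnd (x |: (z |: S'))%SET 0 0; rewrite !subrr.
have -> : ((Negz k)%:~R : K) = - k.+1%:R by rewrite NegzE rmorphN.
by rewrite sub0r raddfN mulNr.
Qed.

Lemma wordS_cons2 (s1 s2 : seq 'I_n) (u w : 'I_n) S : u \in S -> w \in S ->
  [seq i <- s1 | i \in S] = [seq i <- s1 | i \in S'] ->
  [seq i <- s2 | i \in S] = [seq i <- s2 | i \in S'] ->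
  wordS (s1 ++ u :: w :: s2) S = word [seq lett i | i <- s1 & i \in S']
    (Eop (a u) (kap (gz u)) (Eop (a w) (kap (gz w)) (word [seq lett i | i <- s2 & i \in S'] (fun=> 1)))).
Proof.
move=> uS wS f1 f2; rewrite /wordS.
have -> : [seq i <- s1 ++ u :: w :: s2 | i \in S] =
    [seq i <- s1 | i \in S'] ++ [:: u, w & [seq i <- s2 | i \in S']].
  by rewrite filter_cat f1 [filter _ (u :: _)]/= uS wS f2.
by rewrite map_cat word_cat.
Qed.

Lemma wordS_swap (s1 s2 : seq 'I_n) :
  [seq i <- s1 | i \in (x |: (z |: S'))%SET] = [seq i <- s1 | i \in S'] ->
  [seq i <- s2 | i \in (x |: (z |: S'))%SET] = [seq i <- s2 | i \in S'] ->
  MM (s1 ++ x :: z :: s2) (x |: (z |: S'))%SET =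
  MM (s1 ++ z :: x :: s2) (x |: (z |: S'))%SET +
  (if a x + a z == 0 then lmono 0 (ai z) * MM (s1 ++ x :: z :: s2) S' else 0).
Proof.
move=> f1 f2; pose S := (x |: (z |: S'))%SET; apply/eqP; rewrite addrC -subr_eq; apply/eqP.
rewrite /MM -(TLB wtT_bnd) -/S.
have xS1 : x \in S by rewrite !inE eqxx. have zS1 : z \in S by rewrite !inE eqxx orbT.
pose w1 := [seq lett i | i <- s1 & i \in S']; pose w2 := [seq lett i | i <- s2 & i \in S'].
pose v := word w2 (fun=> 1 : L).
have eS : wordS (s1 ++ x :: z :: s2) S = word w1 (Eop (a x) (kap (gz x)) (Eop (a z) (kap (gz z)) v)).
  exact: wordS_cons2.
have eS' : wordS (s1 ++ z :: x :: s2) S = word w1 (Eop (a z) (kap (gz z)) (Eop (a x) (kap (gz x)) v)).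
  exact: wordS_cons2.
have e' : wordS (s1 ++ x :: z :: s2) S' = word w1 v.
  rewrite /wordS; have -> : [seq i <- s1 ++ x :: z :: s2 | i \in S'] =
      [seq i <- s1 | i \in S'] ++ [seq i <- s2 | i \in S'].
    by rewrite filter_cat [filter _ (x :: _)]/= (negbTE xS) (negbTE zS).
  by rewrite map_cat word_cat.
have pv : pf (depP S') v by exact: (pf_wordS s2 S').
have qL := qalgL; have pvT : pfT v by apply: (pf_sub _ pv).
have pvc : pf Pc v by apply: (pf_sub _ pv); exact: Pc_dep.
have Pk0 : Pc k0 by apply: (csubB Pc_sub); exact: Pc_cz.
have Pkd k : Pc (kd k) by apply: (csub_sum Pc_sub) => j _; exact: Pc_cz.
(* The fused operator is k0 times w, plus v when a_x + a_z = 0. After cancelling k0, the part with w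
   keeps the factor [Dz2] and is killed by the functional; in the other part k0 divides [Dz2] itself
   and leaves [kdz (a z)]. *)
have [w [pw wE]] := Eop_div qL Pc_sub Pk0 Pkd (a x + a z) pvc.
have pwT : pfT w by apply: (pf_sub _ pw).
pose kk := kap (gz x) 1 * kap (gz z) 1.
pose E := if a x + a z == 0 then kdz (a z) else 0.
have comm t : 1 * Eop (a x) (kap (gz x)) (Eop (a z) (kap (gz z)) v) t +
    (- 1) * Eop (a z) (kap (gz z)) (Eop (a x) (kap (gz x)) v) t = (kk * Dz2) * w t + (kk * E) * v t.
  apply: (mulfI k0_neq0); rewrite mul1r mulN1r.
  have k1 : kap (gz x * gz z) 1 = k0.
    by rewrite kap_cz /kd big_ord1 -[nat_of_ord ord0]/0%N subr0 mul1r subrr cz0 mulr1.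
  rewrite -{1}k1 (Eop_comm qL) ?ez_unit // -/Dz2 -/kk.
  have -> : kap (gz x * gz z) = fun k => k0 * kd k by apply/funext => k; exact: kap_cz.
  rewrite wE /E; case: eqP => [e|_]; last by rewrite !mul0r mulr0 !addr0 mul0r addr0; ring.
  have -> : Dz2 = k0 * kdz (a z).
    rewrite k0_kdz /Dz2 /cz; have -> : a x = - a z by apply/eqP; rewrite -addr_eq0 e.
    rewrite opprK !ezZ !rmorphN /= !mulrN ![2^-1 * _]mulrC.
    by rewrite [ez z _ * _]mulrC [ez z (- _) * _]mulrC.
  by rewrite mul1r; move: (w t) (v t) (kdz _) k0 kk => *; ring.
have -> : wordS (s1 ++ x :: z :: s2) S tt - wordS (s1 ++ z :: x :: s2) S tt =
    kk * Dz2 * word w1 w tt + kk * E * word w1 v tt.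
  have pE1 : pfT (Eop (a x) (kap (gz x)) (Eop (a z) (kap (gz z)) v)).
    by apply: (pf_Eop qL) => //; apply: (pf_Eop qL).
  have pE2 : pfT (Eop (a z) (kap (gz z)) (Eop (a x) (kap (gz x)) v)).
    by apply: (pf_Eop qL) => //; apply: (pf_Eop qL).
  have := wordD qL w1 1 (-1) pE1 pE2; rewrite (funext comm) (wordD qL _ _ _ pwT pvT).
  by move=> /(congr1 (fun f => f tt)) ->; rewrite eS eS' mul1r mulN1r.
have dw : Pc (word w1 w tt).
  apply: (pf_eval Pc_sub) => [|k]; last by apply: Pc_dep; exact: dep_tt.
  apply: (pf_word qL Pc_sub) => // l lw k; apply: Pc_dep; move: lw.
  rewrite /w1; elim: (s1) => //= i s IH; case: ifP => //= iS [<-|//] /=.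
  exact: dep_kapW.
have -> : kk * Dz2 * word w1 w tt + kk * E * word w1 v tt =
   kk * Dz2 * word w1 w tt - (0 - kk * E * word w1 v tt) by rewrite sub0r opprK.
rewrite (TLB wtT_bnd) TL_Dz2 // sub0r (TLB wtT_bnd).
have T00 : TL S 0 = 0 by have := TLB wtT_bnd S 0 0; rewrite !subrr.
rewrite T00 sub0r opprK /E; case: eqP => [e|_]; last by rewrite mulr0 mul0r T00.
have dw1 : depP S' (word w1 v tt) by rewrite -e'; exact: dep_wordS.
by rewrite (TL_kdz _ e dw1) e'.
Qed.

End Pair.

(** On the vacuum a mode of order at most 0 is delta_(a,0), since h_m is 0 for m < 0 and 1 for m =
    0. *)
Lemma MM_last s S i : i \in S -> i \notin s -> a i <= 0 ->
  MM (rcons s i) S = lser (wtT i 0) *+ (a i == 0) * MM (rcons s i) (S :\ i)%SET.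
Proof.
move=> iS si ai0; have qL := qalgL.
have e1 : Eop (a i) (kap (gz i)) (fun=> 1 : L) = fun t => (a i == 0)%:R * 1 + 0 * 1.
  apply/funext => t; rewrite mul0r addr0 mulr1.
  rewrite (@Eop_eval _ qL (a i) (kap (gz i)) (fun=> 1) t unit (fun=> 1) (fun=> 0%N)) => [|u]; last first.
    by rewrite sum_unit expr0 mulr1.
  rewrite sum_unit mul1r addr0; case: (ltgtP (a i) 0) ai0 => // [h|->] _; first by rewrite he_neg.
  by rewrite -[he _ _ _]/(hs (fun k => kap (gz i) k * t k) 0) hsym0.
pose w := [seq lett j | j <- s & j \in S]; pose X := word w (fun=> 1 : L) tt.
have fE : [seq j <- s | j \in (S :\ i)%SET] = [seq j <- s | j \in S].
  by apply: eq_in_filter => j js; rewrite !inE; case: eqP => // ji; rewrite ji (negbTE si) in js.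
have wE : wordS (rcons s i) S tt = (a i == 0)%:R * X.
  rewrite /wordS filter_rcons iS map_rcons -cats1 word_cat -[word [:: _] _]/(Eop (a i) (kap (gz i)) _) e1.
  rewrite (wordD qL _ _ _ (v := fun=> 1) (w := fun=> 1)) ?mul0r ?addr0 //; exact: pfC.
have wE' : wordS (rcons s i) (S :\ i)%SET tt = X.
  by rewrite /wordS filter_rcons finset.in_setD1 eqxx /= fE.
have dX : depP (S :\ i)%SET X by rewrite -wE'; exact: dep_wordS.
rewrite /MM wE wE'; case: eqP => _; last first.
  rewrite mul0r mulr0n mul0r; by have := TLB wtT_bnd S 0 0; rewrite !subrr.
have -> : S = ([set i] :|: S :\ i)%SET by rewrite finset.setD1K.
rewrite TLM //; last 2 first.
- by rewrite disjoints1 finset.in_setD1 eqxx.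
- by move=> p; rewrite -[true%:R]/(1 : L) coef1; case: (p == 0)%N; [exact: dep1|exact: dep0].
rewrite finset.setU1K ?finset.in_setD1 ?eqxx // mulr1n; congr (_ * _).
rewrite -[RHS]/(lser (wtT i 0)) (_ : (1 : L) = (at_z i 1)%:P); last by rewrite !rmorph1.
rewrite (TLC wtT_bnd); apply: (congr1 (@lser K)); apply: mseriesP => N.
rewrite (T0_at_z wtT_bnd) big_ord_recl big1 ?addr0 => [|k _]; last by rewrite mcoef1 mul0r.
by rewrite mcoef1 mul1r.
Qed.

End FockFunctional.

(** * Vanishing of connected moments with a nonpositive index *)

Section CumulantVanishing.
Variables (A : comNzRingType) (n : nat).

(** An element independent of all others has no cumulant besides its first one. *)
Lemma cumulant_last (M kp : {set 'I_n} -> A) i c : M finset.set0 = 1 -> cumulant_rel M kp ->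
  (forall S : {set 'I_n}, i \in S -> M S = c * M (S :\ i)%SET) ->
  forall T : {set 'I_n}, i \in T -> (1 < #|T|)%N -> kp T = 0.
Proof.
move=> M1 cr Mi.
have k1 : kp [set i]%SET = c.
  have := cr [set i]%SET i (finset.set11 i); rewrite (big_pred1 [set i]%SET) => [|T]; last first.
    rewrite finset.subset1; apply/andP/eqP => [[/orP[/eqP -> //|/eqP ->]]|->].
      by rewrite finset.in_set0.
    by rewrite eqxx finset.set11.
  by rewrite finset.setDv M1 mulr1 => <-; rewrite Mi ?finset.set11 // finset.setDv M1 mulr1.
move=> T; have [m] := ubnP #|T|; elim: m T => // m IH T Tm iT T2.
have := cr T i iT; rewrite (bigD1 [set i]%SET) ?finset.sub1set ?iT ?finset.set11 //= k1.
rewrite -[(T :\: [set i])%SET]/(T :\ i)%SET {1}(Mi T iT) -[X in X = _]addr0 => /addrI/esym.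
rewrite (bigD1 T) /=; last first.
  by rewrite fintype.subxx iT /=; apply: contraTneq T2 => ->; rewrite cards1.
rewrite finset.setDv M1 mulr1 big1 ?addr0 => [//|U /andP[/andP[/andP[UT iU] U1] nUT]].
rewrite IH ?mul0r //.
  by rewrite (leq_trans (proper_card _) Tm) // finset.properEneq nUT.
rewrite ltnNge; apply: contra U1 => h; rewrite eq_sym finset.eqEcard finset.sub1set iU cards1 //.
Qed.

End CumulantVanishing.

Section NonPositive.
Variables (K : closedFieldType) (qK : qalg K) (n : nat) (psi y : mseries nat K) (a : 'I_n -> int).
Hypothesis psi0 : psi 0%N = 0.
Local Notation M s := (MM psi y a s).

Lemma MM_swap s1 x z s2 (S : {set 'I_n}) : uniq (s1 ++ x :: z :: s2) ->
  M (s1 ++ z :: x :: s2) S = M (s1 ++ x :: z :: s2) S -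
    (if (x \in S) && (z \in S) then (if a x + a z == 0 then lmono 0 (a z)%:~R else 0) *
       M (s1 ++ x :: z :: s2) (S :\: [set x; z])%SET else 0).
Proof.
rewrite cat_uniq /= => /and3P[_ h1 /and3P[h2 h3 _]].
move: h1 h2; rewrite inE !negb_or => /and3P[xs1 zs1 hs] /andP[xz xs2].
case: (boolP ((x \in S) && (z \in S))) => [/andP[xS zS]|nS]; last first.
  rewrite subr0 /MM /wordS; congr (TL _ S (word (map _ _) _ _)); rewrite !filter_cat; congr (_ ++ _).
  by rewrite /=; case: (x \in S) (z \in S) nS => [] [].
pose S' := (S :\: [set x; z])%SET.
have SE : S = (x |: (z |: S'))%SET.
  apply/setP => j; rewrite !inE; case: (eqVneq j x) => [->|_] //=.
  by case: (eqVneq j z) => [->|_].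
have xS' : x \notin S' by rewrite !inE eqxx.
have zS' : z \notin S' by rewrite !inE eqxx orbT.
have fE (s : seq 'I_n) : x \notin s -> z \notin s -> [seq i <- s | i \in (x |: (z |: S'))%SET] = [seq i <- s | i \in S'].
  move=> xs zs; apply: eq_in_filter => j js; rewrite !in_setU1.
  case: (eqVneq j x) => [e|_]; first by rewrite -e js in xs.
  by case: (eqVneq j z) => [e|_]; first by rewrite -e js in zs.
have := wordS_swap qK y a psi0 xz xS' zS' (fE s1 xs1 zs1) (fE s2 xs2 h3).
rewrite -SE => ->; case: eqP => _; first by rewrite addrK.
by rewrite addr0 mul0r subr0.
Qed.

(** Induction on the letters to the right of i: each exchange changes a single pair cumulant, by a
    constant times hbar^0, and once i is last it is independent of the rest. *)
Lemma cumulant_nonpos s i kp : uniq s -> (forall j, j \in s) -> a i <= 0 ->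
  cumulant_rel (M s) kp -> forall T : {set 'I_n}, i \in T -> (1 < #|T|)%N ->
  exists2 c : K, kp T = lmono 0 c & (2 < #|T|)%N -> c = 0.
Proof.
move=> us alls ai0; have is_ := alls i; move: is_ us alls; case/splitPr => s1 s2.
elim: s2 s1 kp => [|z s2 IH] s1 kp us alls cr T iT T2.
  exists 0 => //; rewrite raddf0; apply: (cumulant_last _ cr _ iT T2); first exact: (MM0 psi y a).
  move=> S iS; rewrite cats1; apply: (MM_last qK psi y iS _ ai0).
  by move: us; rewrite cats1 rcons_uniq => /andP[].
pose C : laurent K := if a i + a z == 0 then lmono 0 (a z)%:~R else 0.
have iz : i != z.
  by have := us; rewrite cat_uniq => /and3P[_ _ /=/andP[]]; rewrite inE negb_or => /andP[].
have us' : uniq (rcons s1 z ++ i :: s2).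
  rewrite cat_rcons -(@perm_uniq _ (s1 ++ [:: i, z & s2])) // perm_cat2l.
  by apply/permPl; exact: (perm_catCA [:: i] [:: z] s2).
have alls' j : j \in rcons s1 z ++ i :: s2.
  have := alls j; rewrite cat_rcons !mem_cat !inE; case: (j \in s1) => //=.
  by rewrite orbCA.
have cr' := @cumulant_swap _ _ _ _ (M (rcons s1 z ++ i :: s2)) C i z cr iz.
have [|c0 kE c2] := IH _ _ us' alls' (cr' _) T iT T2.
  by move=> S; rewrite cat_rcons; exact: MM_swap.
have [TE|TE] := eqVneq T [set i; z]%SET; last first.
  by move: kE; rewrite (negbTE TE) subr0 => kE; exists c0.
move: kE; rewrite TE eqxx => /eqP; rewrite subr_eq => /eqP kE.
exists (c0 + (if a i + a z == 0 then (a z)%:~R else 0)).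
  by rewrite kE raddfD /C; congr (_ + _); case: ifP => // _; rewrite raddf0.
by rewrite cards2 iz.
Qed.

End NonPositive.

(** * Moments with positive indices are derivatives of Z *)

Section PositiveParts.
Variables (K : closedFieldType) (qK : qalg K) (n : nat) (psi y : mseries nat K) (m : 'I_n -> nat).
Hypotheses (psi0 : psi 0%N = 0) (m0 : forall i, (0 < m i)%N).
Local Notation L := {poly (zser K n)}.
Local Notation a := (fun i => (m i)%:Z).
Local Notation wt := (wtT psi a).
Local Notation TL := (TL wt).

Lemma dep_ezW (i : 'I_n) (S : {set 'I_n}) (c : K) : i \in S -> depP S (ez i c).
Proof.
move=> iS p r j jS rj; have h : depP [set i]%SET (ez i c) by exact: dep_ez.
by apply: (h p r j) => //; rewrite finset.in_set1; apply: contra jS => /eqP ->.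
Qed.

(** The functional is applied one letter at a time: the exponential of the mean content becomes the
    content product of the move. *)
Lemma TL_Wsum N (s : seq 'I_n) (S : {set 'I_n}) (F : ('I_N -> nat) -> L) (F' : ('I_N -> nat) -> laurent K) :
  uniq s -> (forall i, i \in s -> i \notin S) -> (forall b, depP S (F b)) ->
  (forall b, TL S (F b) = F' b) ->
  TL (S :|: [set i in s])%SET (\prod_(i <- s) kap (gz K i) 1 * Wsum [seq (m i, gz K i) | i <- s] F) =
  Wgen (cwt psi N) [seq m i | i <- s] F'.
Proof.
elim: s S F F' => [|i s IH] S F F' us sS dF TF /=.
  by rewrite big_nil mul1r (_ : (S :|: _)%SET = S) //; apply/setP => j; rewrite !inE orbF.
case/andP: us => nis us; have iS : i \notin S by apply: sS; rewrite mem_head.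
rewrite big_cons mulrAC [_ * _ * \prod_(j <- _) _]mulrC -WsumZ.
have -> : (S :|: [set j in i :: s])%SET = ((i |: S) :|: [set j in s])%SET.
  by apply/setP => j; rewrite !inE orbA [(j \in S) || _]orbC.
have sub1 : depP (i |: S)%SET (kap (gz K i) 1) by apply: (dep_kapW qK); rewrite !inE eqxx.
have cS := depP_sub qK (i |: S)%SET.
apply: IH => // [j js|b|b].
- rewrite !inE negb_or sS ?inE ?js ?orbT // andbT.
  by apply: contraNneq nis => <-.
- apply: (csubM cS) => //; apply: (csub_sum cS) => j _; apply: (csubM cS); last first.
    by apply: depPW (dF _); exact: finset.subsetUr.
  rewrite /gz ezZ //; apply: dep_ezW; exact: finset.setU11.
rewrite mulr_sumr (TL_sum (@wtT_bnd _ _ psi a)); apply: eq_bigr => j _.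
have gE (e : int) : gz K i ^ e = ez i (2^-1 * e%:~R) by rewrite /gz ezZ.
rewrite [X in TL _ X](_ : _ = kap (gz K i) 1 * ez i (2^-1 * ((b j).*2%:Z + (m i)%:Z + 1 - N.*2%:Z)%:~R) *
  F (addb b j (m i))); last by rewrite gE mulrA.
apply: etrans (TL_step qK a psi0 _ iS (dF _)) _; rewrite TF; apply: (congr1 (fun q => q * _)).
rewrite (cwt_Phi qK); apply: (congr1 (fun c : K => lser (Phi psi (m i)%:R c))).
have t2 := two_neq0 qK.
rewrite rmorphB !rmorphD /= -!pmulrn -!mul2n !natrM; field; exact: t2.
Qed.

Definition evq (p : {poly K}) : laurent K := (map_poly (@lmono K 0) p).[lmono (-1) 1].

Lemma evq_zmod : zmod_morphism evq.
Proof. by move=> p q; rewrite /evq rmorphB hornerD hornerN. Qed.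
HB.instance Definition _ := GRing.isZmodMorphism.Build {poly K} (laurent K) evq evq_zmod.
Lemma evq_monoid : monoid_morphism evq.
Proof. by split => [|p q]; rewrite /evq ?rmorph1 ?hornerC // rmorphM hornerM. Qed.
HB.instance Definition _ := GRing.isMonoidMorphism.Build {poly K} (laurent K) evq evq_monoid.

Lemma Sdet_map (A B : comUnitRingType) (h : {rmorphism A -> B}) N (b : 'I_N -> nat) t :
  qalg A -> qalg B -> h (Sdet b t) = Sdet b (fun k => h (t k)).
Proof.
move=> qA qB; rewrite /Sdet -det_map_mx; congr (\det _); apply/matrixP => i j; rewrite !mxE /hz.
by case: ifP => _; rewrite ?rmorph0 // hs_map.
Qed.

Lemma Sdet_tt N (b : 'I_N -> nat) :
  depP finset.set0 (Sdet b (tt n y)) /\ TL finset.set0 (Sdet b (tt n y)) = Sdet b (fun k => lmono (-1) (y k)).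
Proof.
pose io : {rmorphism {poly K} -> L} := map_poly (@smono {ffun 'I_n -> nat} K 0).
have qP : qalg {poly K} by move=> k; rewrite -(rmorph_nat (@polyC K)); apply: rmorph_unit; exact: qK.
pose t0 k : {poly K} := 'X * (y k)%:P.
have ttE : tt n y = fun k => io (t0 k).
  by apply/funext => k; rewrite /tt /t0 rmorphM /= map_polyX map_polyC.
rewrite ttE -Sdet_map //; last exact: qalgL.
set P := Sdet b t0; split.
  by move=> p; rewrite coef_map; exact: depC.
rewrite (_ : (fun k => lmono (-1) (y k)) = fun k => evq (t0 k)); last first.
  apply/funext => k; rewrite /evq /t0 rmorphM /= map_polyX map_polyC hornerM hornerX hornerC.
  by rewrite lmonoM mul1r addr0.
rewrite -Sdet_map //; last exact: qalg_laurent.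
rewrite -/P (@TLE _ _ _ (@wtT_bnd _ _ psi a) _ _ (size P)) ?size_poly //.
rewrite -[RHS]/((map_poly (@lmono K 0) P).[lmono (-1) 1]) (@horner_coef_wide _ (size P)) ?size_poly //.
apply: eq_bigr => k _; rewrite !coef_map /= (T0_set0 (@wtT_bnd _ _ psi a)) mulrC; congr (_ * _).
  by apply: laurentP => -[j|j]; rewrite lserE lmonoE ?smonoE.
elim: (nat_of_ord k) => [|j IH]; first by rewrite expr0 oppr0.
by rewrite exprS -IH lmonoM mul1r; congr (lmono _ _); lia.
Qed.

(** Both sides are the same weighted path sum, by [star_line] for the word and by [fold_Zfun] for Z.
    The sum of all m_i is a number N of beta-numbers large enough for every S. *)
Theorem MM_Zfun (S : {set 'I_n}) :
  MM psi y a (enum 'I_n) S = DS m S (Zfun psi y) 0.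
Proof.
pose N := (\sum_i m i)%N; rewrite /DS.
have sE : enum S = [seq i <- enum 'I_n | i \in S] by rewrite [LHS]/enum_mem enumT.
rewrite (@fold_Zfun K qK psi y psi0 N) //; last 2 first.
- by apply/allP => k /mapP[i _ ->]; exact: m0.
- rewrite sumnE big_map big_enum /= /N [X in (X <= _)%N]big_mkcond leq_sum // => i _.
  by case: ifP.
have us : uniq (enum S) by exact: enum_uniq.
pose io : {rmorphism K -> L} := @polyC (zser K n) \o @smono {ffun 'I_n -> nat} K 0.
pose sl := [seq (m i, gz K i) | i <- enum S].
have wE : wordS a (enum 'I_n) S = word (letters sl) (fun=> 1).
  by rewrite /wordS -sE /letters /sl -map_comp.
have dN : (\sum_(l <- sl) l.1 <= N)%N.
  rewrite big_map /= big_enum /= /N [X in (X <= _)%N]big_mkcond leq_sum // => i _; by case: ifP.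
have sall : all (fun l : nat * L => (0 < l.1)%N && (l.2 \is a GRing.unit)) sl.
  by apply/allP => l /mapP[i _ ->] /=; rewrite m0 ez_unit.
have st := @star_line L (@qalgL _ qK n) K io N sl y 'X qK sall dN.
rewrite /MM wE; have -> : word (letters sl) (fun=> 1) (tt n y) = _ := esym st.
rewrite [X in X * _](_ : _ = \prod_(i <- enum S) kap (gz K i) 1); last by rewrite big_map.
have SE : (finset.set0 :|: [set i in enum S])%SET = S.
  by apply/setP => i; rewrite !inE mem_enum.
have h := @TL_Wsum N (enum S) finset.set0 (fun b => Sdet b (tt n y))
  (fun b => Sdet b (fun k => lmono (-1) (y k))) us.
rewrite -h => [|i _|b|b]; last 3 first.
- by rewrite finset.in_set0.
- exact: (Sdet_tt b).1.
- exact: (Sdet_tt b).2.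
by rewrite SE.
Qed.

End PositiveParts.

(** * Expansion of fractions in the region of ordered absolute values *)

Section Expansion.
Variables (K : fieldType) (qK : qalg K) (n : nat).
Local Notation ex := {ffun 'I_n -> nat}.
Local Notation O := (zser K n).
Local Notation dF := (degF 'I_n).
Implicit Types (i j k l : 'I_n) (a b : ex) (f g h o : O).

(* Series in zeta_0, ..., zeta_(n-1), where z_i = zeta_0 ... zeta_i: the expansion in the region
   |z_0| > |z_1| > ... > |z_(n-1)|.  The exponent of z_i in zeta^b is [av b i]. *)
Definition nx b i : nat := (\sum_(j : 'I_n | j == i.+1 :> nat) b j)%N.
Definition av b i : int := (b i)%:Z - (nx b i)%:Z.
Definition zb i : ex := [ffun j : 'I_n => nat_of_bool (j <= i)%N].
Definition zbm a : ex := [ffun j : 'I_n => (\sum_(i : 'I_n | (j <= i)%N) a i)%N].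

Lemma nxD b b' i : nx (b + b') i = (nx b i + nx b' i)%N.
Proof. by rewrite /nx -big_split; apply: eq_bigr => j _; rewrite ffunE. Qed.

Lemma avD b b' i : av (b + b') i = av b i + av b' i.
Proof. by rewrite /av nxD ffunE -[(b i + b' i)%R]/(b i + b' i)%N; lia. Qed.

Lemma av0 i : av 0 i = 0.
Proof. by rewrite /av ffunE /nx big1 // => j _; rewrite ffunE. Qed.

Lemma zbmD a a' : zbm (a + a') = zbm a + zbm a'.
Proof. by apply/ffunP => j; rewrite !ffunE -big_split; apply: eq_bigr => i _; rewrite ffunE. Qed.

Lemma nx_zbm a i : (nx (zbm a) i + a i = zbm a i)%N.
Proof.
rewrite ffunE (bigD1 i) //= addnC; congr (_ + _)%N; rewrite /nx.
have [iN|iN] := ltnP i.+1 n.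
  rewrite (big_pred1 (Ordinal iN)) => [|j]; last by apply/eqP/eqP => [e|->] //; exact: val_inj.
  rewrite ffunE; apply: eq_bigl => j /=; rewrite -val_eqE /=; lia.
rewrite big1 => [|j /eqP e]; last by have := ltn_ord j; rewrite e; lia.
by rewrite big1 // => j /andP[h1 h2]; have := ltn_ord j; move: h2; rewrite -val_eqE /=; lia.
Qed.

Lemma av_zbm a i : av (zbm a) i = (a i)%:Z.
Proof. by rewrite /av -nx_zbm; lia. Qed.

Lemma zbm_inj : injective zbm.
Proof. by move=> a a' e; apply/ffunP => i; have := av_zbm a i; rewrite e av_zbm => -[]. Qed.

Lemma av_inj b b' : (forall i, av b i = av b' i) -> b = b'.
Proof.
move=> e; apply/ffunP => i.
have [m] := ubnP (n - i); elim: m i => // m IH i im.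
suff nxE : nx b i = nx b' i by have := e i; rewrite /av nxE => /addIr[].
apply: eq_bigr => j /eqP ji; apply: IH; rewrite ji; have := ltn_ord i; lia.
Qed.

(** The monomials in the zeta_i that are genuine monomials in the z_i, that is, without negative
    exponents. *)
Definition nonneg b := [forall i, nx b i <= b i]%N.
Definition avn b : ex := [ffun i => (b i - nx b i)%N].

Lemma zbm_avn b : nonneg b -> zbm (avn b) = b.
Proof.
move=> /forallP h; apply: av_inj => i; rewrite av_zbm ffunE /av; have := h i; lia.
Qed.

Lemma nonneg_zbm a : nonneg (zbm a).
Proof. by apply/forallP => i; rewrite -nx_zbm leq_addr. Qed.

Lemma avn_zbm a : avn (zbm a) = a.
Proof. by apply: zbm_inj; rewrite zbm_avn // nonneg_zbm. Qed.

Lemma nonnegD b b' : nonneg b -> nonneg b' -> nonneg (b + b').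
Proof.
move=> /forallP h /forallP h'; apply/forallP => i; rewrite nxD ffunE.
rewrite -[(b i + b' i)%R]/(b i + b' i)%N; have := h i; have := h' i; lia.
Qed.

Lemma zb_zbm i : zb i = zbm (dexp i).
Proof.
apply/ffunP => j; rewrite !ffunE; case: leqP => h.
  by rewrite (bigD1 i) //= dexp1E eqxx big1 // => k /andP[_ /negbTE ki]; rewrite dexp1E ki.
by rewrite big1 // => k jk; rewrite dexp1E; case: eqP => // ki; move: jk; rewrite ki; lia.
Qed.

Lemma av_zb i j : av (zb i) j = (j == i)%:Z.
Proof. by rewrite zb_zbm av_zbm ffunE. Qed.

Definition iota_z f : O := MSeries (fun b => if nonneg b then f (avn b) else 0).
Local Notation io := iota_z.

Lemma io_zbm f a : io f (zbm a) = f a.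
Proof. by rewrite -[LHS]/(if nonneg _ then _ else _) nonneg_zbm avn_zbm. Qed.

Lemma io_inj : injective io.
Proof.
move=> f g e; apply: mseriesP => a; have := congr1 (fun h : O => h (zbm a)) e.
by rewrite !io_zbm.
Qed.

Lemma io_zmod : zmod_morphism io.
Proof.
move=> f g; apply: mseriesP => b; rewrite mcoefB.
rewrite -[LHS]/(if nonneg b then (f - g) (avn b) else 0) -[io f b]/(if nonneg b then _ else 0).
by rewrite -[io g b]/(if nonneg b then _ else 0); case: ifP => _; rewrite ?subr0 // mcoefB.
Qed.
HB.instance Definition _ := GRing.isZmodMorphism.Build O O io io_zmod.

Lemma io_smono a (c : K) : io (smono a c) = smono (zbm a) c.
Proof.
apply: mseriesP => b; rewrite smonoE -[LHS]/(if nonneg b then smono a c (avn b) else 0) smonoE.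
case: ifP => [nb|nb]; last by case: eqP => // e; rewrite e nonneg_zbm in nb.
by rewrite -[b in RHS]zbm_avn // (inj_eq zbm_inj).
Qed.

Lemma io_monoid : monoid_morphism io.
Proof.
split => [|f g].
  rewrite -[1]/(smono 0 1 : O) io_smono; congr (smono _ _); apply/ffunP => j.
  by rewrite !ffunE big1 // => i _; rewrite ffunE.
apply: mseriesP => b; rewrite mcoefM.
pose F (d : ex * ex) := if d.1 + d.2 == b then io f d.1 * io g d.2 else 0.
have nz d : io f d.1 * io g d.2 != 0 -> nonneg d.1 /\ nonneg d.2.
  rewrite -[io f d.1]/(if nonneg d.1 then _ else _) -[io g d.2]/(if nonneg d.2 then _ else _).
  by case: ifP; case: ifP => //; rewrite ?mulr0 ?mul0r ?eqxx.
transitivity (\sum_(d <- splits b) F d); last first.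
  by rewrite big_seq [RHS]big_seq; apply: eq_bigr => d; rewrite mem_splits /F => ->.
rewrite -[LHS]/(if nonneg b then (f * g) (avn b) else 0); case: ifP => nb; last first.
  rewrite big1 // => d _; rewrite /F; case: eqP => // e; apply/eqP; rewrite eq_sym.
  by apply: contraFT nb; rewrite eq_sym => /nz[h1 h2]; rewrite -e; exact: nonnegD.
have ur : uniq [seq (zbm d.1, zbm d.2) | d <- splits (avn b)].
  by rewrite map_inj_uniq ?splits_uniq // => -[? ?] [? ?] [/zbm_inj -> /zbm_inj ->].
rewrite (@sum_supp _ _ F _ _ (splits_uniq b) ur) => [|d]; last first.
  rewrite /F; case: (eqVneq (d.1 + d.2) b) => [e hd|_]; [have [n1 n2] := nz d hd|by rewrite eqxx].
  rewrite mem_splits e eqxx /=; apply/mapP; exists (avn d.1, avn d.2); last first.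
    by rewrite /= !zbm_avn //; case: (d).
  by rewrite mem_splits /=; apply/eqP/zbm_inj; rewrite zbmD !zbm_avn.
rewrite big_map mcoefM big_seq [RHS]big_seq; apply: eq_bigr => d; rewrite mem_splits => /eqP e.
by rewrite -[RHS]/(if zbm d.1 + zbm d.2 == b then io f (zbm d.1) * io g (zbm d.2) else 0) -zbmD e zbm_avn // eqxx !io_zbm.
Qed.
HB.instance Definition _ := GRing.isMonoidMorphism.Build O O io io_monoid.

Lemma ioM f g : io (f * g) = io f * io g. Proof. exact: rmorphM. Qed.
Lemma ioD f g : io (f + g) = io f + io g. Proof. exact: rmorphD. Qed.
Lemma ioB f g : io (f - g) = io f - io g. Proof. exact: rmorphB. Qed.
Lemma io0 : io 0 = 0. Proof. exact: rmorph0. Qed.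
Lemma io1 : io 1 = 1. Proof. exact: rmorph1. Qed.
Lemma ioX f m : io (f ^+ m) = io f ^+ m. Proof. exact: rmorphXn. Qed.

Definition thO i o : O := MSeries (fun b => o b *~ av b i).

Lemma thO_zmod i : zmod_morphism (thO i).
Proof. by move=> o o'; apply: mseriesP => b; rewrite -[LHS]/((o b - o' b) *~ _) mulrzBl. Qed.
HB.instance Definition _ i := GRing.isZmodMorphism.Build O O (thO i) (thO_zmod i).

Lemma thOM i o o' : thO i (o * o') = thO i o * o' + o * thO i o'.
Proof.
apply: mseriesP => b; rewrite -[LHS]/((o * o') b *~ av b i) mcoefD !mcoefM.
rewrite mulrz_suml -big_split /= big_seq [RHS]big_seq; apply: eq_bigr => d.
rewrite mem_splits => /eqP <-; by rewrite avD mulrzDr mulrzAl mulrzAr.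
Qed.

Lemma thO_io i f : thO i (io f) = io (theta i f).
Proof.
apply: mseriesP => b; rewrite -[LHS]/((if nonneg b then f (avn b) else 0) *~ av b i).
rewrite -[RHS]/(if nonneg b then f (avn b) *+ avn b i else 0); case: ifP => nb; last by rewrite mul0rz.
by rewrite -{2}[b]zbm_avn // av_zbm.
Qed.

Lemma thO1 i : thO i 1 = 0.
Proof. exact: (der1 (thOM i)). Qed.

(** The series o expands the fraction x. A relation and not a map, because not every fraction
    expands in this ring. *)
Definition agree (x : zfrac K n) (o : O) :=
  exists f h, [/\ h != 0, x = tofr f / tofr h & io f = io h * o].

Lemma agree_tofr f : agree (tofr f) (io f).
Proof. by exists f, 1; split; rewrite ?oner_neq0 ?tofrac1 ?divr1 // io1 mul1r. Qed.

Lemma io_neq0 h : h != 0 -> io h != 0.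
Proof. by move=> h0; rewrite -io0 (inj_eq io_inj). Qed.

Lemma agree_uniq x x' o : agree x o -> agree x' o -> x = x'.
Proof.
move=> [f [h [h0 -> e]]] [f' [h' [h0' -> e']]]; apply/eqP.
rewrite eqr_div ?tofrac_eq0 // -!tofracM tofrac_eq; apply/eqP/io_inj.
by rewrite !ioM e e'; move: (io h) (io h') => u v; ring.
Qed.

Lemma agreeD x x' o o' : agree x o -> agree x' o' -> agree (x + x') (o + o').
Proof.
move=> [f [h [h0 -> e]]] [f' [h' [h0' -> e']]]; exists (f * h' + f' * h), (h * h'); split.
- by rewrite mulf_neq0.
- by rewrite addf_div ?tofrac_eq0 // tofracD !tofracM.
- by rewrite ioD !ioM e e'; move: (io h) (io h') => u v; ring.
Qed.

Lemma agreeM x x' o o' : agree x o -> agree x' o' -> agree (x * x') (o * o').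
Proof.
move=> [f [h [h0 -> e]]] [f' [h' [h0' -> e']]]; exists (f * f'), (h * h'); split.
- by rewrite mulf_neq0.
- by rewrite mulf_div !tofracM.
- by rewrite !ioM e e'; move: (io h) (io h') => u v; ring.
Qed.

Lemma agreeV x o : o \is a GRing.unit -> agree x o -> agree x^-1 o^-1.
Proof.
move=> uo [f [h [h0 -> e]]]; exists h, f; split.
- apply: contraTneq uo => f0; move: e; rewrite f0 io0 => /esym/eqP.
  by rewrite mulf_eq0 (negbTE (io_neq0 h0)) => /eqP ->; rewrite unitr0.
- by rewrite invf_div.
- by rewrite e mulrK.
Qed.

Lemma agree_theta i x o : agree x o -> agree (thetaF i x) (thO i o).
Proof.
move=> [f [h [h0 -> e]]]; exists (theta i f * h - f * theta i h), (h ^+ 2); split.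
- by rewrite expf_neq0.
- exact: thetaF_frac.
- rewrite ioB ioX !ioM -!thO_io e thOM; move: (io h) (thO i o) (thO i _) => u v w; ring.
Qed.

(** The exponent of z_l / z_k for k < l. *)
Definition tb k l : ex := [ffun j : 'I_n => nat_of_bool (k < j <= l)%N].
Definition tO k l : O := smono (tb k l) 1.

Lemma zb_tb k l : (k < l)%N -> zb l = zb k + tb k l.
Proof.
move=> kl; apply/ffunP => j; rewrite !ffunE -[RHS]/(_ + _)%N.
by case: (leqP j k) => jk; case: (leqP j l) => jl //; lia.
Qed.

Lemma tO0 k l : (k < l)%N -> tO k l 0 = 0.
Proof.
move=> kl; rewrite smonoE; case: eqP => // /ffunP/(_ l); rewrite !ffunE kl leqnn //.
Qed.

Lemma one_tO_unit k l : (k < l)%N -> 1 - tO k l \is a GRing.unit.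
Proof.
by move=> kl; apply: (mseries_unit1 dF); rewrite mcoefB tO0 // subr0 mcoef1 eqxx.
Qed.

(** The function z_k z_l / (z_k - z_l)^2 written in x = z_l / z_k, namely x / (1 - x)^2. *)
Definition Bkl k l : O := tO k l * ((1 - tO k l)^-1) ^+ 2.

Lemma io_zvar i : io (zvar K i) = smono (zb i) 1.
Proof. by rewrite io_smono zb_zbm. Qed.

Lemma agree_B k l : (k < l)%N -> agree (tofr (zvar K k) * tofr (zvar K l) /
  (tofr (zvar K k) - tofr (zvar K l)) ^+ 2) (Bkl k l).
Proof.
move=> kl; exists (zvar K k * zvar K l), ((zvar K k - zvar K l) ^+ 2).
have e : io (zvar K l) = io (zvar K k) * tO k l.
  by rewrite !io_zvar (zb_tb kl) /tO smonoM mulr1.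
have u := one_tO_unit kl; split.
- rewrite expf_neq0 // -(inj_eq io_inj) io0 ioB e -{1}[io (zvar K k)]mulr1 -mulrBr.
  rewrite mulf_neq0 //; last by apply: contraTneq u => ->; rewrite unitr0.
  by rewrite io_zvar; apply/eqP => /(congr1 (fun f : O => f (zb k))); rewrite smonoE eqxx => /eqP; rewrite oner_eq0.
- by rewrite tofracM tofracXn tofracB.
rewrite ioX ioB ioM e /Bkl; move: (io (zvar K k)) (tO k l) u => u v hu.
have -> : (u - u * v) ^+ 2 * (v * (1 - v)^-1 ^+ 2) = u * (u * v) * ((1 - v) * (1 - v)^-1) ^+ 2.
  by move: ((1 - v)^-1) => w; ring.
by rewrite divrr // expr1n mulr1.
Qed.

End Expansion.

(** * Residues against powers of X *)

Section Euler.
Variables (K : fieldType) (qK : qalg K).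
Implicit Types f g : mseries nat K.

Definition eul : mseries nat K -> mseries nat K := cder (id : nat -> nat) (id : nat -> nat).

Lemma eulE f k : eul f k = f k *+ k. Proof. by []. Qed.

Lemma eul_leibniz : leibniz eul.
Proof.
move=> f g; apply: mseriesP => k; rewrite eulE mcoefD !mcoefM -sumrMnl -big_split /=.
rewrite big_seq [RHS]big_seq; apply: eq_bigr => d; rewrite mem_splits => /eqP <-.
by rewrite mulrnDr mulrnAl mulrnAr.
Qed.

Lemma Xs_sderiv f : Xs K * sderiv f = eul f.
Proof. by apply: mseriesP => -[|k]; rewrite mcoefXs // eulE mulr0n. Qed.

Lemma eul_scomp f (x : mseries nat K) : x 0%N = 0 ->
  eul (scomp f x) = eul x * scomp (sderiv f) x.
Proof.
move=> x0; apply: mseriesP => k; pose h := @smono nat K 0%N.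
have E1 g N : (k < N)%N -> forall j, (j <= k)%N -> scomp g x j = (\sum_(i < N) h (g i) * x ^+ i) j.
  by move=> kN j jk; rewrite (scomp_hcomp degN x0) (@hcompE _ _ _ _ _ _ _ _ _ N) //; exact: leq_ltn_trans kN.
rewrite eulE (E1 f k.+2) //.
rewrite (@eq_mcoefMr _ degN _ _ _ (\sum_(i < k.+1) h (sderiv f i) * x ^+ i)); last by move=> j; exact: E1.
rewrite -[LHS]/(eul (\sum_(i < k.+2) h (f i) * x ^+ i) k); congr (mcoef _ k).
rewrite /eul cder_sum big_ord_recl expr0 mulr1 mulr_sumr.
have -> : cder id id (h (f 0%N)) = 0.
  by apply: mseriesP => j; rewrite -[LHS]/(h (f 0%N) j *+ j) smonoE; case: j => // j; rewrite mul0rn.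
rewrite add0r; apply: eq_bigr => i _; rewrite leibnizC (leibnizX eul_leibniz) lift0 /= -/eul.
have -> : h (sderiv f i) = h (f i.+1) *+ i.+1 by rewrite /h -smonoMn.
rewrite -[_ *+ i.+1 in LHS]mulr_natl -[h _ *+ _]mulr_natl.
rewrite -[smono 0 (f i.+1)]/(h (f i.+1)); by move: (h _) (x ^+ i) (eul x) => u v w; ring.
Qed.

End Euler.

Lemma smonoM_coef (K : comNzRingType) n (m c : {ffun 'I_n -> nat}) (a : K) f :
  (smono m a * f) (m + c) = a * f c.
Proof.
rewrite mcoefM (bigD1_seq (m, c)) ?splits_uniq ?mem_splits ?eqxx //= eqxx.
rewrite big_seq_cond big1 ?addr0 // => -[u v] /andP[]; rewrite mem_splits /= => /eqP e ne.
case: eqP => [um|]; last by rewrite mul0r.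
case/eqP: ne; rewrite um in e *; congr (_, _); apply/ffunP => i.
by have /ffunP/(_ i) := e; rewrite !ffunE => /addnI.
Qed.

Lemma qint_eq0 (K : fieldType) (qK : qalg K) (z : int) : z%:~R = 0 :> K -> z = 0.
Proof.
case: z => [[|m]|m] // /eqP; first by rewrite -[_%:~R]/(m.+1%:R) (negbTE (qnat_neq0 qK m)).
by rewrite NegzE rmorphN /= oppr_eq0 -[_%:~R]/(m.+1%:R) (negbTE (qnat_neq0 qK m)).
Qed.

Section XFunctional.
Variables (K : fieldType) (qK : qalg K) (n : nat) (psi y : mseries nat K).
Hypotheses (psi0 : psi 0%N = 0) (y0 : y 0%N = 0).
Local Notation ex := {ffun 'I_n -> nat}.
Local Notation O := (zser K n).
Local Notation io := (@iota_z K n).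
Local Notation eul := (@eul K).
Implicit Types (i j : 'I_n) (b : ex) (o : O).

Lemma theta_at_z i j (f : mseries nat K) : theta i (at_z j f) = if i == j then at_z i (eul f) else 0.
Proof.
apply: mseriesP => r; rewrite -[LHS]/(at_z j f r *+ r i) at_z_coef.
have [->|ij] := eqVneq i j.
  by rewrite at_z_coef eulE; case: (r == _) => //; rewrite mul0rn.
case: eqP => [->|]; last by rewrite mul0rn.
have -> : (dexp j *+ r j : ex) i = 0%N by rewrite dexpE (negbTE ij).
by rewrite mulr0n.
Qed.

Lemma at_zM i (f g : mseries nat K) : at_z i (f * g) = at_z i f * at_z i g :> O.
Proof. exact: rmorphM. Qed.

Lemma mcoef0M (f g : O) : (f * g) 0 = f 0 * g 0.
Proof. exact: (rmorphM (mconst (degF 'I_n))). Qed.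

Lemma thO_at_z i j f : thO i (io (at_z j f)) = if i == j then io (at_z i (eul f)) else 0.
Proof. by rewrite thO_io theta_at_z; case: ifP => _ //; exact: io0. Qed.

Definition Ez : mseries nat K := scomp psi y.
Definition Gz (c : K) : mseries nat K := expS (smono 0%N c * Ez).

Lemma Ez0 : Ez 0%N = 0.
Proof. by rewrite /Ez (scomp_hcomp degN y0) hcomp0 psi0 rmorph0. Qed.

Lemma cEz0 c : (smono 0%N c * Ez) 0%N = 0.
Proof. by rewrite mcoefCM Ez0 mulr0. Qed.

Lemma QserE : Qser psi y = 1 - eul Ez.
Proof. by rewrite /Qser /Ez eul_scomp // Xs_sderiv. Qed.

Lemma eulGz c : eul (Gz c) = smono 0%N c * eul Ez * Gz c.
Proof. have -> : eul (Gz c) = eul (smono 0%N c * Ez) * Gz c by exact: (cder_expS degN qK (@eul_leibniz K) (cEz0 c)).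
by rewrite /eul leibnizC. Qed.

Lemma Gz0c c : Gz c 0%N = 1.
Proof. exact: (expS0c degN (cEz0 c)). Qed.

Lemma Qser0 : Qser psi y 0%N = 1.
Proof. by rewrite QserE mcoefB eulE mulr0n subr0 mcoef1. Qed.

Definition aK b i : K := (av b i)%:~R.
Definition Fz b : O := \prod_i io (at_z i (Gz (aK b i) * Qser psi y)).
(** The residue of o against the product of X_i^(-a_i) dX_i / X_i with a_i = [av b i]: here X^(-a) =
    z^(-a) e^(a psi(y)) and dX / X = Q dz / z. *)
Definition Xf b o : K := (Fz b * o) b.
Definition Qo i : O := io (at_z i (Qser psi y)).
Definition DO i o : O := (Qo i)^-1 * thO i o.

Lemma io_at_z0 i f : io (at_z i f) 0 = f 0%N.
Proof.
have -> : (0 : ex) = zbm (0 : ex).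
  by apply/ffunP => j; rewrite !ffunE big1 // => l _; rewrite ffunE.
by rewrite io_zbm at_z_coef ffunE mulr0n eqxx.
Qed.

Lemma Qo_unit i : Qo i \is a GRing.unit.
Proof. by apply: (mseries_unit1 (degF 'I_n)); rewrite io_at_z0 Qser0. Qed.

(** Integration by parts: at zeta^b the operator theta_i multiplies coefficients by a_i, and the
    derivative of e^(a_i psi(y_i)) combines with this to the factor Q_i = 1 - theta_i psi(y_i). *)
Lemma Xf_D b i o : Xf b (DO i o) = aK b i * Xf b o.
Proof.
pose P : O := \prod_(j | j != i) io (at_z j (Gz (aK b j) * Qser psi y)).
pose g : O := io (at_z i (Gz (aK b i))); pose e : O := io (at_z i (eul Ez)).
have FE : Fz b = g * Qo i * P.
  by rewrite /Fz (bigD1 i) //= /g /Qo -ioM -rmorphM.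
have tP : thO i P = 0.
  rewrite /P; elim/big_ind: _ => [|u v hu hv|j ji]; first exact: thO1.
    by rewrite thOM hu hv mul0r mulr0 addr0.
  by rewrite thO_at_z eq_sym (negbTE ji).
have tg : thO i g = smono 0 (aK b i) * e * g.
  rewrite thO_at_z eqxx eulGz /g /e !at_zM !ioM; congr (_ * _ * _).
  rewrite at_zE hcomp_smono expr0 mulr1 io_smono; congr (smono _ _).
  by apply/ffunP => l; rewrite !ffunE big1 // => l' _; rewrite ffunE.
have QE : Qo i = 1 - e by rewrite /Qo QserE rmorphB rmorph1 ioB io1.
have th : thO i (g * P * o) b = (g * P * o) b * aK b i.
  by rewrite -[LHS]/((g * P * o) b *~ av b i) -mulrzr.
have lz : thO i (g * P * o) = smono 0 (aK b i) * (e * (g * P * o)) + g * P * thO i o.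
  by rewrite !thOM tP mulr0 addr0 tg; ring.
rewrite /Xf FE /DO; have -> : g * Qo i * P * ((Qo i)^-1 * thO i o) = g * P * thO i o.
  have u := Qo_unit i; move: (Qo i) u (thO i o) => q u x.
  have -> : g * q * P * (q^-1 * x) = (q * q^-1) * (g * P * x) by move: (q^-1) => q'; ring.
  by rewrite divrr // mul1r.
have -> : g * Qo i * P * o = g * P * o - e * (g * P * o) by rewrite QE; ring.
have := congr1 (fun x : O => x b) lz; rewrite th mcoefD mcoefCM => h.
by rewrite mcoefB mulrBr [aK b i * (g * P * o) b]mulrC h addrAC subrr add0r.
Qed.

Lemma Xf_eq b o o' : (forall c, (degF 'I_n c <= degF 'I_n b)%N -> o c = o' c) -> Xf b o = Xf b o'.
Proof. by move=> e; exact: (eq_mcoefMr (dg := degF 'I_n)). Qed.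

Lemma XfB b o o' : Xf b (o - o') = Xf b o - Xf b o'.
Proof. by rewrite /Xf mulrBr mcoefB. Qed.

Lemma Xf_sum b I (r : seq I) (P : pred I) (F : I -> O) :
  Xf b (\sum_(i <- r | P i) F i) = \sum_(i <- r | P i) Xf b (F i).
Proof. by rewrite /Xf mulr_sumr mcoef_sum. Qed.

Lemma XfZ b c o : Xf b (smono 0 c * o) = c * Xf b o.
Proof. by rewrite /Xf mulrCA mcoefCM. Qed.

Lemma Fz0 b : Fz b 0 = 1.
Proof.
rewrite /Fz; elim/big_ind: _ => [|u v hu hv|i _]; first by rewrite mcoef1 eqxx.
  by rewrite mcoef0M hu hv mulr1.
by rewrite io_at_z0 mcoefM_nat big_ord1 Gz0c mul1r; exact: Qser0.
Qed.

(** The weight has constant term 1, so residues are triangular in the coefficients of o. *)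
Lemma Xf_inj o : (forall b, Xf b o = 0) -> o = 0.
Proof.
move=> h; apply: mseriesP => b; have [m] := ubnP (degF 'I_n b); elim: m b => // m IH b bm.
have := h b; rewrite /Xf mcoefM (bigD1_seq (0, b)) ?splits_uniq ?mem_splits ?add0r ?eqxx //=.
rewrite Fz0 mul1r big_seq_cond big1 ?addr0 // => -[c d] /andP[]; rewrite mem_splits /= => /eqP cd ne.
rewrite [o d]IH ?mulr0 //; have := congr1 (degF 'I_n) cd; rewrite degD => e.
have c0 : degF 'I_n c != 0%N.
  by apply: contraNneq ne => c0; rewrite -cd (deg_eq0 c0) add0r.
by move: bm; rewrite -e; lia.
Qed.

Lemma Xser_eul : eul (Xser psi y) = Qser psi y * Xser psi y.
Proof.
have NE : (- Ez) 0%N = 0 by rewrite mcoefN Ez0 oppr0.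
have eX : eul (Xs K) = Xs K.
  apply: mseriesP => k; rewrite eulE; case: k => [|[|k]]; rewrite ?mulr0n ?mulr1n //.
  by rewrite -[Xs K k.+2]/(0 : K) mul0rn.
rewrite /Xser -/(Xs K) -/Ez eul_leibniz eX.
have -> : eul (expS (- Ez)) = eul (- Ez) * expS (- Ez) by exact: (cder_expS degN qK (@eul_leibniz K) NE).
have -> : eul (- Ez) = - eul Ez by exact: (raddfN (cder id id)).
by rewrite QserE; ring.
Qed.

(** A monomial in the X_i is an eigenvector of all D_i, so its residue vanishes unless k_i = a_i for
    all i; in that case only leading coefficients meet. *)
Lemma Xf_X b (k : ex) : Xf b (io (\prod_i at_z i (Xser psi y) ^+ k i)) = (b == zbm k)%:R.
Proof.
set M := io _; have DM i : DO i M = smono 0 (k i)%:R * M.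
  have ME : M = io (at_z i (Xser psi y) ^+ k i) * io (\prod_(j | j != i) at_z j (Xser psi y) ^+ k j).
    by rewrite /M (bigD1 i) //= ioM.
  have t0 : thO i (io (\prod_(j | j != i) at_z j (Xser psi y) ^+ k j)) = 0.
    elim/big_ind: _ => [|u v hu hv|j ji]; first by rewrite io1 thO1.
      by rewrite ioM thOM hu hv mul0r mulr0 addr0.
    by rewrite -rmorphXn thO_at_z eq_sym (negbTE ji).
  have eX m : eul (Xser psi y ^+ m) = Qser psi y * Xser psi y ^+ m *+ m.
    rewrite /eul (leibnizX (@eul_leibniz K)) -/eul Xser_eul; case: m => [|m]; first by rewrite !mulr0n.
    by congr (_ *+ _); rewrite exprS /=; ring.
  have t1 : thO i (io (at_z i (Xser psi y) ^+ k i)) = Qo i * io (at_z i (Xser psi y) ^+ k i) *+ k i.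
    rewrite -rmorphXn thO_at_z eqxx eX raddfMn /Qo -ioM -rmorphM.
    exact: (raddfMn io).
  have u := Qo_unit i; rewrite /DO {1}ME thOM t0 mulr0 addr0 t1 ME.
  rewrite mulrnAl mulrnAr !mulrA mulVr // mul1r -mulrA -[_ *+ k i]mulr_natl; congr (_ * _).
  by rewrite (rmorph_nat (@smono ex K 0)).
have [->|ne] := eqVneq b (zbm k); last first.
  have [i hi] : exists i, av b i != av (zbm k) i.
    apply: contrapT => h; case/eqP: ne; apply: av_inj => i; apply/eqP/negPn/negP => hi; apply: h; by exists i.
  have := Xf_D b i M; rewrite DM XfZ => /esym/eqP; rewrite -subr_eq0 -mulrBl mulf_eq0 => /orP[|/eqP //].
  rewrite /aK -[(k i)%:R]/((k i)%:Z%:~R) -rmorphB /= => /eqP/(qint_eq0 qK)/eqP.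
  by rewrite subr_eq0 -av_zbm (negbTE hi).
have zX i : at_z i (Xser psi y) = zvar K i * at_z i (expS (- Ez)).
  by rewrite /Xser at_zM; congr (_ * _); rewrite at_zE hcomp_smono expr1 rmorph1 mul1r.
pose R : O := \prod_i at_z i (expS (- Ez)) ^+ k i.
have ME : M = smono (zbm k) 1 * io R.
  rewrite /M (eq_bigr (fun i => zvar K i ^+ k i * at_z i (expS (- Ez)) ^+ k i)) => [|i _]; last by rewrite zX exprMn.
  rewrite big_split /= ioM -io_smono; congr (io _ * _).
  transitivity (smono (\sum_i dexp i *+ k i) 1 : O); last first.
    congr (smono _ _); apply/ffunP => j; rewrite sum_ffunE (bigD1 j) //= dexpE eqxx big1 ?addr0 // => i ij.
    by rewrite dexpE eq_sym (negbTE ij).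
  elim/big_ind2: _ => // [u u' v v' -> ->|i _]; first by rewrite smonoM mulr1.
  by rewrite /zvar smono1X expr1n.
rewrite /Xf ME mulrCA -[X in mcoef _ X](addr0 (zbm k)) smonoM_coef mul1r.
rewrite mcoef0M Fz0 mul1r /R; elim/big_ind: _ => [|u v hu hv|i _]; first by rewrite io1 mcoef1 eqxx.
  by rewrite ioM mcoef0M hu hv mulr1.
have NE : (- Ez) 0%N = 0 by rewrite mcoefN Ez0 oppr0.
rewrite ioX; elim: (k i) => [|m IH]; first by rewrite expr0 mcoef1 eqxx.
by rewrite exprS mcoef0M IH io_at_z0 (expS0c degN NE) mulr1.
Qed.

End XFunctional.

(** * Words as sums over multigraphs *)

Section BoxSums.
Variables (I : finType) (B : nat) (Q : I -> pred 'I_B.+1).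
Implicit Types (E : {set I}) (d : {ffun I -> 'I_B.+1}).
Hypothesis Q0 : forall e, Q e ord0.

Definition inbox E d := [forall e, if e \in E then Q e (d e) else d e == ord0].
Definition comb E d d' : {ffun I -> 'I_B.+1} := [ffun e => if e \in E then d e else d' e].

Lemma inbox_out E d e : inbox E d -> e \notin E -> d e = ord0.
Proof. by move=> /forallP/(_ e) + /negbTE eE; rewrite eE => /eqP. Qed.

Lemma inbox_in E d e : inbox E d -> e \in E -> Q e (d e).
Proof. by move=> /forallP/(_ e) + eE; rewrite eE. Qed.

Lemma sum_inboxU (V : nmodType) E E' (G : {ffun I -> 'I_B.+1} -> V) : [disjoint E & E']%B ->
  \sum_(d | inbox (E :|: E') d) G d =
  \sum_(d | inbox E d) \sum_(d' | inbox E' d') G (comb E d d').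
Proof.
move=> dis; rewrite pair_big /=.
pose z : {ffun I -> 'I_B.+1} := [ffun=> ord0].
rewrite (reindex_onto (fun p => comb E p.1 p.2) (fun d => (comb E d z, comb E' d z))) /=; last first.
  move=> d hd; apply/ffunP => e; rewrite !ffunE /=; case: (boolP (e \in E)) => // eE.
  by case: ifPn => // eE'; rewrite (inbox_out hd) // inE negb_or eE.
have disE e : e \in E -> e \in E' = false by move=> eE; apply: (disjointFr dis eE).
apply: eq_bigl => -[d d'] /=; apply/andP/andP => [[/forallP h /eqP[h1 h2]]|[/forallP h /forallP h']].
  split; apply/forallP => e; have := h e; rewrite !inE !ffunE.
    case: (boolP (e \in E)) => eE //= _; have /ffunP/(_ e) := h1; rewrite !ffunE (negbTE eE) => <-; exact: eqxx.
  case: (boolP (e \in E)) => eE /=; last by case: ifP => //= eE' _; have /ffunP/(_ e) := h2; rewrite !ffunE eE' => <-.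
  by rewrite (disE _ eE) => _; have /ffunP/(_ e) := h2; rewrite !ffunE (disE _ eE) => <-.
split.
  apply/forallP => e; have := h e; have := h' e; rewrite !inE !ffunE.
  by case: (boolP (e \in E)) => [eE _ //|_]; case: (e \in E').
apply/eqP; congr (_, _); apply/ffunP => e; rewrite !ffunE; have := h e; have := h' e.
  by case: (boolP (e \in E)) => // _ _ /eqP ->.
case: (boolP (e \in E')) => [eE' _ _|_ /eqP -> //].
by case: (boolP (e \in E)) => // eE; rewrite (disE _ eE) in eE'.
Qed.

Lemma prod_sum_inbox (A : comNzRingType) E (F : I -> 'I_B.+1 -> A) :
  \prod_(e in E) \sum_(c | Q e c) F e c = \sum_(d | inbox E d) \prod_(e in E) F e (d e).
Proof.
rewrite (big_distr_big_dep ord0); apply: eq_bigl => d; apply/pfamilyP/forallP => [[h1 h2] e|h].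
  by case: ifP => eE; [exact: h2|apply/negPn/negP => h; have := fintype.subsetP h1 e; rewrite inE eE => /(_ h)].
split=> [|e eE]; last by have := h e; rewrite eE.
by apply/fintype.subsetP => e; rewrite inE; have := h e; case: ifP => // _ /eqP -> /eqP.
Qed.

End BoxSums.

Lemma connect_restrict (T : finType) (r r' : rel T) (A : {set T}) x z :
  (forall u w, u \in A -> r u w -> (w \in A) && r' u w) -> x \in A ->
  connect r x z -> connect r' x z && (z \in A).
Proof.
move=> h Ax /connectP[p]; elim: p x Ax => [|w p IH] x Ax /=; first by move=> _ ->; rewrite connect0.
move=> /andP[xw pw] zE; have /andP[Aw xw'] := h _ _ Ax xw.
have /andP[c ->] := IH w Aw pw zE; rewrite andbT; exact: connect_trans (connect1 xw') c.
Qed.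

Section WordExpansion.
Variables (L : idomainType) (qL : qalg L) (n : nat) (a : 'I_n -> int) (kp : 'I_n -> nat -> L) (t0 : nat -> L).
Variables (B : nat) (D : 'I_n -> nat).
Hypotheses (DB : forall i, (D i <= B.+1)%N) (D0 : forall i, (0 < D i)%N).
Hypothesis DD : forall i j : 'I_n, (i < j)%N -> (`|a j| + n * D j < D i)%N.
Local Notation I := ('I_n * 'I_n)%type.
Local Notation ds := {ffun I -> 'I_B.+1}.
Implicit Types (S T : {set 'I_n}) (d : ds) (i j : 'I_n) (t : nat -> L).

Definition Qb (e : I) (c : 'I_B.+1) : bool := (c < D e.1)%N.
Definition edg S : {set I} := [set e : I | [&& (e.1 < e.2)%N, e.1 \in S & e.2 \in S]]%SET.
(** The index of h at letter i: contractions with later letters raise it, contractions with earlier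
    ones lower it. *)
Definition Ms d i : int := a i + \sum_j (d (i, j) : nat)%:Z - \sum_j (d (j, i) : nat)%:Z.
Definition hse (e : I) (c : nat) : L := hs (fun k => kp e.1 k * kp e.2 k) c.
Definition Wt S t d : L := (\prod_e hse e (d e)) * \prod_(i in S) he (kp i) t (Ms d i).

Lemma Qb0 e : Qb e ord0. Proof. exact: D0. Qed.
Local Notation inb S := (inbox Qb (edg S)).

Lemma edg_out S d i j : inb S d -> (i \notin S) || (j \notin S) || (j <= i)%N -> d (i, j) = ord0.
Proof. by move=> hd h; apply: (inbox_out hd); rewrite inE /=; case: (i \in S) (j \in S) h => -[] //=; rewrite ?andbF // andbT -leqNgt. Qed.

(** Incoming edges lower the index, and each of the n outgoing multiplicities is at most [D j]. [DD]
    leaves room for this, so truncating at [D i] loses no term. *)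
Lemma Ms_bound S d i j : inb S d -> (i < j)%N -> Ms d j < (D i)%:Z.
Proof.
move=> hd ij; have h1 : (\sum_l (d (j, l) : nat) <= n * D j)%N.
  rewrite -[X in (_ <= X * _)%N](card_ord n) -sum_nat_const; apply: leq_sum => l _.
  case: (boolP ((j, l) \in edg S)) => jl; last by rewrite (inbox_out hd jl).
  exact/ltnW/(inbox_in hd jl).
have h2 : 0 <= \sum_l (d (l, j) : nat)%:Z by apply: sumr_ge0.
have := DD ij; rewrite /Ms -(big_morph Posz PoszD (erefl 0%:Z)); move: h1 h2.
move: (\sum_l _)%N (\sum_l (d (l, j) : nat)%:Z) => u v; lia.
Qed.

Lemma Wt_set0 t : \sum_(d | inb finset.set0 d) Wt finset.set0 t d = 1.
Proof.
rewrite (big_pred1 [ffun=> ord0]) => [|d]; last first.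
  apply/forallP/eqP => [h|-> e]; last by rewrite !inE ?andbF ffunE.
  by apply/ffunP => e; have := h e; rewrite !inE ?andbF ffunE => /eqP.
rewrite /Wt big_set0 mulr1 big1 // => e _; rewrite ffunE; exact: hsym0.
Qed.

(** The shift of the first letter i acts on every h to its right; by [he_sh] the order in s of its
    effect on letter j is the multiplicity of the edge (i, j). *)
Lemma word_expand (s : seq 'I_n) t : sorted (fun i j : 'I_n => i < j)%N s ->
  word [seq (a i, kp i) | i <- s] (fun=> 1) t =
  \sum_(d | inb [set i in s]%SET d) Wt [set i in s]%SET t d.
Proof.
elim: s t => [|i s IH] t ss.
  have -> : [set i in [::] : seq 'I_n]%SET = finset.set0 by apply/setP => j; rewrite !inE.
  by rewrite Wt_set0.
have si j : j \in s -> (i < j)%N.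
  have tr : transitive (fun i j : 'I_n => i < j)%N by move=> y x z; exact: ltn_trans.
  by move: ss => /=; rewrite (path_sortedE tr) => /andP[/allP h _]; exact: h.
have {}IH := IH _ (path_sorted ss); rewrite -[LHS]/(Eop (a i) (kp i) (word [seq (a j, kp j) | j <- s] (fun=> 1)) t).
set S := [set j in s]%SET; have iS : i \notin S by rewrite inE; apply/negP => /si; rewrite ltnn.
have Si j : j \in S -> (i < j)%N by rewrite inE; exact: si.
pose R : {set I} := [set e : I | (e.1 == i) && (e.2 \in S)]%SET.
have ES : edg [set j in i :: s]%SET = edg S :|: R.
  apply/setP => -[u w]; rewrite !inE /=; case: (eqVneq u i) => [->|ui] /=.
    case: (eqVneq w i) => [->|wi] /=; first by rewrite ltnn; move: iS; rewrite inE => /negbTE ->.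
    by case: (boolP (w \in s)) => ws; rewrite ?andbF ?andbT //= si // orbT.
  case: (eqVneq w i) => [->|wi] /=; last by rewrite orbF.
  have -> : i \in s = false by move: iS; rewrite inE => /negbTE.
  rewrite andbT !andbF; case: (boolP (u \in s)) => us; rewrite ?andbF // andbT.
  by apply/negbTE; rewrite -leqNgt; exact/ltnW/si.
have dis : [disjoint edg S & R]%B.
  apply/pred0P => -[u w] /=; rewrite !inE /=; case: eqP => [->|]; last by rewrite andbF.
  by move: iS; rewrite inE => /negbTE ->; rewrite andbF.
pose cf (d f : ds) : L := (\prod_e hse e (d e)) * \prod_(j in S) (hse (i, j) (f (i, j)) * he (kp j) t (Ms d j - (f (i, j) : nat)%:Z)).
pose ce (f : ds) : nat := (\sum_(j in S) f (i, j))%N.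
pose cond (p : ds * ds) := inb S p.1 && inbox Qb R p.2.
rewrite (@Eop_eval L qL _ _ _ _ (prod ds ds) (fun p => if cond p then cf p.1 p.2 else 0) (fun p => ce p.2)); last first.
  move=> x; rewrite IH -/S.
  transitivity (\sum_(p : ds * ds | cond p) cf p.1 p.2 * x ^+ ce p.2); last first.
    by rewrite big_mkcond; apply: eq_bigr => p _; case: ifP; rewrite ?mul0r.
  rewrite /cond -(pair_big (fun d => inb S d) (fun f => inbox Qb R f) (fun d f => cf d f * x ^+ ce f)) /=.
  apply: eq_bigr => d hd; rewrite /Wt /cf.
  under [RHS]eq_bigr => f _ do rewrite -mulrA; rewrite -mulr_sumr; congr (_ * _).
  pose F (e : I) (c : 'I_B.+1) : L := hse e c * x ^+ c * he (kp e.2) t (Ms d e.2 - (c : nat)%:Z).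
  have RE (G : I -> L) : \prod_(e in R) G e = \prod_(j in S) G (i, j).
    rewrite (reindex_onto (fun j => (i, j)) (fun e : I => e.2)) /=; last by move=> [u w]; rewrite inE /= => /andP[/eqP -> _].
    by apply: eq_bigl => j; rewrite eqxx andbT inE /= eqxx.
  transitivity (\prod_(e in R) \sum_(c | Qb e c) F e c).
    rewrite RE; apply: eq_bigr => j jS; rewrite (@he_sh L qL _ _ _ _ _ (D i)) ?(Ms_bound hd (Si _ jS)) //.
    by rewrite (big_ord_widen B.+1 (fun c => hs (fun k => kp i k * kp j k) c * x ^+ c * he (kp j) t (Ms d j - c%:Z))).
  rewrite prod_sum_inbox; apply: eq_bigr => f hf; rewrite RE /F /ce /= -prodrXr -big_split /=.
  by apply: eq_bigr => j _; rewrite mulrAC.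
have -> : [set j in i :: s]%SET = (i |: S)%SET by apply/setP => j; rewrite !inE.
rewrite -{1}[(i |: S)%SET](_ : [set j in i :: s]%SET = _); last by apply/setP => j; rewrite !inE.
rewrite ES sum_inboxU // pair_big /= [RHS]big_mkcond; apply: eq_bigr => -[d f] _ /=; rewrite -/(cond (d, f)).
case: (boolP (cond (d, f))) => [/andP[/= hd hf]|]; last by rewrite mul0r.
have R0 e : e \notin R -> f e = ord0 by move=> eR; exact: (inbox_out hf eR).
have cE u w : comb (edg S) d f (u, w) = if u == i then f (u, w) else d (u, w).
  rewrite ffunE; case: ifP => eS; first by move: eS; rewrite inE /=; case: (eqVneq u i) => [->|//]; rewrite (negbTE iS) andbF.
  case: eqVneq => // ui; rewrite (inbox_out hd) ?eS // R0 // inE /= (negbTE ui) //.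
have d0 u : d (u, i) = ord0 by apply: (edg_out hd); rewrite iS orbT.
have d0' u : d (i, u) = ord0 by apply: (edg_out hd); rewrite iS.
have f0 u w : u != i -> f (u, w) = ord0 by move=> ui; apply: R0; rewrite inE /= (negbTE ui).
have fi w : w \notin S -> f (i, w) = ord0 by move=> wS; apply: R0; rewrite inE /= (negbTE wS) andbF.
have Mi : Ms (comb (edg S) d f) i = a i + (ce f)%:Z.
  rewrite /Ms [X in _ - X]big1 ?subr0 => [|j _]; last first.
    by rewrite cE; case: eqVneq => [->|_]; [rewrite fi|rewrite d0].
  congr (_ + _); rewrite /ce (big_morph Posz PoszD (erefl 0%:Z)) [RHS]big_mkcond /=.
  by apply: eq_bigr => j _; rewrite cE eqxx; case: ifPn => // /fi ->.
have Mj j : j \in S -> Ms (comb (edg S) d f) j = Ms d j - (f (i, j) : nat)%:Z.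
  move=> jS; have ji : j != i by apply: contraTneq jS => ->.
  rewrite /Ms -!addrA; congr (_ + _); congr (_ + _).
    by apply: eq_bigr => l _; rewrite cE (negbTE ji).
  rewrite -opprD; congr (- _); rewrite (bigD1 i) //= [in RHS](bigD1 i) //= cE eqxx d0' add0r addrC; congr (_ + _).
  by apply: eq_bigr => l li; rewrite cE (negbTE li).
rewrite /Wt big_setU1 //= Mi; have -> : \prod_(j in S) he (kp j) t (Ms (comb (edg S) d f) j) =
    \prod_(j in S) he (kp j) t (Ms d j - (f (i, j) : nat)%:Z) by apply: eq_bigr => j /Mj ->.
have -> : \prod_e hse e (comb (edg S) d f e) = (\prod_e hse e (d e)) * \prod_(j in S) hse (i, j) (f (i, j)).
  transitivity (\prod_e (hse e (d e) * (if e \in R then hse e (f e) else 1))).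
    apply: eq_bigr => -[u w] _; rewrite cE; case: eqVneq => [->|ui].
      rewrite d0' /hse hsym0 mul1r; case: ifPn => // h; rewrite R0 ?hsym0 //.
    by rewrite inE /= (negbTE ui) mulr1.
  rewrite big_split; congr (_ * _); rewrite -big_mkcond /=.
  rewrite (reindex_onto (fun j => (i, j)) (fun e : I => e.2)) /=; last by move=> [u w]; rewrite inE /= => /andP[/eqP -> _].
  by apply: eq_bigl => j; rewrite eqxx andbT inE /= eqxx.
by rewrite /cf big_split /=; move: (\prod_e _) (\prod_(j in S) _) (\prod_(j in S) _) (he _ _ _) => *; ring.
Qed.

Definition adj d : rel 'I_n := fun k l => (d (k, l) != ord0) || (d (l, k) != ord0).
Definition cnct T d := [forall x in T, forall z in T, connect (adj d) x z].

Lemma adj_sym d x z : adj d x z = adj d z x. Proof. exact: orbC. Qed.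

Lemma Wt_comb T T' t d d' : [disjoint T & T']%B -> inb T d -> inb T' d' ->
  Wt (T :|: T') t (comb (edg T) d d') = Wt T t d * Wt T' t d'.
Proof.
move=> dis hd hd'.
have cE u w : (u \in T) || (w \in T) -> comb (edg T) d d' (u, w) = d (u, w) /\ d' (u, w) = ord0.
  move=> h; have d'0 : d' (u, w) = ord0.
    apply: (edg_out hd'); case/orP: h => h; rewrite (disjointFr dis h) ?orbT //.
  by split=> //; rewrite ffunE; case: ifPn => // eT; rewrite d'0 (inbox_out hd eT).
have cE' u w : ~~ ((u \in T) || (w \in T)) -> comb (edg T) d d' (u, w) = d' (u, w) /\ d (u, w) = ord0.
  rewrite negb_or => /andP[h1 h2]; have eT : (u, w) \notin edg T by rewrite inE /= (negbTE h1) andbF.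
  by split; [rewrite ffunE (negbTE eT)|rewrite (inbox_out hd eT)].
rewrite /Wt mulrACA; congr (_ * _).
  rewrite -big_split /=; apply: eq_bigr => -[u w] _; case: (boolP ((u \in T) || (w \in T))) => h.
    by have [-> ->] := cE _ _ h; rewrite /hse hsym0 mulr1.
  by have [-> ->] := cE' _ _ h; rewrite /hse hsym0 mul1r.
rewrite (eq_bigl (mem [predU T & T'])) => [|i]; last by rewrite !inE.
rewrite bigU //=; congr (_ * _); apply: eq_bigr => i hi; congr (he _ _ _); rewrite /Ms.
  by congr (_ + _ - _); apply: eq_bigr => j _; rewrite (cE _ _ _).1 // hi ?orbT.
have iT : i \notin T by rewrite (disjointFl dis hi).
congr (_ + _ - _); apply: eq_bigr => j _.
  case: (boolP (j \in T)) => jT; last by rewrite (cE' _ _ _).1 // negb_or iT.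
  by have [-> ->] := cE i j (introT orP (or_intror jT)); rewrite (edg_out hd) // iT.
case: (boolP (j \in T)) => jT; last by rewrite (cE' _ _ _).1 // negb_or iT jT.
by have [-> ->] := cE j i (introT orP (or_introl jT)); rewrite (edg_out hd) // iT orbT.
Qed.

Lemma edgU T S : T \subset S -> edg T :|: edg (S :\: T) \subset edg S.
Proof.
move=> /fintype.subsetP TS; apply/fintype.subsetP => -[u w]; rewrite !inE /= => /orP[/and3P[-> /TS -> /TS ->] //|].
by move=> /and3P[-> /andP[_ ->] /andP[_ ->]].
Qed.

Lemma edg_dis T S : [disjoint edg T & edg (S :\: T)]%B.
Proof.
apply/pred0P => -[u w] /=; rewrite !inE /=; apply/negP => /andP[/and3P[_ uT _] /and3P[_ /andP[h _] _]].
by rewrite uT in h.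
Qed.

(** T is the connected component of x, and the weight factors over components. *)
Lemma Wt_cumulant S t x : x \in S ->
  \sum_(d | inb S d) Wt S t d =
  \sum_(T : {set 'I_n} | (T \subset S) && (x \in T))
    (\sum_(d | inb T d && cnct T d) Wt T t d) * (\sum_(d | inb (S :\: T) d) Wt (S :\: T) t d).
Proof.
move=> xS; pose cp d : {set 'I_n} := [set z | connect (adj d) x z]%SET.
rewrite (partition_big cp (fun T : {set 'I_n} => (T \subset S) && (x \in T))) /=; last first.
  move=> d hd; rewrite inE connect0 andbT; apply/fintype.subsetP => z; rewrite inE => c.
  have := connect_restrict (r' := adj d) (A := S) _ xS c; case/(_ _)/andP => // u w uS uw.
  rewrite uw andbT; apply/negPn/negP => wS; case/orP: uw; rewrite (edg_out hd) ?eqxx // wS ?orbT //.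
apply: eq_bigr => T /andP[TS xT].
have dis : [disjoint T & S :\: T]%B by apply/pred0P => z /=; rewrite !inE; case: (z \in T).
have SE : S = T :|: (S :\: T).
  by apply/setP => z; rewrite !inE; case: (boolP (z \in T)) => //= zT; rewrite (fintype.subsetP TS).
transitivity (\sum_(d | inbox Qb (edg T :|: edg (S :\: T)) d && cnct T d) Wt S t d).
  apply: eq_bigl => d; apply/andP/andP => -[].
    move=> hd /eqP cT; have cz z : z \in T -> connect (adj d) x z by rewrite -cT inE.
    split; last first.
      apply/forallP => u; apply/implyP => uT; apply/forallP => w; apply/implyP => wT.
      apply: connect_trans (cz _ wT); rewrite (sym_connect_sym (adj_sym d)) cz //.
    apply/forallP => -[u w]; have := forallP hd (u, w).
    case: ifP => eS; case: ifP => eT // h.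
      apply/negPn/negP => d0; have uw : adj d u w by rewrite /adj d0.
      have uT : (u \in T) = (w \in T).
        rewrite -cT !inE; apply/idP/idP => h1; first exact: connect_trans h1 (connect1 uw).
        by apply: connect_trans h1 (connect1 _); rewrite adj_sym.
      by move: eS eT; rewrite !inE /= uT => /and3P[-> -> ->]; case: (w \in T).
    by have /fintype.subsetP/(_ _ eT) := edgU TS; rewrite eS.
  move=> hd cT; have hS : inb S d.
    apply/forallP => e; have := forallP hd e; have /fintype.subsetP/(_ e) := edgU TS.
    by case: ifP => eT; [move=> -> //|case: ifP => // _ _ /eqP ->; rewrite Qb0].
  split=> //; apply/eqP/setP => z; rewrite inE; apply/idP/idP => [c|zT].
    have := connect_restrict (r' := adj d) (A := T) _ xT c; case/(_ _)/andP => // u w uT uw.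
    rewrite uw andbT; apply/negPn/negP => wT; case/orP: uw.
      by rewrite (inbox_out hd) ?eqxx // !inE /= uT (negbTE wT) !andbF.
    by rewrite (inbox_out hd) ?eqxx // !inE /= uT (negbTE wT) !andbF.
  by have /forallP/(_ x)/implyP/(_ xT)/forallP/(_ z)/implyP := cT; apply.
rewrite big_mkcondr sum_inboxU ?edg_dis //= mulr_suml [RHS]big_mkcondr; apply: eq_bigr => d hd.
have cc d' : inb (S :\: T) d' -> cnct T (comb (edg T) d d') = cnct T d.
  move=> hd'; have ca u w : u \in T -> adj (comb (edg T) d d') u w = adj d u w.
    move=> uT; rewrite /adj !ffunE; case: ifPn => e1; case: ifPn => e2 //.
    - by rewrite (inbox_out hd e2) (edg_out hd') // !inE uT orbT.
    - by rewrite (inbox_out hd e1) (edg_out hd') // !inE uT.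
    - by rewrite (inbox_out hd e1) (inbox_out hd e2) !(edg_out hd') // !inE uT ?orbT.
  have cl u w : u \in T -> adj d u w -> w \in T.
    by move=> uT; apply: contraTT => wT; rewrite /adj !(edg_out hd) ?wT ?orbT // eqxx.
  apply/forallP/forallP => h u; apply/implyP => uT; apply/forallP => w; apply/implyP => wT;
    have := implyP (forallP (implyP (h u) uT) w) wT => c.
    have hh v v' : v \in T -> adj (comb (edg T) d d') v v' -> (v' \in T) && adj d v v'.
      by move=> vT; rewrite ca // => vv; rewrite vv (cl _ _ vT vv).
    by have /andP[] := connect_restrict hh uT c.
  have hh v v' : v \in T -> adj d v v' -> (v' \in T) && adj (comb (edg T) d d') v v'.
    by move=> vT vv; rewrite (cl _ _ vT vv) ca.
  by have /andP[] := connect_restrict hh uT c.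
transitivity (\sum_(d' | inb (S :\: T) d') if cnct T d then Wt T t d * Wt (S :\: T) t d' else 0).
  by apply: eq_bigr => d' hd'; rewrite cc // -Wt_comb // -SE.
by case: ifP => _; rewrite ?mulr_sumr // big1.
Qed.

End WordExpansion.

Section GraphCumulant.
Variables (K : closedFieldType) (qK : qalg K) (n : nat) (psi y : mseries nat K) (a : 'I_n -> int) (A : nat).
Hypotheses (psi0 : psi 0%N = 0) (aA : forall i, (`|a i| <= A)%N).
Local Notation L := {poly (zser K n)}.
Local Notation wt := (wtT psi a).
Local Notation I := ('I_n * 'I_n)%type.

(* Bounds on the multiplicities of the edges leaving the vertex i. *)
Definition rowD (i : 'I_n) : nat := (A.+1 * n.+1 ^ (n - i))%N.
Definition rowB : nat := (A.+1 * n.+1 ^ n)%N.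

Lemma rowDB i : (rowD i <= rowB.+1)%N.
Proof. by apply: leqW; rewrite leq_mul2l /= leq_pexp2l // leq_subr. Qed.

Lemma rowD0 i : (0 < rowD i)%N.
Proof. by rewrite muln_gt0 /= expn_gt0. Qed.

Lemma rowDA i : (A < rowD i)%N.
Proof. by rewrite -[X in (X <= _)%N]muln1 leq_mul2l /= expn_gt0. Qed.

Lemma rowDD (i j : 'I_n) : (i < j)%N -> (`|a j| + n * rowD j < rowD i)%N.
Proof.
move=> ij; have e : (n.+1 * rowD j <= rowD i)%N.
  by rewrite /rowD mulnCA leq_mul2l /= -expnS leq_pexp2l //; have := ltn_ord j; lia.
have := rowDA j; have := aA j; move: e; rewrite mulSn; lia.
Qed.

Local Notation kp := (fun i => kap (gz K i)).
Local Notation ds := {ffun I -> 'I_rowB.+1}.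
Local Notation inb S := (inbox (@Qb n rowB rowD) (edg S)).
Local Notation W := (Wt (B := rowB) a kp).
Local Notation t := (tt n y).

Lemma dep_Wt (T : {set 'I_n}) (d : ds) : inb T d -> depP T (W T t d).
Proof.
move=> hd; have cs := depP_sub qK T; apply: (csubM cs); last first.
  elim/big_ind: _ => [|u v|i iT]; [exact: (csub1 cs)|exact: (csubM cs)|].
  by apply: (pf_eval cs (v := fun t => he (kap (gz K i)) t (Ms a d i))); [apply: (pf_he (qalgL qK n)) => // k; exact: dep_kapW|move=> k; exact: dep_tt].
elim/big_ind: _ => [|u v|e _]; [exact: (csub1 cs)|exact: (csubM cs)|].
case: (boolP (e \in edg T)) => eT; last by rewrite (inbox_out hd eT) /hse hsym0; exact: (csub1 cs).
move: eT; rewrite inE => /and3P[_ h1 h2].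
apply: (pf_eval cs (v := fun t => hs (fun k => kap (gz K e.1) k * t k) (d e))).
  by apply: (pf_hsym (qalgL qK n) cs) => k; exact: dep_kapW.
by move=> k; exact: dep_kapW.
Qed.

Definition connW (T : {set 'I_n}) : L := \sum_(d : ds | inb T d && cnct T d) W T t d.

Lemma wordS_expand S : wordS a (enum 'I_n) S t = \sum_(d : ds | inb S d) W S t d.
Proof.
have SE : S = [set i in [seq i <- enum 'I_n | i \in S]]%SET.
  by apply/setP => i; rewrite inE mem_filter mem_enum andbT.
rewrite /wordS -[X in word X]/([seq (a i, kp i) | i <- enum 'I_n & i \in S]).
rewrite (word_expand (qalgL qK n) kp rowDB rowDD) -?SE //.
apply: (@sorted_filter _ (fun i j : 'I_n => i < j)%N); first by move=> ? ? ?; exact: ltn_trans.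
have : sorted ltn [seq val i | i <- enum 'I_n] by rewrite val_enum_ord iota_ltn_sorted.
by rewrite sorted_map.
Qed.

(** The weights of T and of its complement involve disjoint sets of variables, so the functional
    factors as well. *)
Lemma MM_cumulant : cumulant_rel (MM psi y a (enum 'I_n)) (fun T => TL wt T (connW T)).
Proof.
move=> S x xS; rewrite {1}/MM wordS_expand (Wt_cumulant a kp rowB rowD0 t xS).
rewrite (TL_sum (@wtT_bnd _ _ psi a)); apply: eq_bigr => T /andP[TS xT].
have SE : S = T :|: (S :\: T).
  by apply/setP => z; rewrite !inE; case: (boolP (z \in T)) => //= zT; rewrite (fintype.subsetP TS).
rewrite {1}SE (TLM (@wtT_bnd _ _ psi a)) /MM ?wordS_expand //.
- by apply/pred0P => z /=; rewrite !inE; case: (z \in T).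
- by apply: (csub_sum (depP_sub qK T)) => d /andP[h _]; exact: dep_Wt.
- by apply: (csub_sum (depP_sub qK _)) => d h; exact: dep_Wt.
Qed.

Lemma connW_nonpos i : a i <= 0 -> (1 < n)%N -> exists2 c : K,
  TL wt finset.setT (connW finset.setT) = lmono 0 c & (2 < n)%N -> c = 0.
Proof.
move=> ai n1; have h (j : 'I_n) : j \in enum 'I_n by rewrite mem_enum.
have iT : i \in [set: 'I_n]%SET by rewrite inE.
have cT : #|[set: 'I_n]%SET| = n by rewrite cardsT card_ord.
have [|c -> hc] := cumulant_nonpos qK psi0 (enum_uniq 'I_n) h ai MM_cumulant iT; first by rewrite cT.
by exists c => // n2; apply: hc; rewrite cT.
Qed.

End GraphCumulant.

(** Connected graph sums and derivatives of log Z are cumulants of the same moments, and cumulants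
    are unique. *)
Lemma connW_pos (K : closedFieldType) (qK : qalg K) n (psi y : mseries nat K) (m : 'I_n -> nat) A :
  psi 0%N = 0 -> (forall i, 0 < m i)%N -> (forall i, m i <= A)%N -> (0 < n)%N ->
  let a i := (m i)%:Z in
  TL (wtT psi a) finset.setT (connW y a A finset.setT) =
  foldr (@pderiv K) (Ffun psi y) [seq m i | i <- enum 'I_n] 0 *+ (\prod_i m i)%N.
Proof.
move=> psi0 m0 mA n0 a; have aA i : (`|a i| <= A)%N by exact: mA.
have MZ : MM psi y a (enum 'I_n) = fun S => DS m S (Zfun psi y) 0.
  by apply/funext => S; exact: MM_Zfun.
have Z1 : Zfun psi y 0 = 1.
  have := congr1 (fun M => M finset.set0) MZ; rewrite MM0 // => ->.
  by rewrite /DS (_ : enum finset.set0 = [::]) //; apply/eqP; rewrite -size_eq0 -cardE cards0.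
have nT : finset.setT != finset.set0 :> {set 'I_n}.
  by apply/set0Pn; exists (Ordinal n0); rewrite inE.
have cl := cumulant_logS (qalg_laurent qK) m Z1.
have cm := MM_cumulant qK psi y aA.
rewrite MZ in cm; rewrite (cumulant_uniq _ cm cl nT); last first.
  by rewrite -[LHS]/((fun S => DS m S (Zfun psi y) 0) finset.set0) -MZ MM0.
rewrite /DS enum_setT -enumT fold_Dk_pder mcoefMn big_map big_enum; congr (_ *+ _).
Qed.

(** * The right-hand side over an arbitrary coefficient ring *)

Section Smap.
Variables (M : exponentType) (A B : comUnitRingType) (h : {rmorphism A -> B}).
Local Notation sm := (@smap M A B h).

Lemma smapE (f : mseries M A) m : sm f m = h (f m). Proof. by []. Qed.

Lemma smap_zmod : zmod_morphism sm.
Proof. by move=> f g; apply: mseriesP => m; rewrite mcoefB !smapE mcoefB rmorphB. Qed.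
HB.instance Definition _ := GRing.isZmodMorphism.Build (mseries M A) (mseries M B) sm smap_zmod.

Lemma smap_monoid : monoid_morphism sm.
Proof.
split=> [|f g]; apply: mseriesP => m; rewrite smapE; first by rewrite !mcoef1 rmorph_nat.
by rewrite !mcoefM rmorph_sum; apply: eq_bigr => d _; rewrite rmorphM.
Qed.
HB.instance Definition _ := GRing.isMonoidMorphism.Build (mseries M A) (mseries M B) sm smap_monoid.

Lemma smap_expS (dg : degree M) (f : mseries M A) : qalg A -> f 0 = 0 -> sm (expS f) = expS (sm f).
Proof.
move=> qA f0; have f0' : sm f 0 = 0 by rewrite smapE f0 rmorph0.
apply: mseriesP => m; rewrite smapE !(expS_sum (dg := dg) (N := (dg m).+1)) // rmorph_sum.
apply: eq_bigr => k _; rewrite rmorphM rmorphV ?qalg_fact // rmorph_nat; congr (_ * _).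
by rewrite -[RHS]/((sm f ^+ k) m) -rmorphXn.
Qed.

End Smap.

Section VertexOperators.
Variables (K : fieldType) (qK : qalg K) (A : comUnitRingType) (io : {rmorphism K -> A}) (n : nat).
Variables (yv : 'I_n -> nat -> A) (bv : 'I_n -> 'I_n -> nat -> nat -> A) (D : 'I_n -> A -> A).
Variables (qi : 'I_n -> A) (lc : 'I_n -> nat -> nat -> nat -> A).
Local Notation ex := {ffun 'I_n -> nat}.
Local Notation U := (mseries ex (mseries nat A)).
Local Notation dF := (degF 'I_n).
Implicit Types (i : 'I_n) (m : ex) (f g : U).

Lemma qalgA : qalg A. Proof. exact: (qalg_rmorph io). Qed.

Definition uc (B : nmodType) i (r : nat) (g : mseries ex B) : mseries ex B :=
  MSeries (fun m => if m i == 0%N then g (m + dexp i *+ r) else 0).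
Definition onv (B : nmodType) i (F : nat -> B) : mseries ex B :=
  MSeries (fun m => if m == dexp i *+ m i then F (m i) else 0).

Definition Svs i : U := onv i (fun a => smono a (io ((Sser K)^-1 a))).
Definition kex i : U :=
  onv i (fun a => if a is k.+2 then smono k.+1 (io (Sser K k.+1) * yv i k.+1) else 0).
(** The exponent in w_(k,l). The derivatives of the pair function enter as parameters [bv], so that
    the same formula can be read in the fraction field and in the ring of expansions. *)
Definition wex (k l : 'I_n) : U := MSeries (fun m =>
  if [&& m == dexp k *+ m k + dexp l *+ m l, (0 < m k)%N & (0 < m l)%N] then
    smono (m k + m l)%N (io (Sser K (m k).-1) * io (Sser K (m l).-1) * bv k l (m k).-1 (m l).-1)
  else 0).
Definition Ks i : U := expS (kex i) * Svs i.
Definition ws k l : U := expS (wex k l) - 1.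
Definition gs : U := \sum_(E : {set 'I_n * 'I_n} | simple_graph E && connected_graph E)
  \prod_(e in E) ws e.1 e.2.
Definition lcs i j r : mseries nat A := MSeries (lc i j r).
(** The (j, r) term of U_i without its factor 1 / hbar, so that only nonnegative powers of hbar
    occur. *)
Definition Wt1 i (jr : nat * nat) g : U := smap (smap (iter jr.1 (D i)))
  (smono 0 (lcs i jr.1 jr.2 * smono 0%N (qi i)) * uc i jr.2.+1 (Ks i * g)).
Definition Wop i g : U := MSeries (fun m => MSeries (fun k : nat =>
  \sum_(j < (2 * k).+1) \sum_(r < 2 * k) Wt1 i (nat_of_ord j, nat_of_ord r) g m k)).

Lemma coef2M f g m k : (f * g) m k = \sum_(d <- splits m) \sum_(i < k.+1) f d.1 i * g d.2 (k - i)%N.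
Proof. by rewrite mcoefM mcoef_sum; apply: eq_bigr => d _; rewrite mcoefM_nat. Qed.

Lemma coef2_expS f m k : f 0 = 0 ->
  expS f m k = \sum_(j < (dF m).+1) io (j`!%:R)^-1 * (f ^+ j) m k.
Proof.
move=> f0; rewrite (expS_sum (dg := dF) (N := (dF m).+1)) // mcoef_sum; apply: eq_bigr => j _.
rewrite (fact_const_V nat j qalgA) mcoefCM rmorphV ?rmorph_nat //; exact: qalg_fact.
Qed.

Lemma onv0 (B : nmodType) i (F : nat -> B) : onv i F 0 = F 0%N.
Proof. by rewrite -[LHS]/(if _ then _ else _) ffunE mulr0n eqxx. Qed.

Lemma kex0 i : kex i 0 = 0. Proof. exact: onv0. Qed.
Lemma wex0 k l : wex k l 0 = 0.
Proof. by rewrite -[LHS]/(if _ then _ else _) ffunE andbF. Qed.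

(* Weights bounding the powers of u by those of hbar, which make the sums over (j, r) finite. *)
Definition sl g := forall m k, (2 * k < dF m)%N -> g m k = 0.

Lemma sl1 : sl 1.
Proof. by move=> m k mk; rewrite mcoef1; case: eqP => [m0|_]; rewrite ?mcoef0 //; move: mk; rewrite m0 deg0. Qed.

Lemma slD f g : sl f -> sl g -> sl (f + g).
Proof. by move=> hf hg m k mk; rewrite !mcoefD hf ?hg // addr0. Qed.

Lemma slN f : sl f -> sl (- f).
Proof. by move=> hf m k mk; rewrite !mcoefN hf // oppr0. Qed.

Lemma slM f g : sl f -> sl g -> sl (f * g).
Proof.
move=> hf hg m k mk; rewrite coef2M big_seq big1 // => d; rewrite mem_splits => /eqP e.
apply: big1 => i _; have := congr1 dF e; rewrite degD => e'.
case: (ltnP (2 * i) (dF d.1)) => h1; first by rewrite hf ?mul0r.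
rewrite hg ?mulr0 //; move: mk h1 (ltn_ord i) e'.
by move: (dF d.1) (dF d.2) (dF m) (nat_of_ord i) => u v w x; lia.
Qed.

Lemma slX f j : sl f -> sl (f ^+ j).
Proof. by move=> hf; elim: j => [|j IH]; [exact: sl1|rewrite exprS; exact: slM]. Qed.

Lemma sl_expS f : f 0 = 0 -> sl f -> sl (expS f).
Proof.
by move=> f0 hf m k mk; rewrite coef2_expS // big1 // => j _; rewrite slX ?mulr0.
Qed.

Lemma dF_dexp i (a : nat) : dF (dexp i *+ a) = a.
Proof.
rewrite -[LHS]/(\sum_j (dexp i *+ a) j)%N (bigD1 i) //= dexpE eqxx big1 ?addn0 // => j ji.
by rewrite dexpE (negbTE ji).
Qed.

Lemma sl_onv i (F : nat -> mseries nat A) : (forall a k, (2 * k < a)%N -> F a k = 0) -> sl (onv i F).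
Proof.
move=> h m k mk; rewrite -[onv i F m]/(if _ then _ else _); case: eqP => [e|_] //.
by apply: h; move: mk; rewrite {1}e dF_dexp.
Qed.

Lemma sl_wex k l : sl (wex k l).
Proof.
move=> m c mc; rewrite -[wex k l m]/(if _ then _ else _); case: ifP => // /and3P[/eqP e h1 h2].
by rewrite smonoE; case: eqP => // ce; move: mc; rewrite e degD !dF_dexp ce; lia.
Qed.

Lemma sl_Ks i : sl (Ks i).
Proof.
apply: slM.
  apply: sl_expS; [exact: kex0|apply: sl_onv => -[|[|a]] k ka //].
  by rewrite smonoE; case: eqP => // ke; lia.
by apply: sl_onv => a k ka; rewrite smonoE; case: eqP => // ke; lia.
Qed.

Lemma sl_gs : sl gs.
Proof.
rewrite /gs; elim/big_ind: _ => [|f g|E _]; [by move=> m k _|exact: slD|].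
elim/big_ind: _ => [|f g|e _]; [exact: sl1|exact: slM|].
by apply: slD; [apply: sl_expS; [exact: wex0|exact: sl_wex]|apply: slN; exact: sl1].
Qed.

Hypothesis D0 : forall i, D i 0 = 0.
Hypothesis DA : forall i x x', D i (x + x') = D i x + D i x'.
Hypothesis lc_bnd : forall i j r l, (2 * l + r < j)%N -> lc i j r l = 0.

Lemma iterD0 i j : iter j (D i) 0 = 0.
Proof. by elim: j => //= j ->; exact: D0. Qed.

Lemma iterD_sum i j I (s : seq I) (F : I -> A) :
  iter j (D i) (\sum_(x <- s) F x) = \sum_(x <- s) iter j (D i) (F x).
Proof.
elim: s => [|x s IH]; first by rewrite !big_nil iterD0.
rewrite !big_cons -IH; move: (F x) (\sum_(x <- s) F x) => u v.
by elim: j {IH} => //= j ->; exact: DA.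
Qed.

Lemma Wt1E i jr g m k : Wt1 i jr g m k = if m i == 0%N then
  \sum_(l < k.+1) iter jr.1 (D i) (lc i jr.1 jr.2 l * (qi i * (Ks i * g) (m + dexp i *+ jr.2.+1) (k - l)%N))
  else 0.
Proof.
rewrite -[LHS]/(iter jr.1 (D i) ((smono 0 (lcs i jr.1 jr.2 * smono 0%N (qi i)) * uc i jr.2.+1 (Ks i * g)) m k)).
rewrite mcoefCM -[uc _ _ _ m]/(if m i == 0%N then _ else 0); case: ifP => _; last by rewrite mulr0 mcoef0 iterD0.
rewrite -mulrA mcoefM_nat iterD_sum; apply: eq_bigr => l _; rewrite mcoefCM //.
Qed.

Lemma dF_shift i m (r : nat) : dF (m + dexp i *+ r) = (dF m + r)%N.
Proof. by rewrite degD dF_dexp. Qed.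

(** If the coefficient of L_r has order l in hbar, then u_i^(r+1) forces r + 1 <= 2 (k - l), while
    v^j forces j <= 2 l + r. *)
Lemma Wt1_zero i jr g m k : sl g -> (2 * k < jr.1)%N || (2 * k <= jr.2)%N -> Wt1 i jr g m k = 0.
Proof.
move=> hg h; rewrite Wt1E; case: ifP => // _; rewrite big1 // => l _.
case: (ltnP (2 * (k - l)) jr.2.+1) => h1.
  rewrite (slM (sl_Ks i) hg) ?mulr0 ?iterD0 // dF_shift; lia.
by rewrite lc_bnd ?mul0r ?iterD0 //; have := ltn_ord l; lia.
Qed.

Lemma sl_Wt1 i jr g : sl g -> sl (Wt1 i jr g).
Proof.
move=> hg m k mk; rewrite Wt1E; case: ifP => // _; rewrite big1 // => l _.
by rewrite (slM (sl_Ks i) hg) ?mulr0 ?iterD0 // dF_shift; lia.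
Qed.

Lemma sl_Wop i g : sl g -> sl (Wop i g).
Proof.
move=> hg m k mk; rewrite -[LHS]/(\sum_(j < (2 * k).+1) \sum_(r < 2 * k) Wt1 i (nat_of_ord j, nat_of_ord r) g m k).
by rewrite big1 // => j _; rewrite big1 // => r _; exact: sl_Wt1.
Qed.

Lemma sl_foldl s g : sl g -> sl (foldl (fun f i => Wop i f) g s).
Proof. by elim: s g => //= i s IH g hg; apply: IH; exact: sl_Wop. Qed.

Lemma Wt1_low i jr g c : (forall m k, (k <= c)%N -> g m k = 0) ->
  forall m k, (k <= c)%N -> Wt1 i jr g m k = 0.
Proof.
move=> h m k kc; rewrite Wt1E; case: ifP => // _; rewrite big1 // => l _.
rewrite coef2M big1 ?mulr0 ?iterD0 // => d _; rewrite big1 // => x _; rewrite h ?mulr0 //; lia.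
Qed.

Lemma foldl_Wt1_low (jr : {ffun 'I_n -> nat * nat}) s g c i : sl g -> i \in s ->
  (2 * c < (jr i).1)%N || (2 * c <= (jr i).2)%N ->
  forall m, foldl (fun f i => Wt1 i (jr i) f) g s m c = 0.
Proof.
move=> hg is_ h; have lowf s' g' : (forall m k, (k <= c)%N -> g' m k = 0) ->
    forall m k, (k <= c)%N -> foldl (fun f i => Wt1 i (jr i) f) g' s' m k = 0.
  by elim: s' g' => //= x s' IH g' hg'; apply: IH; exact: Wt1_low.
elim: s g hg is_ => //= x s IH g hg; rewrite inE => /orP[/eqP e|is_] m; last by apply: IH => //; exact: sl_Wt1.
rewrite -e; apply: (lowf s) => // m' k kc; apply: Wt1_zero => //; move: h; lia.
Qed.

End VertexOperators.

Section OneVariable.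
Variables (K : fieldType) (A : comUnitRingType) (io : {rmorphism K -> A}) (n : nat) (i : 'I_n).
Local Notation ex := {ffun 'I_n -> nat}.
Local Notation U := (mseries ex (mseries nat A)).

Definition uhs (f : mseries nat K) : U := onv i (fun a => smono a (io (f a))).
Let h : {rmorphism K -> U} := @smono ex (mseries nat A) 0 \o (@smono nat A 0%N \o io).
Let x : U := smono (dexp i) (smono 1%N 1).
Let x0 : x 0 = 0.
Proof. by rewrite smonoE; case: eqP => // /ffunP/(_ i); rewrite dexp1E eqxx ffunE. Qed.

Let uhsE f : uhs f = hcomp (degF 'I_n) h x0 f.
Proof.
apply: mseriesP => m; rewrite (@hcompE _ _ _ _ _ _ _ _ _ (degF 'I_n m).+1) // mcoef_sum.
have tm k : (h (f k) * x ^+ k) m = if m == dexp i *+ k then smono k (io (f k)) else 0.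
  rewrite /x smono1X -[h _]/(smono 0 (smono 0%N (io (f k))) : U) smonoM add0r smonoE; case: eqP => // _.
  by rewrite smono1X natmuln1 expr1n smonoM mulr1 add0r.
rewrite -[LHS]/(if m == dexp i *+ m i then smono (m i) (io (f (m i))) else 0).
have hm : (m i < (degF 'I_n m).+1)%N by rewrite ltnS -[degF _ m]/(\sum_j m j)%N (bigD1 i) //= leq_addr.
rewrite (bigD1 (Ordinal hm)) // tm big1 => [|k ki]; first by rewrite [RHS]addr0.
rewrite tm; case: eqP => // e.
case/eqP: ki; apply: val_inj; have := congr1 (fun m' : ex => m' i) e.
by rewrite dexpE eqxx /= => ->.
Qed.

Lemma uhsM f g : uhs (f * g) = uhs f * uhs g. Proof. by rewrite !uhsE rmorphM. Qed.
Lemma uhs1 : uhs 1 = 1. Proof. by rewrite uhsE rmorph1. Qed.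

End OneVariable.

Lemma scomp0l (M : exponentType) (A : comUnitRingType) (x : mseries M A) : scomp 0 x = 0.
Proof.
apply: mseriesP => m; rewrite /scomp (@csum_nat _ _ _ m 0) ?big_ord0 // => k _.
by rewrite -[sconst _ _]/(smono 0 0 : mseries M A) rmorph0 mul0r mcoef0.
Qed.

Lemma sderiv0 (K : fieldType) : sderiv (0 : mseries nat K) = 0.
Proof. by apply: mseriesP => k; rewrite -[LHS]/(0 *+ k.+1) mul0rn. Qed.

Lemma vvarM (K : fieldType) (X : mseries nat (mseries nat (mseries nat K))) j : (vvar K * X) j.+1 = X j.
Proof.
rewrite -[vvar K]/(smono 1%N 1) mcoefM_nat big_ord_recl big_ord_recl big1 => [|i _]; last by rewrite smonoE mul0r.
by rewrite smonoE mul0r add0r addr0 smonoE mul1r -[(j.+1 - _)%N]/(j.+1 - 1)%N subSS subn0.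
Qed.

(** Each application of d/dy + v psi' raises the degree in v by at most one. *)
Lemma Lfun_vbnd (K : fieldType) (qK : qalg K) (psi : mseries nat K) r j l :
  (2 * l + r < j)%N -> Lfun psi r j l = 0.
Proof.
have L0b : vbnd 0 (L0 psi) by apply: (vbnd_expS qK (Lexp0 qK psi)); exact: Lexp_vbnd.
elim: r j l => [|r IH] j l h; first by apply: L0b.
rewrite -[Lfun psi r.+1]/(smap (smap (@sderiv K)) (Lfun psi r) + vvar K * vhy_cst (sderiv psi) * Lfun psi r).
rewrite !mcoefD -[X in X + _ = _]/(sderiv (Lfun psi r j l)) IH ?sderiv0 ?add0r; last by lia.
case: j h => [//|j] h; rewrite -mulrA vvarM.
rewrite -[vhy_cst _]/(smono 0%N (smono 0%N (sderiv psi)) : mseries nat (mseries nat (mseries nat K))) !mcoefCM.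
by rewrite IH ?mulr0 //; lia.
Qed.

(** * The right-hand side in the field of fractions *)

Section FractionSide.
Variables (K : fieldType) (qK : qalg K) (n : nat) (psi y : mseries nat K).
Hypotheses (psi0 : psi 0%N = 0) (y0 : y 0%N = 0).
Local Notation ex := {ffun 'I_n -> nat}.
Local Notation F := (zfrac K n).
Local Notation UF := (mseries ex (mseries nat F)).
Local Notation Us := (useries K n).
Implicit Types (i : 'I_n) (m : ex) (g : UF) (x : F).

Lemma thetaD i (f g : zser K n) : theta i (f + g) = theta i f + theta i g.
Proof. by apply: mseriesP => m; rewrite -[LHS]/((f m + g m) *+ m i) mulrnDl. Qed.

Lemma thetaF_D i x x' : thetaF i (x + x') = thetaF i x + thetaF i x'.
Proof.
have h0 (u : F) : \d_(generic_quotient.repr u) != 0 by exact: denom_ratioP.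
rewrite [x in LHS]frac_repr [x' in LHS]frac_repr addf_div ?tofrac_eq0 //.
rewrite -!tofracM -tofracD thetaF_frac ?mulf_neq0 // /thetaF.
move: (h0 x) (h0 x'); move: (\n_(generic_quotient.repr x)) (\d_(generic_quotient.repr x)) (\n_(generic_quotient.repr x')) (\d_(generic_quotient.repr x')) => a b c d b0 d0.
rewrite addf_div ?tofrac_eq0 ?expf_neq0 // -!tofracM -tofracD.
apply/eqP; rewrite eqr_div ?tofrac_eq0 ?expf_neq0 ?mulf_neq0 ?expf_neq0 // -!tofracM tofrac_eq; apply/eqP.
by rewrite thetaD !thetaM; move: (theta i a) (theta i b) (theta i c) (theta i d) => *; ring.
Qed.

Lemma thetaF_tofr i (f : zser K n) : thetaF i (tofr f) = tofr (theta i f).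
Proof.
have := @thetaF_frac K n i f 1 (oner_neq0 _); rewrite tofrac1 divr1 => ->.
have t1 : theta i 1 = 0 :> zser K n.
  by have := thetaM i (1 : zser K n) 1; rewrite !mulr1 mul1r => /esym/(canRL (addrK _)); rewrite subrr.
by rewrite t1 mulr0 subr0 mulr1 expr1n tofrac1 divr1.
Qed.

Lemma thetaF_0 i : thetaF i 0 = 0 :> F.
Proof. by have := thetaF_D i 0 0; rewrite addr0 => /esym/(canRL (addrK _)); rewrite subrr. Qed.

Lemma DzD i x x' : Dz psi y i (x + x') = Dz psi y i x + Dz psi y i x'.
Proof. by rewrite /Dz thetaF_D mulrDr. Qed.

Lemma Dz0 i : Dz psi y i 0 = 0. Proof. by rewrite /Dz thetaF_0 mulr0. Qed.

Lemma Qz_neq0 i : Qz psi y i != 0.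
Proof.
rewrite /Qz tofrac_eq0; apply/eqP => /(congr1 (fun f : zser K n => f 0)).
rewrite at_z_coef ffunE mulr0n eqxx (Qser0 psi y0) => /eqP; by rewrite oner_eq0.
Qed.

Lemma QDz i x : Qz psi y i * Dz psi y i x = thetaF i x.
Proof. by rewrite /Dz mulrA divff ?mul1r // Qz_neq0. Qed.

Definition cF : {rmorphism K -> F} := @FracField.tofrac (zser K n) \o @smono ex K 0.
Definition yF i (a : nat) : F := iter a (thetaF i) (tofr (at_z i y)).
Definition bF (k l : 'I_n) (a b : nat) : F := iter a (thetaF k) (iter b (thetaF l)
  (tofr (zvar K k) * tofr (zvar K l) / (tofr (zvar K k) - tofr (zvar K l)) ^+ 2)).
Definition qF i : F := (Qz psi y i)^-1.
Definition lF i (j r l : nat) : F := tofr (scomp (Lfun psi r j l) (at_z i y)).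
Local Notation Ksf := (Ks cF yF).
Local Notation gsf := (gs cF bF).
Local Notation Wt1f := (Wt1 cF yF (@Dz K psi y n) qF lF).
Local Notation Wopf := (Wop cF yF (@Dz K psi y n) qF lF).
Definition lam g : Us := smap (@lser F) g.
(** Collects the factors 1 / hbar of t operators U_i. *)
Definition hsf (t : nat) (f : Us) : Us := sconst _ (lmono (- t%:Z) 1) * f.

Lemma lamE g m : lam g m = lser (g m). Proof. by []. Qed.
Lemma lamM g g' : lam (g * g') = lam g * lam g'. Proof. exact: (rmorphM (smap (@lser F))). Qed.

Lemma lmap_coef (phi : F -> F) (f : laurent F) N k : phi 0 = 0 -> lbnd f N -> lmap phi f k = phi (f k).
Proof. by move=> p0 fN; rewrite /lmap (@laurent_ofE _ _ N) // => j /fN ->. Qed.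

Lemma Du_coef i (f : Us) m k : Du psi y i f m k = Dz psi y i (f m k).
Proof. have [N fN] := laurent_lb (f m); exact: (@lmap_coef _ _ N k (Dz0 i)). Qed.

Lemma QDu_coef i (f : Us) m k : QDu psi y i f m k = thetaF i (f m k).
Proof. by rewrite /QDu /zcst mcoefCM lcoef_monoM subr0 Du_coef QDz. Qed.

Lemma iter_QDu i a (f : Us) m k : iter a (QDu psi y i) f m k = iter a (thetaF i) (f m k).
Proof. by elim: a => //= a IH; rewrite QDu_coef IH. Qed.

Lemma iter_thetaF0 i a : iter a (thetaF i) 0 = 0 :> F.
Proof. by elim: a => //= a ->; exact: thetaF_0. Qed.

Lemma exI m m1 m2 : m + m1 = m + m2 -> m1 = m2.
Proof. by move=> /ffunP h; apply/ffunP => j; have := h j; rewrite !ffunE => /addnI. Qed.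

Definition mz i m : ex := [ffun j => if j == i then 0%N else m j].

Lemma mzE i m : m = dexp i *+ m i + mz i m.
Proof. by apply/ffunP => j; rewrite !ffunE ffunMnE ffunE; case: eqP => [->|_] /=; rewrite ?natmuln1 ?addr0 ?mul0rn ?add0r. Qed.

Lemma mz_eq0 i m : (mz i m == 0) = (m == dexp i *+ m i).
Proof.
apply/eqP/eqP => [e|e]; first by rewrite {1}[m](mzE i) e addr0.
by apply/ffunP => j; rewrite !ffunE; case: eqP => // /eqP ji; rewrite e dexpE (negbTE ji).
Qed.

Lemma S_uhQD_coef i (f : Us) m : (forall m', m' i != 0%N -> f m' = 0) ->
  S_uhQD psi y i f m = lmono (m i)%:Z (cF (Sser K (m i))) * iter (m i) (QDu psi y i) f (mz i m).
Proof.
move=> f0; have f0' a m' : m' i != 0%N -> iter a (QDu psi y i) f m' = 0.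
  by move=> h; apply: laurentP => k; rewrite iter_QDu f0 // iter_thetaF0.
have tE a : zcst (Sz K n a) * uh K i a = smono (dexp i *+ a) (lmono a%:Z (cF (Sser K a))).
  by rewrite /zcst /uh /sconst smonoM add0r lmonoM add0r mulr1.
rewrite /S_uhQD (@csum1 _ _ _ m (m i)) => [|a am].
  by rewrite tE [X in mcoef (_ * iter _ _ _) X](mzE i m) smonoM_coef.
rewrite tE mcoefM big_seq big1 // => d; rewrite mem_splits smonoE => /eqP e.
case: eqP => [d1|]; last by rewrite mul0r.
rewrite f0' ?mulr0 //; apply: contra_neq am => d2; rewrite -e ffunE d1 dexpE eqxx d2.
by rewrite -[(a + 0)%R]/(a + 0)%N addn0.
Qed.

Lemma zcst_coef x m : zcst x m = if m == 0 then lmono 0 x else 0. Proof. by []. Qed.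

Lemma zcst_supp i x m : m i != 0%N -> zcst x m = 0.
Proof. by rewrite zcst_coef; case: (eqVneq m 0) => // ->; rewrite ffunE. Qed.

Lemma S_uhQD_zcst i x m : S_uhQD psi y i (zcst x) m =
  if m == dexp i *+ m i then lmono (m i)%:Z (cF (Sser K (m i)) * iter (m i) (thetaF i) x) else 0.
Proof.
rewrite S_uhQD_coef; last exact: zcst_supp.
have -> : iter (m i) (QDu psi y i) (zcst x) (mz i m) = if mz i m == 0 then lmono 0 (iter (m i) (thetaF i) x) else 0.
  apply: laurentP => k; rewrite iter_QDu zcst_coef; case: eqP => _; last exact: iter_thetaF0.
  by rewrite !lmonoE; case: eqP => _; rewrite ?iter_thetaF0.
by rewrite mz_eq0; case: eqP => _; rewrite ?mulr0 // lmonoM addr0.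
Qed.

Lemma lser_smono (k : nat) x : lser (smono k x) = lmono k%:Z x.
Proof. by apply: laurentP => -[j|j]; rewrite lserE lmonoE // smonoE eqz_nat. Qed.

Lemma lserM (f g : mseries nat F) : lser (f * g) = lser f * lser g. Proof. exact: rmorphM. Qed.

Lemma lser0 : lser (0 : mseries nat F) = 0. Proof. exact: (rmorph0 (@lser F)). Qed.

Lemma qalgF : qalg F. Proof. exact: (qalg_rmorph cF). Qed.
Lemma qalgFh : qalg (mseries nat F). Proof. exact/qalg_mseries/qalgF. Qed.

Lemma lamB g g' : lam (g - g') = lam g - lam g'. Proof. exact: (rmorphB (smap (@lser F))). Qed.
Lemma lam1 : lam 1 = 1. Proof. exact: (rmorph1 (smap (@lser F))). Qed.
Lemma lam_expS g : g 0 = 0 -> lam (expS g) = expS (lam g).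
Proof. by move=> g0; apply: (smap_expS _ (degF 'I_n) qalgFh g0). Qed.

Lemma thetaF_C i c x : thetaF i (cF c * x) = cF c * thetaF i x.
Proof.
rewrite [x in LHS]frac_repr mulrA -[cF c]/(tofr (smono 0 c)) -tofracM thetaF_frac; last exact: denom_ratioP.
rewrite /thetaF.
move: (\n_(generic_quotient.repr x)) (\d_(generic_quotient.repr x)) => a b.
have -> : theta i (smono 0 c * a) = smono 0 c * theta i a.
  by apply: mseriesP => m; rewrite mcoefCM -[LHS]/((smono 0 c * a) m *+ m i) mcoefCM mulrnAr.
by rewrite mulrA -tofracM; congr (tofr _ / _); ring.
Qed.

Lemma iter_thetaFC i a c x : iter a (thetaF i) (cF c * x) = cF c * iter a (thetaF i) x.
Proof. by elim: a => //= a ->; exact: thetaF_C. Qed.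

Lemma kex_lam i : smono (dexp i) 1 * (S_uhQD psi y i (zcst (tofr (at_z i y))) - zcst (tofr (at_z i y))) =
  lam (kex cF yF i).
Proof.
set x := tofr _; apply: mseriesP => m; rewrite lamE.
rewrite -[kex _ _ _ m]/(if m == dexp i *+ m i then _ else _).
case: (posnP (m i)) => [mi0|mi0].
  rewrite mi0 if_same lser0 mcoefM big_seq big1 // => d; rewrite mem_splits smonoE => /eqP e.
  case: eqP => [d1|]; last by rewrite mul0r.
  by move: mi0; rewrite -e ffunE d1 dexp1E eqxx.
have [m' e] : exists m', m = dexp i + m'.
  exists [ffun j => if j == i then (m i).-1 else m j]; apply/ffunP => j; rewrite !ffunE.
  by case: (eqVneq j i) => [->|_]; [rewrite -[RHS]/(1 + (m i).-1)%N|rewrite -[RHS]/(0 + m j)%N]; lia.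
have mi : m i = (m' i).+1 by rewrite e ffunE dexp1E eqxx.
have me : (m == dexp i *+ m i) = (m' == dexp i *+ m' i).
  rewrite mi mulrS e; apply/eqP/eqP => [|-> //]; first by move=> /exI.
  by rewrite dexpE eqxx.
rewrite me mi e smonoM_coef mul1r mcoefB S_uhQD_zcst zcst_coef.
case: eqP => [em|em]; last first.
  by rewrite lser0; case: eqP => [m0|_]; [case: em; rewrite m0 ffunE mulr0n|rewrite subr0].
case me' : (m' i) => [|a].
  by rewrite em me' mulr0n eqxx Sser0 // rmorph1 mul1r subrr lser0.
case: eqP => [m0|_]; first by move: me'; rewrite m0 ffunE.
by rewrite subr0 lser_smono.
Qed.

Lemma wex_lam (k l : 'I_n) : k != l -> w psi y k l = lam (ws cF bF k l).
Proof.
move=> kl; rewrite /w /ws lamB lam1; congr (_ - 1); rewrite lam_expS; last exact: wex0.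
congr (expS _); set x := _ / _; apply: mseriesP => m; rewrite lamE.
rewrite -[wex _ _ _ _ m]/(if _ then _ else _).
have lk : (l == k) = false by rewrite eq_sym (negbTE kl).
have uhE : uh K k 1 * uh K l 1 = smono (dexp k + dexp l) (lmono 2 1).
  by rewrite /uh smonoM lmonoM mulr1 !mulr1n.
rewrite uhE; case: (boolP ((0 < m k)%N && (0 < m l)%N)) => hp; last first.
  rewrite andbF lser0 mcoefM big_seq big1 // => d; rewrite mem_splits smonoE => /eqP e.
  case: eqP => [d1|]; last by rewrite mul0r.
  by case/negP: hp; rewrite -e d1 !ffunE !eqxx lk eq_sym lk.
have [m' e] : exists m', m = (dexp k + dexp l) + m'.
  exists [ffun j => if (j == k) || (j == l) then (m j).-1 else m j]; apply/ffunP => j; rewrite !ffunE.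
  rewrite -[RHS]/((j == k) + (j == l) + (if (j == k) || (j == l) then (m j).-1 else m j))%N.
  case: (eqVneq j k) hp => [->|jk] /andP[h1 h2]; first by rewrite (negbTE kl); case: (m k) h1.
  by case: (eqVneq j l) => [->|jl]; [case: (m l) h2|].
have mk : m k = (m' k).+1 by rewrite e !ffunE eqxx (negbTE kl) -[(_ + _)%R]/(1 + 0 + m' k)%N; lia.
have ml : m l = (m' l).+1 by rewrite e !ffunE eqxx lk -[(_ + _)%R]/(0 + 1 + m' l)%N; lia.
rewrite andbT {1}e smonoM_coef mk ml S_uhQD_coef; last first.
  move=> m2 h; rewrite S_uhQD_zcst; case: eqP => // e2; move: h; rewrite e2 dexpE (negbTE kl) eqxx //.
have me : (m == dexp k *+ (m' k).+1 + dexp l *+ (m' l).+1) = (mz k m' == dexp l *+ mz k m' l).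
  have -> : mz k m' l = m' l by rewrite ffunE lk.
  have em' := mzE k m'; rewrite e {1}em' !mulrS; apply/eqP/eqP => [h|->]; last first.
    by rewrite -!addrA; congr (_ + _); rewrite addrCA.
  apply: (@exI (dexp k + dexp l + dexp k *+ m' k)); rewrite -[LHS]addrA h.
  by rewrite -!addrA; congr (_ + _); rewrite addrCA.
rewrite me; have zl : mz k m' l = m' l by rewrite ffunE lk.
apply: laurentP => c; rewrite !lcoef_monoM mul1r iter_QDu S_uhQD_zcst zl; case: ifP => _; last first.
  by rewrite -[(0 : laurent F) _]/(0 : F) iter_thetaF0 mulr0 lser0.
rewrite -[X in _ * iter _ _ X]/(lmono (m' l)%:Z (cF (Sser K (m' l)) * iter (m' l) (thetaF l) x) (c - 2 - (m' k)%:Z)).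
rewrite lser_smono !lmonoE; have -> : (c - 2 - (m' k)%:Z == (m' l)%:Z) = (c == ((m' k).+1 + (m' l).+1)%N%:Z).
  by apply/eqP/eqP; lia.
case: eqP => _; last by rewrite iter_thetaF0 mulr0.
by rewrite iter_thetaFC mulrA.
Qed.

Lemma graph_sum_lam : graph_sum psi y n = lam gsf.
Proof.
rewrite /graph_sum /gs /lam (rmorph_sum (smap (@lser F))); apply: eq_bigr => E /andP[sE _].
rewrite (rmorph_prod (smap (@lser F))); apply: eq_bigr => e eE; rewrite wex_lam //.
by have /forallP/(_ e)/implyP/(_ eE) := sE; apply: contraTneq => ->; rewrite ltnn.
Qed.

Lemma kernel_lam i : kernel psi y i = lam (Ksf i).
Proof.
rewrite /kernel /Ks lamM kex_lam lam_expS; last exact: kex0.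
congr (_ * _); apply: mulr1_eq.
have -> : S_uh K i = lam (uhs cF i (Sser K)).
  apply: mseriesP => m; rewrite lamE -[uhs _ _ _ m]/(if _ then _ else _).
  have tE a : zcst (Sz K n a) * uh K i a = smono (dexp i *+ a) (lmono a%:Z (cF (Sser K a))).
    by rewrite /zcst /uh /sconst smonoM add0r lmonoM add0r mulr1.
  rewrite /S_uh (@csum1 _ _ _ m (m i)) => [|a am]; rewrite tE smonoE.
    by case: eqP => _; rewrite ?lser0 ?lser_smono.
  by case: eqP => // e; case/eqP: am; rewrite e dexpE eqxx.
rewrite -lamM -[Svs _ _]/(uhs cF i (Sser K)^-1) -uhsM divrr ?Sser_unit // uhs1; exact: lam1.
Qed.

Lemma hsf_coef t (f : Us) m k : hsf t f m k = f m (k + t%:Z).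
Proof. by rewrite /hsf mcoefCM lcoef_monoM mul1r opprK. Qed.

Lemma Uterm_lam i jr t g : Uterm psi y i jr (hsf t (lam g)) = hsf t.+1 (lam (Wt1f i jr g)).
Proof.
case: jr => j r; rewrite /Uterm /=.
have -> : kernel psi y i * hsf t (lam g) = hsf t (lam (Ksf i * g)).
  by rewrite kernel_lam (lamM (Ksf i) g) /hsf mulrCA.
set Y : UF := smono 0 (lcs lF i j r * smono 0%N (qF i)) * uc i r.+1 (Ksf i * g).
have -> : sconst _ (Lz psi y i j r) * zcst (Qz psi y i)^-1 *
    (sconst _ (lmono (-1) 1) * ucoef i r.+1 (hsf t (lam (Ksf i * g)))) = hsf t.+1 (lam Y).
  apply: mseriesP => m; rewrite /hsf /zcst /sconst -mulrA !mcoefCM lamE /Y mcoefCM.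
  rewrite -[ucoef _ _ _ m]/(if m i == 0%N then (hsf t (lam (Ksf i * g))) (m + dexp i *+ r.+1) else 0).
  rewrite -[uc _ _ _ m]/(if m i == 0%N then (Ksf i * g) (m + dexp i *+ r.+1) else 0).
  case: ifP => _; last by rewrite !mulr0 lser0 mulr0.
  rewrite /hsf mcoefCM lamE lserM lserM lser_smono.
  rewrite -[lser (lcs _ _ _ _)]/(Lz psi y i j r) -/(qF i).
  have -> : lmono (- t.+1%:Z) 1 = lmono (-1) 1 * lmono (- t%:Z) 1 :> laurent F.
    by rewrite lmonoM mulr1; congr (lmono _ _); lia.
  rewrite -[lmono 0%Z (qF i)]/(lmono 0 (qF i)).
  move: (lser (mcoef (Ksf i * g) _)) (Lz psi y i j r) (lmono 0 (qF i)) (lmono (-1) 1) (lmono (- t%:Z) 1) => u1 u2 u3 u4 u5.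
  by ring.
have DuE s (Z : UF) : Du psi y i (hsf s (lam Z)) = hsf s (lam (smap (smap (Dz psi y i)) Z)).
  apply: mseriesP => m; apply: laurentP => k; rewrite Du_coef !hsf_coef !lamE !lserE.
  by case: (k + _) => [//|c]; exact: Dz0.
have : hsf t.+1 (lam (smap (smap (iter 0 (Dz psi y i))) Y)) = hsf t.+1 (lam Y).
  by congr (hsf _ (lam _)); apply: mseriesP => m; apply: mseriesP.
rewrite -[Wt1f i (j, r) g]/(smap (smap (iter j (Dz psi y i))) Y) => e0.
elim: j {Y e0} (Y) e0 => [|j IH] Y e0 //=.
by rewrite (IH Y e0) DuE.
Qed.

Definition jrs (k : nat) : seq (nat * nat) := [seq (j, r) | j <- iota 0 (2 * k).+1, r <- iota 0 (2 * k)].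

Lemma lc_bndF i j r l : (2 * l + r < j)%N -> lF i j r l = 0.
Proof. by move=> h; rewrite /lF (Lfun_vbnd qK) // scomp0l tofrac0. Qed.

Lemma Wt1_jrs i jr g m k : sl g -> jr \notin jrs k -> Wt1f i jr g m k = 0.
Proof.
move=> hg h; apply: (Wt1_zero qK cF yF qF Dz0 DzD lc_bndF) => //; apply: contraR h; rewrite negb_or -!leqNgt -ltnNge => /andP[h1 h2].
by case: jr h1 h2 => j r /= h1 h2; apply/allpairsP; exists (j, r); rewrite !mem_iota /=; split=> //; lia.
Qed.

Lemma Wop_jrs i g m k : Wopf i g m k = \sum_(jr <- jrs k) Wt1f i jr g m k.
Proof.
rewrite /jrs big_allpairs -[LHS]/(\sum_(j < (2 * k).+1) \sum_(r < 2 * k) Wt1f i (nat_of_ord j, nat_of_ord r) g m k).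
rewrite -[iota 0 (2 * k).+1]/(index_iota 0 (2 * k).+1) big_mkord; apply: eq_bigr => j _.
have -> : iota 0 (2 * k) = index_iota 0 (2 * k) by rewrite /index_iota subn0.
by rewrite [RHS]big_mkord.
Qed.

Lemma jrs_uniq k : uniq (jrs k).
Proof. by apply: allpairs_uniq; rewrite ?iota_uniq // => -[a b] [c d] _ _. Qed.

Lemma Uterm_coef i jr t g m (k : int) : Uterm psi y i jr (hsf t (lam g)) m k =
  if k + t.+1%:Z is Posz c then Wt1f i jr g m c else 0.
Proof. by rewrite Uterm_lam hsf_coef lamE lserE. Qed.

Lemma Uterm_summable i t g m : sl g -> summable (fun jr => Uterm psi y i jr (hsf t (lam g)) m).
Proof.
move=> hg; split=> [k|].
  apply: (@sub_finite_set _ _ [set` (if k + t.+1%:Z is Posz c then jrs c else [::])]); last exact: finite_seq.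
  move=> jr /=; rewrite Uterm_coef; case: (k + _) => [c|c]; last by rewrite eqxx.
  by apply: contra_neqT; exact: Wt1_jrs.
exists (- t.+1%:Z) => jr k kt; rewrite Uterm_coef; case e : (k + _) => [c|//]; lia.
Qed.

Lemma Uop_lam i t g : sl g -> Uop psi y i (hsf t (lam g)) = hsf t.+1 (lam (Wopf i g)).
Proof.
move=> hg; apply: mseriesP => m; apply: laurentP => k; rewrite hsf_coef lamE lserE.
rewrite -[LHS]/(lsum (fun jr => Uterm psi y i jr (hsf t (lam g)) m) k) /lsum.
rewrite (@laurent_ofE _ _ (- t.+1%:Z)) => [|c ct]; last first.
  apply: fsbig1 => jr _; rewrite Uterm_coef; case e : (c + _) => [c'|//]; lia.
case e : (k + t.+1%:Z) => [c|c]; last by apply: fsbig1 => jr _; rewrite Uterm_coef e.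
rewrite (fsbigE (jrs c)) ?jrs_uniq // => [|jr _ h]; last by rewrite Uterm_coef e; exact: Wt1_jrs.
by rewrite Wop_jrs big_mkcond; apply: eq_bigr => jr _; rewrite in_setT Uterm_coef e.
Qed.

Lemma slWf i g : sl g -> sl (Wopf i g).
Proof. exact: (sl_Wop qK cF yF qF lF Dz0 DzD). Qed.

Lemma foldl_Uop s t g : sl g -> foldl (fun f i => Uop psi y i f) (hsf t (lam g)) s =
  hsf (t + size s) (lam (foldl (fun f i => Wopf i f) g s)).
Proof.
elim: s t g => [|i s IH] t g hg /=; first by rewrite addn0.
by rewrite Uop_lam // IH ?addSnnS //; exact: slWf.
Qed.

Lemma hsf0 (f : Us) : hsf 0 f = f.
Proof. by rewrite /hsf oppr0 -[X in X * _]/(1 : Us) mul1r. Qed.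

Lemma Uiter_lam s : Uiter psi y s = hsf (size s) (lam (foldl (fun f i => Wopf i f) gsf s)).
Proof. by rewrite /Uiter graph_sum_lam -[lam gsf]hsf0 foldl_Uop //; exact: (sl_gs qK cF bF). Qed.

Lemma rhs_Wop (k : nat) : rhs psi y n (k%:Z - n%:Z) = foldl (fun f i => Wopf i f) gsf (enum 'I_n) 0 k.
Proof. by rewrite /rhs Uiter_lam hsf_coef size_enum_ord subrK lamE lserE. Qed.

Lemma finite_sums_hold (N : int) : finite_sums psi y n N.
Proof.
split=> [i m|].
  by rewrite Uiter_lam; apply: Uterm_summable; apply: (sl_foldl qK cF yF qF lF Dz0 DzD); exact: (sl_gs qK cF bF).
have fold_lam (jr : {ffun 'I_n -> nat * nat}) s t g : foldl (fun f i => Uterm psi y i (jr i) f) (hsf t (lam g)) s =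
    hsf (t + size s) (lam (foldl (fun f i => Wt1f i (jr i) f) g s)).
  by elim: s t g => [|i s IH] t g /=; rewrite ?addn0 // Uterm_lam IH addSnnS.
rewrite graph_sum_lam -[lam gsf]hsf0.
case e : (N + n%:Z) => [c|c]; last first.
  rewrite (_ : [set _ | _] = set0) //; apply/seteqP; split=> jr //=.
  by rewrite fold_lam add0n hsf_coef size_enum_ord e lamE lserE eqxx.
(* At hbar^c, after the n factors 1 / hbar are removed, every index j or r is at most 2 c, by
   [foldl_Wt1_low]. *)
pose B := (2 * c).+1.
apply: (@sub_finite_set _ _ (range (fun h : {ffun 'I_n -> 'I_B * 'I_B} => [ffun i => (nat_of_ord (h i).1, nat_of_ord (h i).2)]))).
  move=> jr /=; rewrite fold_lam add0n hsf_coef size_enum_ord e lamE lserE => nz.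
  have bnd i : ((jr i).1 < B)%N /\ ((jr i).2 < B)%N.
    apply/andP; apply: contra_neqT nz; rewrite negb_and -!leqNgt => h.
    apply: (foldl_Wt1_low qK cF yF qF Dz0 DzD lc_bndF (i := i)); [exact: (sl_gs qK cF bF)|by rewrite mem_enum|].
    by case/orP: h => h; apply/orP; [left|right; exact: ltnW].
  exists [ffun i => (inord (jr i).1, inord (jr i).2)] => //; apply/ffunP => i; rewrite !ffunE /=.
  by have [h1 h2] := bnd i; rewrite !inordK // -surjective_pairing.
exact: finite_image (@finite_finset _ _).
Qed.

End FractionSide.

(** * Transfer of relations through the construction, and uniformity in psi and y *)

Section Lifting.
Variables (Pt : Type) (K : fieldType) (qK : qalg K) (A A' : comUnitRingType).
Variables (io : {rmorphism K -> A}) (io' : {rmorphism K -> A'}) (n : nat).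
Variable R : (Pt -> A) -> (Pt -> A') -> Prop.
Hypothesis RC : forall c, R (fun=> io c) (fun=> io' c).
Hypothesis RD : forall x z x' z', R x x' -> R z z' -> R (fun p => x p + z p) (fun p => x' p + z' p).
Hypothesis RM : forall x z x' z', R x x' -> R z z' -> R (fun p => x p * z p) (fun p => x' p * z' p).
Local Notation ex := {ffun 'I_n -> nat}.
Local Notation U A := (mseries ex (mseries nat A)).

Lemma R_eq x z x' z' : (forall p, x p = z p) -> (forall p, x' p = z' p) -> R z z' -> R x x'.
Proof. by move=> /funext -> /funext ->. Qed.

Lemma R0 : R (fun=> 0) (fun=> 0).
Proof. by apply: (R_eq _ _ (RC 0)) => p; rewrite rmorph0. Qed.

Lemma R_sum I (s : seq I) (P : pred I) (f : I -> Pt -> A) (f' : I -> Pt -> A') : (forall i, P i -> R (f i) (f' i)) ->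
  R (fun p => \sum_(i <- s | P i) f i p) (fun p => \sum_(i <- s | P i) f' i p).
Proof.
move=> h; elim: s => [|i s IH]; first by apply: (R_eq _ _ R0) => p; rewrite big_nil.
case Pi : (P i); last by apply: (R_eq _ _ IH) => p; rewrite big_cons Pi.
by apply: (R_eq _ _ (RD (h i Pi) IH)) => p; rewrite big_cons Pi.
Qed.

(** A relation that respects constants, sums and products passes to all series built from them. It
    will be [good], and later also the vanishing of a derivative. *)
Definition G2 (F : Pt -> U A) (F' : Pt -> U A') := forall m (k : nat), R (fun p => F p m k) (fun p => F' p m k).

Lemma G2_1 : G2 (fun=> 1) (fun=> 1).
Proof.
move=> m k; apply: (R_eq _ _ (RC ((m == 0) && (k == 0%N))%:R)) => p; rewrite mcoef1 rmorph_nat;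
  by case: (m == 0); rewrite ?mcoef0 // mcoef1.
Qed.

Lemma G2D F H F' H' : G2 F F' -> G2 H H' -> G2 (fun p => F p + H p) (fun p => F' p + H' p).
Proof. by move=> h1 h2 m k; exact: (RD (h1 m k) (h2 m k)). Qed.

Lemma G2N F F' : G2 F F' -> G2 (fun p => - F p) (fun p => - F' p).
Proof.
by move=> h m k; apply: (R_eq _ _ (RM (RC (-1)) (h m k))) => p; rewrite !mcoefN rmorphN1 mulN1r.
Qed.

Lemma G2M F H F' H' : G2 F F' -> G2 H H' -> G2 (fun p => F p * H p) (fun p => F' p * H' p).
Proof.
move=> h1 h2 m k; apply: (R_eq (fun p => coef2M _ _ _ _) (fun p => coef2M _ _ _ _)).
by apply: R_sum => d _; apply: R_sum => i _; exact: RM.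
Qed.

Lemma G2_sum I (s : seq I) (P : pred I) (F : I -> Pt -> U A) F' : (forall i, P i -> G2 (F i) (F' i)) ->
  G2 (fun p => \sum_(i <- s | P i) F i p) (fun p => \sum_(i <- s | P i) F' i p).
Proof.
move=> h m k; apply: (R_eq _ _ (R_sum s (fun i Pi => h i Pi m k))) => p; by rewrite !mcoef_sum.
Qed.

Lemma G2_prod I (s : seq I) (P : pred I) (F : I -> Pt -> U A) F' : (forall i, P i -> G2 (F i) (F' i)) ->
  G2 (fun p => \prod_(i <- s | P i) F i p) (fun p => \prod_(i <- s | P i) F' i p).
Proof.
move=> h; elim: s => [|i s IH] m k; first by apply: (R_eq _ _ (G2_1 m k)) => p; rewrite big_nil.
case Pi : (P i); last by apply: (R_eq _ _ (IH m k)) => p; rewrite big_cons Pi.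
by apply: (R_eq _ _ (G2M (h i Pi) IH m k)) => p; rewrite big_cons Pi.
Qed.

Lemma G2X F F' j : G2 F F' -> G2 (fun p => F p ^+ j) (fun p => F' p ^+ j).
Proof.
move=> h; elim: j => [|j IH] m k; first exact: (G2_1 m k).
by apply: (R_eq _ _ (G2M h IH m k)) => p; rewrite exprS.
Qed.

Lemma G2_expS (F : Pt -> U A) (F' : Pt -> U A') : (forall p, F p 0 = 0) -> (forall p, F' p 0 = 0) -> G2 F F' ->
  G2 (fun p => expS (F p)) (fun p => expS (F' p)).
Proof.
move=> h0 h0' h m k.
apply: (R_eq (fun p => coef2_expS qK io m k (h0 p)) (fun p => coef2_expS qK io' m k (h0' p))).
by apply: R_sum => j _; apply: RM; [exact: RC|exact: (G2X j h m k)].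
Qed.

Lemma G2_onv i (f : Pt -> nat -> mseries nat A) (f' : Pt -> nat -> mseries nat A') :
  (forall a k : nat, R (fun p => f p a k) (fun p => f' p a k)) ->
  G2 (fun p => onv i (f p)) (fun p => onv i (f' p)).
Proof.
move=> h m k; case e : (m == dexp i *+ m i); last first.
  by apply: (R_eq _ _ R0) => p; rewrite -[onv _ _ m]/(if _ then _ else _) e.
by apply: (R_eq _ _ (h (m i) k)) => p; rewrite -[onv _ _ m]/(if _ then _ else _) e.
Qed.

Lemma R_smono (a k : nat) x x' : R x x' -> R (fun p => (smono a (x p) : mseries nat A) k) (fun p => (smono a (x' p) : mseries nat A') k).
Proof.
move=> h; case e : (k == a); last by apply: (R_eq _ _ R0) => p; rewrite smonoE e.
by apply: (R_eq _ _ h) => p; rewrite smonoE e.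
Qed.

Variables (yv : Pt -> 'I_n -> nat -> A) (yv' : Pt -> 'I_n -> nat -> A').

Lemma G2_Ks i : (forall a, R (fun p => yv p i a.+1) (fun p => yv' p i a.+1)) ->
  G2 (fun p => Ks io (yv p) i) (fun p => Ks io' (yv' p) i).
Proof.
move=> Ry; apply: G2M.
  apply: G2_expS => [p|p|]; [exact: kex0|exact: kex0|].
  apply: G2_onv => -[|[|a]] k; [exact: R0|exact: R0|].
  by apply: R_smono; apply: RM; [exact: RC|exact: Ry].
by apply: G2_onv => a k; apply: R_smono; exact: RC.
Qed.

Variables (bv : Pt -> 'I_n -> 'I_n -> nat -> nat -> A) (bv' : Pt -> 'I_n -> 'I_n -> nat -> nat -> A').
Hypothesis Rb : forall (k l : 'I_n) a b, (k < l)%N -> R (fun p => bv p k l a b) (fun p => bv' p k l a b).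

Lemma G2_gs : G2 (fun p => gs io (bv p)) (fun p => gs io' (bv' p)).
Proof.
apply: G2_sum => E /andP[sE _]; apply: G2_prod => e eE.
have kl : (e.1 < e.2)%N by have /forallP/(_ e)/implyP/(_ eE) := sE.
apply: G2D; last exact: G2N G2_1.
apply: G2_expS => [p|p|m c]; [exact: wex0|exact: wex0|].
case h : [&& m == dexp e.1 *+ m e.1 + dexp e.2 *+ m e.2, (0 < m e.1)%N & (0 < m e.2)%N]; last first.
  by apply: (R_eq _ _ R0) => p; rewrite -[wex _ _ _ _ m]/(if _ then _ else _) h.
apply: (R_eq (z := fun p => smono _ _ c) (z' := fun p => smono _ _ c)) => [p|p|].
- by rewrite -[wex _ _ _ _ m]/(if _ then _ else _) h.
- by rewrite -[wex _ _ _ _ m]/(if _ then _ else _) h.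
by apply: R_smono; apply: RM; [apply: RM; exact: RC|exact: Rb].
Qed.

Variables (D : Pt -> 'I_n -> A -> A) (D' : Pt -> 'I_n -> A' -> A').
Variables (qi : Pt -> 'I_n -> A) (qi' : Pt -> 'I_n -> A').
Variables (lc : Pt -> 'I_n -> nat -> nat -> nat -> A) (lc' : Pt -> 'I_n -> nat -> nat -> nat -> A').
Hypotheses (D0 : forall p i, D p i 0 = 0) (D0' : forall p i, D' p i 0 = 0).
Hypotheses (DA : forall p i x x', D p i (x + x') = D p i x + D p i x').
Hypotheses (DA' : forall p i x x', D' p i (x + x') = D' p i x + D' p i x').
Hypothesis Ry : forall i a, R (fun p => yv p i a.+1) (fun p => yv' p i a.+1).
Hypothesis RDv : forall i x x', R x x' -> R (fun p => D p i (x p)) (fun p => D' p i (x' p)).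
Hypothesis Rq : forall i, R (fun p => qi p i) (fun p => qi' p i).
Hypothesis Rl : forall i j r l, R (fun p => lc p i j r l) (fun p => lc' p i j r l).

Lemma G2_Wop i F F' : G2 F F' ->
  G2 (fun p => Wop io (yv p) (D p) (qi p) (lc p) i (F p)) (fun p => Wop io' (yv' p) (D' p) (qi' p) (lc' p) i (F' p)).
Proof.
move=> h m k.
apply: (@R_sum _ _ xpredT (fun (j : 'I_(2 * k).+1) p => \sum_(r < 2 * k) Wt1 io (yv p) (D p) (qi p) (lc p) i (nat_of_ord j, nat_of_ord r) (F p) m k)
  (fun (j : 'I_(2 * k).+1) p => \sum_(r < 2 * k) Wt1 io' (yv' p) (D' p) (qi' p) (lc' p) i (nat_of_ord j, nat_of_ord r) (F' p) m k)) => j _.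
apply: R_sum => r _.
apply: (R_eq (fun p => Wt1E _ _ _ _ (D0 p) (DA p) _ _ _ _ _) (fun p => Wt1E _ _ _ _ (D0' p) (DA' p) _ _ _ _ _)).
case: (m i == 0%N); last exact: R0.
apply: R_sum => l _ /=; have Rit x x' : R x x' -> R (fun p => iter j (D p i) (x p)) (fun p => iter j (D' p i) (x' p)).
  by move=> hx; elim: (nat_of_ord j) => [//|j' IH]; exact: RDv IH.
apply: Rit; apply: RM; first exact: Rl.
apply: RM; first exact: Rq.
exact: (G2M (G2_Ks (Ry i)) h).
Qed.

Lemma G2_foldl (s : seq 'I_n) F F' : G2 F F' ->
  G2 (fun p => foldl (fun f i => Wop io (yv p) (D p) (qi p) (lc p) i f) (F p) s)
     (fun p => foldl (fun f i => Wop io' (yv' p) (D' p) (qi' p) (lc' p) i f) (F' p) s).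
Proof. by elim: s F F' => [//|i s IH] F F' h; apply: IH; exact: G2_Wop. Qed.

End Lifting.

Section PsiPolynomials.
Variables (K : fieldType) (qK : qalg K).
Local Notation ser := (mseries nat K).

Inductive ppoly : (ser -> ser) -> Prop :=
  | ppoly_C c : ppoly (fun=> smono 0%N c)
  | ppoly_psi k : ppoly (fun psi => iter k.+1 (@sderiv K) psi)
  | ppoly_D F G : ppoly F -> ppoly G -> ppoly (fun psi => F psi + G psi)
  | ppoly_M F G : ppoly F -> ppoly G -> ppoly (fun psi => F psi * G psi).

Lemma ppoly_eq F G : (forall psi, F psi = G psi) -> ppoly G -> ppoly F.
Proof. by move=> /funext ->. Qed.

Lemma ppoly0 : ppoly (fun=> 0).
Proof. by apply: (ppoly_eq _ (ppoly_C 0)) => psi; rewrite rmorph0. Qed.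

Lemma sderivD (f g : ser) : sderiv (f + g) = sderiv f + sderiv g.
Proof. by apply: mseriesP => k; rewrite -[LHS]/((f k.+1 + g k.+1) *+ k.+1) mulrnDl. Qed.

Lemma Xs_injl (f g : ser) : Xs K * f = Xs K * g -> f = g.
Proof. by move=> e; apply: mseriesP => k; have := congr1 (fun h : ser => h k.+1) e; rewrite !mcoefXs. Qed.

Lemma sderivM (f g : ser) : sderiv (f * g) = sderiv f * g + f * sderiv g.
Proof.
apply: Xs_injl; rewrite Xs_sderiv (eul_leibniz f g) -!Xs_sderiv.
by move: (Xs K) (sderiv f) (sderiv g) => *; ring.
Qed.

Lemma ppoly_deriv F : ppoly F -> ppoly (fun psi => sderiv (F psi)).
Proof.
elim=> [c|k|G H hG dG hH dH|G H hG dG hH dH].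
- apply: (ppoly_eq _ ppoly0) => psi; apply: mseriesP => k.
  by rewrite -[LHS]/(smono 0%N c k.+1 *+ k.+1) smonoE mul0rn.
- exact: (ppoly_psi k.+1).
- by apply: (ppoly_eq _ (ppoly_D dG dH)) => psi; exact: sderivD.
- apply: (ppoly_eq _ (ppoly_D (ppoly_M dG hH) (ppoly_M hG dH))) => psi; exact: sderivM.
Qed.

Lemma ppoly_sum I (s : seq I) (F : I -> ser -> ser) : (forall i, ppoly (F i)) ->
  ppoly (fun psi => \sum_(i <- s) F i psi).
Proof.
move=> h; elim: s => [|i s IH]; first by apply: (ppoly_eq _ ppoly0) => psi; rewrite big_nil.
by apply: (ppoly_eq _ (ppoly_D (h i) IH)) => psi; rewrite big_cons.
Qed.

Local Notation vhy := (mseries nat (mseries nat ser)).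
Definition ppoly2 (F : ser -> vhy) := forall j l : nat, ppoly (fun psi => F psi j l).

Lemma ppoly2M F G : ppoly2 F -> ppoly2 G -> ppoly2 (fun psi => F psi * G psi).
Proof.
move=> hF hG j l; apply: (ppoly_eq (fun psi => vhy_coefM _ _ _ _)).
by apply: ppoly_sum => i; apply: ppoly_sum => p; exact: ppoly_M.
Qed.

Lemma ppoly2_cst F : ppoly F -> ppoly2 (fun psi => vhy_cst (F psi)).
Proof.
move=> hF [|j] [|l]; rewrite ?/vhy_cst ?/sconst.
- exact: hF.
- by apply: (ppoly_eq _ ppoly0).
- by apply: (ppoly_eq _ ppoly0).
- by apply: (ppoly_eq _ ppoly0).
Qed.

Lemma coef2_1 j l : (1 : vhy) j l = if (j == 0%N) && (l == 0%N) then 1 else 0.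
Proof.
rewrite mcoef1; case: j => [|j]; last by rewrite mulr0n mcoef0.
by rewrite mulr1n mcoef1; case: l => [|l]; rewrite ?mulr1n ?mulr0n.
Qed.

Lemma ppoly2X F k : ppoly2 F -> ppoly2 (fun psi => F psi ^+ k).
Proof.
move=> hF; elim: k => [|k IH] j l; last first.
  by apply: (ppoly_eq _ (ppoly2M hF IH j l)) => psi; rewrite exprS.
apply: (ppoly_eq (G := fun=> smono 0%N ((j == 0%N) && (l == 0%N))%:R)); last exact: ppoly_C.
by move=> psi; rewrite expr0 coef2_1; case: ifP => _; rewrite ?rmorph1 ?rmorph0.
Qed.

Lemma ppoly_Lfun r : ppoly2 (fun psi => Lfun psi r).
Proof.
elim: r => [|r IH] j l.
  apply: (ppoly_eq (fun psi => expS_coef2 qK l (Lexp0 qK psi) (ltnSn j))).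
  apply: ppoly_sum => k; apply: ppoly_M.
    by apply: (ppoly_eq _ (ppoly_C (k`!%:R)^-1)) => psi; rewrite fact_const_V.
  apply: (ppoly2X (F := @Lexp K)) => j' l'; apply: (ppoly_eq (fun psi => Lexp_coef qK psi j' l')).
  case: j' => [|al]; first exact: ppoly0.
  case: (posnP l') => [->|l0]; first by rewrite andbF; exact: ppoly0.
  case: (al <= l')%N; last exact: ppoly0.
  by apply: ppoly_M; [exact: ppoly_C|case: l' l0 => // l' _; exact: ppoly_psi].
apply: (ppoly_D (F := fun psi => sderiv (Lfun psi r j l)) (G := fun psi => (vvar K * vhy_cst (sderiv psi) * Lfun psi r) j l)).
  exact: ppoly_deriv.
apply: (ppoly2M (F := fun psi => vvar K * vhy_cst (sderiv psi))) => // j' l'.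
apply: (ppoly2M (F := fun=> vvar K)); last exact: (ppoly2_cst (ppoly_psi 0)).
move=> a b; apply: (ppoly_eq (G := fun=> smono 0%N ((a == 1%N) && (b == 0%N))%:R)) => [psi|]; last exact: ppoly_C.
rewrite -[vvar K]/(smono 1%N 1 : vhy) smonoE; case: (a == 1%N); last by rewrite mcoef0 rmorph0.
by rewrite mcoef1; case: b => [|b]; rewrite ?mulr1n ?mulr0n ?rmorph1 ?rmorph0.
Qed.

End PsiPolynomials.

Section Families.
Variables (K : fieldType) (qK : qalg K) (n : nat).
Local Notation ser := (mseries nat K).
Local Notation ex := {ffun 'I_n -> nat}.
Local Notation O := (zser K n).
Local Notation F := (zfrac K n).
Local Notation io := (@iota_z K n).
(** Families over all pairs (psi, y), so that one rational expression serves every pair. *)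
Definition Pt : Type := {p : ser * ser | p.1 0%N = 0 /\ p.2 0%N = 0}.
Local Notation ps p := (sval p).1.
Local Notation ys p := (sval p).2.
Implicit Types (p : Pt) (i : 'I_n).

Lemma ps0 p : ps p 0%N = 0. Proof. by case: p => -[? ?] []. Qed.
Lemma ys0 p : ys p 0%N = 0. Proof. by case: p => -[? ?] []. Qed.

Definition dlt : O := \prod_(e : 'I_n * 'I_n | (e.1 < e.2)%N) (zvar K e.1 - zvar K e.2).

Lemma zvar_neq (k l : 'I_n) : k != l -> zvar K k - zvar K l != 0.
Proof.
move=> kl; apply/eqP => /(congr1 (fun f : O => f (dexp k))); rewrite mcoefB !smonoE eqxx.
case: eqP => [/ffunP/(_ k)|_]; first by rewrite !dexp1E eqxx (negbTE kl).
by rewrite subr0 => /eqP; rewrite oner_eq0.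
Qed.

Lemma dlt_neq0 : dlt != 0.
Proof.
apply/prodf_neq0 => e el; apply: zvar_neq; apply: contraTneq el => ->; by rewrite ltnn.
Qed.

Lemma RlocE (x : F) : Rloc x <-> exists f k, x = tofr f / tofr (dlt ^+ k).
Proof.
have e k : tofr (dlt ^+ k) = (\prod_(e : 'I_n * 'I_n | (e.1 < e.2)%N) tofr (zvar K e.1 - zvar K e.2)) ^+ k.
  by rewrite tofracXn rmorph_prod.
by split=> -[f [k ->]]; exists f, k; rewrite e.
Qed.

Lemma Rloc_tofr f : Rloc (tofr f : F).
Proof. by apply/RlocE; exists f, 0%N; rewrite expr0 tofrac1 divr1. Qed.

Lemma RlocD (x x' : F) : Rloc x -> Rloc x' -> Rloc (x + x').
Proof.
move=> /RlocE[f [k ->]] /RlocE[f' [k' ->]]; apply/RlocE; exists (f * dlt ^+ k' + f' * dlt ^+ k), (k + k')%N.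
by rewrite addf_div ?tofrac_eq0 ?expf_neq0 ?dlt_neq0 // exprD !(tofracM, tofracD).
Qed.

Lemma RlocM (x x' : F) : Rloc x -> Rloc x' -> Rloc (x * x').
Proof.
move=> /RlocE[f [k ->]] /RlocE[f' [k' ->]]; apply/RlocE; exists (f * f'), (k + k')%N.
by rewrite mulf_div exprD !tofracM.
Qed.

Lemma Rloc_theta i (x : F) : Rloc x -> Rloc (thetaF i x).
Proof.
move=> /RlocE[f [k ->]]; rewrite thetaF_frac ?expf_neq0 ?dlt_neq0 // -exprM.
by apply/RlocE; exists (theta i f * dlt ^+ k - f * theta i (dlt ^+ k)), (k * 2)%N.
Qed.

Lemma thetaF_M i (x x' : F) : thetaF i (x * x') = thetaF i x * x' + x * thetaF i x'.
Proof.
have h0 (u : F) : \d_(generic_quotient.repr u) != 0 by exact: denom_ratioP.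
have := h0 x; have := h0 x'; have := frac_repr x; have := frac_repr x'.
move: (\n_(generic_quotient.repr x)) (\d_(generic_quotient.repr x)) (\n_(generic_quotient.repr x')) (\d_(generic_quotient.repr x')).
move=> a b c d -> -> d0 b0; rewrite mulf_div -!tofracM !thetaF_frac ?mulf_neq0 //.
rewrite !mulf_div addf_div ?mulf_neq0 ?tofrac_eq0 ?expf_neq0 // -!tofracM -!tofracD.
apply/eqP; rewrite eqr_div ?tofrac_eq0 ?mulf_neq0 ?expf_neq0 ?mulf_neq0 // -!tofracM tofrac_eq; apply/eqP.
by rewrite !thetaM; move: (theta i a) (theta i b) (theta i c) (theta i d) => *; ring.
Qed.

Lemma thetaF_V i (x : F) : x != 0 -> thetaF i x^-1 = - thetaF i x * (x^-1 * x^-1).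
Proof.
move=> x0; have t1 : thetaF i 1 = 0 :> F.
  have <- : tofr (1 : O) = 1 :> F by exact: tofrac1.
  rewrite thetaF_tofr -tofrac0; congr tofr.
  by have := thetaM i (1 : O) 1; rewrite !mulr1 mul1r => /esym/(canRL (addrK _)); rewrite subrr.
have := thetaF_M i x x^-1; rewrite divff // t1 => /esym/eqP; rewrite addr_eq0 => /eqP e.
by rewrite mulrA mulNr e opprK mulrAC divff // mul1r.
Qed.

(** Symbolic z_i d/dz_i, independent of psi and y. *)
Fixpoint rder i (e : ratexpr K n) : ratexpr K n :=
  match e with
  | RConst _ => RConst _ 0
  | RZ j => if i == j then RZ _ j else RConst _ 0
  | RDy j k => if i == j then RMul (RZ _ i) (RDy _ i k.+1) else RConst _ 0
  | RDpsi j k => if i == j then RMul (RMul (RZ _ i) (RDy _ i 0)) (RDpsi _ i k.+1) else RConst _ 0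
  | RAdd e1 e2 => RAdd (rder i e1) (rder i e2)
  | RMul e1 e2 => RAdd (RMul (rder i e1) e2) (RMul e1 (rder i e2))
  | RInv e1 => RMul (RMul (RConst _ (-1)) (rder i e1)) (RMul (RInv e1) (RInv e1))
  end.

Lemma at_z0 i (f : ser) : f 0%N = 0 -> at_z i f 0 = 0 :> K.
Proof. by move=> f0; rewrite at_z_coef ffunE mulr0n eqxx. Qed.

Lemma at_z_scomp i (f y : ser) : y 0%N = 0 -> at_z i (scomp f y) = scomp f (at_z i y).
Proof.
move=> y0; apply: mseriesP => r; have ay0 := at_z0 i y0; pose N := (degF 'I_n r).+1.
have e1 c : (c < N)%N -> scomp f y c = \sum_(k < N) f k * (y ^+ k) c.
  move=> cN; rewrite /scomp (@csum_nat _ _ _ c N) => [|k kN].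
    by apply: eq_bigr => k _; exact: mcoefCM.
  by rewrite (mcoef_mulX_deg (dg := degN)) //; exact: leq_trans kN.
transitivity (\sum_(k < N) f k * (at_z i y ^+ k) r); last first.
  apply/esym; rewrite /scomp (@csum_nat _ _ _ r N) => [|k kN]; first by apply: eq_bigr => k _; exact: mcoefCM.
  by rewrite (mcoef_mulX_deg (dg := degF 'I_n)).
have ri : (r i < N)%N by rewrite ltnS -[degF _ r]/(\sum_j r j)%N (bigD1 i) //= leq_addr.
rewrite at_z_coef e1 //.
case: ifP => h; last by rewrite big1 // => k _; rewrite -rmorphXn at_z_coef h mulr0.
by apply: eq_bigr => k _; rewrite -rmorphXn at_z_coef h.
Qed.

Lemma theta_zvar i j : theta i (zvar K j) = if i == j then zvar K j else 0.
Proof.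
apply: mseriesP => m; rewrite -[LHS]/(zvar K j m *+ m i) smonoE.
have [->|ij] := eqVneq i j; rewrite ?smonoE; case: eqP => [->|_]; rewrite ?mul0rn //.
  by rewrite dexp1E eqxx.
by rewrite dexp1E (negbTE ij).
Qed.

Lemma at_z_eul i (f : ser) : at_z i (eul f) = zvar K i * at_z i (sderiv f).
Proof. by rewrite -Xs_sderiv at_zM; congr (_ * _); rewrite at_zE hcomp_smono expr1 rmorph1 mul1r. Qed.

Lemma rder_defined psi y i e : rdefined psi y e -> rdefined psi y (rder i e).
Proof.
elim: e => //= [j|j k|j k|e1 h1 e2 h2 /andP[d1 d2]|e1 h1 e2 h2 /andP[d1 d2]|e1 h1 /andP[d1 d2]]; try by case: ifP.
- by rewrite h1 // h2.
- by rewrite h1 // h2 // d1 d2.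
- by rewrite h1 // d1 d2.
Qed.

Lemma reval_rder (psi y : ser) i e : y 0%N = 0 -> rdefined psi y e ->
  reval psi y (rder i e) = thetaF i (reval psi y e).
Proof.
move=> y0; elim: e => [c|j|j k|j k|e1 h1 e2 h2|e1 h1 e2 h2|e1 h1] /= d.
- rewrite thetaF_tofr; congr tofr; apply: mseriesP => m; rewrite -[RHS]/(smono 0 c m *+ m i) !smonoE.
  by case: eqP => [->|_]; rewrite ?ffunE ?mul0rn.
- rewrite thetaF_tofr theta_zvar; case: ifP => _ //=; by rewrite tofrac0 -[sconst _ _]/(smono 0 0 : O) rmorph0 tofrac0.
- case: (eqVneq i j) => [<-|ij] /=; rewrite thetaF_tofr theta_at_z ?eqxx ?(negbTE ij); first by rewrite at_z_eul tofracM.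
  by rewrite tofrac0 -[sconst _ _]/(smono 0 0 : O) rmorph0 tofrac0.
- case: (eqVneq i j) => [<-|ij] /=; rewrite thetaF_tofr;
    [rewrite -(at_z_scomp i (sderiv (iter k (@sderiv K) psi)) y0) theta_at_z eqxx|
     rewrite -(at_z_scomp j (sderiv (iter k (@sderiv K) psi)) y0) theta_at_z (negbTE ij)]; last first.
    by rewrite tofrac0 -[sconst _ _]/(smono 0 0 : O) rmorph0 tofrac0.
  by rewrite (eul_scomp _ y0) at_zM at_z_eul !tofracM (at_z_scomp i _ y0).
- by case/andP: d => d1 d2; rewrite h1 // h2 // thetaF_D.
- by case/andP: d => d1 d2; rewrite h1 // h2 // thetaF_M.
- case/andP: d => d1 d2; rewrite h1 // thetaF_V // -[sconst _ _]/(smono 0 (-1) : O) rmorphN1 tofracN tofrac1 mulN1r //.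
Qed.

(** All that is wanted of the right-hand side at once: a uniform rational expression, membership in
    R, and an expansion in the zeta_i. *)
Definition good (x : Pt -> F) (o : Pt -> O) : Prop :=
  (exists e, forall p, rdefined (ps p) (ys p) e /\ x p = reval (ps p) (ys p) e) /\
  forall p, Rloc (x p) /\ agree (x p) (o p).

Lemma zbm0 : zbm (0 : ex) = 0.
Proof. by apply/ffunP => j; rewrite !ffunE big1 // => l _; rewrite ffunE. Qed.

Definition cO : {rmorphism K -> O} := @smono ex K 0.

Lemma good_C c : good (fun=> cF K n c) (fun=> cO c).
Proof.
split; first by exists (RConst _ c).
move=> p; split; first exact: Rloc_tofr.
have := agree_tofr (smono 0 c : O); by rewrite io_smono zbm0.
Qed.

Lemma good_D x z x' z' : good x x' -> good z z' -> good (fun p => x p + z p) (fun p => x' p + z' p).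
Proof.
move=> [[e he] hx] [[f hf] hz]; split.
  by exists (RAdd e f) => p; have [/= -> ->] := he p; have [/= -> ->] := hf p.
by move=> p; have [r1 a1] := hx p; have [r2 a2] := hz p; split; [exact: RlocD|exact: agreeD].
Qed.

Lemma good_M x z x' z' : good x x' -> good z z' -> good (fun p => x p * z p) (fun p => x' p * z' p).
Proof.
move=> [[e he] hx] [[f hf] hz]; split.
  by exists (RMul e f) => p; have [/= -> ->] := he p; have [/= -> ->] := hf p.
by move=> p; have [r1 a1] := hx p; have [r2 a2] := hz p; split; [exact: RlocM|exact: agreeM].
Qed.

Lemma good_theta i x x' : good x x' -> good (fun p => thetaF i (x p)) (fun p => thO i (x' p)).
Proof.
move=> [[e he] hx]; split.
  by exists (rder i e) => p; have [d ->] := he p; rewrite rder_defined // reval_rder // ys0.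
by move=> p; have [r1 a1] := hx p; split; [exact: Rloc_theta|exact: agree_theta].
Qed.

Lemma good_q i : good (fun p => qF (ps p) (ys p) i) (fun p => (Qo (ps p) (ys p) i)^-1).
Proof.
have QE p : Qz (ps p) (ys p) i = reval (ps p) (ys p) (RAdd (RConst _ 1)
    (RMul (RConst _ (-1)) (RMul (RMul (RZ K i) (RDy K i 0)) (RDpsi K i 0)))).
  rewrite /= /Qz /Qser; set u := smono 1%N 1 * sderiv (ys p) * _.
  have -> : at_z i (1 - u) = 1 - at_z i u :> O by rewrite rmorphB rmorph1.
  have -> : tofr (sconst ex (1 : K)) = 1 :> F by exact: tofrac1.
  have -> : tofr (sconst ex (-1 : K)) = - 1 :> F.
    by rewrite -[sconst _ _]/(smono 0 (-1) : O) rmorphN1 tofracN tofrac1.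
  rewrite tofracB tofrac1 mulN1r; congr (1 - _).
  by rewrite /u !at_zM !tofracM -at_z_scomp ?ys0 // at_zE hcomp_smono expr1 rmorph1 mul1r.
split.
  eexists (RInv _) => p; split; last by rewrite /= /qF QE.
  by have h : Qz (ps p) (ys p) i != 0 by [apply: Qz_neq0; exact: ys0]; move: h; rewrite QE.
move=> p; split; last by apply: agreeV; [apply: Qo_unit; exact: ys0|exact: agree_tofr].
have u : (at_z i (Qser (ps p) (ys p)) : O) \is a GRing.unit.
  by apply: (mseries_unit1 (degF 'I_n)); rewrite at_z_coef ffunE mulr0n eqxx Qser0 // ys0.
have -> : qF (ps p) (ys p) i = tofr (at_z i (Qser (ps p) (ys p)))^-1.
  by apply: mulr1_eq; rewrite /Qz -tofracM divrr // tofrac1.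
exact: Rloc_tofr.
Qed.

Definition yO p i (a : nat) : O := iter a (thO i) (io (at_z i (ys p))).
Definition bO (k l : 'I_n) (a b : nat) : O := iter a (thO k) (iter b (thO l) (Bkl K k l)).
Definition lO p i (j r l : nat) : O := io (scomp (Lfun (ps p) r j l) (at_z i (ys p))).

(** Order 0 is excluded because y itself is no atom of [ratexpr]; in the kernel the term S - 1 has
    removed it. *)
Lemma good_y i a : good (fun p => yF (ys p) i a.+1) (fun p => yO p i a.+1).
Proof.
elim: a => [|a IH]; last exact: (good_theta i IH).
split; last first.
  move=> p; rewrite /yF /yO /= thetaF_tofr thO_io; split; [exact: Rloc_tofr|exact: agree_tofr].
exists (RMul (RZ K i) (RDy K i 0)) => p; split=> //=.
by rewrite /yF /= thetaF_tofr theta_at_z eqxx at_z_eul tofracM.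
Qed.

Lemma good_b (k l : 'I_n) a b : (k < l)%N -> good (fun=> bF K k l a b) (fun=> bO k l a b).
Proof.
move=> kl; have kl' : k != l by apply: contraTneq kl => ->; rewrite ltnn.
have z0 := zvar_neq kl'.
have g0 : good (fun=> tofr (zvar K k) * tofr (zvar K l) / (tofr (zvar K k) - tofr (zvar K l)) ^+ 2) (fun=> Bkl K k l).
  split.
    pose d := RAdd (RZ K k) (RMul (RConst n (-1)) (RZ K l)).
    have dE p : reval (ps p) (ys p) d = tofr (zvar K k) - tofr (zvar K l).
      by rewrite /= -[sconst _ _]/(smono 0 (-1) : O) rmorphN1 tofracN tofrac1 mulN1r.
    exists (RMul (RMul (RZ K k) (RZ K l)) (RInv (RMul d d))) => p.
    have -> : reval (ps p) (ys p) (RMul (RMul (RZ K k) (RZ K l)) (RInv (RMul d d))) =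
      tofr (zvar K k) * tofr (zvar K l) / (reval (ps p) (ys p) d * reval (ps p) (ys p) d) by [].
    split; last by rewrite dE expr2.
    have -> : rdefined (ps p) (ys p) (RMul (RMul (RZ K k) (RZ K l)) (RInv (RMul d d))) =
      (reval (ps p) (ys p) d * reval (ps p) (ys p) d != 0) by [].
    by rewrite dE -tofracB mulf_neq0 // tofrac_eq0.
  move=> p; split; last exact: agree_B.
  pose r : O := \prod_(e : 'I_n * 'I_n | (e.1 < e.2)%N && (e != (k, l))) (zvar K e.1 - zvar K e.2).
  apply/RlocE; exists (zvar K k * zvar K l * r ^+ 2), 2%N.
  have dE : dlt = (zvar K k - zvar K l) * r by rewrite /dlt (bigD1 (k, l)).
  have r0 : r != 0 by have := dlt_neq0; rewrite dE mulf_eq0 negb_or => /andP[].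
  rewrite -tofracB -!tofracM -tofracXn; apply/eqP.
  rewrite eqr_div ?tofrac_eq0 ?expf_neq0 ?dlt_neq0 // -!tofracM tofrac_eq dE exprMn.
  by apply/eqP; move: (zvar K k) (zvar K l) => u v; ring.
rewrite /bF /bO; elim: a => [|a IH]; last exact: (good_theta k IH).
by elim: b => [|b IH] //; exact: (good_theta l IH).
Qed.

Lemma good_l i j r l : good (fun p => lF (ps p) (ys p) i j r l) (fun p => lO p i j r l).
Proof.
suff h G : ppoly G -> good (fun p => tofr (scomp (G (ps p)) (at_z i (ys p)))) (fun p => io (scomp (G (ps p)) (at_z i (ys p)))).
  exact: (h _ (ppoly_Lfun qK r j l)).
move=> pG.
have e p f : scomp f (at_z i (ys p)) = hcomp (degF 'I_n) (@smono ex K 0) (at_z0 i (ys0 p)) f by exact: scomp_hcomp.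
elim: pG => [c|k|G1 G2 _ h1 _ h2|G1 G2 _ h1 _ h2].
- apply: (R_eq (R := good) _ _ (good_C c)) => p; rewrite e hcomp_smono expr0 mulr1 //.
  by rewrite io_smono zbm0.
- split; first by exists (RDpsi K i k).
  by move=> p; split; [exact: Rloc_tofr|exact: agree_tofr].
- by apply: (R_eq (R := good) _ _ (good_D h1 h2)) => p; rewrite !e rmorphD ?tofracD ?ioD.
- by apply: (R_eq (R := good) _ _ (good_M h1 h2)) => p; rewrite !e rmorphM ?tofracM ?ioM.
Qed.

Lemma good_Dz i x x' : good x x' ->
  good (fun p => Dz (ps p) (ys p) i (x p)) (fun p => DO (ps p) (ys p) i (x' p)).
Proof. by move=> h; exact: good_M (good_q i) (good_theta i h). Qed.

Definition rhsO p (k : nat) : O := foldl (fun f i =>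
  Wop cO (yO p) (@DO K n (ps p) (ys p)) (fun i => (Qo (ps p) (ys p) i)^-1) (lO p) i f) (gs cO bO) (enum 'I_n) 0 k.

Lemma DO0 psi y i : DO psi y i 0 = 0 :> O.
Proof. by rewrite /DO (raddf0 (thO i)) mulr0. Qed.
Lemma DO_add psi y i (x x' : O) : DO psi y i (x + x') = DO psi y i x + DO psi y i x'.
Proof. by rewrite /DO (raddfD (thO i)) mulrDr. Qed.

Lemma good_rhs k : good (fun p => rhs (ps p) (ys p) n (k%:Z - n%:Z)) (fun p => rhsO p k).
Proof.
suff h : good (fun p => foldl (fun f i => Wop (cF K n) (yF (ys p)) (@Dz K (ps p) (ys p) n) (qF (ps p) (ys p))
    (lF (ps p) (ys p)) i f) (gs (cF K n) (@bF K n)) (enum 'I_n) 0 k) (fun p => rhsO p k).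
  by apply: (R_eq (R := good) _ _ h) => // p; apply: (rhs_Wop qK); exact: ys0.
suff h : G2 good (fun p => foldl (fun f i => Wop (cF K n) (yF (ys p)) (@Dz K (ps p) (ys p) n) (qF (ps p) (ys p))
    (lF (ps p) (ys p)) i f) (gs (cF K n) (@bF K n)) (enum 'I_n)) (fun p => foldl (fun f i =>
    Wop cO (yO p) (@DO K n (ps p) (ys p)) (fun i => (Qo (ps p) (ys p) i)^-1) (lO p) i f) (gs cO bO) (enum 'I_n)).
  exact: (h 0 k).
apply: (G2_foldl qK good_C good_D good_M) => [p i|p i|p i x x'|p i x x'|i a|i x x'|i|i j r l|].
- exact: Dz0.
- exact: DO0.
- exact: DzD.
- exact: DO_add.
- exact: good_y.
- exact: good_Dz.
- exact: good_q.
- exact: good_l.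
- by apply: (G2_gs qK good_C good_D good_M) => k' l a b; exact: good_b.
Qed.

End Families.

Lemma WopE (K : fieldType) (A : comUnitRingType) (io : {rmorphism K -> A}) n yv D qi lc (i : 'I_n) g m (k : nat) :
  Wop io yv D qi lc i g m k =
  \sum_(j < (2 * k).+1) \sum_(r < 2 * k) Wt1 io yv D qi lc i (nat_of_ord j, nat_of_ord r) g m k.
Proof. by []. Qed.

(** * Residues of the right-hand side *)

Section Evaluation.
Variables (K : fieldType) (qK : qalg K) (n : nat) (p : Pt K) (b : {ffun 'I_n -> nat}).
Local Notation ex := {ffun 'I_n -> nat}.
Local Notation O := (zser K n).
Local Notation UO := (mseries ex (mseries nat O)).
Local Notation io := (@iota_z K n).
Local Notation psi := (sval p).1.
Local Notation y := (sval p).2.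
Local Notation dF := (degF 'I_n).
Local Notation al i := (aK K b i).
Local Notation cO := (@cO K n).
Local Notation Xf := (Xf psi y b).
Implicit Types (i j : 'I_n) (g : UO) (m : ex).

Definition qO i : O := (Qo psi y i)^-1.
(** What D_i becomes under the residue at b. *)
Definition Da i (x : O) : O := cO (al i) * x.
Local Notation W := (Wop cO (yO p) (@DO K n psi y) qO (lO p)).
Local Notation Wa := (Wop cO (yO p) Da qO (lO p)).
Local Notation KO := (Ks cO (yO p)).

Lemma Da0 i : Da i 0 = 0. Proof. exact: mulr0. Qed.
Lemma Da_add i x x' : Da i (x + x') = Da i x + Da i x'. Proof. exact: mulrDr. Qed.

Lemma thO_C i c : thO i (cO c) = 0.
Proof.
apply: mseriesP => m; rewrite -[LHS]/(smono 0 c m *~ av m i) smonoE.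
by case: eqP => [->|_]; rewrite ?av0 ?mulr0z ?mul0rz.
Qed.

Lemma thO_unitV i (x : O) : x \is a GRing.unit -> thO i x = 0 -> thO i x^-1 = 0.
Proof.
move=> u tx; have := thOM i x x^-1; rewrite divrr // thO1 tx mul0r add0r => /esym e.
by apply: (mulrI u); rewrite e mulr0.
Qed.

Lemma thO_lO i j a r l : i != j -> thO i (lO p j a r l) = 0.
Proof.
by move=> ij; rewrite /lO -(at_z_scomp j _ (ys0 p)) thO_at_z (negbTE ij).
Qed.

Lemma thO_yO i j a : i != j -> thO i (yO p j a) = 0.
Proof.
move=> ij; have h c : thO j (io (at_z j c)) = io (at_z j (eul c)) by rewrite thO_at_z eqxx.
have e c : iter a (thO j) (io (at_z j c)) = io (at_z j (iter a (@eul K) c)).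
  by elim: a => //= a ->; exact: h.
by rewrite /yO e thO_at_z (negbTE ij).
Qed.

Lemma thO_KO i j m (k : nat) : i != j -> thO i (KO j m k) = 0.
Proof.
(* The transfer lemma again, with the relation that theta_i of the entry vanishes. *)
move=> ij; pose R (x x' : unit -> O) := thO i (x Datatypes.tt) = 0.
have := @G2_Ks unit K qK O O cO cO n R _ _ _ (fun=> yO p) (fun=> yO p) j; apply.
- by move=> c; exact: thO_C.
- by move=> x z x' z' hx hz; rewrite /R raddfD /= hx hz addr0.
- by move=> x z x' z' hx hz; rewrite /R thOM hx hz mul0r mulr0 addr0.
- by move=> a; exact: thO_yO.
Qed.

Lemma Xf_DOc i (c x : O) : thO i c = 0 -> Xf (c * DO psi y i x) = al i * Xf (c * x).
Proof.
move=> tc; rewrite -(Xf_D qK (ps0 p) (ys0 p)); congr (Xf _).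
by rewrite /DO thOM tc mul0r add0r mulrCA.
Qed.

Lemma Xf_iter i (c x : O) (a : nat) : thO i c = 0 ->
  Xf (c * iter a (DO psi y i) x) = Xf (c * iter a (Da i) x).
Proof.
move=> tc; elim: a => //= a IH; rewrite Xf_DOc // IH /Da.
by rewrite mulrCA -[cO _]/(smono 0 (al i) : O) XfZ.
Qed.

Lemma Xf_sum_eq N (F F' : 'I_N -> O) (c : O) : (forall a, Xf (c * F a) = Xf (c * F' a)) ->
  Xf (c * \sum_(a < N) F a) = Xf (c * \sum_(a < N) F' a).
Proof. by move=> h; rewrite !mulr_sumr !Xf_sum; apply: eq_bigr => a _; exact: h. Qed.

Lemma Xf_coefM (c : O) (f g g' : UO) m (k : nat) :
  (forall (d : ex * ex) (e : nat), Xf (c * (f d.1 e * g d.2 (k - e)%N)) = Xf (c * (f d.1 e * g' d.2 (k - e)%N))) ->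
  Xf (c * (f * g) m k) = Xf (c * (f * g') m k).
Proof.
move=> h; rewrite !coef2M !mulr_sumr !Xf_sum; apply: eq_bigr => d _; apply: Xf_sum_eq => e; exact: h.
Qed.

(** The prefactor c stands for the operators applied afterwards. It contains none of the variables
    treated so far, so it commutes with their D_j and the replacement can be made inside. *)
Lemma Xf_Wstep (s : seq 'I_n) i g g' : i \notin s ->
  (forall (c : O) m (k : nat), (forall j, j \in s -> thO j c = 0) -> Xf (c * g m k) = Xf (c * g' m k)) ->
  forall (c : O) m (k : nat), (forall j, j \in rcons s i -> thO j c = 0) -> Xf (c * W i g m k) = Xf (c * Wa i g' m k).
Proof.
move=> is_ IH c m k hc; have ci : thO i c = 0 by apply: hc; rewrite mem_rcons mem_head.
refine (etrans (congr1 (fun z => Xf (c * z)) (WopE cO (yO p) (@DO K n psi y) qO (lO p) i g m k)) _).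
refine (esym (etrans (congr1 (fun z => Xf (c * z)) (WopE cO (yO p) Da qO (lO p) i g' m k)) (esym _))).
apply: Xf_sum_eq => a; apply: Xf_sum_eq => r.
refine (etrans (congr1 (fun z => Xf (c * z)) (Wt1E cO (yO p) qO (lO p) (@DO0 K n psi y) (@DO_add K n psi y) i
  (nat_of_ord a, nat_of_ord r) g m k)) _).
refine (esym (etrans (congr1 (fun z => Xf (c * z)) (Wt1E cO (yO p) qO (lO p) Da0 Da_add i
  (nat_of_ord a, nat_of_ord r) g' m k)) (esym _))).
case: (m i == 0%N) => //; apply: Xf_sum_eq => l; rewrite Xf_iter //.
have itZ (x : O) : iter a (Da i) x = smono 0 (al i ^+ a) * x.
  elim: (nat_of_ord a) => [|a' /= ->]; first by rewrite expr0 rmorph1 mul1r.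
  by rewrite /Da exprS rmorphM mulrA.
rewrite !itZ ![c * (smono 0 _ * _)]mulrCA !XfZ; congr (_ * _).
rewrite !mulrA; apply: Xf_coefM => d e; rewrite !mulrA; apply: IH => j js.
have ji : j != i by apply: contraNneq is_ => <-.
rewrite !thOM thO_lO // thO_KO // hc ?mem_rcons ?inE ?js ?orbT //.
have tq : thO j (qO i) = 0 by apply: (thO_unitV (Qo_unit psi (ys0 p) i)); rewrite /Qo thO_at_z (negbTE ji).
by rewrite tq !(mulr0, mul0r, addr0).
Qed.

Lemma Xf_WWa (s : seq 'I_n) g : uniq s -> forall (c : O) m (k : nat),
  (forall i, i \in s -> thO i c = 0) ->
  Xf (c * foldl (fun f i => W i f) g s m k) = Xf (c * foldl (fun f i => Wa i f) g s m k).
Proof.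
elim/last_ind: s => [//|s i IH]; rewrite rcons_uniq => /andP[is_ us].
rewrite !foldl_rcons; exact: (Xf_Wstep is_ (IH us)).
Qed.

Definition ph i (l : nat) : mseries nat K := phia psi (al i) l.
Definition ff i r l : O := io (at_z i (scomp (iter r (@sderiv K) (ph i l)) y)).
(** U_i under the residue once the sum over j is done: [ff] is the r-th derivative of [phia] at
    y(z_i). *)
Definition Yop i g : UO := MSeries (fun m => MSeries (fun k : nat => if m i == 0%N then
  \sum_(r < 2 * k) \sum_(l < k.+1) ff i r l * (KO i * g) (m + dexp i *+ r.+1) (k - l)%N else 0)).
Definition GQ i : O := io (at_z i (Gz psi y (al i) * Qser psi y)).

Lemma sderiv_exp (c : K) : sderiv (expS (smono 0%N c * psi)) = smono 0%N c * sderiv psi * expS (smono 0%N c * psi).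
Proof.
have c0 : (smono 0%N c * psi) 0%N = 0 by rewrite mcoefCM ps0 mulr0.
apply: Xs_injl; rewrite Xs_sderiv.
have -> : eul (expS (smono 0%N c * psi)) = eul (smono 0%N c * psi) * expS (smono 0%N c * psi).
  exact: (cder_expS degN qK (@eul_leibniz K) c0).
have -> : eul (smono 0%N c * psi) = smono 0%N c * (Xs K * sderiv psi).
  by rewrite Xs_sderiv; exact: leibnizC.
by move: (expS (smono 0%N c * psi)) (smono 0%N c) (sderiv psi) (Xs K) => u v w x; ring.
Qed.

(** Conjugation by e^(c psi) turns d/dy + c psi' into d/dy, r times. *)
Lemma spec_Lfun (c : K) r l : expS (smono 0%N c * psi) * spec c (Lfun psi r) l = iter r (@sderiv K) (phia psi c l).
Proof.
elim: r => [|r IH]; first by rewrite /phia mcoefCM.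
have vb r' : vbnd r' (Lfun psi r') by move=> j l' h; exact: (Lfun_vbnd qK).
rewrite iterS -IH sderivM sderiv_exp.
rewrite (spec_bnd c (vb r.+1) (N := (2 * l + r).+2)) ?addnS //.
rewrite (spec_bnd c (vb r) (N := (2 * l + r).+1)) // .
have step (j : nat) : Lfun psi r.+1 j l = sderiv (Lfun psi r j l) + (if j is j'.+1 then sderiv psi * Lfun psi r j' l else 0).
  rewrite -[Lfun psi r.+1]/(smap (smap (@sderiv K)) (Lfun psi r) + vvar K * vhy_cst (sderiv psi) * Lfun psi r).
  rewrite !mcoefD; congr (_ + _); case: j => [|j]; rewrite -mulrA ?vvarM; last first.
    by rewrite -[vhy_cst _]/(smono 0%N (smono 0%N (sderiv psi)) : mseries nat (mseries nat (mseries nat K))) !mcoefCM.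
  rewrite -[vvar K]/(smono 1%N 1 : mseries nat (mseries nat (mseries nat K))) mcoefM_nat big_ord1 smonoE mul0r //.
under eq_bigr => j _ do rewrite step mulrDr.
rewrite big_split /= big_ord_recr /= (vb r) ?sderiv0 ?mulr0 ?addr0; last by rewrite addnC; lia.
rewrite [X in _ * (_ + X) = _]big_ord_recl mulr0 add0r.
have sd (f : mseries nat K) (j : nat) : smono 0%N (c ^+ j) * sderiv f = sderiv (smono 0%N (c ^+ j) * f).
  rewrite sderivM (_ : sderiv (smono 0%N _) = 0) ?mul0r ?add0r //.
  by apply: mseriesP => k; rewrite -[LHS]/(smono 0%N (c ^+ j) k.+1 *+ k.+1) smonoE mul0rn.
have sds N (G : nat -> mseries nat K) : sderiv (\sum_(j < N) G j) = \sum_(j < N) sderiv (G j).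
  by elim: N => [|N IHN]; rewrite ?big_ord0 ?sderiv0 // !big_ord_recr /= sderivD IHN.
rewrite (sds _ (fun j : nat => smono 0%N (c ^+ j) * Lfun psi r j l)).
under eq_bigr => j _ do rewrite sd; under [X in _ * (_ + X) = _]eq_bigr => j _ do rewrite lift0.
have -> : \sum_(j < (2 * l + r).+1) smono 0%N (c ^+ j.+1) * (sderiv psi * Lfun psi r j l) =
    smono 0%N c * sderiv psi * \sum_(j < (2 * l + r).+1) smono 0%N (c ^+ j) * Lfun psi r j l.
  rewrite mulr_sumr; apply: eq_bigr => j _.
  have -> : smono 0%N (c ^+ j.+1) = smono 0%N c * smono 0%N (c ^+ j) :> mseries nat K.
    by rewrite exprS; exact: (rmorphM (@smono nat K 0%N)).
  by move: (smono 0%N c) (smono 0%N (c ^+ j)) (sderiv psi) (Lfun psi r j l) => u1 u2 u3 u4; ring.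
by move: (expS (smono 0%N c * psi)) (\sum_(j < (2 * l + r).+1) sderiv (smono 0%N (c ^+ j) * Lfun psi r j l))
  (\sum_(j < (2 * l + r).+1) smono 0%N (c ^+ j) * Lfun psi r j l) (smono 0%N c) (sderiv psi) => u1 u2 u3 u4 u5; ring.
Qed.

Lemma scompM (f h : mseries nat K) : scomp (f * h) y = scomp f y * scomp h y.
Proof. by rewrite !(scomp_hcomp degN (ys0 p)) rmorphM. Qed.

(** The Q_i of the residue cancels the 1 / Q_i of U_i, and its e^(a_i psi(y_i)) is the factor needed
    in [spec_Lfun]. *)
Lemma GzL i r l : GQ i * (qO i * io (at_z i (scomp (spec (al i) (Lfun psi r) l) y))) = ff i r l.
Proof.
have u := Qo_unit psi (ys0 p) i.
rewrite /GQ at_zM ioM /qO -/(Qo psi y i) -mulrA [Qo psi y i * _]mulrA divrr // mul1r -ioM -at_zM /ff -spec_Lfun scompM.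
suff -> : Gz psi y (al i) = scomp (expS (smono 0%N (al i) * psi)) y by [].
have c0 : (smono 0%N (al i) * psi) 0%N = 0 by rewrite mcoefCM ps0 mulr0.
have h f : scomp f y = hcomp degN (@smono nat K 0%N) (ys0 p) f by exact: scomp_hcomp.
by rewrite h (hcomp_expS degN _ (ys0 p) qK c0) -h scompM (h (smono 0%N _)) hcomp_smono expr0 mulr1.
Qed.

Lemma WaY i g m (k : nat) : sl g -> GQ i * Wa i g m k = Yop i g m k.
Proof.
move=> hg; rewrite WopE.
rewrite -[Yop i g m k]/(if m i == 0%N then _ else _); case: (boolP (m i == 0%N)) => mi; last first.
  by rewrite big1 ?mulr0 // => a _; rewrite big1 // => r _; rewrite (Wt1E _ _ _ _ Da0 Da_add) (negbTE mi).
rewrite exchange_big mulr_sumr; apply: eq_bigr => r _.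
transitivity (GQ i * \sum_(l < k.+1) \sum_(a < (2 * k).+1)
   iter a (Da i) (lO p i a r l * (qO i * (KO i * g) (m + dexp i *+ r.+1) (k - l)%N))).
  by rewrite [in RHS]exchange_big; congr (_ * _); apply: eq_bigr => a _; rewrite (Wt1E _ _ _ _ Da0 Da_add) mi.
rewrite mulr_sumr; apply: eq_bigr => l _; set X := (KO i * g) _ _.
have [X0|X0] := eqVneq X 0.
  by rewrite X0 mulr0 big1 ?mulr0 // => a _; rewrite !mulr0 (iterD0 Da0).
(* This bound on r brings the degree in v of the coefficient of L_r below 2 k, so the truncated sum
   over j is all of [spec]. *)
have rl : (r.+1 <= 2 * (k - l))%N.
  by rewrite leqNgt; apply: contra_neqN X0 => h; apply: (slM (sl_Ks qK cO (yO p) i) hg); rewrite dF_shift; lia.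
have -> : \sum_(a < (2 * k).+1) iter a (Da i) (lO p i a r l * (qO i * X)) =
   qO i * io (at_z i (scomp (spec (al i) (Lfun psi r) l) y)) * X.
  have vb : vbnd r (Lfun psi r) by move=> j l' h; exact: (Lfun_vbnd qK).
  rewrite (spec_bnd _ vb (N := (2 * k).+1)); last by have := ltn_ord l; lia.
  have hs (a : nat) : iter a (Da i) (lO p i a r l * (qO i * X)) = io (at_z i (scomp (smono 0%N (al i ^+ a) * Lfun psi r a l) y)) * (qO i * X).
    rewrite scompM at_zM ioM /lO -(at_z_scomp i _ (ys0 p)) -mulrA.
    have -> : io (at_z i (scomp (smono 0%N (al i ^+ a)) y)) = smono 0 (al i ^+ a).
      rewrite (scomp_hcomp degN (ys0 p)) hcomp_smono expr0 mulr1 at_zE hcomp_smono expr0 mulr1 io_smono.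
      by rewrite zbm0.
    move: (io (at_z i (scomp (Lfun psi r a l) y)) * (qO i * X)) => Y.
    elim: a => [|a' /= ->]; first by rewrite expr0 rmorph1 mul1r.
    by rewrite /Da exprS rmorphM mulrA.
  under eq_bigr => a _ do rewrite hs; rewrite -mulr_suml mulrCA mulrA; congr (_ * _ * _).
  rewrite (scomp_hcomp degN (ys0 p)) rmorph_sum (rmorph_sum (@at_z K n i)) (rmorph_sum io).
  by apply: eq_bigr => a _; rewrite (scomp_hcomp degN (ys0 p)).
by rewrite mulrA GzL.
Qed.

Lemma YopC i g g' (C : O) : (forall m (k : nat), C * g m k = g' m k) ->
  forall m (k : nat), C * Yop i g m k = Yop i g' m k.
Proof.
move=> h m k; rewrite -[Yop i g m k]/(if m i == 0%N then _ else _) -[Yop i g' m k]/(if m i == 0%N then _ else _).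
case: ifP => _; last by rewrite mulr0.
rewrite mulr_sumr; apply: eq_bigr => r _; rewrite mulr_sumr; apply: eq_bigr => l _; rewrite mulrCA; congr (_ * _).
rewrite !coef2M mulr_sumr; apply: eq_bigr => d _; rewrite mulr_sumr; apply: eq_bigr => e _.
by rewrite mulrCA h.
Qed.

Lemma fold_WaY (s : seq 'I_n) g m (k : nat) : sl g ->
  (\prod_(i <- s) GQ i) * foldl (fun f i => Wa i f) g s m k = foldl (fun f i => Yop i f) g s m k.
Proof.
move=> hg; elim/last_ind: s m k => [|s i IH] m k; first by rewrite big_nil mul1r.
rewrite !foldl_rcons -cats1 big_cat big_seq1 -mulrA WaY; last exact: (sl_foldl qK cO (yO p) qO (lO p) Da0 Da_add).
exact: (YopC i IH).
Qed.

Lemma Xf_rhsO (k : nat) : Xf (rhsO n p k) = foldl (fun f i => Yop i f) (gs cO (@bO K n)) (enum 'I_n) 0 k b.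
Proof.
have := @Xf_WWa (enum 'I_n) (gs cO (@bO K n)) (enum_uniq 'I_n) 1 0 k (fun i _ => thO1 K i); rewrite !mul1r => ->.
rewrite -[Xf _]/(mcoef (Fz psi y b * _) b) -(fold_WaY _ _ _ (sl_gs qK cO (@bO K n))).
by congr (mcoef (_ * _) b); rewrite /Fz big_enum.
Qed.

End Evaluation.

Lemma exD0 n (d d' m : {ffun 'I_n -> nat}) j : d + d' = m -> m j = 0%N -> d j = 0%N /\ d' j = 0%N.
Proof.
move=> e mj; have : (d j + d' j = 0)%N by have /ffunP/(_ j) := e; rewrite ffunE mj.
by move/eqP; rewrite addn_eq0 => /andP[/eqP -> /eqP ->].
Qed.

(** * Coefficient extraction and Taylor expansion at y = 0 *)

Section SupportLemmas.
Variables (n : nat) (B : comNzRingType).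
Local Notation ex := {ffun 'I_n -> nat}.
Implicit Types (f h : mseries ex B) (m v : ex).

(* A factor not involving the variables of [v] passes through the extraction of the coefficient of [v]. *)
Lemma mcoefM_shift f h m v : (forall (d : ex) j, v j != 0%N -> d j != 0%N -> f d = 0) ->
  (forall j, v j != 0%N -> m j = 0%N) ->
  (f * h) (m + v) = \sum_(d <- splits m) f d.1 * h (d.2 + v).
Proof.
move=> hf hm; pose G (d : ex * ex) := if d.1 + d.2 == m + v then f d.1 * h d.2 else 0.
have ur : uniq [seq (d.1, d.2 + v) | d <- splits m].
  rewrite map_inj_in_uniq ?splits_uniq // => -[a c] [a' c'] _ _ /= [-> e]; congr (_, _).
  by apply/ffunP => i; have /ffunP/(_ i) := e; rewrite !ffunE => /addIn.
transitivity (\sum_(d <- splits (m + v)) G d).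
  by rewrite mcoefM big_seq [RHS]big_seq; apply: eq_bigr => d; rewrite mem_splits /G => ->.
rewrite (@sum_supp _ _ G _ _ (splits_uniq _) ur) => [|d].
  rewrite big_map big_seq [RHS]big_seq; apply: eq_bigr => d; rewrite mem_splits => /eqP e.
  by rewrite /G addrA e eqxx.
rewrite /G mem_splits; case: (eqVneq (d.1 + d.2) (m + v)) => [e nz|_]; last by rewrite eqxx.
have f0 : f d.1 != 0 by apply: contraNneq nz => ->; rewrite mul0r.
have ej j : (d.1 j + d.2 j = m j + v j)%N by have /ffunP/(_ j) := e; rewrite !ffunE.
have vd j : (v j <= d.2 j)%N.
  case: (eqVneq (v j) 0%N) => [-> //|vj]; have := ej j; rewrite (hm j vj).
  by case: (eqVneq (d.1 j) 0%N) => [->|dj]; [lia|rewrite (hf _ _ vj dj) eqxx in f0].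
rewrite /=; apply/mapP; exists (d.1, [ffun j => (d.2 j - v j)%N]); last first.
  case: (d) vd => d1 d2 /= vd; congr (_, _); apply/ffunP => j; rewrite !ffunE.
  by rewrite -[RHS]/(d2 j - v j + v j)%N subnK.
rewrite mem_splits; apply/eqP/ffunP => j; rewrite !ffunE -[LHS]/(d.1 j + (d.2 j - v j))%N.
by rewrite addnBA // ej addnK.
Qed.

Lemma onvM i (F : nat -> B) h m (x : nat) : m i = 0%N ->
  (onv i F * h) (m + dexp i *+ x) = \sum_(e < x.+1) F e * h (m + dexp i *+ (x - e)).
Proof.
move=> mi; pose G (d : ex * ex) := if d.1 + d.2 == m + dexp i *+ x then onv i F d.1 * h d.2 else 0.
have ur : uniq [seq (dexp i *+ e : ex, m + dexp i *+ (x - e)) | e <- iota 0 x.+1].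
  rewrite map_inj_in_uniq ?iota_uniq // => e e' _ _ [/ffunP/(_ i)]; by rewrite !dexpE eqxx.
transitivity (\sum_(d <- splits (m + dexp i *+ x)) G d).
  by rewrite mcoefM big_seq [RHS]big_seq; apply: eq_bigr => d; rewrite mem_splits /G => ->.
rewrite (@sum_supp _ _ G _ _ (splits_uniq _) ur) => [|d].
  rewrite big_map -[iota 0 x.+1]/(index_iota 0 x.+1) big_mkord; apply: eq_bigr => e _.
  rewrite -[LHS]/(if dexp i *+ e + (m + dexp i *+ (x - e)) == m + dexp i *+ x
    then onv i F (dexp i *+ e) * h (m + dexp i *+ (x - e)) else 0).
  have -> : dexp i *+ e + (m + dexp i *+ (x - e)) = m + dexp i *+ x.
    by rewrite addrCA -mulrnDr subnKC // -ltnS.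
  rewrite eqxx; congr (_ * _).
  by rewrite -[onv i F _]/(if _ then _ else _) dexpE !eqxx.
rewrite /G mem_splits; case: (eqVneq (d.1 + d.2) (m + dexp i *+ x)) => [e nz|_]; last by rewrite eqxx.
have : onv i F d.1 != 0 by apply: contraNneq nz => ->; rewrite mul0r.
rewrite -[onv i F d.1]/(if _ then _ else _); case: (eqVneq d.1 (dexp i *+ d.1 i)) => [d1 _|]; last by rewrite eqxx.
have ei : (d.1 i + d.2 i = x)%N by have /ffunP/(_ i) := e; rewrite !ffunE mi ffunMnE ffunE eqxx add0r natmuln1.
have dE : d = (fun e : nat => (dexp i *+ e : ex, m + dexp i *+ (x - e))) (d.1 i); last first.
  rewrite andTb dE; apply: map_f; rewrite mem_iota; move: ei; move: (d.1 i) (d.2 i) => a1 a2; lia.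
case: (d) d1 e ei => d1 d2 d1E e ei; rewrite -[d1]/(_, d2).1 -[RHS]/(dexp i *+ d1 i, m + dexp i *+ (x - d1 i)); congr (_, _) => //; apply/ffunP => j; move: d1E e ei; rewrite -[(d1, d2).1]/d1 -[(d1, d2).2]/d2 => d1E e ei.
have /ffunP/(_ j) := e; rewrite ffunE {1}d1E !ffunE !dexpE; case: (eqVneq j i) => [->|_]; last by rewrite add0r addr0.
by move=> _; rewrite mi -ei -[RHS]/(0 + (d1 i + d2 i - d1 i))%N add0n addKn.
Qed.

Definition only (i : 'I_n) f := forall m j, j != i -> m j != 0%N -> f m = 0.

Lemma only1 i : only i 1.
Proof. by move=> m j _ mj; rewrite mcoef1; case: eqP => // m0; rewrite m0 ffunE in mj. Qed.

Lemma onlyM i f h : only i f -> only i h -> only i (f * h).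
Proof.
move=> hf hh m j ji mj; rewrite mcoefM big_seq big1 // => d; rewrite mem_splits => /eqP e.
case: (eqVneq (d.1 j) 0%N) => [d0|d0]; last by rewrite (hf _ _ ji d0) mul0r.
rewrite (hh d.2 j) ?mulr0 //; apply: contra_neq mj => d2; rewrite -e ffunE d0 d2 //.
Qed.

Lemma only_onv i (F : nat -> B) : only i (onv i F).
Proof.
move=> m j ji mj; rewrite -[LHS]/(if _ then _ else _); case: eqP => // e.
by move: mj; rewrite e dexpE (negbTE ji).
Qed.

End SupportLemmas.

Lemma only_expS n (B : comUnitRingType) (i : 'I_n) (f : mseries {ffun 'I_n -> nat} B) :
  f 0 = 0 -> only i f -> only i (expS f).
Proof.
move=> f0 hf m j ji mj; rewrite (expS_sum (dg := degF 'I_n) (N := (degF 'I_n m).+1)) // big1 // => k _.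
suff h : only i (f ^+ k) by rewrite (h _ _ ji mj) mulr0.
by elim: (nat_of_ord k) => [|k' IH]; [exact: only1|rewrite exprS; exact: onlyM].
Qed.

Section Taylor.
Variables (K : fieldType) (qK : qalg K) (n : nat) (p : Pt K) (b : {ffun 'I_n -> nat}) (E : nat).
Local Notation ex := {ffun 'I_n -> nat}.
Local Notation O := (zser K n).
Local Notation UO := (mseries ex (mseries nat O)).
Local Notation io := (@iota_z K n).
Local Notation y := (sval p).2.
Local Notation dF := (degF 'I_n).
Local Notation cO := (@cO K n).
Local Notation KO := (Ks cO (yO p)).
Local Notation Y := (Yop p b).
Local Notation ph := (ph p b).
Implicit Types (i j : 'I_n) (g h : UO) (m : ex) (o : O).

(** Equality in the degrees that reach zeta^b. As y(z_i) has no constant term, Taylor expansions in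
    it become finite. *)
Definition eqE o o' := forall c, (dF c <= E)%N -> o c = o' c.

Lemma eqEr o : eqE o o. Proof. by []. Qed.
Lemma eqET o o' o'' : eqE o o' -> eqE o' o'' -> eqE o o''.
Proof. by move=> h h' c hc; rewrite h // h'. Qed.
Lemma eqEM o1 o2 o1' o2' : eqE o1 o1' -> eqE o2 o2' -> eqE (o1 * o2) (o1' * o2').
Proof. by move=> h h' c hc; apply: (eq_mcoefM (dg := dF)) => a ac; [apply: h|apply: h']; exact: leq_trans hc. Qed.
Lemma eqE_sum I (s : seq I) (P : pred I) (f f' : I -> O) : (forall x, P x -> eqE (f x) (f' x)) ->
  eqE (\sum_(x <- s | P x) f x) (\sum_(x <- s | P x) f' x).
Proof. by move=> h c hc; rewrite !mcoef_sum; apply: eq_bigr => x Px; exact: h. Qed.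

Definition yi i : O := io (at_z i y).
Lemma yi0 i : yi i 0 = 0. Proof. by rewrite /yi io_at_z0 ys0. Qed.

Lemma yi_pow i e : (E < e)%N -> eqE (yi i ^+ e) 0.
Proof. by move=> Ee c cE; rewrite (mcoef_pow_deg (dg := dF)) ?yi0 //; exact: leq_ltn_trans Ee. Qed.

Definition phs i (s l : nat) : K := s`!%:R * ph i l s.
(** The series e^(u_i y(z_i)), which absorbs the Taylor expansion and completes (S - 1) y in the
    kernel to S y. *)
Definition ey i : UO := onv i (fun e => smono 0%N (cO (e`!%:R)^-1 * yi i ^+ e)).
Definition Gk i : UO := ey i * KO i.
Definition Zop (S : nat) i g : UO := MSeries (fun m => MSeries (fun k : nat => if m i == 0%N then
  \sum_(s < S) \sum_(l < k.+1) cO (phs i s l) * (Gk i * g) (m + dexp i *+ s.+1) (k - l)%N else 0)).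

Lemma ff_taylor i (r l : nat) : eqE (ff p b i r l)
  (\sum_(e < E.+1) cO (phs i (r + e) l) * (cO (e`!%:R)^-1 * yi i ^+ e)).
Proof.
move=> c cE; rewrite /ff (at_z_scomp i _ (ys0 p)).
have -> : io (scomp (iter r (@sderiv K) (ph i l)) (at_z i y)) = scomp (iter r (@sderiv K) (ph i l)) (yi i).
  rewrite -(at_z_scomp i _ (ys0 p)); apply: mseriesP => c'; pose N := (dF c').+1.
  transitivity ((\sum_(k < N) smono 0 (iter r (@sderiv K) (ph i l) k) * yi i ^+ k) c'); last first.
    by rewrite (scomp_hcomp dF (yi0 i)) (@hcompE _ _ _ _ _ _ _ _ _ N).
  rewrite -[LHS]/(if nonneg c' then at_z i (scomp (iter r (@sderiv K) (ph i l)) y) (avn c') else 0).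
  rewrite (at_z_scomp i _ (ys0 p)) (scomp_hcomp dF (at_z0 i (ys0 p))).
  have yE k : smono 0 (iter r (@sderiv K) (ph i l) k) * yi i ^+ k = io (smono 0 (iter r (@sderiv K) (ph i l) k) * at_z i y ^+ k).
    by rewrite ioM ioX io_smono zbm0.
  rewrite (eq_bigr _ (fun (k : 'I_N) _ => yE k)) -(rmorph_sum io).
  rewrite -[RHS]/(if nonneg c' then mcoef (\sum_(k < N) _) (avn c') else 0); case: ifP => // nc.
  rewrite (@hcompE _ _ _ _ _ _ _ _ _ N) // ltnS -{2}(zbm_avn nc).
  rewrite -[dF _]/(\sum_j _ j)%N -[X in (_ <= X)%N]/(\sum_j _ j)%N; apply: leq_sum => j _; rewrite [X in (_ <= X)%N]ffunE.
  by rewrite (bigD1 j) //= leq_addr.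
rewrite (scomp_hcomp dF (yi0 i)) (@hcompE _ _ _ _ _ _ _ _ _ E.+1) // !mcoef_sum; apply: eq_bigr => e _.
congr (mcoef _ c); rewrite mulrA -[cO _ * cO _]rmorphM; congr (cO _ * _).
rewrite (iter_sderiv qK) /phs [(e + r)%N]addnC; have := qfact qK e; move: (e`!%:R : K) ((r + e)`!%:R : K) => u v u0; by field.
Qed.

(** Divisibility by u_i. The graph sum has it because in a connected graph with n >= 2 every vertex
    lies on an edge. *)
Definition dv i g := forall m, m i = 0%N -> g m = 0.

Lemma dvM i (f g : UO) : dv i g -> dv i (f * g).
Proof.
move=> hg m mi; rewrite mcoefM big_seq big1 // => d; rewrite mem_splits => /eqP e.
by rewrite hg ?mulr0 //; exact: (exD0 e mi).2.
Qed.

Lemma dv_Y i j g : i != j -> dv i g -> dv i (Y j g).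
Proof.
move=> ij hg m mi; apply: mseriesP => k; rewrite -[LHS]/(if m j == 0%N then _ else _); case: ifP => // _.
rewrite big1 // => r _; rewrite big1 // => l _; rewrite (dvM _ hg) ?mulr0 //.
by rewrite ffunE dexpE (negbTE ij) mi.
Qed.

Lemma sl_Y i g : sl g -> sl (Y i g).
Proof.
move=> hg m k mk; rewrite -[LHS]/(if m i == 0%N then _ else _); case: ifP => // _.
rewrite big1 // => r _; rewrite big1 // => l _; rewrite (slM (sl_Ks qK cO (yO p) i) hg) ?mulr0 // dF_shift; lia.
Qed.

(** The terms phi^(r+e)(0) y^e / e! [u_i^(r+1)] h are regrouped by s = r + e, which leaves
    phi^(s)(0) [u_i^(s+1)] of e^(u_i y) h. *)
Lemma YZ S i g g' k0 : (2 * k0 + E < S)%N -> sl g -> dv i g ->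
  (forall m (k : nat), (k <= k0)%N -> eqE (g m k) (g' m k)) ->
  forall m (k : nat), (k <= k0)%N -> eqE (Y i g m k) (Zop S i g' m k).
Proof.
move=> kS hg dg hgg m k kk.
rewrite -[Y i g m k]/(if m i == 0%N then _ else _) -[Zop S i g' m k]/(if m i == 0%N then _ else _).
case: (boolP (m i == 0%N)) => // /eqP mi; pose h := KO i * g; pose h' := KO i * g'.
have hh m' (k' : nat) : (k' <= k0)%N -> eqE (h m' k') (h' m' k').
  move=> kk'; rewrite /h /h' !coef2M; apply: eqE_sum => d _; apply: eqE_sum => e _.
  by apply: eqEM => //; apply: hgg; rewrite (leq_trans (leq_subr _ _)).
have h0 m' : m' i = 0%N -> h m' = 0 by exact: dvM.
have hsl r (k' : nat) : (2 * k' <= r)%N -> h (m + dexp i *+ r.+1) k' = 0.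
  by move=> kr; apply: (slM (sl_Ks qK cO (yO p) i) hg); rewrite dF_shift; lia.
rewrite exchange_big [X in eqE _ X]exchange_big /=; apply: eqE_sum => l _; set k' := (k - l)%N.
have kk' : (k' <= k0)%N by rewrite (leq_trans (leq_subr _ _)).
pose T (e r : nat) : O := cO (phs i (r + e) l) * (cO (e`!%:R)^-1 * yi i ^+ e) * h (m + dexp i *+ r.+1) k'.
apply: (@eqET _ (\sum_(r < 2 * k) \sum_(e < E.+1) T e r)).
  apply: eqE_sum => r _; rewrite /T -mulr_suml; apply: eqEM => //; exact: ff_taylor.
apply: (@eqET _ (\sum_(s < S) cO (phs i s l) * \sum_(e < s.+1) cO (e`!%:R)^-1 * yi i ^+ e * h (m + dexp i *+ (s - e).+1) k')); last first.
  apply: eqE_sum => s _; apply: eqEM => //.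
  have GE0 : Gk i * g' = ey i * h' by exact: esym (mulrA _ _ _).
  have GE := congr1 (fun z : UO => z (m + dexp i *+ s.+1) k') GE0.
  refine (@eq_rect _ _ (fun o => eqE _ o) _ _ (esym GE)); clear GE.
  have onvE : (ey i * h') (m + dexp i *+ s.+1) k' = \sum_(e < s.+1) cO (e`!%:R)^-1 * yi i ^+ e * h' (m + dexp i *+ (s - e).+1) k' +
      cO ((s.+1)`!%:R)^-1 * yi i ^+ s.+1 * h' m k'.
    rewrite /ey onvM // mcoef_sum big_ord_recr; congr (_ + _).
      apply: eq_bigr => e _; rewrite mcoefCM -[nat_of_ord (widen_ord _ e)]/(nat_of_ord e) subSn //; by rewrite -ltnS.
    by rewrite mcoefCM -[nat_of_ord ord_max]/s.+1 subnn mulr0n addr0.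
  refine (@eq_rect _ _ (fun o => eqE _ o) _ _ (esym onvE)); clear onvE.
  (* The convolution for u_i^(s+1) has the extra term e = s + 1, with the coefficient of u_i^0 in
     h'; divisibility of g by u_i removes it. *)
  have e0 : eqE (h' m k') 0 by move=> c cE; rewrite -(hh m k' kk' c cE) h0.
  apply: (@eqET _ (\sum_(e < s.+1) cO (e`!%:R)^-1 * yi i ^+ e * h' (m + dexp i *+ (s - e).+1) k')); last first.
    move=> c cE; rewrite mcoefD [X in _ + X](eqEM (eqEr _) e0 cE) mulr0 addr0 //.
  by apply: eqE_sum => e _; apply: eqEM => //; exact: hh.
have -> : \sum_(s < S) cO (phs i s l) * \sum_(e < s.+1) cO (e`!%:R)^-1 * yi i ^+ e * h (m + dexp i *+ (s - e).+1) k' =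
    \sum_(e < S) \sum_(r < S - e) T e r.
  rewrite -triangular_sum; apply: eq_bigr => s _; rewrite mulr_sumr; apply: eq_bigr => e _.
  by rewrite /T mulrA subnK // -ltnS.
move=> c cE; transitivity (\sum_(e < E.+1) \sum_(r < 2 * k) T e r c).
  by rewrite exchange_big mcoef_sum; apply: eq_bigr => r _; rewrite mcoef_sum.
transitivity (\sum_(e < S) \sum_(r < S - e) T e r c); last first.
  by rewrite mcoef_sum; apply: eq_bigr => r _; rewrite mcoef_sum.
have lkk : (k <= k0)%N by [].
rewrite (big_ord_widen S (fun e => \sum_(r < 2 * k) T e r c)); last by lia.
rewrite big_mkcond; apply: eq_bigr => e _; case: ltnP => eE; last first.
  by rewrite big1 // => r _; rewrite /T (mulrA (cO _) (cO _)) (mulrC _ (yi i ^+ e)) -(mulrA (yi i ^+ e)) (eqEM (yi_pow i eE) (eqEr _) cE) mul0r.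
rewrite (big_ord_widen (S - e) (fun r => T e r c)); last by lia.
rewrite big_mkcond; apply: eq_bigr => r _; case: ltnP => // kr.
by rewrite /T hsl ?mulr0 // /k'; lia.
Qed.

Lemma fold_YZ S (s : seq 'I_n) g k0 : (2 * k0 + E < S)%N -> uniq s -> sl g -> (forall i, dv i g) ->
  forall m (k : nat), (k <= k0)%N ->
  eqE (foldl (fun f i => Y i f) g s m k) (foldl (fun f i => Zop S i f) g s m k).
Proof.
move=> kS us hg dg; elim/last_ind: s us => [//|s i IH]; rewrite rcons_uniq => /andP[is_ us].
rewrite !foldl_rcons; apply: YZ => //; last exact: IH.
  by elim/last_ind: s {is_ us IH} => //= s j hs; rewrite foldl_rcons; exact: sl_Y.
elim/last_ind: s is_ {us IH} => [_|s j hs]; first exact: dg.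
rewrite mem_rcons inE negb_or => /andP[ij is_]; rewrite foldl_rcons; apply: dv_Y => //; exact: hs.
Qed.

Definition Phs i (s : nat) : mseries nat O := MSeries (fun l => cO (phs i s l)).
Definition tv (S : nat) (s : seq 'I_n) (t : {ffun 'I_n -> 'I_S.+1}) : ex := [ffun i => if i \in s then (t i).+1 else 0%N].

Lemma Zop_ring S i g m : m i = 0%N ->
  Zop S i g m = \sum_(s < S) Phs i s * (Gk i * g) (m + dexp i *+ s.+1).
Proof.
move=> mi; apply: mseriesP => k; rewrite -[LHS]/(if m i == 0%N then _ else _) mi eqxx mcoef_sum.
by apply: eq_bigr => s _; rewrite mcoefM_nat.
Qed.

Lemma only_Gk i : only i (Gk i).
Proof.
apply: onlyM; first exact: only_onv.
apply: onlyM; last exact: only_onv.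
by apply: only_expS; [exact: kex0|exact: only_onv].
Qed.

(** The kernel of each operator contains its own u_i only, so it passes through the earlier
    extractions and all of them can be made at once. *)
Lemma fold_Z S (s : seq 'I_n) g m : uniq s -> (forall j, j \in s -> m j = 0%N) ->
  foldl (fun f i => Zop S.+1 i f) g s m =
  \sum_(t : {ffun 'I_n -> 'I_S.+1} | inbox (fun _ _ => true) [set i in s]%SET t)
    (\prod_(i <- s) Phs i (t i)) * ((\prod_(i <- s) Gk i) * g) (m + tv s t).
Proof.
elim/last_ind: s m => [|s i IH] m.
  move=> _ _; rewrite (big_pred1 [ffun=> ord0]) => [|t]; last first.
    apply/forallP/eqP => [h|-> x]; last by rewrite !inE ffunE.
    by apply/ffunP => x; have := h x; rewrite !inE ffunE => /eqP.
  rewrite !big_nil !mul1r; congr (mcoef g _); apply/ffunP => j; rewrite !ffunE addr0 //.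
rewrite rcons_uniq => /andP[is_ us] hm; rewrite foldl_rcons.
have mi : m i = 0%N by apply: hm; rewrite mem_rcons mem_head.
have hs j : j \in s -> m j = 0%N by move=> js; apply: hm; rewrite mem_rcons inE js orbT.
rewrite Zop_ring //; set G := foldl _ g s; set H := (\prod_(j <- s) Gk j) * g.
have hv (t : {ffun 'I_n -> 'I_S.+1}) j : tv s t j != 0%N -> j \in s by rewrite ffunE; case: (j \in s).
have GE x : (Gk i * G) (m + dexp i *+ x) = \sum_(t : {ffun 'I_n -> 'I_S.+1} | inbox (fun _ _ => true) [set i in s]%SET t)
    (\prod_(j <- s) Phs j (t j)) * (Gk i * H) (m + dexp i *+ x + tv s t).
  transitivity (\sum_(d <- splits (m + dexp i *+ x)) \sum_(t : {ffun 'I_n -> 'I_S.+1} | inbox (fun _ _ => true) [set i in s]%SET t)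
    (\prod_(j <- s) Phs j (t j)) * (Gk i d.1 * H (d.2 + tv s t))).
    rewrite mcoefM big_seq [RHS]big_seq; apply: eq_bigr => d; rewrite mem_splits => /eqP e.
    rewrite /G IH // => [|j js]; first by rewrite mulr_sumr; apply: eq_bigr => t _; rewrite mulrCA.
    have ji : j != i by apply: contraNneq is_ => <-.
    by apply: (exD0 e _).2; rewrite ffunE hs // dexpE (negbTE ji).
  rewrite exchange_big; apply: eq_bigr => t _; rewrite -mulr_sumr; congr (_ * _).
  rewrite mcoefM_shift // => [d j vj dj|j vj]; have js := hv _ _ vj; have ji : j != i by apply: contraNneq is_ => <-.
    exact: (only_Gk ji dj).
  by rewrite ffunE hs // dexpE (negbTE ji).
transitivity (\sum_(x < S.+1) \sum_(t : {ffun 'I_n -> 'I_S.+1} | inbox (fun _ _ => true) [set i in s]%SET t)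
    Phs i x * ((\prod_(j <- s) Phs j (t j)) * (Gk i * H) (m + dexp i *+ x.+1 + tv s t))).
  apply: eq_bigr => x _; refine (etrans (congr1 (fun z => Phs i x * z) (GE x.+1)) _); exact: mulr_sumr.
rewrite exchange_big /=.
have SE : [set j in rcons s i]%SET = [set j in s]%SET :|: [set i]%SET.
  by apply/setP => j; rewrite !inE mem_rcons inE orbC.
have dis : [disjoint [set j in s]%SET & [set i]%SET]%B.
  by apply/pred0P => j /=; rewrite !inE; apply/negP => /andP[js /eqP ji]; rewrite -ji js in is_.
rewrite SE (sum_inboxU _ _ dis) //; apply: eq_bigr => t _.
pose dl (x : 'I_S.+1) : {ffun 'I_n -> 'I_S.+1} := [ffun j => if j == i then x else ord0].
rewrite (reindex_onto dl (fun t' : {ffun 'I_n -> 'I_S.+1} => t' i)) /=; last first.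
  move=> t' /forallP ht; apply/ffunP => j; rewrite ffunE; case: (eqVneq j i) => [-> //|ji].
  by have := ht j; rewrite !inE (negbTE ji) => /eqP.
apply: congr_big => // [x|x _].
  rewrite ffunE eqxx eqxx andbT; apply/esym/forallP => j; rewrite !inE !ffunE; by case: eqVneq.
set c := comb _ _ _; have ci : c i = x by rewrite ffunE inE (negbTE is_) ffunE eqxx.
have cs j : j \in s -> c j = t j by move=> js; rewrite ffunE inE js.
rewrite -!cats1 !big_cat !big_seq1 /= ci mulrA; congr (_ * _).
  rewrite mulrC; congr (_ * _); rewrite big_seq [RHS]big_seq; apply: eq_bigr => j js; by rewrite cs.
have HE : Gk i * H = (\prod_(j <- s) Gk j * Gk i) * g.
  by rewrite /H; exact: etrans (mulrA (Gk i) _ g) (congr1 (fun z : UO => z * g) (mulrC _ _)).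
refine (etrans (congr1 (fun z : UO => z (m + dexp i *+ x.+1 + tv s t)) HE) _).
refine (congr1 (mcoef (\prod_(j <- s) Gk j * Gk i * g)) (_ : _ = m + tv (s ++ [:: i]) c)); apply/ffunP => j; rewrite !ffunE dexpE mem_cat mem_seq1 inE.
by case: (eqVneq j i) => [->|_]; [rewrite (negbTE is_) ?eqxx|case: (j \in s)]; rewrite ?addr0.
Qed.

End Taylor.

(** * The integrand as a series in the zeta_i with coefficients in u and hbar *)

Section Flip.
Variables (K : fieldType) (qK : qalg K) (n : nat).
Local Notation ex := {ffun 'I_n -> nat}.
Local Notation O := (zser K n).
Local Notation UO := (mseries ex (mseries nat O)).
Local Notation V := (mseries ex (mseries nat K)).
Local Notation W := (mseries ex V).
Local Notation dF := (degF 'I_n).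

(* Exchanges the roles of the variables zeta and (u, hbar). *)
Definition Fl (F : W) : UO := MSeries (fun r => MSeries (fun k : nat => MSeries (fun c => F c r k))).

Lemma FlE F r (k : nat) c : Fl F r k c = F c r k. Proof. by []. Qed.

Lemma Fl_zmod : zmod_morphism Fl.
Proof. by move=> F G; apply: mseriesP => r; apply: mseriesP => k; exact: mseriesP. Qed.
HB.instance Definition _ := GRing.isZmodMorphism.Build W UO Fl Fl_zmod.

Lemma mcoef1_2 (A : comUnitRingType) r (k : nat) :
  (1 : mseries ex (mseries nat A)) r k = ((r == 0) && (k == 0%N))%:R.
Proof. by rewrite mcoef1; case: (r == 0); rewrite ?(mulr1n, mulr0n) ?mcoef1 ?mcoef0. Qed.

Lemma Fl_monoid : monoid_morphism Fl.
Proof.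
split=> [|F G]; apply: mseriesP => r; apply: mseriesP => k; apply: mseriesP => c; rewrite FlE.
  by rewrite mcoef1_2 mcoef1; case hr: ((r == 0) && (k == 0%N)); case hc: (c == 0);
    rewrite ?(mulr1n, mulr0n) ?mcoef1_2 ?hr ?mcoef0 ?mcoef1 ?hc.
rewrite coef2M mcoefM !mcoef_sum; under eq_bigr => d _ do rewrite coef2M.
rewrite exchange_big; apply: eq_bigr => e _; rewrite mcoef_sum exchange_big; apply: eq_bigr => a _.
by rewrite mcoefM.
Qed.
HB.instance Definition _ := GRing.isMonoidMorphism.Build W UO Fl Fl_monoid.

Lemma FlM F G : Fl (F * G) = Fl F * Fl G. Proof. exact: Fl_monoid.2. Qed.
Lemma FlB F G : Fl (F - G) = Fl F - Fl G. Proof. exact: Fl_zmod. Qed.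
Lemma Fl1 : Fl 1 = 1. Proof. exact: Fl_monoid.1. Qed.
Lemma FlD F G : Fl (F + G) = Fl F + Fl G. Proof. exact: (rmorphD Fl). Qed.
Lemma Fl0 : Fl 0 = 0. Proof. exact: (rmorph0 Fl). Qed.

Lemma Fl_expS (f : W) : f 0 = 0 -> Fl f 0 = 0 -> Fl (expS f) = expS (Fl f).
Proof.
move=> f0 f0'; apply: mseriesP => r; apply: mseriesP => k; apply: mseriesP => c; rewrite FlE.
pose N := (dF c + dF r).+1; have q1 := qalg_mseries nat qK; have q2 := qalg_mseries ex qK.
rewrite (expS_sum (dg := dF) (N := N)) //; last by rewrite /N ltnS leq_addr.
rewrite (expS_sum (dg := dF) (m := r) (N := N)) //; last by rewrite /N ltnS leq_addl.
rewrite !mcoef_sum; apply: eq_bigr => j _.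
rewrite (fact_const_V ex j q1) mcoefCM (fact_const_V nat j qK) mcoefCM.
rewrite (fact_const_V nat j q2) mcoefCM (fact_const_V ex j qK) mcoefCM -(rmorphXn Fl) FlE //.
Qed.

(** The series f in the monomial of exponent v, the power being read at a coordinate i0 where v is
    1. *)
Definition along (A : comUnitRingType) (v : ex) (i0 : 'I_n) (f : mseries nat A) : mseries ex A :=
  MSeries (fun c : ex => if c == v *+ c i0 then f (c i0) else 0).

Section Along.
Variables (A : comUnitRingType) (v : ex) (i0 : 'I_n).
Hypothesis v1 : v i0 = 1%N.
Local Notation al := (@along A v i0).

Lemma vMn (d : nat) : (v *+ d) i0 = d.
Proof. by rewrite ffunMnE v1 natmuln1. Qed.

Lemma along_x0 : (smono v 1 : mseries ex A) 0 = 0.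
Proof. by rewrite smonoE; case: eqP => // e; move: v1; rewrite -e ffunE. Qed.

Lemma along_sum (f : mseries nat A) (c : ex) N : (dF c < N)%N -> al f c = (\sum_(d < N) smono (v *+ d) (f d)) c.
Proof.
move=> cN; rewrite mcoef_sum -[LHS]/(if c == v *+ c i0 then f (c i0) else 0).
case: (eqVneq c (v *+ c i0)) => [e|ne]; last first.
  rewrite big1 // => d _; rewrite smonoE; case: eqP => // cd; case/negP: ne; by rewrite {2}cd vMn cd.
have ciN : (c i0 < N)%N.
  by apply: leq_ltn_trans cN; rewrite -[dF c]/(\sum_j c j)%N (bigD1 i0) //= leq_addr.
rewrite (bigD1 (Ordinal ciN)) // smonoE -[nat_of_ord (Ordinal ciN)]/(c i0) -e eqxx big1 => [|d]; first by rewrite /= addr0.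
rewrite -val_eqE /= => dn.
by case: eqP => // cd; case/negP: dn; rewrite cd vMn.
Qed.

Lemma along_hcomp (f : mseries nat A) : al f = hcomp dF (@smono ex A 0) along_x0 f.
Proof.
apply: mseriesP => c; rewrite (@hcompE _ _ _ _ _ _ _ _ _ (dF c).+1) // (@along_sum _ _ (dF c).+1) //.
congr (mcoef _ c); apply: eq_bigr => d _; by rewrite smono1X smonoM add0r expr1n mulr1.
Qed.

Lemma alongB f g : al (f - g) = al f - al g.
Proof. by rewrite !along_hcomp (rmorphB (hcomp dF (@smono ex A 0) along_x0)). Qed.
Lemma along1 : al 1 = 1.
Proof. by rewrite along_hcomp (rmorph1 (hcomp dF (@smono ex A 0) along_x0)). Qed.
Lemma alongM f g : al (f * g) = al f * al g.
Proof. by rewrite !along_hcomp (rmorphM (hcomp dF (@smono ex A 0) along_x0)). Qed.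
Lemma along_expS (f : mseries nat A) : qalg A -> f 0%N = 0 -> al (expS f) = expS (al f).
Proof. by move=> qA f0; rewrite !along_hcomp hcomp_expS. Qed.
Lemma along_at f d : al f (v *+ d) = f d.
Proof. by rewrite -[LHS]/(if v *+ d == v *+ (v *+ d) i0 then f ((v *+ d) i0) else 0) vMn eqxx. Qed.
Lemma along_0 f : al f 0 = f 0%N.
Proof. by have := along_at f 0; rewrite mulr0n. Qed.

End Along.

Lemma onvM_only (B : comNzRingType) (i : 'I_n) (F : nat -> B) (h : mseries ex B) (m : ex) :
  (forall m' : ex, m' i != 0%N -> h m' = 0) -> (onv i F * h) m = F (m i) * h (mz i m).
Proof.
move=> hh; rewrite {1}[m](mzE i) addrC onvM; last by rewrite ffunE eqxx.
rewrite big_ord_recr /= subnn mulr0n addr0 big1 ?add0r // => e _; rewrite hh ?mulr0 //.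
by rewrite ffunE dexpE eqxx ffunE eqxx add0r -lt0n subn_gt0.
Qed.

Lemma onv_pair (B : comNzRingType) (k l : 'I_n) (F G : nat -> B) (m : ex) : k != l ->
  (onv k F * onv l G) m = if m == dexp k *+ m k + dexp l *+ m l then F (m k) * G (m l) else 0.
Proof.
move=> kl; rewrite onvM_only => [|m' mk]; last exact: (only_onv _ kl mk).
have lE : mz k m l = m l by rewrite ffunE eq_sym (negbTE kl).
rewrite -[onv l G _]/(if mz k m == dexp l *+ mz k m l then G (mz k m l) else 0) lE.
have -> : (m == dexp k *+ m k + dexp l *+ m l) = (mz k m == dexp l *+ m l).
  by apply/eqP/eqP => [e|<-]; [apply: (@exI _ (dexp k *+ m k)); rewrite -mzE|exact: mzE].
by case: ifP => // _; rewrite mulr0.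
Qed.

Lemma prod_onv (B : comNzRingType) (F : 'I_n -> nat -> B) (s : seq 'I_n) (m : ex) : uniq s ->
  (\prod_(i <- s) onv i (F i)) m =
  if [forall j, (j \in s) || (m j == 0%N)] then \prod_(i <- s) F i (m i) else 0.
Proof.
elim: s m => [|i s IH] m.
  move=> _; rewrite !big_nil mcoef1; have -> : [forall j, (j \in [::]) || (m j == 0%N)] = (m == 0).
    apply/forallP/eqP => [h|-> j]; last by rewrite ffunE eqxx.
    by apply/ffunP => j; have := h j; rewrite ffunE => /eqP.
  by case: (m == 0).
move=> /= /andP[is_ us]; rewrite !big_cons onvM_only => [|m' mi]; last first.
  rewrite IH //; case: forallP => // /(_ i); by rewrite (negbTE is_) (negbTE mi).
rewrite IH //; have -> : [forall j, (j \in i :: s) || (m j == 0%N)] = [forall j, (j \in s) || (mz i m j == 0%N)].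
  apply: eq_forallb => j; rewrite inE ffunE; by case: (eqVneq j i) => [->|]; rewrite ?eqxx ?orbT.
case: ifP => _; last by rewrite mulr0.
congr (_ * _); rewrite big_seq [RHS]big_seq; apply: eq_bigr => j js; congr (F j _).
by rewrite ffunE; case: eqP => // ji; rewrite -ji js in is_.
Qed.

End Flip.

Section Generators.
Variables (K : fieldType) (qK : qalg K) (n : nat) (p : Pt K).
Local Notation ex := {ffun 'I_n -> nat}.
Local Notation O := (zser K n).
Local Notation UO := (mseries ex (mseries nat O)).
Local Notation V := (mseries ex (mseries nat K)).
Local Notation W := (mseries ex V).
Local Notation dF := (degF 'I_n).
Local Notation cO := (@cO K n).
Local Notation y := (sval p).2.

(** This is e^(k u_i hbar / 2) - e^(-k u_i hbar / 2); [kq] is the same times y_k / hbar, still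
    without negative powers of hbar. *)
Definition ks (i : 'I_n) (k : nat) : V :=
  onv i (fun a => smono a ((Eser (k%:R / 2) - Eser (- (k%:R / 2))) a)).
Definition kq (i : 'I_n) (k : nat) : V :=
  onv i (fun a => if a is a'.+1 then smono a' (k%:R ^+ a'.+1 * Sser K a' * y k) else 0).

Lemma Eser_diff (c : K) a : (Eser (c / 2) - Eser (- (c / 2))) a = if a is a'.+1 then c ^+ a * Sser K a' else 0.
Proof.
have := Tser_Eser c 0; rewrite add0r sub0r => <-; rewrite mcoefXs.
by case: a => // a; rewrite Tser_S.
Qed.

Lemma natV_V (m : nat) : (m.+1%:R : V)^-1 = smono 0 (smono 0%N (m.+1%:R)^-1).
Proof.
pose cV : {rmorphism K -> V} := @smono ex (mseries nat K) 0 \o @smono nat K 0%N.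
by rewrite -[RHS]/(cV _) rmorphV ?rmorph_nat //; exact: qK.
Qed.

Lemma iter_thO (i : 'I_n) a (o : O) c : iter a (thO i) o c = o c * (av c i)%:~R ^+ a.
Proof.
elim: a => [|a IH]; first by rewrite mulr1.
by rewrite iterS -[LHS]/(iter a (thO i) o c *~ av c i) IH exprSr mulrA mulrzr.
Qed.

Lemma zb_mul (i : 'I_n) m : zb i *+ m = zbm (dexp i *+ m).
Proof.
elim: m => [|m IH]; first by rewrite !mulr0n zbm0.
by rewrite !mulrSr IH zbmD zb_zbm.
Qed.

Lemma zb1 (i : 'I_n) : zb i i = 1%N. Proof. by rewrite ffunE leqnn. Qed.

Lemma io_at_z_along (i : 'I_n) f : iota_z (at_z i f) = along (zb i) i f :> O.
Proof.
apply: mseriesP => c; rewrite -[RHS]/(if c == zb i *+ c i then f (c i) else 0).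
case: (eqVneq c (zb i *+ c i)) => [e|ne]; first by rewrite {1}e zb_mul io_zbm at_z_coefX.
rewrite -[LHS]/(if nonneg c then at_z i f (avn c) else 0); case: ifP => // nc; rewrite at_z_coef.
case: eqP => // e; case/negP: ne; apply/eqP.
have cE : c = zb i *+ avn c i by rewrite zb_mul -e zbm_avn.
by rewrite {2}cE vMn ?zb1.
Qed.

Lemma yO_coef (i : 'I_n) a (c : ex) : yO p i a c = if c == zb i *+ c i then y (c i) * (c i)%:R ^+ a else 0.
Proof.
rewrite /yO iter_thO io_at_z_along -[along _ _ _ c]/(if c == zb i *+ c i then y (c i) else 0).
case: (eqVneq c (zb i *+ c i)) => [e|_]; last by rewrite mul0r.
by rewrite {2}e zb_mul av_zbm dexpE eqxx.
Qed.

Lemma pserV (q : nat -> V) m (r : ex) (k : nat) : pser q m r k = if m is m'.+1 then (m%:R)^-1 * q m r k else 0.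
Proof.
case: m => [|m] //; rewrite -[pser q m.+1]/(q m.+1 / m.+1%:R) natV_V mulrC mcoefCM mcoefCM //.
Qed.

(** On z_i^k the operator u_i S(u_i hbar theta_i) is the number [ks i k] / (k hbar). So u_i S(u_i
    hbar theta_i) y is the exponent belonging to the power sums [kq i k]. *)
Lemma Fl_kq (i : 'I_n) : Fl (along (zb i) i (pser (kq i))) = smono (dexp i) (smono 0%N (yi p i)) + kex cO (yO p) i.
Proof.
have RE (r : ex) : (smono (dexp i) (smono 0%N (yi p i)) + kex cO (yO p) i) r =
    if r == dexp i *+ r i then (if r i is a'.+1 then smono a' (cO (Sser K a') * yO p i a') else 0) else 0.
  rewrite mcoefD smonoE -[kex cO (yO p) i r]/(if r == dexp i *+ r i then (if r i is k.+2 then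
    smono k.+1 (cO (Sser K k.+1) * yO p i k.+1) else 0) else 0).
  case: (eqVneq r (dexp i *+ r i)) => [e|ne]; last first.
    by rewrite addr0; case: eqP => // e; case/negP: ne; rewrite e dexp1E eqxx mulr1n.
  have -> : (r == dexp i) = (r i == 1%N).
    by apply/eqP/eqP => [->|e1]; [rewrite dexp1E eqxx|rewrite e e1 mulr1n].
  by case: (r i) => [|[|k]]; rewrite ?add0r ?addr0 // Sser0 // rmorph1 mul1r.
apply: mseriesP => r; rewrite RE; apply: mseriesP => k; apply: mseriesP => c; rewrite FlE.
rewrite -[along _ _ _ c]/(if c == zb i *+ c i then pser (kq i) (c i) else 0).
transitivity (if c == zb i *+ c i then pser (kq i) (c i) r k else 0); first by case: ifP.
rewrite pserV; set Q := kq i.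
have QE m : Q m r k = if r == dexp i *+ r i then (if r i is a'.+1 then (if k == a' then m%:R ^+ a'.+1 * Sser K a' * y m else 0) else 0) else 0.
  rewrite -[Q m r]/(if r == dexp i *+ r i then (if r i is a'.+1 then smono a' (m%:R ^+ a'.+1 * Sser K a' * y m) else 0) else 0).
  by case: ifP => // _; case: (r i) => // a'; rewrite smonoE.
case: (boolP (r == dexp i *+ r i)) => er; last first.
  by case: ifP => // _; case: (c i) => // m; rewrite QE (negbTE er) mulr0.
case: (r i) er QE => [|a'] er QE.
  by case: ifP => // _; case: (c i) => // m; rewrite QE er mulr0.
rewrite smonoE; case: (eqVneq k a') QE => [->|ka] QE; last first.
  by case: ifP => // _; case: (c i) => // m; rewrite QE er mulr0.
rewrite mcoefCM yO_coef; case: ifP => _; last by rewrite mulr0.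
case: (c i) => [|m]; first by rewrite ys0 mul0r mulr0.
rewrite QE er exprS; have := qnat_neq0 qK m; move: (m.+1%:R : K) => z z0; by field.
Qed.

Lemma tb1 (k l : 'I_n) : (k < l)%N -> tb k l l = 1%N.
Proof. by move=> kl; rewrite ffunE kl leqnn. Qed.

Lemma av_mul (v : ex) d i : av (v *+ d) i = av v i * d%:Z.
Proof.
elim: d => [|d IH]; first by rewrite mulr0n av0 mulr0.
by rewrite mulrSr avD IH -[d.+1]addn1 PoszD mulrDr mulr1.
Qed.

Lemma av_tb (k l i : 'I_n) : (k < l)%N -> av (tb k l) i = (i == l)%:Z - (i == k)%:Z.
Proof. by move=> kl; have := avD (zb k) (tb k l) i; rewrite -zb_tb // !av_zb => ->; rewrite addrC addKr. Qed.

Lemma Bkl_along (k l : 'I_n) : (k < l)%N -> Bkl K k l = along (tb k l) l (MSeries (fun d : nat => d%:R)).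
Proof.
move=> kl; pose D : mseries nat K := MSeries (fun d : nat => d%:R); pose G : mseries nat K := MSeries (fun=> 1).
have DG : D * (1 - Xs K) = Xs K * G.
  apply: mseriesP => -[|d]; rewrite mulrBr mulr1 [D * _]mulrC mcoefB !mcoefXs; first by rewrite subr0.
  by rewrite -[D d.+1]/(d.+1%:R) -[D d]/(d%:R) -natr1 addrC addKr.
have GG : G * (1 - Xs K) = 1.
  apply: mseriesP => -[|d]; rewrite mulrBr mulr1 [G * _]mulrC mcoefB !mcoefXs mcoef1; first by rewrite subr0.
  by rewrite subrr.
have t1 := tb1 kl; have tE : along (tb k l) l (Xs K) = tO K k l.
  by rewrite (along_hcomp t1) hcomp_smono rmorph1 mul1r expr1.
have := congr1 (along (tb k l) l) (congr1 (fun z => z * (1 - Xs K)) DG).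
rewrite -[Xs K * G * _]mulrA GG mulr1 tE !(alongM t1) (alongB t1) (along1 _ t1) tE => e.
have u := one_tO_unit K kl; by rewrite /Bkl -[X in X * _]e expr2 mulrA mulrK // mulrK.
Qed.

(** S is an even series. *)
Lemma Sser_sign a : Sser K a * (-1) ^+ a = Sser K a.
Proof.
rewrite -[Sser K a]/((2^-1 ^+ a.+1 - (- 2^-1) ^+ a.+1) / (a.+1)`!%:R) [(- 2^-1) ^+ _]exprNn [(-1) ^+ a.+1]exprS.
have : ((-1) ^+ a : K) * (-1) ^+ a = 1 by rewrite -exprD addnn -mul2n exprM sqrrN expr1n expr1n.
move: ((-1) ^+ a : K) (2^-1 ^+ a.+1 : K) (((a.+1)`!%:R)^-1 : K) => s h f ss.
transitivity (h * f * s + h * f * (s * s)); first by ring.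
by rewrite ss; ring.
Qed.

(** The pair function is the sum of d x^d with x = z_l / z_k, on which theta_k acts by -d and
    theta_l by d; evenness of S removes the sign. This is the pair interaction of two vertex
    operators. *)
Lemma Fl_ks (k l : 'I_n) : (k < l)%N ->
  Fl (along (tb k l) l (pser (fun d => ks k d * ks l d))) = wex cO (@bO K n) k l.
Proof.
move=> kl; have kl' : k != l by rewrite -val_eqE neq_ltn kl.
apply: mseriesP => r; apply: mseriesP => h; apply: mseriesP => c; rewrite FlE.
rewrite -[along _ _ _ c]/(if c == tb k l *+ c l then pser (fun d => ks k d * ks l d) (c l) else 0).
transitivity (if c == tb k l *+ c l then pser (fun d => ks k d * ks l d) (c l) r h else 0); first by case: ifP.
have QE d : (ks k d * ks l d) r h = if [&& r == dexp k *+ r k + dexp l *+ r l, (0 < r k)%N & (0 < r l)%N] then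
    (if h == (r k + r l)%N then d%:R ^+ r k * Sser K (r k).-1 * (d%:R ^+ r l * Sser K (r l).-1) else 0) else 0.
  rewrite /ks onv_pair //; case: (r == _) => //.
  rewrite smonoM !Eser_diff smonoE; case: (r k) => [|a]; first by rewrite mul0r; case: ifP.
  by case: (r l) => [|a']; first by rewrite mulr0; case: ifP.
rewrite -[wex cO (@bO K n) k l r]/(if [&& r == dexp k *+ r k + dexp l *+ r l, (0 < r k)%N & (0 < r l)%N] then
    smono (r k + r l)%N (cO (Sser K (r k).-1) * cO (Sser K (r l).-1) * bO K k l (r k).-1 (r l).-1) else 0).
rewrite pserV; case: (boolP [&& _, _ & _]) => hr; last first.
  by case: ifP => // _; case: (c l) => // d; rewrite QE (negbTE hr) mulr0.
rewrite smonoE; case: (eqVneq h (r k + r l)%N) => hh; last first.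
  by case: ifP => // _; case: (c l) => // d; rewrite QE hr (negbTE hh) mulr0.
rewrite -mulrA !mcoefCM /bO !iter_thO (Bkl_along kl).
rewrite -[along _ _ _ c]/(if c == tb k l *+ c l then (c l)%:R else 0).
case: (eqVneq c (tb k l *+ c l)) => [e|_]; last by rewrite !mul0r !mulr0.
have -> : av c k = - (c l)%:Z by rewrite {1}e av_mul av_tb // eqxx (negbTE kl') sub0r mulN1r.
have -> : av c l = (c l)%:Z by rewrite {1}e av_mul av_tb // eqxx eq_sym (negbTE kl') subr0 mul1r.
case: (c l) => [|d]; first by rewrite !mul0r !mulr0.
rewrite QE hr hh eqxx; case/and3P: hr => _; case: (r k) => // a _; case: (r l) => // a' _.
rewrite -[a.+1.-1]/a -[a'.+1.-1]/a' mulrNz -[(Posz d.+1)%:~R]/(d.+1%:R : K) [(- d.+1%:R) ^+ _]exprNn.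
rewrite -{1}(Sser_sign a) !exprS; have := qnat_neq0 qK d; move: (Sser K a) (Sser K a') => S1 S2; move: (d.+1%:R : K) ((-1) ^+ a : K) => z s z0; by field.
Qed.

Lemma qV : qalg V. Proof. exact: (qalg_mseries ex (qalg_mseries nat qK)). Qed.

Definition hw (i : 'I_n) : W := along (zb i) i (expS (pser (kq i))).
Definition cw (e : 'I_n * 'I_n) : W := along (tb e.1 e.2) e.2 (expS (pser (fun d => ks e.1 d * ks e.2 d))).

Lemma ey_expS (i : 'I_n) : ey p i = expS (smono (dexp i) (smono 0%N (yi p i))).
Proof.
have q1 := qalg_mseries ex qK.
have s0 : (smono (dexp i) (smono 0%N (yi p i)) : UO) 0 = 0.
  by rewrite smonoE; case: eqP => // /ffunP/(_ i); rewrite dexp1E eqxx ffunE.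
apply: mseriesP => r; rewrite (expS_sum (dg := dF) (N := (dF r).+1)) //.
rewrite -[LHS]/(if r == dexp i *+ r i then smono 0%N (cO ((r i)`!%:R)^-1 * yi p i ^+ r i) else 0).
have tE j : (smono (dexp i) (smono 0%N (yi p i)) : UO) ^+ j = smono (dexp i *+ j) (smono 0%N (yi p i ^+ j)).
  by rewrite !smono1X mul0rn.
under eq_bigr => j _ do rewrite tE smonoE.
case: (eqVneq r (dexp i *+ r i)) => [e|ne]; last first.
  rewrite big1 // => j _; case: eqP => [e|]; last by rewrite mulr0.
  by case/negP: ne; rewrite {2}e dexpE eqxx {1}e.
have rN : (r i < (dF r).+1)%N by rewrite {2}e dF_dexp.
rewrite (bigD1 (Ordinal rN)) //= -e eqxx big1 ?addr0 => [|j].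
  by rewrite (fact_const_V nat _ q1) (fact_const_V ex _ qK) smonoM addr0.
rewrite -val_eqE /= => jr; case: eqP => [e'|]; last by rewrite mulr0.
have := congr1 (fun z : ex => z i) e'; rewrite dexpE eqxx => ri; by case/eqP: jr; rewrite ri.
Qed.

Lemma Hx_Fl (i : 'I_n) : ey p i * expS (kex cO (yO p) i) = Fl (hw i).
Proof.
have q1 : qalg (mseries nat O) by exact: (qalg_mseries nat (qalg_mseries ex qK)).
have s0 : (smono (dexp i) (smono 0%N (yi p i)) : UO) 0 = 0.
  by rewrite smonoE; case: eqP => // /ffunP/(_ i); rewrite dexp1E eqxx ffunE.
have k0 : kex cO (yO p) i 0 = 0 by exact: kex0.
rewrite ey_expS -(expSD dF q1 s0 k0) -Fl_kq -Fl_expS //.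
- by rewrite /hw (along_expS (zb1 i) qV).
- by rewrite (along_0 (zb1 i)).
- by rewrite Fl_kq mcoefD s0 k0 addr0.
Qed.

Lemma cw_Fl (e : 'I_n * 'I_n) : (e.1 < e.2)%N -> ws cO (@bO K n) e.1 e.2 = Fl (cw e - 1).
Proof.
move=> lt; rewrite /ws FlB Fl1 -(Fl_ks lt) -Fl_expS //.
- by rewrite /cw (along_expS (tb1 lt) qV).
- by rewrite (along_0 (tb1 lt)).
- by rewrite Fl_ks // wex0.
Qed.

Definition Sv (i : 'I_n) : V := onv i (fun a => smono a ((Sser K)^-1 a)).
Definition gw : W := \sum_(E : {set 'I_n * 'I_n} | simple_graph E && connected_graph E) \prod_(e in E) (cw e - 1).
(** The integrand apart from the factors 1 / S(u_i hbar), which do not depend on z. *)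
Definition Pw : W := (\prod_(i <- enum 'I_n) hw i) * gw.

Lemma Svs_Fl (i : 'I_n) : Svs cO i = Fl (smono 0 (Sv i)).
Proof.
apply: mseriesP => r; apply: mseriesP => k; apply: mseriesP => c; rewrite FlE smonoE.
rewrite -[Svs cO i r]/(if r == dexp i *+ r i then smono (r i) (cO ((Sser K)^-1 (r i))) else 0).
transitivity (if r == dexp i *+ r i then (if k == r i then cO ((Sser K)^-1 (r i)) c else 0) else 0).
  by case: ifP => // _; rewrite smonoE; case: ifP.
transitivity (if c == 0 then Sv i r k else 0); last by case: ifP.
rewrite -[Sv i r]/(if r == dexp i *+ r i then smono (r i) ((Sser K)^-1 (r i)) else 0).
rewrite -[cO _ c]/(if c == 0 then _ else 0).
case: (c == 0); case: (r == _) => //; rewrite ?smonoE //; by case: ifP.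
Qed.

Lemma gs_Fl : gs cO (@bO K n) = Fl gw.
Proof.
rewrite /gs /gw (big_morph _ (@FlD K n) (Fl0 K n)); apply: eq_bigr => E /andP[/forallP sE _]; rewrite (big_morph _ (@FlM K n) (Fl1 K n)).
apply: eq_bigr => e eE; apply: cw_Fl; exact: (implyP (sE e)).
Qed.

Lemma Gk_Fl : (\prod_(i <- enum 'I_n) Gk p i) * gs cO (@bO K n) = Fl (smono 0 (\prod_(i <- enum 'I_n) Sv i) * Pw).
Proof.
have GE i : Gk p i = Fl (smono 0 (Sv i) * hw i).
  by rewrite FlM -Svs_Fl -Hx_Fl; exact: (etrans (mulrA _ _ _) (mulrC _ _)).
rewrite gs_Fl (eq_bigr _ (fun i _ => GE i)) -(big_morph _ (@FlM K n) (Fl1 K n)) -FlM /Pw; congr (Fl _).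
by rewrite big_split /= -mulrA (rmorph_prod (@smono ex V 0)).
Qed.

Lemma dv_gs (i : 'I_n) : (1 < n)%N -> dv i (gs cO (@bO K n)).
Proof.
move=> n1 m mi; rewrite /gs mcoef_sum big1 // => E /andP[sE /forallP cE].
have [j ij] : exists j : 'I_n, j != i.
  by case: (eqVneq i (Ordinal (ltnW n1))) => [->|h]; [exists (Ordinal n1)|exists (Ordinal (ltnW n1)); rewrite eq_sym].
have /connectP[[|x q]] := forallP (cE i) j; first by move=> _ /= e; rewrite e eqxx in ij.
move=> /= /andP[ix _] _.
have dw (k l : 'I_n) : (i == k) || (i == l) -> dv i (ws cO (@bO K n) k l).
  move=> ikl; have dwx : dv i (wex cO (@bO K n) k l).
    move=> m' mi'; rewrite -[LHS]/(if [&& _, _ & _] then _ else _); case: ifP => // /and3P[_ h1 h2].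
    by case/orP: ikl => /eqP e; move: h1 h2; rewrite -e mi'.
  move=> m' mi'; rewrite /ws mcoefB (expS_sum (dg := dF) (N := (dF m').+1)) ?wex0 //.
  rewrite big_ord_recl expr0 fact0 invr1 mul1r big1 ?addr0 ?subrr // => a _.
  by rewrite -[lift _ _ : nat]/(a.+1) exprSr (dvM _ dwx mi') mulr0.
have [e eE ie] : exists2 e, e \in E & (i == e.1) || (i == e.2).
  by case/orP: ix => h; [exists (i, x)|exists (x, i)]; rewrite //= eqxx ?orbT.
have -> : \prod_(e0 in E) ws cO (@bO K n) e0.1 e0.2 =
    (\prod_(e0 in E | e0 != e) ws cO (@bO K n) e0.1 e0.2) * ws cO (@bO K n) e.1 e.2 by rewrite (bigD1 e) // mulrC.
exact: (dvM _ (dw _ _ ie) mi).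
Qed.

End Generators.

Section DegreeTruncation.
Variables (n : nat) (A : comUnitRingType) (E : nat).
Local Notation ex := {ffun 'I_n -> nat}.
Local Notation dF := (degF 'I_n).

Definition eqd (F G : mseries ex A) := forall c, (dF c <= E)%N -> F c = G c.

Lemma eqdM F G F' G' : eqd F F' -> eqd G G' -> eqd (F * G) (F' * G').
Proof. by move=> h h' c hc; apply: (eq_mcoefM (dg := dF)) => a ac; [apply: h|apply: h']; exact: leq_trans hc. Qed.

Lemma eqd_sum I (s : seq I) (P : pred I) (F G : I -> mseries ex A) : (forall x, P x -> eqd (F x) (G x)) ->
  eqd (\sum_(x <- s | P x) F x) (\sum_(x <- s | P x) G x).
Proof. by move=> h c hc; rewrite !mcoef_sum; apply: eq_bigr => x Px; exact: h. Qed.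

Lemma eqd_prod I (s : seq I) (P : pred I) (F G : I -> mseries ex A) : (forall x, P x -> eqd (F x) (G x)) ->
  eqd (\prod_(x <- s | P x) F x) (\prod_(x <- s | P x) G x).
Proof. by move=> h; apply: (big_ind2 eqd) => // *; exact: eqdM. Qed.

Lemma smono_prod (I : finType) (P : pred I) (m : I -> ex) (c : I -> A) :
  \prod_(i | P i) smono (m i) (c i) = smono (\sum_(i | P i) m i) (\prod_(i | P i) c i).
Proof.
by apply: (big_rec3 (fun x s z => x = smono s z)) => // i x s z _ ->; rewrite smonoM.
Qed.

End DegreeTruncation.

Section Expansion.
Variables (K : fieldType) (qK : qalg K) (n : nat) (p : Pt K) (b : {ffun 'I_n -> nat}).
Local Notation ex := {ffun 'I_n -> nat}.
Local Notation V := (mseries ex (mseries nat K)).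
Local Notation W := (mseries ex V).
Local Notation dF := (degF 'I_n).
Local Notation I := ('I_n * 'I_n)%type.
Local Notation rB := (@rowB n (dF b)).
Local Notation rD := (@rowD n (dF b)).
Local Notation ds := {ffun I -> 'I_rB.+1}.
Local Notation a := (fun i => av b i).

Definition cE (e : I) (c : nat) : V := hs (fun k => @ks K n e.1 k * @ks K n e.2 k) c.
Definition hE (i : 'I_n) (M : int) : V := if M is Posz m then hs (@kq K n p i) m else 0.
Definition Qn (e : I) (c : 'I_rB.+1) : bool := (c != ord0) && (c < rD e.1)%N.
Definition supp (d : ds) : {set I} := [set e | d e != ord0]%SET.

Lemma conn_supp d : connected_graph (supp d) = cnct finset.setT d.
Proof.
have ec : connect (fun k l => ((k, l) \in supp d) || ((l, k) \in supp d)) =2 connect (adj d).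
  by apply: eq_connect => k l; rewrite /adj !inE.
apply/forallP/forallP => h x.
  apply/implyP => _; apply/forallP => z; apply/implyP => _; rewrite -ec; exact: (forallP (h x) z).
by apply/forallP => z; rewrite ec; exact: (implyP (forallP (implyP (h x) (finset.in_setT x)) z) (finset.in_setT z)).
Qed.

Lemma dF_ge (c : ex) i : (c i <= dF c)%N.
Proof. by rewrite -[dF c]/(\sum_j c j)%N (bigD1 i) //= leq_addr. Qed.

(** All factors are generating series of h's, so a term is given by edge multiplicities d and vertex
    powers t. The exponent of z_i then forces t_i = [Ms a d i], the index found in [word_expand]. *)
Lemma Pw_coef : @Pw K n p b =
  \sum_(d : ds | inbox (@Qb n rB rD) (edg finset.setT) d && cnct finset.setT d)
    (\prod_e cE e (d e)) * \prod_i hE i (Ms a d i).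
Proof.
have _ := qK; pose N := (dF b + n * rB.+1).+1.
pose X : W := \sum_(t : {ffun 'I_n -> 'I_N}) smono (\sum_i zb i *+ t i) (\prod_i hs (@kq K n p i) (t i)).
pose G (d : ds) : W := smono (\sum_e tb e.1 e.2 *+ d e) (\prod_e cE e (d e)).
pose Y : W := \sum_(d : ds | inbox (@Qb n rB rD) (edg finset.setT) d && cnct finset.setT d) G d.
have hX : eqd (dF b) (\prod_(i <- enum 'I_n) @hw K n p i) X.
  have -> : X = \prod_(i <- enum 'I_n) \sum_(m < N) smono (zb i *+ m) (hs (@kq K n p i) m).
    transitivity (\prod_(i : 'I_n) \sum_(m < N) smono (zb i *+ m) (hs (@kq K n p i) m)); last by rewrite big_enum.
    by rewrite bigA_distr_bigA; apply: eq_bigr => t _; rewrite smono_prod.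
  apply: eqd_prod => i _ c hc; rewrite /hw (@along_sum _ _ _ _ (zb1 i) _ _ N); last by rewrite ltnS (leq_trans hc) ?leq_addr.
  by congr (mcoef _ c); apply: eq_bigr => m _; rewrite hsymE.
(* Multigraphs are grouped by their support, a connected simple graph; the -1 in each w leaves the
   nonzero multiplicities. *)
have YE : Y = \sum_(E : {set I} | simple_graph E && connected_graph E) \sum_(d : ds | inbox Qn E d) G d.
  rewrite /Y (partition_big supp (fun E => simple_graph E && connected_graph E)) => [|d /andP[hd hc]]; last first.
    rewrite conn_supp hc andbT; apply/forallP => e; apply/implyP; rewrite inE => de.
    have : e \in edg finset.setT by apply: contraNT de => h; rewrite (inbox_out hd h).
    by rewrite inE => /and3P[].
  apply: eq_bigr => E /andP[/forallP sE cnE]; apply: eq_bigl => d; apply/andP/forallP => [[/andP[hd hc] /eqP Es] e|h].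
    rewrite -Es inE; case: (eqVneq (d e) ord0) => [-> //|de] /=.
    have eG : e \in edg finset.setT by apply: contraNT de => h; rewrite (inbox_out hd h).
    by rewrite /Qn de; exact: (inbox_in hd eG).
  have Es : supp d = E.
    by apply/setP => e; rewrite inE; have := h e; case: ifP => [_ /andP[-> _] //|_ /eqP ->]; rewrite eqxx.
  split; last by rewrite Es.
  rewrite -conn_supp Es cnE andbT; apply/forallP => e; have := h e; case: (boolP (e \in E)) => eE.
    by move=> /andP[_ h2]; rewrite inE (implyP (sE e) eE) !inE.
  by move=> /eqP ->; case: ifP => // _; exact: rowD0.
have gY : eqd (dF b) (@gw K n) Y.
  rewrite YE; apply: eqd_sum => E /andP[/forallP sE _].
  have -> : \sum_(d : ds | inbox Qn E d) G d = \prod_(e in E) \sum_(c | Qn e c) smono (tb e.1 e.2 *+ c) (cE e c).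
    rewrite prod_sum_inbox; apply: eq_bigr => d hd; rewrite smono_prod /G; congr (smono _ _).
      rewrite [LHS](bigID (mem E)) /= [X in _ + X]big1 ?addr0 // => e eE; by rewrite (inbox_out hd eE) mulr0n.
    rewrite [LHS](bigID (mem E)) /= [X in _ * X]big1 ?mulr1 // => e eE; rewrite (inbox_out hd eE); exact: hsym0.
  apply: eqd_prod => e eE c hc; have lt := implyP (sE e) eE.
  rewrite mcoefB /cw (@along_sum _ _ _ _ (tb1 lt) _ _ (rD e.1)); last by rewrite (leq_ltn_trans hc) ?rowDA.
  suff -> : \sum_(d < rD e.1) smono (tb e.1 e.2 *+ d) (expS (pser (fun k => @ks K n e.1 k * @ks K n e.2 k)) d) =
      1 + \sum_(c' : 'I_rB.+1 | Qn e c') smono (tb e.1 e.2 *+ c') (cE e c') by rewrite mcoefD addrAC subrr add0r.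
  rewrite (big_ord_widen rB.+1 (fun d => smono (tb e.1 e.2 *+ d) (expS (pser (fun k => @ks K n e.1 k * @ks K n e.2 k)) d))) ?rowDB //.
  rewrite (bigD1 ord0) ?rowD0 //; congr (_ + _).
    by rewrite -[nat_of_ord ord0]/0%N mulr0n -hsymE hsym0.
  by apply: eq_big => [c'|c' _]; [rewrite andbC|rewrite -hsymE].
have XY : X * Y = \sum_(d : ds | inbox (@Qb n rB rD) (edg finset.setT) d && cnct finset.setT d)
    \sum_(t : {ffun 'I_n -> 'I_N}) smono (\sum_e tb e.1 e.2 *+ d e + \sum_j zb j *+ t j)
      ((\prod_e cE e (d e)) * \prod_i hs (@kq K n p i) (t i)).
  by rewrite mulrC /Y mulr_suml; apply: eq_bigr => d _; rewrite /X mulr_sumr; apply: eq_bigr => t _; rewrite /G smonoM.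
rewrite /Pw (eqdM hX gY (leqnn _)); refine (etrans (congr1 (fun z : W => z b) XY) _); cbv beta.
rewrite mcoef_sum; apply: eq_bigr => d /andP[hd _].
have avE (t : {ffun 'I_n -> 'I_N}) i : av (\sum_e tb e.1 e.2 *+ d e + \sum_j zb j *+ t j) i = av b i - Ms a d i + (t i : nat)%:Z.
  rewrite avD; congr (_ + _); last first.
    rewrite (big_morph (fun c : ex => av c i) (fun c c' => avD c c' i) (av0 i)) (bigD1 i) //=.
    rewrite zb_mul av_zbm dexpE eqxx big1 ?addr0 // => j ji; by rewrite zb_mul av_zbm dexpE eq_sym (negbTE ji).
  rewrite (big_morph (fun c : ex => av c i) (fun c c' => avD c c' i) (av0 i)).
  have -> : av b i - Ms a d i = \sum_j (d (j, i) : nat)%:Z - \sum_j (d (i, j) : nat)%:Z.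
    rewrite /Ms; move: (av b i) (\sum_j (d (i, j) : nat)%:Z) (\sum_j (d (j, i) : nat)%:Z) => u v w; lia.
  transitivity (\sum_e ((if e.2 == i then (d e : nat)%:Z else 0) - (if e.1 == i then (d e : nat)%:Z else 0))).
    apply: eq_bigr => e _; case: (boolP (e \in edg finset.setT)) => eG; last first.
      by rewrite (inbox_out hd eG) mulr0n av0; case: ifP; case: ifP.
    have lt : (e.1 < e.2)%N by move: eG; rewrite inE => /and3P[].
    rewrite av_mul av_tb // ![i == _]eq_sym; case: (e.2 == i); case: (e.1 == i); rewrite ?subrr ?subr0 ?sub0r ?mul0r ?mul1r ?mulN1r //.
  rewrite sumrB; congr (_ - _).
    transitivity (\sum_k \sum_l (if l == i then (d (k, l) : nat)%:Z else 0)).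
      by rewrite pair_big; apply: eq_big => [[k l]|[k l] _].
    by apply: eq_bigr => k _; rewrite -big_mkcond big_pred1_eq.
  transitivity (\sum_k \sum_l (if k == i then (d (k, l) : nat)%:Z else 0)).
    by rewrite pair_big; apply: eq_big => [[k l]|[k l] _].
  rewrite exchange_big /=.
  by apply: eq_bigr => k _; rewrite -big_mkcond big_pred1_eq.
transitivity (\sum_(t : {ffun 'I_n -> 'I_N}) (\prod_e cE e (d e)) *
    \prod_i (if (t i : nat)%:Z == Ms a d i then hs (@kq K n p i) (t i) else 0)).
  rewrite mcoef_sum; apply: eq_bigr => t _; rewrite smonoE.
  case: (eqVneq b (\sum_e tb e.1 e.2 *+ d e + \sum_j zb j *+ t j)) => [e|ne].
    congr (_ * _); apply: eq_bigr => i _; have := avE t i; rewrite -e => h.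
    have -> : (t i : nat)%:Z = Ms a d i by apply: (@addrI _ (av b i - Ms a d i)); rewrite -h subrK.
    by rewrite eqxx.
  have [i hi] : exists i, (t i : nat)%:Z != Ms a d i.
    apply/existsP; apply: contraNT ne; rewrite negb_exists => /forallP h; apply/eqP/av_inj => i.
    by rewrite avE; have := h i; rewrite negbK => /eqP ->; rewrite subrK.
  by rewrite (bigD1 i) //= (negbTE hi) mul0r mulr0.
rewrite -mulr_sumr; congr (_ * _); rewrite -(bigA_distr_bigA (fun i (m : 'I_N) => if (m : nat)%:Z == Ms a d i then hs (@kq K n p i) m else 0)).
apply: eq_bigr => i _.
have MN : Ms a d i < N%:Z.
  have h1 : (\sum_l (d (i, l) : nat) <= n * rB)%N.
    rewrite -[X in (_ <= X * _)%N](card_ord n) -sum_nat_const; apply: leq_sum => l _; by rewrite -ltnS.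
  have h2 : 0 <= \sum_l (d (l, i) : nat)%:Z by apply: sumr_ge0.
  have h3 := dF_ge b i; rewrite /Ms -(big_morph Posz PoszD (erefl 0%:Z)) /av /N; move: h1 h2 h3.
  rewrite mulnS; move: (dF b) (b i) (nx b i) (n * rB)%N (\sum_l (d (i, l) : nat))%N (\sum_l (d (l, i) : nat)%:Z) => u v u1 u2 u3 u4; lia.
rewrite -[LHS]/(\sum_(m < N) (if (m : nat)%:Z == Ms a d i then hs (@kq K n p i) m else 0)).
case: (Ms a d i) MN => [m|m] MN; last by rewrite big1.
have mN : (m < N)%N by [].
rewrite (bigD1 (Ordinal mN)) //; rewrite big1 => [|m' hm]; first by rewrite -[nat_of_ord (Ordinal mN)]/m eqxx /= addr0.
by case: eqP => // -[e]; case/eqP: hm; apply: val_inj.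
Qed.

End Expansion.

Lemma smono_coef_nat (A : comNzRingType) s (c : A) (g : mseries nat A) N :
  (smono s c * g) N = if (s <= N)%N then c * g (N - s)%N else 0.
Proof.
rewrite mcoefM_nat; case: leqP => sN.
  have sN' : (s < N.+1)%N by [].
  rewrite (bigD1 (Ordinal sN')) //= eqxx big1 ?addr0 // => i; rewrite -val_eqE /= => /negbTE ->; by rewrite mul0r.
rewrite big1 // => i _; rewrite smonoE; case: eqP => [e|_]; last by rewrite mul0r.
by move: sN; rewrite -e ltnNge -ltnS ltn_ord.
Qed.

Lemma lmono0 (A : comNzRingType) (m : int) : lmono m (0 : A) = 0.
Proof. by apply: laurentP => k; rewrite -[LHS]/(if k == m then 0 else 0); case: ifP. Qed.

Lemma lmonoD (A : comNzRingType) (m : int) (x z : A) : lmono m (x + z) = lmono m x + lmono m z.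
Proof.
apply: laurentP => k; rewrite -[LHS]/(if k == m then x + z else 0).
by rewrite -[RHS]/((if k == m then x else 0) + (if k == m then z else 0)); case: ifP; rewrite ?addr0.
Qed.

Lemma lser_mono (A : comNzRingType) (k : nat) (x : A) : lser (smono k x) = lmono k%:Z x.
Proof.
apply: laurentP => -[m|m]; rewrite lserE ?smonoE // -[RHS]/(if Posz m == Posz k then x else 0) eqz_nat //.
Qed.

(** * Identification with the connected word and its functional *)

Section Homogenization.
Variables (K : closedFieldType) (qK : qalg K) (n : nat).
Local Notation ex := {ffun 'I_n -> nat}.
Local Notation V := (mseries ex (mseries nat K)).
Local Notation Z := (mseries ex (laurent K)).
Local Notation zs := (zser K n).
Local Notation L := {poly zs}.
Local Notation dF := (degF 'I_n).

(* Substitutes hbar u for u. *)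
Definition hgz (f : zs) : Z := MSeries (fun r => lmono (dF r)%:Z (f r)).

Lemma hgz_zmod : zmod_morphism hgz.
Proof.
move=> f g; apply: mseriesP => r; rewrite mcoefB -[LHS]/(lmono (dF r)%:Z (f r - g r)).
rewrite -[hgz f r]/(lmono (dF r)%:Z (f r)) -[hgz g r]/(lmono (dF r)%:Z (g r)).
by apply/eqP; rewrite eq_sym subr_eq -lmonoD subrK.
Qed.
HB.instance Definition _ := GRing.isZmodMorphism.Build zs Z hgz hgz_zmod.

Lemma hgz_monoid : monoid_morphism hgz.
Proof.
split=> [|f g]; apply: mseriesP => r.
  rewrite mcoef1 -[LHS]/(lmono (dF r)%:Z ((1 : zs) r)) mcoef1; case: (eqVneq r 0) => [->|_]; last exact: lmono0.
  by rewrite deg0.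
rewrite mcoefM -[LHS]/(lmono (dF r)%:Z ((f * g) r)) mcoefM.
rewrite (big_morph (lmono (dF r)%:Z) (lmonoD (dF r)%:Z) (lmono0 K (dF r)%:Z)) big_seq [RHS]big_seq.
apply: eq_bigr => d; rewrite mem_splits => /eqP <-.
by rewrite -[hgz f d.1]/(lmono _ _) -[hgz g d.2]/(lmono _ _) lmonoM degD PoszD.
Qed.
HB.instance Definition _ := GRing.isMonoidMorphism.Build zs Z hgz hgz_monoid.

Definition Jh (f : L) : Z := (map_poly hgz f).[smono 0 (lmono (-1) 1)].

Lemma Jh_zmod : zmod_morphism Jh.
Proof. by move=> f g; rewrite /Jh rmorphB hornerD hornerN. Qed.
HB.instance Definition _ := GRing.isZmodMorphism.Build L Z Jh Jh_zmod.
Lemma Jh_monoid : monoid_morphism Jh.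
Proof. by split => [|f g]; rewrite /Jh ?rmorph1 ?hornerC // rmorphM hornerM. Qed.
HB.instance Definition _ := GRing.isMonoidMorphism.Build L Z Jh Jh_monoid.

Lemma JhM f g : Jh (f * g) = Jh f * Jh g. Proof. exact: Jh_monoid.2. Qed.
Lemma JhB f g : Jh (f - g) = Jh f - Jh g. Proof. exact: Jh_zmod. Qed.
Lemma JhD f g : Jh (f + g) = Jh f + Jh g. Proof. exact: (rmorphD Jh). Qed.
Lemma Jh0 : Jh 0 = 0. Proof. exact: (rmorph0 Jh). Qed.
Lemma Jh1 : Jh 1 = 1. Proof. exact: Jh_monoid.1. Qed.
Lemma JhC c : Jh c%:P = hgz c.
Proof. by rewrite /Jh map_polyC hornerC. Qed.

Lemma JhE f r : Jh f r = \sum_(q < size f) lmono ((dF r)%:Z - q%:Z) (f`_q r).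
Proof.
rewrite /Jh (@horner_coef_wide _ (size f)) ?size_poly // mcoef_sum; apply: eq_bigr => q _.
have lX : (lmono (-1) 1 : laurent K) ^+ q = lmono (- (q : nat)%:Z) 1.
  elim: (nat_of_ord q) => [|m IH]; first by rewrite expr0 oppr0.
  by rewrite exprS IH lmonoM mulr1; congr (lmono _ _); lia.
rewrite coef_map smono1X mul0rn lX mulrC mcoefCM -[hgz _ r]/(lmono (dF r)%:Z _) lmonoM mul1r.
by rewrite addrC.
Qed.

Definition SL (f : V) : Z := smap (@lser K) f.
Lemma SLM f g : SL (f * g) = SL f * SL g. Proof. exact: (rmorphM (smap (@lser K))). Qed.
Lemma SLD f g : SL (f + g) = SL f + SL g. Proof. exact: (rmorphD (smap (@lser K))). Qed.
Lemma SL0 : SL 0 = 0. Proof. exact: (rmorph0 (smap (@lser K))). Qed.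
Lemma SL1 : SL 1 = 1. Proof. exact: (rmorph1 (smap (@lser K))). Qed.
Lemma SLE f r : SL f r = lser (f r). Proof. by []. Qed.

Lemma SL_ks i k : SL (@ks K n i k) = Jh (kap (gz K i) k).
Proof.
have ezE (c : K) : ez i c = (at_z i (Eser c))%:P.
  exact: (congr1 (fun F : forall (K : fieldType) (n : nat), 'I_n -> K -> {poly zser K n} => F K n i c) ez.unlock).
rewrite (kap_gz qK) !ezE JhB !JhC -[hgz _ - _](rmorphB hgz) -[at_z i _ - _](rmorphB (@at_z K n i)).
apply: mseriesP => r; rewrite SLE -[RHS]/(lmono (dF r)%:Z (at_z i (Eser (k%:R / 2) - Eser (- (k%:R / 2))) r)) at_z_coef.
rewrite -[ks K i k r]/(if r == dexp i *+ r i then smono (r i) ((Eser (k%:R / 2) - Eser (- (k%:R / 2))) (r i)) else 0).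
case: (eqVneq r (dexp i *+ r i)) => [e|_]; last by rewrite lmono0 (rmorph0 (@lser K)).
by rewrite lser_mono {3}e dF_dexp.
Qed.

Lemma SL_kq (p : Pt K) i k : SL (@kq K n p i k) = Jh (kap (gz K i) k * tt n (sval p).2 k).
Proof.
set y := (sval p).2.
have tE : Jh (tt n y k) = smono 0 (lmono (-1) (y k)).
  rewrite /tt JhM JhC /Jh map_polyX hornerX.
  have -> : hgz (smono 0 (y k)) = smono 0 (lmono 0 (y k)).
    apply: mseriesP => r; rewrite smonoE -[LHS]/(lmono (dF r)%:Z (smono 0 (y k) r)) smonoE.
    by case: eqP => [->|_]; [rewrite deg0|exact: lmono0].
  by rewrite smonoM addr0 lmonoM addr0 mul1r.
rewrite JhM -SL_ks tE mulrC; apply: mseriesP => r; rewrite mcoefCM !SLE.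
rewrite -[ks K i k r]/(if r == dexp i *+ r i then smono (r i) ((Eser (k%:R / 2) - Eser (- (k%:R / 2))) (r i)) else 0).
rewrite -[kq p i k r]/(if r == dexp i *+ r i then (if r i is a'.+1 then smono a' (k%:R ^+ a'.+1 * Sser K a' * y k) else 0) else 0).
case: ifP => _; last by rewrite !(rmorph0 (@lser K)) mulr0.
rewrite lser_mono lmonoM Eser_diff; case: (r i) => [|a]; first by rewrite mulr0 lmono0 (rmorph0 (@lser K)).
rewrite lser_mono mulrC; congr (lmono _ _); lia.
Qed.

(** Both sides are the same polynomial in complete homogeneous functions, whose arguments match by
    [SL_ks] and [SL_kq]. *)
Lemma SL_Pw (p : Pt K) (b : ex) :
  SL (@Pw K n p b) = Jh (connW (sval p).2 (fun i => av b i) (dF b) finset.setT).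
Proof.
have qV : qalg V := qV qK n; have qL := qalgL qK n.
have hm q q' m : (forall j, SL (q j) = Jh (q' j)) -> SL (hs q m) = Jh (hs q' m).
  move=> h; transitivity (hs (fun j => Jh (q' j)) m); last exact: esym (hs_map Jh q' m qL (qalg_rmorph Jh qL)).
  have -> : hs (fun j => Jh (q' j)) m = hs (fun j => SL (q j)) m by apply: eq_hsym => j _; rewrite h.
  exact: (hs_map (@smap ex (mseries nat K) (laurent K) (@lser K)) q m qV (qalg_rmorph Jh qL)).
rewrite (Pw_coef qK) /connW (big_morph _ SLD SL0) (big_morph _ JhD Jh0).
apply: eq_bigr => d _; rewrite /Wt JhM SLM; congr (_ * _).
  rewrite (big_morph _ SLM SL1) (big_morph _ JhM Jh1).
  apply: eq_bigr => e _; apply: hm => j; by rewrite SLM JhM !SL_ks.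
rewrite (big_morph _ SLM SL1) (big_morph _ JhM Jh1).
rewrite [RHS](eq_bigl xpredT) => [|i]; last by rewrite inE.
apply: eq_bigr => i _; rewrite /hE /he; case: (Ms _ d i) => [m|m]; last by rewrite SL0 Jh0.
apply: hm => j; exact: SL_kq.
Qed.

End Homogenization.

Section Matching.
Variables (K : closedFieldType) (qK : qalg K) (n : nat) (psi : mseries nat K) (a : 'I_n -> int).
Local Notation ex := {ffun 'I_n -> nat}.
Local Notation V := (mseries ex (mseries nat K)).
Local Notation dF := (degF 'I_n).
Local Notation Si := ((Sser K)^-1).

Definition phm (i : 'I_n) (s : nat) : mseries nat K := MSeries (fun l => s`!%:R * phia psi ((a i)%:~R) l s).
(** The part of 1 / S(u_i hbar) that completes the r-th power of u_i to the u-th. *)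
Definition sv (u r : nat) : mseries nat K := if (r <= u)%N then smono (u - r)%N (Si (u - r)%N) else 0.

Lemma Sv_conv B (Pb : V) (u : ex) : (forall i, u i < B)%N ->
  ((\prod_(i <- enum 'I_n) @Sv K n i) * Pb) u = \sum_(r <- boxl n B) (\prod_i sv (u i) (r i)) * Pb r.
Proof.
move=> uB; pose P := \prod_(i <- enum 'I_n) @Sv K n i.
pose Gd (d : ex * ex) := if d.1 + d.2 == u then P d.1 * Pb d.2 else 0.
pose mk (r : ex) : ex * ex := ([ffun i => (u i - r i)%N], r).
have ur : uniq [seq mk r | r <- boxl n B] by rewrite map_inj_uniq ?boxl_uniq // => r r' [].
transitivity (\sum_(d <- splits u) Gd d).
  by rewrite mcoefM big_seq [RHS]big_seq; apply: eq_bigr => d; rewrite mem_splits /Gd => ->.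
rewrite (@sum_supp _ _ Gd _ _ (splits_uniq _) ur) => [|d]; last first.
  rewrite /Gd mem_splits; case: (eqVneq (d.1 + d.2) u) => [e nz|_]; last by rewrite eqxx.
  have de i : (d.1 i + d.2 i = u i)%N by have /ffunP/(_ i) := e; rewrite ffunE.
  have dE : d = mk d.2.
    case: (d) de => d1 d2 de; rewrite /mk; congr (_, _); apply/ffunP => i; rewrite ffunE.
    by have := de i; rewrite -[(d1, d2).1]/d1 -[(d1, d2).2]/d2 => <-; rewrite addnK.
  rewrite andTb dE; apply: map_f; apply: mem_boxl => i; apply: leq_ltn_trans (uB i).
  by rewrite -(de i) leq_addl.
rewrite big_map; apply: eq_bigr => r _; rewrite /Gd -[(mk r).1]/([ffun i => (u i - r i)%N]) -[(mk r).2]/r.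
case: (boolP [forall i, r i <= u i]%N) => [/forallP h|].
  have -> : [ffun i => (u i - r i)%N] + r = u by apply/ffunP => i; rewrite !ffunE -[LHS]/(u i - r i + r i)%N subnK.
  rewrite eqxx; congr (_ * _); rewrite /P prod_onv ?enum_uniq //.
  rewrite (_ : [forall _, _] = true); last by apply/forallP => j; rewrite mem_enum.
  by rewrite big_enum; apply: eq_bigr => i _; rewrite ffunE /sv h.
rewrite negb_forall => /existsP[i hi]; rewrite (bigD1 i) //= /sv (negbTE hi) mul0r mul0r.
case: eqP => // /ffunP/(_ i); rewrite !ffunE -[(_ + _)%R]/(u i - r i + r i)%N => e.
by case/negP: hi; rewrite -e leq_addl.
Qed.

(** [wtT] cut at Taylor order S, which makes it one finite sum, exact up to hbar^S. *)
Definition wtS (S : nat) (i : 'I_n) (r : nat) : mseries nat K :=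
  \sum_(s < S.+1) smono (s : nat) (if (r <= s.+1)%N then Si (s.+1 - r)%N else 0) * phm i s.

Lemma wtS_wtT S i r N : (N <= S)%N -> wtS S i r N = wtT psi a i r N.
Proof.
move=> NS; rewrite /wtS mcoef_sum -[RHS]/(\sum_(s < N.+1) (s`!%:R * phia psi ((a i)%:~R) (N - s)%N s) *
  (if (r <= s.+1)%N then Si (s.+1 - r)%N else 0)).
rewrite (big_ord_widen S.+1 (fun s => (s`!%:R * phia psi ((a i)%:~R) (N - s)%N s) * (if (r <= s.+1)%N then Si (s.+1 - r)%N else 0))) //.
by rewrite [RHS]big_mkcond; apply: eq_bigr => s _; rewrite smono_coef_nat ltnS; case: ifP => // _; rewrite mulrC.
Qed.

Lemma lser_om S i r : lser (\sum_(s < S.+1) phm i s * sv s.+1 r) = lmono (1 - r%:Z) 1 * lser (wtS S i r).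
Proof.
rewrite /wtS !(rmorph_sum (@lser K)) mulr_sumr; apply: eq_bigr => s _; rewrite !(rmorphM (@lser K)) /= lser_mono mulrA lmonoM mul1r mulrC.
congr (_ * _); rewrite /sv; case: leqP => h; last by rewrite lmono0 (rmorph0 (@lser K)).
by rewrite lser_mono; congr (lmono _ _); rewrite -subzn //; lia.
Qed.

(** Each variable contributes hbar^(1 - r_i) beyond the functional, the homogenization gives back
    hbar to the degree of r, and the p-th power of q counts as hbar^(-p): altogether a shift by
    n. *)
Lemma TL_match (f : {poly zser K n}) (Pb : V) k S : (forall r, lser (Pb r) = Jh f r) -> (k + size f < S)%N ->
  (\sum_(t : {ffun 'I_n -> 'I_S.+1}) (\prod_i phm i (t i)) *
    ((\prod_(i <- enum 'I_n) @Sv K n i) * Pb) [ffun i => (t i).+1]) k =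
  TL (wtT psi a) finset.setT f (k%:Z - n%:Z).
Proof.
move=> PJ kS; have _ := qK; set X := \sum_t _.
have XE : X = \sum_(r <- boxl n S.+2) (\prod_i \sum_(s < S.+1) phm i s * sv s.+1 (r i)) * Pb r.
  transitivity (\sum_(t : {ffun 'I_n -> 'I_S.+1}) \sum_(r <- boxl n S.+2) (\prod_i (phm i (t i) * sv (t i).+1 (r i))) * Pb r).
    apply: eq_bigr => t _; rewrite (@Sv_conv S.+2) => [|i]; last by rewrite ffunE ltnS; exact: ltn_ord.
    rewrite mulr_sumr; apply: eq_bigr => r _; rewrite mulrA; congr (_ * _); rewrite big_split; congr (_ * _).
    by apply: eq_bigr => i _; rewrite ffunE.
  rewrite exchange_big; apply: eq_bigr => r _; rewrite -mulr_suml; congr (_ * _).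
  by rewrite bigA_distr_bigA.
pose wS (r : ex) := \prod_i wtS S i (r i).
have lX : lser X = \sum_(q < size f) \sum_(r <- boxl n S.+2) lmono (n%:Z - (q : nat)%:Z) (f`_q r) * lser (wS r).
  rewrite XE (rmorph_sum (@lser K)) exchange_big; apply: eq_bigr => r _.
  rewrite (rmorphM (@lser K)) /= PJ JhE mulr_sumr; apply: eq_bigr => q _.
  have oE : lser (\prod_i \sum_(s < S.+1) phm i s * sv s.+1 (r i)) =
      lmono (n%:Z - (dF r)%:Z) 1 * \prod_i lser (wtS S i (r i)).
    rewrite (rmorph_prod (@lser K)) (eq_bigr _ (fun i _ => lser_om S i (r i))) big_split; congr (_ * _).
    have -> : n%:Z - (dF r)%:Z = \sum_i (1 - (r i)%:Z).
      rewrite sumrB sumr_const card_ord -[dF r]/(\sum_j r j)%N (big_morph Posz PoszD (erefl 0%:Z)).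
      by congr (_ - _); rewrite pmulrn intz.
    have pE : \prod_i lmono (1 - (r i)%:Z) (1 : K) = lmono (\sum_i (1 - (r i)%:Z)) 1.
      by apply: (big_rec2 (fun x s => x = lmono s 1)) => // i x s _ ->; rewrite lmonoM mulr1.
    exact: pE.
  have wE : lser (wS r) = \prod_i lser (wtS S i (r i)) by exact: (rmorph_prod (@lser K)).
  transitivity (lmono (n%:Z - (dF r)%:Z) 1 * (\prod_i lser (wtS S i (r i))) * lmono ((dF r)%:Z - (q : nat)%:Z) (f`_q r)).
    exact: (congr1 (fun z : laurent K => z * lmono ((dF r)%:Z - (q : nat)%:Z) (f`_q r)) oE).
  rewrite wE mulrAC lmonoM mul1r.
  by have -> : n%:Z - (dF r)%:Z + ((dF r)%:Z - (q : nat)%:Z) = n%:Z - (q : nat)%:Z by rewrite addrA subrK.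
have -> : X k = lser X (Posz k) by rewrite lserE.
have bnd := @wtT_bnd K n psi a.
have lsum I (s : seq I) (F : I -> laurent K) m : (\sum_(i <- s) F i) m = \sum_(i <- s) F i m.
  by elim/big_rec2: _ => // i x z _ <-.
rewrite lX /TL !lsum; apply: eq_bigr => q _; rewrite lsum lcoef_monoM mul1r.
have qf := ltn_ord q; rewrite (_ : k%:Z - n%:Z - - (q : nat)%:Z = k%:Z - (n%:Z - (q : nat)%:Z)); last by lia.
transitivity (\sum_(r <- boxl n S.+2) f`_q r * lser (wS r) (k%:Z - (n%:Z - (q : nat)%:Z))).
  by apply: eq_bigr => r _; rewrite lcoef_monoM.
have : k%:Z - (n%:Z - (q : nat)%:Z) <= S%:Z by lia.
case: (k%:Z - _) => [M|M] MS; last by rewrite lserE big1 // => r _; rewrite lserE mulr0.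
have MS' : (M <= S)%N by [].
have TE : T0 (wtT psi a) finset.setT f`_q M = \sum_(r <- boxl n S.+2) f`_q r * wprod (wtT psi a) finset.setT r M.
  by apply: T0E.
rewrite [RHS]lserE TE; apply: eq_bigr => r _; rewrite lserE; congr (_ * _).
rewrite /wS /wprod; apply: (big_ind2 (fun x z : mseries nat K => forall N, (N <= S)%N -> x N = z N)) => // [x x' z z' hx hz N NS|i _ N NS].
  by rewrite !mcoefM_nat; apply: eq_bigr => j _; rewrite hx ?hz //; have := ltn_ord j; lia.
by rewrite inE; exact: wtS_wtT.
Qed.

End Matching.

Theorem Xf_rhsO_TL (K : closedFieldType) (qK : qalg K) n (p : Pt K) (b : {ffun 'I_n -> nat}) k : (1 < n)%N ->
  Xf (sval p).1 (sval p).2 b (rhsO n p k) =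
  TL (wtT (sval p).1 (fun i => av b i)) finset.setT
    (connW (sval p).2 (fun i => av b i) (degF 'I_n b) finset.setT) (k%:Z - n%:Z).
Proof.
(* S exceeds both bounds needed: 2 k plus the degree of b for the Taylor step, k plus the size in q
   for the functional. *)
move=> n1; set f := connW _ _ _ _; pose S := (2 * k + degF 'I_n b + k + size f).+1.
rewrite -(@TL_match K qK n (sval p).1 (fun i => av b i) f (@Pw K n p b) k S) => [||]; last by rewrite /S; lia.
  rewrite (Xf_rhsO qK).
  rewrite (@fold_YZ K qK n p b (degF 'I_n b) S.+1 (enum 'I_n) (gs (@cO K n) (@bO K n)) k) //; first last.
  - by move=> i; exact: dv_gs.
  - exact: sl_gs.
  - exact: enum_uniq.
  - by rewrite /S; lia.
  rewrite (fold_Z p b) ?enum_uniq // => [|j _]; last by rewrite ffunE.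
  rewrite !mcoef_sum; apply: eq_big => [t|t _].
    by apply/forallP => i; rewrite inE mem_enum.
  have -> : \prod_(i <- enum 'I_n) Phs p b i (t i) =
      smap (@cO K n) (\prod_i phm (sval p).1 (fun i => av b i) i (t i)).
    by rewrite (rmorph_prod (@smap nat K (zser K n) (@cO K n))) big_enum.
  rewrite Gk_Fl // add0r.
  have -> : tv (enum 'I_n) t = [ffun i => (t i).+1] by apply/ffunP => i; rewrite !ffunE mem_enum.
  rewrite [RHS]mcoefM_nat mcoefM_nat mcoef_sum; apply: eq_bigr => j _.
  refine (etrans (mcoefCM ((\prod_i phm (sval p).1 (fun i => av b i) i (t i)) j) _ b) _).
  by rewrite FlE mcoefCM.
by move=> r; rewrite -SLE (SL_Pw qK).
Qed.

(** * Residues of the left-hand side and the comparison *)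

Section LeftHandSide.
Variables (K : fieldType) (qK : qalg K) (n : nat) (psi y : mseries nat K).
Hypotheses (psi0 : psi 0%N = 0) (y0 : y 0%N = 0).
Local Notation ex := {ffun 'I_n -> nat}.
Local Notation O := (zser K n).
Local Notation io := (@iota_z K n).
Local Notation dF := (degF 'I_n).

Lemma agree_foldr_Dz (s : seq 'I_n) (f : O) :
  agree (foldr (@Dz K psi y n) (tofr f) s) (foldr (@DO K n psi y) (io f) s).
Proof.
elim: s => [|i s IH]; first exact: agree_tofr.
rewrite -[foldr _ _ (i :: s)]/(Dz psi y i (foldr (@Dz K psi y n) (tofr f) s)).
rewrite -[foldr (@DO K n psi y) _ (i :: s)]/(DO psi y i (foldr (@DO K n psi y) (io f) s)).
by apply: agreeM; [apply: (agreeV (Qo_unit psi y0 i)); exact: agree_tofr|exact: agree_theta].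
Qed.

Lemma Xf_foldr_DO b (s : seq 'I_n) (o : O) :
  Xf psi y b (foldr (@DO K n psi y) o s) = (\prod_(i <- s) aK K b i) * Xf psi y b o.
Proof.
elim: s => [|i s IH]; first by rewrite big_nil mul1r.
rewrite -[foldr (@DO K n psi y) _ (i :: s)]/(DO psi y i (foldr (@DO K n psi y) o s)) (Xf_D qK psi0 y0) IH.
by rewrite big_cons mulrA.
Qed.

Lemma Xser0 : Xser psi y 0%N = 0.
Proof. by rewrite /Xser -/(Xs K) mcoefXs. Qed.

Lemma Hgn_z_coef g (m : ex) B : (dF m < B)%N ->
  Hgn_z psi y n g m = (\sum_(k <- boxl n B) smono 0 (Hgn psi y g n k) * \prod_(i < n) at_z i (Xser psi y) ^+ k i) m.
Proof.
move=> mB; rewrite /Hgn_z (csum_seq (boxl_uniq n B)) ?mcoef_sum // => k kB.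
have [i hi] : exists i, (B <= k i)%N.
  apply/existsP; apply: contraNT kB; rewrite negb_exists => /forallP h; apply: mem_boxl => i.
  by rewrite ltnNge; exact: h.
rewrite mcoefCM; suff -> : (\prod_(i0 < n) at_z i0 (Xser psi y) ^+ k i0) m = 0 by rewrite mulr0.
have -> : \prod_(i0 < n) at_z i0 (Xser psi y) ^+ k i0 =
    (\prod_(i0 < n | i0 != i) at_z i0 (Xser psi y) ^+ k i0) * at_z i (Xser psi y) ^+ k i by rewrite (bigD1 i) // mulrC.
by apply: (mcoef_mulX_deg (dg := dF)); [exact: (at_z0 i Xser0)|exact: leq_trans mB hi].
Qed.

Lemma dF_avn (c : ex) : (dF (avn c) <= dF c)%N.
Proof.
rewrite -[dF (avn c)]/(\sum_i avn c i)%N -[dF c]/(\sum_i c i)%N; apply: leq_sum => i _; rewrite ffunE; exact: leq_subr.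
Qed.

(** X(z) has no constant term, so only the exponents in a finite box reach the degree of b, and
    [Xf_X] picks one of them. *)
Lemma Xf_Hgn g (b : ex) : Xf psi y b (io (Hgn_z psi y n g)) =
  \sum_(k <- boxl n (dF b).+1) Hgn psi y g n k * (b == zbm k)%:R.
Proof.
transitivity (Xf psi y b (\sum_(k <- boxl n (dF b).+1) smono 0 (Hgn psi y g n k) * io (\prod_(i < n) at_z i (Xser psi y) ^+ k i))).
  apply: Xf_eq => c cb; have e k : smono 0 (Hgn psi y g n k) * io (\prod_(i < n) at_z i (Xser psi y) ^+ k i) =
      io (smono 0 (Hgn psi y g n k) * \prod_(i < n) at_z i (Xser psi y) ^+ k i) by rewrite ioM io_smono zbm0.
  rewrite (eq_bigr _ (fun k _ => e k)) -(big_morph _ (@ioD K n) (io0 K n)).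
  rewrite -[io _ c]/(if nonneg c then _ else _) -[RHS]/(if nonneg c then mcoef (\sum_(k <- _) _) (avn c) else 0).
  case: ifP => // _; apply: Hgn_z_coef; rewrite ltnS; exact: leq_trans (dF_avn c) cb.
by rewrite Xf_sum; apply: eq_bigr => k _; rewrite XfZ (Xf_X qK psi0 y0).
Qed.

End LeftHandSide.

Lemma DHgn_rhs (K : closedFieldType) (qK : qalg K) (g n : nat) (psi y : mseries nat K) :
  (2 <= n)%N -> (g, n) <> (0%N, 2%N) -> psi 0%N = 0 -> y 0%N = 0 ->
  DHgn psi y n g = rhs psi y n (hpow g n).
Proof.
(* k is the power of hbar once the n factors 1 / hbar of the operators U_i are taken out. *)
move=> n2 gn psi0 y0; pose p : Pt K := exist _ (psi, y) (conj psi0 y0); pose k := (g.*2 + n + n - 2)%N.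
have hk : hpow g n = k%:Z - n%:Z by rewrite /hpow /k -subzn; lia.
have [_ /(_ p) [_ ag]] := good_rhs qK n k; rewrite -hk in ag.
suff e : foldr (@DO K n psi y) (iota_z (Hgn_z psi y n g)) (enum 'I_n) = rhsO n p k.
  by apply: agree_uniq ag; rewrite -e; exact: agree_foldr_Dz.
apply/eqP; rewrite -subr_eq0; apply/eqP; apply: (Xf_inj psi0 y0) => b; rewrite XfB; apply/eqP; rewrite subr_eq0; apply/eqP.
rewrite (Xf_foldr_DO qK psi0 y0) (Xf_Hgn qK psi0 y0).
have := Xf_rhsO_TL qK p b k n2; rewrite -hk => ->.
have av_le i : (`|av b i| <= degF 'I_n b)%N.
  have h1 := dF_ge b i; have h2 : (nx b i <= degF 'I_n b)%N.
    rewrite /nx -[degF 'I_n b]/(\sum_j b j)%N [X in (_ <= X)%N](bigID (fun j : 'I_n => j == i.+1 :> nat)) /=; exact: leq_addr.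
  by rewrite /av; move: (b i) (nx b i) (degF 'I_n b) h1 h2 => u v w; lia.
rewrite -[(sval p).1]/psi -[(sval p).2]/y.
case: (boolP [forall i, 0 < av b i]) => [/forallP bp|].
  have nb : nonneg b by apply/forallP => i; have := bp i; rewrite /av; move: (b i) (nx b i) => u v; lia.
  pose m := avn b; have mE i : av b i = (m i)%:Z by rewrite -{1}(zbm_avn nb) av_zbm.
  have m0 i : (0 < m i)%N by have := bp i; rewrite mE.
  have mA i : (m i <= degF 'I_n b)%N by have := av_le i; rewrite mE.
  have n0 : (0 < n)%N by exact: ltnW.
  have -> : (fun i => av b i) = (fun i => (m i)%:Z) by apply/funext => i; exact: mE.
  have SE : \sum_(k' <- boxl n (degF 'I_n b).+1) Hgn psi y g n k' * (b == zbm k')%:R = Hgn psi y g n m.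
    rewrite (bigD1_seq m) ?boxl_uniq //; last by apply: mem_boxl => i; rewrite ltnS.
    rewrite big1 => [|k' k'm]; first by rewrite /m zbm_avn // eqxx mulr1 -[RHS]addr0.
    case: (eqVneq b (zbm k')) => [e|_]; last by rewrite mulr0.
    by case/eqP: k'm; rewrite /m e avn_zbm.
  rewrite (connW_pos qK y psi0 m0 mA n0) SE -[Hgn psi y g n m]/(if [forall i, (0 < m i)%N] then _ else _).
  have -> : [forall i, (0 < m i)%N] by apply/forallP.
  have lMn (x : laurent K) c N : (x *+ c) N = x N *+ c.
    by elim: c => [|c IH]; rewrite ?mulr0n // !mulrSr -IH.
  rewrite lMn -[RHS]mulr_natl; congr (_ * _); rewrite natr_prod big_enum; apply: eq_bigr => i _.
  by rewrite /aK mE.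
move=> nb; have [i bi] : exists i, av b i <= 0.
  by apply: contrapT => h; case/negP: nb; apply/forallP => i; rewrite ltNge; apply/negP => hi; apply: h; exists i.
(* H contains only positive powers of the X_i, so the left-hand side has no residue here. *)
have SE : \sum_(k' <- boxl n (degF 'I_n b).+1) Hgn psi y g n k' * (b == zbm k')%:R = 0.
  apply: big1 => k' _; case: (eqVneq b (zbm k')) => [e|_]; last by rewrite mulr0.
  rewrite -[Hgn psi y g n k']/(if [forall i, (0 < k' i)%N] then _ else _).
  case: forallP => [h|_]; last by rewrite mul0r.
  by move: bi; rewrite e av_zbm; have := h i; move: (k' i) => u; lia.
(* The right-hand side is at most a multiple of hbar^0, and for n >= 2 the exponent [hpow g n] is 0
   only at the excluded (0, 2). *)
rewrite SE mulr0; have [c -> _] := connW_nonpos qK y psi0 av_le bi n2.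
rewrite -[RHS]/(if hpow g n == 0 then c else 0); case: eqP => // e0; case: gn.
by move: e0; rewrite /hpow => e0; congr (_, _); move: n2; lia.
Qed.

Theorem theorem4p8 (R : realType) (g n : nat)
    (n_ge2 : (2 <= n)%N) (gn_neq : (g, n) <> (0%N, 2%N)) :
  (forall psi y : mseries nat R[i], psi 0%N = 0 -> y 0%N = 0 ->
    [/\ Rloc (rhs psi y n (hpow g n)),
        DHgn psi y n g = rhs psi y n (hpow g n) &
        finite_sums psi y n (hpow g n)]) /\
  (exists e : ratexpr R[i] n,
    forall psi y : mseries nat R[i], psi 0%N = 0 -> y 0%N = 0 ->
      rdefined psi y e /\ rhs psi y n (hpow g n) = reval psi y e).
Proof.
have qK : qalg R[i] by exact: qalg_num.
pose k := (g.*2 + n + n - 2)%N.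
have hk : hpow g n = k%:Z - n%:Z by rewrite /hpow /k -subzn; lia.
have [[e he] hl] := good_rhs qK n k; rewrite -hk in he hl.
split=> [psi y psi0 y0|]; last first.
  exists e => psi y psi0 y0; exact: (he (exist _ (psi, y) (conj psi0 y0))).
split; last exact: finite_sums_hold.
  by have [] := hl (exist _ (psi, y) (conj psi0 y0)).
exact: (DHgn_rhs qK).
Qed.
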